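(* Let $(X,\omega,J,g)$ be a tamed almost complex manifold with bounded geometry, let $K\subset X$ be a compact subset, $\ell\ge 0$ an integer and $A>0$ a real number. Then there exist $\lambda_0>0$ depending only on the bounds on the geometry, an integer $m\ge 0$ and a real number $\Lambda>0$, both depending explicitly on $\ell$, $A$ and the local bounds on the geometry of $X$ and not on $K$, with the following significance. (i) Every $u\in\overline{\mathcal M}_{0,\ell}(X,J;K)^{\le A}$ has an $m$-decoration $\varphi$ such that the associated map $u^\varphi$ has $1$-local Lipschitz constant $\mathrm{Lip}_1(u^\varphi)\le\Lambda\lambda_0$. (ii) Let $u\mapsto\varphi_u$ be an assignment of an $m$-decoration of $1$-local Lipschitz constant $\le\Lambda\lambda_0$, as in (i), to each $u\in\overline{\mathcal M}_{0,\ell}(X,J;K)^{\le A}$. Given any $0<\delta\le 1$, there is a number $N\ge 0$, depending explicitly on $\ell$, $A$, $K\subset(X,\omega,J,g)$ and $\delta$, with the following property: there is a subset $I\subset\overline{\mathcal M}_{0,\ell}(X,J;K)^{\le A}$ with at most $N$ elements such that for every $u\in\overline{\mathcal M}_{0,\ell}(X,J;K)^{\le A}$ there is $v\in I$ with $$\mathrm{dist}_{\lambda_0}(u^{\varphi_u},v^{\varphi_v})\le 4\delta .$$ In particular, the neighborhoods $\{V_{\lambda_0,4\delta}(v;\varphi_v)\}_{v\in I}$ cover $\overline{\mathcal M}_{0,\ell}(X,J;K)^{\le A}$. In fact, one can take $m$ and $\Lambda$ to be given by $$m=\lfloor c\cdot(\ell+A/\lambda^2)\rfloor,\qquad \log\Lambda=c\cdot(\ell+A/\lambda^2),$$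 where $\lambda$ is a constant depending only on the local bounds on the geometry of $X$ and $c$ is a sufficiently large absolute constant. Having fixed $m$ and $\Lambda$, one can take $$N=\left(1+\sigma\delta^{-2k}\nu(K,\lambda_0)\right)^{(8\pi\Lambda^2\delta^{-2})^{\binom{m+\ell}{3}}},$$ where $\sigma$ is a constant depending on the local bounds on the geometry of $X$, $\nu(K,\lambda_0)$ is the size of the smallest $\lambda_0$-net in the compact metric space $K$, and $2k=\dim X$.
   Context: **Geometry.** $(X,g)$ is a smooth Riemannian manifold, $\omega$ a symplectic form on $X$, $J$ an $\omega$-tame almost complex structure. Bounded geometry means that there are $C^j$ bounds on the geometry of $(X,\omega,J,g)$ for some integer $j\ge 3$: there is a constant $B_j$ such that every $x\in X$ is the centre of a unit coordinate ball in which the matrices of $\omega,J,g$ and their inverses have $C^j$ norms $\le B_j$, and $g(V,V)\le B_j\,\omega(V,JV)$ for all tangent vectors $V$. A constant ''depends only on the bounds on the geometry'' if it can be chosen as a function of these bounds (and $\dim X$). Distances in $X$ are $g$-distances. **Moduli space.** $\overline{\mathcal M}_{0,\ell}(X,J;K)^{\le A}$ is the moduli space of (isomorphism classes of) closed stable $\ell$-pointed genus $0$ $J$-holomorphic maps $u=[\Sigma,x_1,\dots,x_\ell,f]$ in $X$ with energy $E(f)=\frac12\int_\Sigma|df|_h^2\,\mathrm{dvol}_h\le A$ ($h$ any conformal metric on $\Sigma$) and image in $K$. **Universal curves inside products of spheres.** Identify $\mathbb P^1$ with $\overline{\mathcal M}_{0,4}$ by sending $[a:b]$ (with $a^3\ne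 b^3$) to $\mathbb P^1$ with the marked points $[1:1],[e^{2\pi i/3}:1],[e^{-2\pi i/3}:1],[a:b]$ and extending continuously; this gives $\overline{\mathcal M}_{0,4}$ the round metric of total area $4\pi$ (unit round sphere). For $m\ge 3$ let $Z_m=\overline{\mathcal M}_{0,4}^{\binom m3}$, with factors indexed by $1\le i<j<k\le m$, with distance function the maximum of the distances in the factors. Let $\pi_m:\overline{\mathcal M}_{0,m+1}\to\overline{\mathcal M}_{0,m}$ be the map forgetting the last marked point (and stabilizing). For $s\in\overline{\mathcal M}_{0,m}$ let $\mathcal C_s=\pi_m^{-1}(s)$, which is the stable $m$-pointed genus $0$ curve represented by $s$, regarded as a closed subscheme of $Z_m$ via $[\Sigma,x_1,\dots,x_{m+1}]\mapsto([\Sigma,x_i,x_j,x_k,x_{m+1}]^{\mathrm{st}})_{i<j<k}$ (4-point stabilizations); this is an embedding of $\mathcal C_s$. **$L$-distance.** For $L>0$ and an integer $m\ge 3$, the $L$-distance on $Z_m\times X$ is the maximum of the distance on $Z_m$ and $L^{-1}$ times the distance on $X$; $d_{H,L}$ is the associated Hausdorff distance between compact subsets of $Z_m\times X$. For $p,q\in\overline{\mathcal M}_{0,m}$ and continuous $f:\mathcal C_p\to X$, $g:\mathcal C_q\to X$ with graphs $\Gamma_f,\Gamma_g\subset Z_m\times X$, set $\mathrm{dist}_L(f,g)=d_{H,L}(\Gamma_f,\Gamma_g)$. **Decorations.** Given $u=[\Sigma,x_1,\dots,x_\ell,f]\in\overline{\mathcal M}_{0,\ell}(X,J;K)^{\le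 A}$ and a nonnegative integer $m\ge 3-\ell$, an $m$-decoration of $u$ is a choice of a point $p\in\overline{\mathcal M}_{0,\ell+m}$ and a biholomorphism $\varphi:\Sigma\to\mathcal C_p$ such that $\varphi(x_1),\dots,\varphi(x_\ell)$ are the first $\ell$ marked points, in this order, of the $(\ell+m)$-pointed curve $\mathcal C_p$. Put $u^\varphi:=f\circ\varphi^{-1}:\mathcal C_p\to X$. For $0<\varepsilon\le\pi$, the $\varepsilon$-local Lipschitz constant is $$\mathrm{Lip}_\varepsilon(u^\varphi)=\sup_{0<\mathrm{dist}(q_1,q_2)\le\varepsilon}\frac{\mathrm{dist}(u^\varphi(q_1),u^\varphi(q_2))}{\mathrm{dist}(q_1,q_2)},$$ with the metric on $\mathcal C_p$ induced from $\mathcal C_p\subset Z_{\ell+m}$. For $\delta>0$, $V_{L,\delta}(u;\varphi)\subset\overline{\mathcal M}_{0,\ell}(X,J;K)^{\le A}$ is the set of all $v\in\overline{\mathcal M}_{0,\ell}(X,J;K)^{\le A}$ for which there exists an $m$-decoration $\psi$ of $v$ with $\mathrm{dist}_L(u^\varphi,v^\psi)\le\delta$. **Nets.** A subset $Y$ of a metric space $Z$ is a $\gamma$-net if the Hausdorff distance of $Y$ and $Z$ is $<\gamma$; $\nu(Z,\gamma)$ is the minimum cardinality of a $\gamma$-net. *)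

(* Defs.v *)
From HB Require Import structures.
From mathcomp Require Import all_boot all_order all_algebra complex.
From mathcomp Require Import all_classical all_reals all_analysis.

Set Implicit Arguments.
Unset Strict Implicit.
Unset Printing Implicit Defensive.

Import Order.TTheory GRing.Theory Num.Theory.
Import numFieldNormedType.Exports.

Local Open Scope classical_set_scope.
Local Open Scope ring_scope.

(** * Smooth functions on open subsets of R^n *)

Definition partial (R : realType) (n : nat) (i : 'I_n) (f : 'rV[R]_n -> R) :
    'rV[R]_n -> R :=
  fun y => 'D_(delta_mx 0 i) f y.

Definition iter_partial (R : realType) (n : nat) (s : seq 'I_n)
    (f : 'rV[R]_n -> R) : 'rV[R]_n -> R :=
  foldr (@partial R n) f s.

(* The three notions below are meant for open [U], where they only depend on
   the restriction of [f] to [U]. *)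
Definition smooth_on (R : realType) (n : nat) (U : set 'rV[R]_n)
    (f : 'rV[R]_n -> R) : Prop :=
  forall (s : seq 'I_n) (y : 'rV[R]_n), U y ->
    {for y, continuous (iter_partial s f)} /\
    forall i : 'I_n, derivable (iter_partial s f) y (delta_mx 0 i).

Definition smooth_mx_on (R : realType) (n p q : nat) (U : set 'rV[R]_n)
    (M : 'rV[R]_n -> 'M[R]_(p, q)) : Prop :=
  forall i j, smooth_on U (fun y => M y i j).

(* The C^j norm of a matrix-valued function is the supremum of the absolute
   values of the partial derivatives of order at most j of its entries. *)
Definition Cnorm_le (R : realType) (n p q : nat) (j : nat) (U : set 'rV[R]_n)
    (M : 'rV[R]_n -> 'M[R]_(p, q)) (B : R) : Prop :=
  forall (a : 'I_p) (b : 'I_q) (s : seq 'I_n) (y : 'rV[R]_n),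
    (size s <= j)%N -> U y -> `|iter_partial s (fun y' => M y' a b) y| <= B.

Definition unit_ball (R : realType) (n : nat) : set 'rV[R]_n :=
  [set y | \sum_(i < n) y 0 i ^+ 2 < 1].
Arguments unit_ball : clear implicits.

(** * Smooth manifolds *)

(* [cmap] is only meaningful on [cdom], and [cinv] on [cimg]. *)
Record chart (R : realType) (n : nat) (X : Type) := Chart {
  cdom : set X;
  cmap : X -> 'rV[R]_n;
  cinv : 'rV[R]_n -> X }.

Definition cimg (R : realType) (n : nat) (X : Type) (c : chart R n X) :
    set 'rV[R]_n :=
  cmap c @` cdom c.

Definition is_chart (R : realType) (n : nat) (X : topologicalType)
    (c : chart R n X) : Prop :=
  [/\ open (cdom c) /\ open (cimg c),
      forall x, cdom c x -> cinv c (cmap c x) = x,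
      forall x, cdom c x -> {for x, continuous (cmap c)} &
      forall y, cimg c y -> {for y, continuous (cinv c)}].

Definition transition (R : realType) (n : nat) (X : Type)
    (c c' : chart R n X) : 'rV[R]_n -> 'rV[R]_n :=
  fun y => cmap c' (cinv c y).

Definition compatible (R : realType) (n : nat) (X : Type)
    (c c' : chart R n X) : Prop :=
  smooth_mx_on (cmap c @` (cdom c `&` cdom c')) (transition c c').

(* The atlas is the maximal one, so its members are all the smooth charts;
   [chart_at] is an arbitrary choice of a chart around each point, used to
   evaluate expressions that do not depend on the chart. *)
Record smooth_manifold (R : realType) (n : nat) := SmoothManifold {
  points :> topologicalType;
  atlas : set (chart R n points);
  chart_at : points -> chart R n points;
  points_hausdorff : hausdorff_space points;
  points_second_countable : @second_countable points;
  atlas_is_chart : forall c, atlas c -> is_chart c;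
  atlas_compatible : forall c c', atlas c -> atlas c' -> compatible c c';
  atlas_maximal : forall c, is_chart c ->
    (forall c', atlas c' -> compatible c c' /\ compatible c' c) -> atlas c;
  chart_at_atlas : forall x, atlas (chart_at x);
  chart_at_dom : forall x, cdom (chart_at x) x }.

(* Tangent vectors are represented in charts by row vectors; the differential
   of the coordinate change from [c] to [c'] sends [v] to [v *m jacobian]. *)
Definition jacobian (R : realType) (n : nat) (X : Type)
    (c c' : chart R n X) (y : 'rV[R]_n) : 'M[R]_n :=
  \matrix_(i, j) partial i (fun y' => transition c c' y' 0 j) y.

(* A tensor field is given by its smooth coordinate matrices in all the charts,
   related by the transformation rule of its type: (0,2) for bilinear forms
   [b(v, w) = v *m M *m w^T], and (1,1) for endomorphisms [v |-> v *m M]. *)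
Definition bilinear_field (R : realType) (n : nat) (X : smooth_manifold R n)
    (M : chart R n X -> 'rV[R]_n -> 'M[R]_n) : Prop :=
  (forall c, atlas c -> smooth_mx_on (cimg c) (M c)) /\
  (forall c c' x, atlas c -> atlas c' -> cdom c x -> cdom c' x ->
    let D := jacobian c c' (cmap c x) in
    M c (cmap c x) = D *m M c' (cmap c' x) *m D^T).

Definition endomorphism_field (R : realType) (n : nat)
    (X : smooth_manifold R n) (M : chart R n X -> 'rV[R]_n -> 'M[R]_n) : Prop :=
  (forall c, atlas c -> smooth_mx_on (cimg c) (M c)) /\
  (forall c c' x, atlas c -> atlas c' -> cdom c x -> cdom c' x ->
    let D := jacobian c c' (cmap c x) in
    M c (cmap c x) *m D = D *m M c' (cmap c' x)).

Definition bilin (R : realType) (n : nat) (M : 'M[R]_n) (v w : 'rV[R]_n) : R :=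
  (v *m M *m w^T) 0 0.

Definition is_riemannian (R : realType) (n : nat) (X : smooth_manifold R n)
    (g : chart R n X -> 'rV[R]_n -> 'M[R]_n) : Prop :=
  bilinear_field g /\
  forall c y, atlas c -> cimg c y ->
    (forall v w, bilin (g c y) v w = bilin (g c y) w v) /\
    (forall v, v != 0 -> 0 < bilin (g c y) v v).

Definition is_symplectic (R : realType) (n : nat) (X : smooth_manifold R n)
    (w : chart R n X -> 'rV[R]_n -> 'M[R]_n) : Prop :=
  bilinear_field w /\
  forall c y, atlas c -> cimg c y ->
    [/\ forall u v, bilin (w c y) u v = - bilin (w c y) v u,
        w c y \in unitmx &
        forall i j k : 'I_n,
          partial i (fun y' => w c y' j k) y +
          partial j (fun y' => w c y' k i) y +
          partial k (fun y' => w c y' i j) y = 0].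

Definition is_almost_complex (R : realType) (n : nat) (X : smooth_manifold R n)
    (J : chart R n X -> 'rV[R]_n -> 'M[R]_n) : Prop :=
  endomorphism_field J /\
  forall c y, atlas c -> cimg c y -> J c y *m J c y = - 1%:M.

Definition is_tame (R : realType) (n : nat) (X : smooth_manifold R n)
    (w J : chart R n X -> 'rV[R]_n -> 'M[R]_n) : Prop :=
  forall c y, atlas c -> cimg c y ->
    forall v, v != 0 -> 0 < bilin (w c y) v (v *m J c y).

Record tamed_manifold (R : realType) (n : nat) := TamedManifold {
  underlying :> smooth_manifold R n;
  metric : chart R n underlying -> 'rV[R]_n -> 'M[R]_n;
  sform : chart R n underlying -> 'rV[R]_n -> 'M[R]_n;
  acs : chart R n underlying -> 'rV[R]_n -> 'M[R]_n;
  metric_riemannian : is_riemannian metric;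
  sform_symplectic : is_symplectic sform;
  acs_almost_complex : is_almost_complex acs;
  acs_tame : is_tame sform acs }.

Definition bounded_geometry (R : realType) (n : nat) (X : tamed_manifold R n)
    (j : nat) (B : R) : Prop :=
  (forall x : X, exists c : chart R n X,
    [/\ atlas c /\ cdom c x, cmap c x = 0, cimg c = unit_ball R n &
      forall M, [\/ M = sform c, M = acs c | M = metric c] ->
        Cnorm_le j (unit_ball R n) M B /\
        Cnorm_le j (unit_ball R n) (fun y => invmx (M y)) B]) /\
  (forall (c : chart R n X) y, atlas c -> cimg c y -> forall v,
    bilin (metric c y) v v <= B * bilin (sform c y) v (v *m acs c y)).

(** * Riemannian distance *)

Definition C1_curve (R : realType) (n : nat) (X : smooth_manifold R n)
    (p : R -> X) : Prop :=
  continuous p /\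
  forall c t i, atlas c -> cdom c (p t) ->
    derivable (fun s => cmap c (p s) 0 i) t 1 /\
    {for t, continuous (derive1 (fun s => cmap c (p s) 0 i))}.

Definition speed (R : realType) (n : nat) (X : tamed_manifold R n)
    (p : R -> X) (t : R) : R :=
  let c := chart_at (p t) in
  let v := \row_i derive1 (fun s => cmap c (p s) 0 i) t in
  Num.sqrt (bilin (metric c (cmap c (p t))) v v).

(* The value is +oo for points in different connected components. *)
Definition rdist (R : realType) (n : nat) (X : tamed_manifold R n)
    (x y : X) : \bar R :=
  ereal_inf [set l | exists p : R -> X, [/\ C1_curve p, p 0 = x, p 1 = y &
    l = (\int[@lebesgue_measure R]_(t in `[0%R, 1%R]) (speed p t)%:E)%E]].

Definition hausdorff (R : realType) (T : Type) (d : T -> T -> \bar R)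
    (A B : set T) : \bar R :=
  maxe (ereal_sup [set ereal_inf [set d a b | b in B] | a in A])
       (ereal_sup [set ereal_inf [set d a b | a in A] | b in B]).

Definition is_net (R : realType) (T : Type) (d : T -> T -> \bar R) (K : set T)
    (gamma : R) (Y : set T) : Prop :=
  Y `<=` K /\ (hausdorff d Y K < gamma%:E)%E.

(* The infimum is over a set of natural numbers, hence it is a minimum as soon
   as there are finite nets. *)
Definition net_number (R : realType) (T : Type) (d : T -> T -> \bar R)
    (K : set T) (gamma : R) : R :=
  inf [set r | exists (q : nat) (Y : set T),
    [/\ r = q%:R, is_net d K gamma Y & (Y #= `I_q)%card]].

(** * The Riemann sphere *)

(* [Some z] is the point [z : 1], and [None] is the point [1 : 0]. *)
Definition P1 (R : realType) : Type := option R[i].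

Definition moebius (R : realType) (a b c d : R[i]) (x : P1 R) : P1 R :=
  match x with
  | Some z => if c * z + d == 0 then None else Some ((a * z + b) / (c * z + d))
  | None => if c == 0 then None else Some (a / c)
  end.

Definition is_moebius (R : realType) (T : P1 R -> P1 R) : Prop :=
  exists a b c d : R[i], a * d - b * c != 0 /\ T =1 moebius a b c d.

(* Inverse stereographic projection onto the unit sphere in R^3. *)
Definition stereo (R : realType) (x : P1 R) : 'rV[R]_3 :=
  match x with
  | Some z =>
      let a := complex.Re z in let b := complex.Im z in
      (1 + a ^+ 2 + b ^+ 2)^-1 *:
        \row_(i < 3) [:: 2 * a; 2 * b; a ^+ 2 + b ^+ 2 - 1]`_i
  | None => \row_(i < 3) [:: 0; 0; 1]`_i
  end.

(* Geodesic distance of the round metric of total area 4 pi. *)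
Definition sdist (R : realType) (x y : P1 R) : R :=
  acos ((stereo x *m (stereo y)^T) 0 0).

(** * Pseudoholomorphic spheres *)

(* The two standard holomorphic coordinates z and 1/z of the sphere. *)
Definition zcoord (R : realType) (y : 'rV[R]_2) : P1 R :=
  Some (y 0 0 +i* y 0 1)%C.

Definition wcoord (R : realType) (y : 'rV[R]_2) : P1 R :=
  moebius 0 1 1 0 (zcoord y).

(* First partial derivative of [F : R^2 -> X] in the coordinates of [c]. *)
Definition dpartial (R : realType) (n : nat) (X : Type) (c : chart R n X)
    (F : 'rV[R]_2 -> X) (a : 'I_2) (y : 'rV[R]_2) : 'rV[R]_n :=
  \row_i partial a (fun y' => cmap c (F y') 0 i) y.

(* Smoothness and the Cauchy-Riemann equation dF/dt = J dF/ds for z = s + it. *)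
Definition Jhol_local (R : realType) (n : nat) (X : tamed_manifold R n)
    (F : 'rV[R]_2 -> X) : Prop :=
  continuous F /\
  forall c, atlas c ->
    smooth_mx_on (F @^-1` cdom c) (fun y => cmap c (F y)) /\
    forall y, cdom c (F y) ->
      dpartial c F 1 y = dpartial c F 0 y *m acs c (cmap c (F y)).

Definition Jhol (R : realType) (n : nat) (X : tamed_manifold R n)
    (f : P1 R -> X) : Prop :=
  Jhol_local (f \o @zcoord R) /\ Jhol_local (f \o @wcoord R).

Definition energy_density (R : realType) (n : nat) (X : tamed_manifold R n)
    (F : 'rV[R]_2 -> X) (y : 'rV[R]_2) : R :=
  let c := chart_at (F y) in
  \sum_(a < 2) bilin (metric c (cmap c (F y))) (dpartial c F a y)
                                               (dpartial c F a y).

(* The energy is computed in the coordinate z = s + it, which omits one point;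
   |df|_h^2 dvol_h is the same for all conformal h and equals
   (|df/ds|^2 + |df/dt|^2) ds dt. *)
Definition sphere_energy (R : realType) (n : nat) (X : tamed_manifold R n)
    (f : P1 R -> X) : \bar R :=
  ((2^-1)%:E * \int[@lebesgue_measure R \x @lebesgue_measure R]_z
     (energy_density (f \o @zcoord R) (\row_(i < 2) [:: z.1; z.2]`_i))%:E)%E.

(** * Nodal curves of genus 0 *)

(* The components are spheres indexed by ['I_ncomp.+1]; if [v] and [w] are
   adjacent, then the point [node v w] of the component [v] is glued to the
   point [node w v] of the component [w]. A point of the curve is represented
   by a component and a point on it. *)
Record curve (R : realType) (l : nat) := Curve {
  ncomp : nat;
  adj : 'I_ncomp.+1 -> 'I_ncomp.+1 -> bool;
  node : 'I_ncomp.+1 -> 'I_ncomp.+1 -> P1 R;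
  mark : 'I_l -> 'I_ncomp.+1 * P1 R }.

Notation component C := 'I_(ncomp C).+1.

Definition is_tree (T : finType) (e : rel T) : Prop :=
  [/\ symmetric e, irreflexive e &
      forall x y, exists! p, [/\ path e x p, last x p = y & uniq (x :: p)]].

Definition is_curve (R : realType) (l : nat) (C : curve R l) : Prop :=
  [/\ is_tree (@adj R l C),
      forall v w w' : component C, adj v w -> adj v w' ->
        node v w = node v w' -> w = w',
      injective (@mark R l C) &
      forall i (v w : component C), adj v w -> mark C i <> (v, node v w)].

(* The number of nodal and marked points on a component. *)
Definition nspecial (R : realType) (l : nat) (C : curve R l)
    (v : component C) : nat :=
  (#|[pred w | adj v w]| + #|[pred i | (mark C i).1 == v]|)%N.

Definition is_stable_curve (R : realType) (l : nat) (C : curve R l) : Prop :=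
  is_curve C /\ forall v : component C, (3 <= nspecial v)%N.

(* Isomorphisms (biholomorphisms) of the underlying nodal curves, without
   marked points. *)
Definition is_biholomorphism (R : realType) (l l' : nat)
    (C : curve R l) (C' : curve R l') (h : component C -> component C')
    (T : component C -> P1 R -> P1 R) : Prop :=
  [/\ bijective h,
      forall v w, adj (h v) (h w) = adj v w,
      forall v, is_moebius (T v) &
      forall v w, adj v w -> T v (node v w) = node (h v) (h w)].

Definition map_point (R : realType) (l l' : nat)
    (C : curve R l) (C' : curve R l') (h : component C -> component C')
    (T : component C -> P1 R -> P1 R) (x : component C * P1 R) : component C' * P1 R :=
  (h x.1, T x.1 x.2).

(** * Stable maps and their moduli *)

Record nodal_map (R : realType) (X : Type) (l : nat) := NodalMap {
  domain : curve R l;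
  fmap : component domain * P1 R -> X }.
Arguments fmap {R X l} _ _.

(* A component on which the map is constant must have at least three special
   points. *)
Definition is_stable_map (R : realType) (n : nat) (X : tamed_manifold R n)
    (l : nat) (u : nodal_map R X l) : Prop :=
  let C := domain u in
  [/\ is_curve C,
      forall v : component C, Jhol (fun z => fmap u (v, z)),
      forall v w : component C, adj v w ->
        fmap u (v, node v w) = fmap u (w, node w v) &
      forall v : component C,
        (forall z z' : P1 R, fmap u (v, z) = fmap u (v, z')) ->
        (3 <= nspecial v)%N].

Definition energy (R : realType) (n : nat) (X : tamed_manifold R n)
    (l : nat) (u : nodal_map R X l) : \bar R :=
  (\sum_(v : component (domain u)) sphere_energy (fun z => fmap u (v, z)))%E.

Definition isomorphic (R : realType) (X : Type) (l : nat)
    (u u' : nodal_map R X l) : Prop :=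
  exists (h : component (domain u) -> component (domain u'))
         (T : component (domain u) -> P1 R -> P1 R),
    [/\ is_biholomorphism h T,
        forall i, mark (domain u') i = map_point h T (mark (domain u) i) &
        forall x, fmap u' (map_point h T x) = fmap u x].

(* The points of the moduli space are the isomorphism classes, represented as
   sets of stable maps. *)
Definition moduli (R : realType) (n : nat) (X : tamed_manifold R n) (l : nat)
    (K : set X) (A : R) : set (set (nodal_map R X l)) :=
  [set u | exists f : nodal_map R X l,
    [/\ is_stable_map f, (energy f <= A%:E)%E, forall x, K (fmap f x) &
        u = [set f' | is_stable_map f' /\ isomorphic f f']]].
Arguments moduli {R n X} l K A _.

(** * Stable curves inside products of spheres *)

Definition triple (m : nat) : finType :=
  {t : 'I_m * 'I_m * 'I_m | (t.1.1 < t.1.2 < t.2)%N}.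

Definition Z (R : realType) (m : nat) : Type := triple m -> P1 R.

Definition zdist (R : realType) (m : nat) (y y' : Z R m) : R :=
  \big[Num.max/0]_(t : triple m) sdist (y t) (y' t).

(* The neighbour of [v] on the path from [v] to [w], for [w != v]. *)
Definition toward (T : finType) (e : rel T) (v w : T) : T :=
  odflt v [pick x | e v x &
    connect [rel a b | [&& e a b, a != v & b != v]] x w].

(* The projection of the curve onto its component [v], which collapses every
   other component to the node of [v] through which it is attached. *)
Definition retract (R : realType) (l : nat) (C : curve R l) (v : component C)
    (x : component C * P1 R) : P1 R :=
  if x.1 == v then x.2 else node v (toward (@adj R l C) v x.1).

(* The points [1 : 1], [e^(2 pi i / 3) : 1] and [e^(- 2 pi i / 3) : 1]. *)
Definition root3 (R : realType) (e : int) : P1 R :=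
  Some (cos (2 * pi / 3 *~ e) +i* sin (2 * pi / 3 *~ e))%C.

(* The 4-point stabilization of (C, x_i, x_j, x_k, x), as a point of the sphere.
   Only one component [v] remains stable when all marked points other than
   x_i, x_j, x_k are forgotten, namely the one on which they have different
   projections. If [x] projects to that of, say, x_i, then [x] and x_i lie on a
   bubble attached to [v], which is the boundary point of the moduli space of
   4-pointed curves where the fourth point approaches the first one. *)
Definition stab4 (R : realType) (l : nat) (C : curve R l) (i j k : 'I_l)
    (x : component C * P1 R) (y : P1 R) : Prop :=
  exists (v : component C) (T : P1 R -> P1 R), is_moebius T /\
    [/\ T (retract v (mark C i)) = root3 R 0,
        T (retract v (mark C j)) = root3 R 1,
        T (retract v (mark C k)) = root3 R (-1) &
        y = T (retract v x)].

(* The embedding of a stable curve [C] in [Z R l] maps [x] to [y]. *)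
Definition embeds (R : realType) (l : nat) (C : curve R l)
    (x : component C * P1 R) (y : Z R l) : Prop :=
  forall t : triple l, stab4 (val t).1.1 (val t).1.2 (val t).2 x (y t).

(** * Decorations *)

(* A representative of the isomorphism class, a stable curve with [l + m] marked
   points, and the data of a biholomorphism from the former to the latter. *)
Record decoration (R : realType) (X : Type) (l m : nat) := Decoration {
  drep : nodal_map R X l;
  dcurve : curve R (l + m);
  dcomp : component (domain drep) -> component dcurve;
  dmoebius : component (domain drep) -> P1 R -> P1 R }.
Arguments dcomp {R X l m} _ _.
Arguments dmoebius {R X l m} _ _ _.

(* There is no stable curve with fewer than three marked points, so that the
   existence of a decoration implies [3 <= l + m]. *)
Definition is_decoration (R : realType) (n : nat) (X : tamed_manifold R n)
    (l m : nat) (u : set (nodal_map R X l)) (d : decoration R X l m) : Prop :=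
  [/\ u (drep d), is_stable_curve (dcurve d),
      is_biholomorphism (dcomp d) (dmoebius d) &
      forall i : 'I_l, mark (dcurve d) (lshift m i) =
        map_point (dcomp d) (dmoebius d)
          (mark (domain (drep d)) i)].

(* The graph of the map induced on the curve embedded in [Z R (l + m)]. *)
Definition graph (R : realType) (X : Type) (l m : nat)
    (d : decoration R X l m) : set (Z R (l + m) * X) :=
  [set q | exists x,
    embeds (map_point (dcomp d) (dmoebius d) x) q.1 /\
    q.2 = fmap (drep d) x].

Definition Lip (R : realType) (n : nat) (X : tamed_manifold R n) (l m : nat)
    (eps : R) (d : decoration R X l m) : \bar R :=
  ereal_sup [set r | exists q1 q2 : Z R (l + m) * X,
    [/\ graph d q1, graph d q2, 0 < zdist q1.1 q2.1 <= eps &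
        r = (rdist q1.2 q2.2 * ((zdist q1.1 q2.1)^-1)%:E)%E]].

Definition ldist (R : realType) (n : nat) (X : tamed_manifold R n) (m : nat)
    (L : R) (q q' : Z R m * X) : \bar R :=
  maxe (zdist q.1 q'.1)%:E ((L^-1)%:E * rdist q.2 q'.2)%E.

Definition dist_L (R : realType) (n : nat) (X : tamed_manifold R n) (l m : nat)
    (L : R) (d d' : decoration R X l m) : \bar R :=
  hausdorff (@ldist R n X (l + m) L) (graph d) (graph d').

Definition V (R : realType) (n : nat) (X : tamed_manifold R n) (l m : nat)
    (K : set X) (A L delta : R) (d : decoration R X l m) :
    set (set (nodal_map R X l)) :=
  [set v | moduli l K A v /\ exists d' : decoration R X l m,
    is_decoration v d' /\ (dist_L L d d' <= delta%:E)%E].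

(* Main.v *)
(* Let e be the square root of the energy density of a J-holomorphic sphere in
   the coordinate z of the plane. In a chart of bounded geometry, the
   coordinates of the map satisfy |Laplacian| <= C e^2, and comparing odd parts
   of these functions with explicit barriers gives everything the elliptic
   theory is needed for: where e <= 2 e(p) near p, the density stays comparable
   to e(p) on a disc of radius ~ 1/e(p), which thus carries a definite energy;
   and on an annulus r1 < |z - a| < r2 where e(z) |z - a| is small, one has
   e(z) <= K (1/r2 + r1/|z - a|^2).

   By the energy quantum, at most ~ E points p can be selected greedily such
   that e(z) |z - p| is small for some p at all other z. Let Q consist of these
   points p, of the points p + eps/e(p) and of infinity. Then e is bounded, up
   to a constant, by the maximum over pairs of points of Q of the conformal
   factor of the metric in which the pair and infinity are the three standard
   points of the round sphere. Integrating along a path made of two segments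
   that avoids Q bounds dist(f x, f x') by a polynomial in |Q| times the
   largest distance between the images of x and x' when three points of Q are
   put in standard position, and these distances are among the coordinates of
   the embedding into the product of spheres.

   Adding the points of Q on all components as marked points, and summing over
   the path from one component to another, gives decorations of controlled
   Lipschitz constant. The covering bound counts, for a partition of the product
   of spheres and of K into small cells, the functions that assign to each cell
   of the first the cell of a value of the map on it, if there is any. *)
Require Import Defs.
From HB Require Import structures.
From mathcomp Require Import all_boot all_order all_algebra complex.
From mathcomp Require Import all_classical all_reals all_analysis.
From mathcomp Require Import ring lra measurable_realfun.
Import Order.TTheory GRing.Theory Num.Theory.
Import numFieldNormedType.Exports.
Local Open Scope classical_set_scope.
Local Open Scope ring_scope.

Set Implicit Arguments.
Unset Strict Implicit.
Unset Printing Implicit Defensive.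

(** * Differential calculus in R^n *)

(** The analytic input is always the bound of one first derivative at one point. By the
    Cauchy-Riemann equation a single directional derivative controls the whole density, and the
    t-derivative of a coordinate u at t = 0 is half that of its odd part u(s,t) - u(s,-t). The odd
    part vanishes on t = 0, so a superharmonic barrier that vanishes there as well turns the maximum
    principle into a bound of the derivative.

    On an annulus the optimal decay is not reached at once, because the Laplacian is bounded only by
    the square of the density. A contraction from scale to scale first gives decay with exponent
    3/4. Since 3/4 > 1/2, the square of this bound is of lower order than the harmonic barriers, and
    one more comparison gives exponent 1. The weak decay also bounds the radial length by a constant
    that does not depend on the ratio of the radii, so that the image of the whole annulus stays in
    one chart.

    The distance bound is polynomial in the number of marks, with a factor from the geometry. The
    exponential form of Lambda absorbs the polynomial; a small lambda absorbs the factor. *)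

Lemma mvt_bound (R : realType) (f f' : R -> R) (c e t0 t1 : R) :
  (forall t, Num.min t0 t1 <= t <= Num.max t0 t1 -> is_derive t 1 f (f' t)) ->
  (forall t, Num.min t0 t1 <= t <= Num.max t0 t1 -> `|f' t - c| <= e) ->
  `|f t1 - f t0 - c * (t1 - t0)| <= e * `|t1 - t0|.
Proof.
wlog le01 : t0 t1 / t0 <= t1 => [hw|] df he.
  have [le01|/ltW le10] := leP t0 t1; first exact: hw.
  have := hw t1 t0 le10; rewrite minC maxC => /(_ df he).
  rewrite -normrN distrC; apply: le_trans.
  by rewrite le_eqVlt; apply/orP; left; apply/eqP; congr (`|_|); ring.
rewrite (min_idPl le01) (max_idPr le01) in df he.
have [|//|c' cin ->] := @MVT_segment R f f' t0 t1 le01.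
- by move=> x xin; apply: df; move: xin; rewrite in_itv/= => /andP[/ltW-> /ltW->].
- apply: derivable_within_continuous => x; rewrite in_itv/= => xin.
  by have [] := df _ xin.
rewrite -mulrBl normrM ler_wpM2r//; apply: he.
by move: cin; rewrite in_itv.
Qed.

Lemma entry_norm (R : realType) (n : nat) (w : 'rV[R]_n) i : `|w 0 i| <= `|w|.
Proof.
rewrite [leRHS]/Num.Def.normr/= mx_normrE.
exact: (le_bigmax _ (fun ij => `|w ij.1 ij.2|) (0, i)).
Qed.

Lemma rv_norm_le (R : realType) (n : nat) (w : 'rV[R]_n) (b : R) : 0 <= b ->
  (forall i, `|w 0 i| <= b) -> `|w| <= b.
Proof.
move=> b0 wb; rewrite [leLHS]/Num.Def.normr/= mx_normrE.
by apply: bigmax_le => //= -[a j] _ /=; rewrite ord1.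
Qed.

Definition lincomb (R : realType) (n : nat) (a : 'I_n -> R) (v : 'rV[R]_n) : R :=
  \sum_i v 0 i * a i.

Lemma lincomb_is_linear (R : realType) (n : nat) (a : 'I_n -> R) :
  linear (lincomb a : 'rV[R]_n -> R^o).
Proof.
move=> k u v; rewrite /lincomb scaler_sumr -big_split/=; apply: eq_bigr => i _.
by rewrite !mxE /GRing.scale/= mulrDl mulrA.
Qed.

HB.instance Definition _ (R : realType) (n : nat) (a : 'I_n -> R) :=
  GRing.isLinear.Build R 'rV[R]_n R^o *:%R (lincomb a) (lincomb_is_linear a).

Lemma is_derive_line (R : realType) (V W : normedModType R) (f : V -> W) (y v : V) (x : R) :
  derivable f (y + x *: v) v ->
  is_derive x 1 (fun t : R => f (y + t *: v)) ('D_v f (y + x *: v)).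
Proof.
set z := y + _ => dz.
have E : (fun t : R => t^-1 *: (f (y + (t%:A + x) *: v) - f z)) =
         (fun t : R => t^-1 *: (f (t *: v + z) - f z)).
  apply/funext => t; congr (_ *: (f _ - _)).
  by rewrite /z scalerDl [t%:A]mulr1 addrCA.
by split; rewrite /derivable/derive /= -/z ?E.
Qed.

Section C1_differentiable.
Variables (R : realType) (n : nat) (f : 'rV[R]_n -> R) (y : 'rV[R]_n).
Hypothesis df : \forall z \near y, forall i, derivable f z (delta_mx 0 i).
Hypothesis cf : forall i, {for y, continuous (partial i f)}.

Let trunc (h : 'rV[R]_n) (k : nat) : 'rV[R]_n :=
  \row_i (if (i < k)%N then h 0 i else 0).

Let truncS h (k : 'I_n) : trunc h k.+1 = trunc h k + h 0 k *: delta_mx 0 k.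
Proof.
apply/rowP => i; rewrite !mxE eqxx/= ltnS leq_eqVlt.
have [->|] := eqVneq i k; first by rewrite eqxx/= ltnn add0r mulr1.
by move=> /negPf ik; rewrite (inj_eq val_inj) ik/= mulr0 addr0.
Qed.

Let trunc_norm (h : 'rV[R]_n) (k : nat) (x : R) (i : 'I_n) : `|x| <= `|h 0 i| -> (k <= i)%N ->
  `|trunc h k + x *: delta_mx 0 i| <= `|h|.
Proof.
move=> xh ki; apply: rv_norm_le => // j; rewrite !mxE eqxx/=.
have [->|_] := eqVneq j i.
  by rewrite ltnNge ki/= add0r mulr1 (le_trans xh)// entry_norm.
by rewrite mulr0 addr0; case: ifP => _; rewrite ?normr0// entry_norm.
Qed.

Let step_derive (h : 'rV[R]_n) (k : 'I_n) (x : R) :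
  derivable f (y + (trunc h k + x *: delta_mx 0 k)) (delta_mx 0 k) ->
  is_derive x 1 (fun t : R => f (y + (trunc h k + t *: delta_mx 0 k)))
     (partial k f (y + (trunc h k + x *: delta_mx 0 k))).
Proof.
rewrite addrA => /is_derive_line.
by under [X in is_derive _ _ X _]eq_fun do rewrite -addrA.
Qed.

(** The coordinates are changed one at a time: [trunc h k] keeps the first [k] coordinates of [h],
    and each step is a mean value estimate in one variable. The [n] errors must add up to at most
    [e], whence [e / n.+1], which also makes sense for [n = 0]. *)
Lemma C1_littleo (e : R) : 0 < e -> \forall h \near (0 : 'rV[R]_n),
  `|f (y + h) - f y - lincomb (fun i => partial i f y) h| <= e * `|h|.
Proof.
move=> e0; pose e' := e / n.+1%:R.
have e'0 : 0 < e' by rewrite divr_gt0.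
have : \forall z \near y, (forall i, derivable f z (delta_mx 0 i)) /\
    (forall i, `|partial i f z - partial i f y| <= e').
  apply: filterI; first exact: df.
  apply: (@filter_forall _ _
    (fun (i : 'I_n) z => `|partial i f z - partial i f y| <= e') (nbhs y)) => i; have /cvgrPdist_le := cf (i := i).
  by move=> /(_ _ e'0); apply: filterS => z; rewrite distrC.
move=> /nbhs_ballP[d /= d0 dP].
apply/nbhs_ballP; exists d => //= h; rewrite -ball_normE/= sub0r normrN => hd.
have main (k : nat) : (k <= n)%N ->
    `|f (y + trunc h k) - f y -
      \sum_(i < n | (i < k)%N) h 0 i * partial i f y| <= k%:R * (e' * `|h|).
  elim: k => [_|k IH kn].
    rewrite big_pred0_eq subr0 mul0r; suff -> : trunc h 0 = 0.
      by rewrite addr0 subrr normr0.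
    by apply/rowP => i; rewrite !mxE.
  pose K := Ordinal kn.
  rewrite (bigD1 K)/=; last by rewrite ltnS.
  under eq_bigl do rewrite ltnS -(inj_eq val_inj)/= andbC -ltn_neqAle.
  have {}IH := IH (ltnW kn).
  have -> : f (y + trunc h k.+1) - f y - (h 0 K * partial K f y +
      \sum_(i < n | (i < k)%N) h 0 i * partial i f y) =
      (f (y + trunc h k) - f y - \sum_(i < n | (i < k)%N) h 0 i * partial i f y) +
      (f (y + trunc h k.+1) - f (y + trunc h k) - partial K f y * (h 0 K - 0)).
    by ring.
  apply: le_trans (ler_normD _ _) _.
  rewrite -natr1 mulrDl mul1r; apply: lerD => //.
  rewrite (truncS h K).
  have in_ball x : Num.min 0 (h 0 K) <= x <= Num.max 0 (h 0 K) ->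
      ball y d (y + (trunc h k + x *: delta_mx 0 K)).
    move=> xin; rewrite -ball_normE/= opprD addNKr normrN.
    apply: le_lt_trans hd; apply: trunc_norm => //.
    move: xin; rewrite /Num.min /Num.max; case: ltP => h0 /andP[h1 h2].
      by rewrite !ger0_norm// ltW.
    by rewrite !ler0_norm// lerN2.
  have -> : f (y + trunc h k) = (fun t : R => f (y + (trunc h k + t *: delta_mx 0 K))) 0.
    by rewrite scale0r addr0.
  have D1 x xin := @step_derive h K x (proj1 (dP _ (in_ball x xin)) K).
  have D2 x xin := proj2 (dP _ (in_ball x xin)) K.
  apply: le_trans (mvt_bound D1 D2) _.
  by rewrite subr0 ler_wpM2l// ?(ltW e'0)// entry_norm.
have := main n (leqnn n).
have -> : trunc h n = h by apply/rowP => i; rewrite !mxE ltn_ord.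
under eq_bigl do rewrite ltn_ord.
move=> /le_trans; apply; rewrite mulrA ler_wpM2r//.
by rewrite /e' mulrCA ler_piMr ?(ltW e0)// ler_pdivrMr// mul1r ler_nat leqnSn.
Qed.

Lemma C1_differentiable : differentiable f y.
Proof.
pose L : {linear 'rV[R]_n -> R^o} := lincomb (fun i => partial i f y).
have cL : continuous L.
  rewrite (_ : (L : _ -> _) = (fun v : 'rV[R]_n => \sum_i v 0 i * partial i f y)) //.
  apply: continuous_big => [|i _ v]; first exact: add_continuous.
  exact: (@continuousM _ 'rV[R]_n (fun x : 'rV[R]_n => x 0 i : R)
    (fun=> partial i f y : R) v (differentiable_continuous (differentiable_coord _ _ _)) (@cst_continuous _ _ _ _)).
have L0 : (f : 'rV[R]_n -> R^o) \o shift y = cst (f y : R^o) + L +o_ (0 : 'rV[R]_n) id.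
  apply/eqaddoP => e e0; near=> h.
  have -> : (((f : 'rV[R]_n -> R^o) \o shift y) - (cst (f y : R^o) + L)) h =
      f (y + h) - f y - lincomb (fun i => partial i f y) h.
    by rewrite [y + h]addrC -addrA -opprD.
  by near: h; exact: C1_littleo.
apply/diff_locallyP; have E := diff_unique cL L0.
split; last by rewrite E.
by rewrite E; exact: cL.
Unshelve. all: by end_near. Qed.

Lemma C1_derive v : 'D_v f y = \sum_i v 0 i * partial i f y.
Proof.
have fd := C1_differentiable.
rewrite deriveE// {1}(row_sum_delta v) linear_sum; apply: eq_bigr => i _.
by rewrite linearZ /partial deriveE.
Qed.

End C1_differentiable.

Lemma smooth_C1 (R : realType) (n : nat) (U : set 'rV[R]_n) (f : 'rV[R]_n -> R)
    (s : seq 'I_n) (y : 'rV[R]_n) : open U -> smooth_on U f -> U y ->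
  differentiable (iter_partial s f) y /\
  forall v, 'D_v (iter_partial s f) y =
    \sum_i v 0 i * iter_partial (i :: s) f y.
Proof.
move=> oU sf Uy.
have d : \forall z \near y, forall i, derivable (iter_partial s f) z (delta_mx 0 i).
  by apply: filterS (open_nbhs_nbhs (conj oU Uy)) => z /(sf s)[].
have c i : {for y, continuous (partial i (iter_partial s f))}.
  by have [] := sf (i :: s) y Uy.
by split; [exact: C1_differentiable|move=> v; exact: C1_derive].
Qed.

Lemma is_derive_rV (R : realType) (n : nat) (g : R -> 'rV[R]_n) (t : R)
    (w : 'rV[R]_n) : (forall i, is_derive t 1 (fun s => g s 0 i) (w 0 i)) ->
  is_derive t 1 g w.
Proof.
move=> gd; have dg : derivable g t 1.
  by apply/derivable_mxP => i j; rewrite ord1; have [] := gd j.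
split => //; rewrite derive_mx//; apply/rowP => j; rewrite mxE.
by have [_ ->] := gd j.
Qed.

Lemma chain_curve (R : realType) (n : nat) (f : 'rV[R]_n -> R)
    (g : R -> 'rV[R]_n) (t : R) (w : 'rV[R]_n) :
  differentiable f (g t) -> is_derive t 1 g w ->
  is_derive t 1 (f \o g) ('D_w f (g t)).
Proof.
move=> df [/derivable1_diffP dg gw].
have dfg : differentiable (f \o g) t by exact: differentiable_comp.
split; first exact/derivable1_diffP.
rewrite deriveE// diff_comp//= deriveE//; congr ('d f _ _).
by rewrite -gw deriveE.
Qed.

Lemma schwarz_aux (R : realType) (A B1 B2 C p q e h : R) : 0 < h ->
  `|A - B1 - (B2 - C) - p * h * h| <= e / 2 * h * h ->
  `|A - B2 - (B1 - C) - q * h * h| <= e / 2 * h * h -> `|q - p| <= e.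
Proof.
move=> h0; have h2 : 0 < h * h by rewrite mulr_gt0.
rewrite !ler_norml => /andP[? ?] /andP[? ?].
by apply/andP; split; rewrite -(ler_pM2r h2); lra.
Qed.

(** Both mixed derivatives are limits of the same second difference over a square of side [h],
    divided by [h^2]. In [key] the mean value estimate is applied in direction [a] and inside it in
    direction [b]; the result is used in both orders. *)
Lemma schwarz (R : realType) (n : nat) (U : set 'rV[R]_n) (f : 'rV[R]_n -> R)
    (y : 'rV[R]_n) (i j : 'I_n) : open U -> smooth_on U f -> U y ->
  partial i (partial j f) y = partial j (partial i f) y.
Proof.
move=> oU sf Uy.
have key (a b : 'I_n) (e : R) : 0 < e -> \forall h \near 0^'+,
  `|(f (y + h *: delta_mx 0 a + h *: delta_mx 0 b) - f (y + h *: delta_mx 0 a))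
    - (f (y + h *: delta_mx 0 b) - f y) - (partial b (partial a f) y * h) * h|
    <= e * h * h.
  move=> e0.
  have : \forall z \near y, U z /\
      `|partial b (partial a f) z - partial b (partial a f) y| <= e.
    apply: filterI; first exact: open_nbhs_nbhs.
    have cf : {for y, continuous (partial b (partial a f))}.
      by have [] := sf [:: b; a] y Uy.
    by move/cvgrPdistC_le : cf => /(_ _ e0).
  move=> /nbhs_ballP[d /= d0 dP].
  have d20 : 0 < d / 2 by rewrite divr_gt0.
  near=> h.
  have h0 : 0 < h by near: h; exact: nbhs_right_gt.
  have hd : h < d / 2 by near: h; exact: nbhs_right_lt.
  have inb s t : 0 <= s <= h -> 0 <= t <= h ->
      ball y d (y + s *: delta_mx 0 a + t *: delta_mx 0 b).
    move=> /andP[s0 sh] /andP[t0 th].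
    rewrite -ball_normE/= -addrA opprD addNKr normrN.
    rewrite (le_lt_trans (ler_normD _ _))// (splitr d) ltrD//.
      rewrite normrZ (ger0_norm s0) (le_lt_trans _ hd)// (le_trans _ sh)//.
      rewrite ler_piMr// rv_norm_le// => k; rewrite !mxE/=.
      by case: (_ == _) => /=; rewrite ?normr0 ?normr1 ?ler01.
    rewrite normrZ (ger0_norm t0) (le_lt_trans _ hd)// (le_trans _ th)//.
    rewrite ler_piMr// rv_norm_le// => k; rewrite !mxE/=.
    by case: (_ == _) => /=; rewrite ?normr0 ?normr1 ?ler01.
  have inh s : Num.min 0 h <= s <= Num.max 0 h -> 0 <= s <= h.
    by rewrite (min_idPl (ltW h0)) (max_idPr (ltW h0)).
  have h00 : (0 : R) <= (0 : R) <= h by rewrite lexx ltW.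
  have hh : 0 <= h <= h by rewrite lexx ltW.
  pose g s := f (y + s *: delta_mx 0 a + h *: delta_mx 0 b) - f (y + s *: delta_mx 0 a).
  pose g' s := partial a f (y + s *: delta_mx 0 a + h *: delta_mx 0 b)
               - partial a f (y + s *: delta_mx 0 a).
  have -> : f (y + h *: delta_mx 0 b) - f y = g 0 by rewrite /g scale0r addr0.
  rewrite -/(g h).
  have := @mvt_bound R g g' (partial b (partial a f) y * h) (e * h) 0 h.
  rewrite subr0 (gtr0_norm h0); apply.
    move=> s /inh sin; apply: is_deriveB.
      have := @is_derive_line R _ _ f (y + h *: delta_mx 0 b) (delta_mx 0 a) s.
      rewrite addrAC; under [X in _ -> is_derive _ _ X _]eq_fun do rewrite addrAC.
      by apply; have [+ _] := dP _ (inb s h sin hh); move=> /(sf [::])[].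
    apply: is_derive_line.
    have := inb s 0 sin h00; rewrite scale0r addr0 => /dP[+ _].
    by move=> /(sf [::])[].
  move=> s /inh sin; rewrite /g'.
  have -> : partial a f (y + s *: delta_mx 0 a) =
    (fun t => partial a f (y + s *: delta_mx 0 a + t *: delta_mx 0 b)) 0.
    by rewrite scale0r addr0.
  have := @mvt_bound R (fun t => partial a f (y + s *: delta_mx 0 a + t *: delta_mx 0 b))
    (fun t => partial b (partial a f) (y + s *: delta_mx 0 a + t *: delta_mx 0 b))
    (partial b (partial a f) y) e 0 h.
  rewrite subr0 (gtr0_norm h0); apply.
    move=> t /inh tin; apply: is_derive_line.
    have [/(sf [:: a])[_ h'] _] := dP _ (inb s t sin tin); exact: h'.
  by move=> t /inh tin; have [_ +] := dP _ (inb s t sin tin).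
apply/eqP; rewrite -subr_eq0 -normr_le0; apply/ler_addgt0Pr => e e0; rewrite add0r.
have e20 : 0 < e / 2 by rewrite divr_gt0.
have [h [k1 [k2 h0]]] := filter_ex (filterI (key i j _ e20)
  (filterI (key j i _ e20) (nbhs_right_gt (0 : R)))).
rewrite [y + _ + _]addrAC in k2; exact: schwarz_aux h0 k1 k2.
Unshelve. all: by end_near. Qed.

(** * Charts and pseudoholomorphic maps *)

Section chart_basics.
Variables (R : realType) (n : nat) (X : smooth_manifold R n).
Implicit Types c : chart R n X.

Lemma chart_open c : atlas c -> open (cdom c).
Proof. by move=> /atlas_is_chart[[]]. Qed.

Lemma chart_img_open c : atlas c -> open (cimg c).
Proof. by move=> /atlas_is_chart[[]]. Qed.

Lemma chartK c x : atlas c -> cdom c x -> cinv c (cmap c x) = x.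
Proof. by move=> /atlas_is_chart[_ + _ _]; exact. Qed.

Lemma chart_img c x : cdom c x -> cimg c (cmap c x).
Proof. by move=> cx; exists x. Qed.

Lemma chart_invK c y : atlas c -> cimg c y -> cdom c (cinv c y) /\ cmap c (cinv c y) = y.
Proof. by move=> ac [x cx <-]; rewrite chartK. Qed.

Lemma chart_continuous c x : atlas c -> cdom c x -> {for x, continuous (cmap c)}.
Proof. by move=> /atlas_is_chart[_ _ h _] cx; exact: h. Qed.

Lemma chart_inv_continuous c y : atlas c -> cimg c y -> {for y, continuous (cinv c)}.
Proof. by move=> /atlas_is_chart[_ _ _]; exact. Qed.

Lemma overlap_open c c' : atlas c -> atlas c' ->
  open (cmap c @` (cdom c `&` cdom c')).
Proof.
move=> ac ac'; rewrite openE => y [x [cx c'x] xy].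
have iy : cimg c y by rewrite -xy; exact: chart_img.
have : \forall z \near y, cimg c z /\ cdom c' (cinv c z).
  apply: filterI; first exact: (open_nbhs_nbhs (conj (chart_img_open ac) iy)).
  apply: (chart_inv_continuous ac iy).
  by apply: open_nbhs_nbhs; split; [exact: chart_open|rewrite -xy chartK].
apply: filterS => z [iz c'z]; have [cz zK] := chart_invK ac iz.
by exists (cinv c z).
Qed.

Lemma velocity_change c c' (q : R -> X) (t : R) (v : 'rV[R]_n) :
  atlas c -> atlas c' -> {for t, continuous q} -> cdom c (q t) -> cdom c' (q t) ->
  is_derive t 1 (fun s => cmap c (q s)) v ->
  is_derive t 1 (fun s => cmap c' (q s)) (v *m Defs.jacobian c c' (cmap c (q t))).
Proof.
move=> ac ac' cq cd cd' dv; set y := cmap c (q t).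
have Uy : (cmap c @` (cdom c `&` cdom c')) y by exists (q t).
apply: is_derive_rV => i.
have sm : smooth_on (cmap c @` (cdom c `&` cdom c')) (fun y' => transition c c' y' 0 i).
  exact: (atlas_compatible ac ac').
have [df dE] := smooth_C1 [::] (overlap_open ac ac') sm Uy.
have := chain_curve df dv; rewrite dE.
have -> : \sum_i0 v 0 i0 * iter_partial [:: i0] (fun y' => transition c c' y' 0 i) (cmap c (q t)) =
  (v *m Defs.jacobian c c' y) 0 i.
  by rewrite mxE; apply: eq_bigr => j _; rewrite mxE.
apply: near_eq_is_derive.
have : \forall s \near t, cdom c (q s).
  by apply: cq; apply: open_nbhs_nbhs; split => //; exact: chart_open.
by apply: filterS => s cs; rewrite /= /transition chartK.
Qed.

Lemma velocity_norm_change (g : chart R n X -> 'rV[R]_n -> 'M[R]_n) c c' (q : R -> X) (t : R) (v : 'rV[R]_n) :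
  bilinear_field g ->
  atlas c -> atlas c' -> cdom c (q t) -> cdom c' (q t) ->
  let v' := v *m Defs.jacobian c c' (cmap c (q t)) in
  bilin (g c' (cmap c' (q t))) v' v' = bilin (g c (cmap c (q t))) v v.
Proof.
move=> [_ gc] ac ac' cd cd' /=; rewrite /bilin (gc c c' (q t))//=.
by rewrite trmx_mul !mulmxA.
Qed.

End chart_basics.

Lemma is_derive_coord (R : realType) (n : nat) (g : R -> 'rV[R]_n) (t : R) v i :
  is_derive t 1 g v -> is_derive t 1 (fun s => g s 0 i) (v 0 i).
Proof.
move=> [dg <-]; have /derivable_mxP dgi := dg.
by split; [exact: dgi|rewrite derive_mx// mxE].
Qed.

Section Jholomorphic.
Variables (R : realType) (n : nat) (X : tamed_manifold R n) (F : 'rV[R]_2 -> X).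
Hypothesis JF : Jhol_local F.
Variables (c : chart R n X).
Hypothesis ac : atlas c.

Let U := F @^-1` cdom c.
Let u k := fun y => cmap c (F y) 0 k.

Lemma Jhol_open : open U.
Proof. by case: JF => cF _; apply: open_comp => [x _|]; [exact: cF|exact: chart_open]. Qed.

Lemma Jhol_smooth k : smooth_on U (u k).
Proof. by case: JF => _ /(_ c ac)[+ _]; exact. Qed.

Lemma Jhol_CR y k : U y ->
  partial 1 (u k) y = \sum_i partial 0 (u i) y * acs c (cmap c (F y)) i k.
Proof.
case: JF => _ /(_ c ac)[_ /(_ y)] cr /cr /rowP/(_ k); rewrite !mxE => ->.
by apply: eq_bigr => i _; rewrite mxE.
Qed.

Lemma acs_sqr y k l : U y -> \sum_i acs c (cmap c (F y)) k i * acs c (cmap c (F y)) i l =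
  - (k == l)%:R.
Proof.
move=> Uy; have [_ /(_ c (cmap c (F y)) ac (chart_img Uy))] := acs_almost_complex X.
by move=> /matrixP/(_ k l); rewrite !mxE.
Qed.

Lemma Jhol_CR' y k : U y ->
  partial 0 (u k) y = - \sum_i partial 1 (u i) y * acs c (cmap c (F y)) i k.
Proof.
move=> Uy; under eq_bigr do rewrite Jhol_CR// mulr_suml.
rewrite exchange_big/=; under eq_bigr do under eq_bigr do rewrite -mulrA.
under eq_bigr do rewrite -mulr_sumr acs_sqr//.
rewrite (bigD1 k)//= eqxx big1 ?addr0 => [|i /negPf->]; last by rewrite oppr0 mulr0.
by rewrite mulrN1 opprK.
Qed.

Lemma acs_smooth i k : smooth_on (cimg c) (fun y => acs c y i k).
Proof. by have [[+ _] _] := acs_almost_complex X; move=> /(_ c ac i k). Qed.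

Lemma acs_derive a y i k : U y ->
  is_derive y (delta_mx 0 a) (fun z => acs c (cmap c (F z)) i k)
    (\sum_l partial a (u l) y * partial l (fun w => acs c w i k) (cmap c (F y))).
Proof.
move=> Uy.
have [dJ dJE] := smooth_C1 [::] (chart_img_open ac) (@acs_smooth i k) (chart_img Uy).
have d0 : is_derive (0 : R) 1 (fun h : R => cmap c (F (y + h *: delta_mx 0 a)))
   (\row_l partial a (u l) y).
  apply: is_derive_rV => l; rewrite mxE.
  have := @is_derive_line R _ _ (u l) y (delta_mx 0 a) 0.
  rewrite scale0r addr0; apply.
  by have [_ +] := @Jhol_smooth l [::] y Uy; apply.
have := @chain_curve R n (fun w => acs c w i k) (fun h : R => cmap c (F (y + h *: delta_mx 0 a))) 0 _ _ d0.
rewrite scale0r addr0 => /(_ dJ); rewrite dJE => -[d1 d2].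
have E : (fun h : R => h^-1 *: (acs c (cmap c (F (h *: delta_mx 0 a + y))) i k - acs c (cmap c (F y)) i k)) =
  (fun h : R => h^-1 *: (((fun w => acs c w i k) \o (fun h : R => cmap c (F (y + h *: delta_mx 0 a)))) (h%:A + 0) -
   ((fun w => acs c w i k) \o (fun h : R => cmap c (F (y + h *: delta_mx 0 a)))) 0)).
  by apply/funext => h; rewrite /= addr0 scale0r addr0 [h%:A]mulr1 [y + _]addrC.
split; first by rewrite /derivable/= E.
rewrite /derive/= E; move: d2; rewrite /derive => ->.
by apply: eq_bigr => l _; rewrite mxE.
Qed.

(** The Cauchy-Riemann equation expresses each first derivative by J and the other one. When both
    forms are differentiated, the terms with second derivatives cancel by the symmetry of mixed
    partial derivatives. What remains is quadratic in the first derivatives, with derivatives of J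
    as coefficients. *)
Lemma Jhol_laplacian y k : U y ->
  partial 0 (partial 0 (u k)) y + partial 1 (partial 1 (u k)) y =
  \sum_i (partial 0 (u i) y * (\sum_l partial 1 (u l) y * partial l (fun w => acs c w i k) (cmap c (F y)))
        - partial 1 (u i) y * (\sum_l partial 0 (u l) y * partial l (fun w => acs c w i k) (cmap c (F y)))).
Proof.
move=> Uy; pose J i := fun z => acs c (cmap c (F z)) i k.
have nU : \forall z \near y, U z by exact: (open_nbhs_nbhs (conj Jhol_open Uy)).
have du a b i : is_derive y (delta_mx 0 a) (partial b (u i)) (partial a (partial b (u i)) y).
  by have [_ /(_ a)] := @Jhol_smooth i [:: b] y Uy; move=> d; split.
have prod a b : is_derive y (delta_mx 0 a) (fun z => \sum_i partial b (u i) z * J i z)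
   (\sum_i (partial a (partial b (u i)) y * J i y + partial b (u i) y *
      \sum_l partial a (u l) y * partial l (fun w => acs c w i k) (cmap c (F y)))).
  rewrite (_ : (fun z => _) = \sum_i (fun z => partial b (u i) z * J i z)); last first.
    by apply/funext => z; rewrite fct_sumE.
  apply: is_derive_sum => i.
  apply: is_derive_eq; first exact: is_deriveM (du a b i) (@acs_derive a y i k Uy).
  by rewrite /GRing.scale/= addrC [J i y * _]mulrC.
have -> : partial 1 (partial 1 (u k)) y = 'D_(delta_mx 0 1) (fun z => \sum_i partial 0 (u i) z * J i z) y.
  by apply: near_eq_derive; apply: filterS nU => z Uz; exact: Jhol_CR.
have -> : partial 0 (partial 0 (u k)) y = 'D_(delta_mx 0 0) (- (fun z => \sum_i partial 1 (u i) z * J i z)) y.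
  by apply: near_eq_derive; apply: filterS nU => z Uz; exact: Jhol_CR'.
rewrite deriveN; last by have [] := prod 0 1.
have [_ ->] := prod 0 1; have [_ ->] := prod 1 0.
rewrite addrC -sumrB.
apply: eq_bigr => i _.
rewrite (schwarz 1 0 Jhol_open (@Jhol_smooth i) Uy).
by rewrite opprD addrACA subrr add0r.
Qed.

End Jholomorphic.

Lemma norm_cross_le (R : realDomainType) (x y x' y' p q : R) :
  `|x| <= p -> `|y| <= q -> `|x'| <= p -> `|y'| <= q -> `|x * y - x' * y'| <= p * q + p * q.
Proof.
by move=> xp yq xp' yq'; apply: le_trans (ler_normB _ _) _; rewrite !normrM lerD// ler_pM.
Qed.

Lemma sum2 (V : nmodType) (f : 'I_2 -> V) : \sum_i f i = f 0 + f 1.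
Proof.
rewrite big_ord_recl big_ord1; congr (f _ + f _); exact: val_inj.
Qed.

Lemma is_derive_uniq (R : realType) (V W : normedModType R) (x v : V) (f : V -> W) a b :
  is_derive x v f a -> is_derive x v f b -> a = b.
Proof. by move=> [_ <-] [_ <-]. Qed.

(** * Positive definite forms, and norms of tangent vectors in charts *)

Section bilin_theory.
Variables (R : realType) (n : nat).
Implicit Types (M : 'M[R]_n) (v w : 'rV[R]_n).

Lemma bilinE M v w : bilin M v w = \sum_i \sum_j v 0 i * M i j * w 0 j.
Proof.
rewrite /bilin mxE exchange_big/=; apply: eq_bigr => j _.
by rewrite !mxE mulr_suml.
Qed.

Lemma bilinDl M v v' w : bilin M (v + v') w = bilin M v w + bilin M v' w.
Proof. by rewrite /bilin !mulmxDl mxE. Qed.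

Lemma bilinDr M v w w' : bilin M v (w + w') = bilin M v w + bilin M v w'.
Proof. by rewrite /bilin linearD/= mulmxDr mxE. Qed.

Lemma bilinZl M a v w : bilin M (a *: v) w = a * bilin M v w.
Proof. by rewrite /bilin -!scalemxAl mxE. Qed.

Lemma bilinZr M a v w : bilin M v (a *: w) = a * bilin M v w.
Proof. by rewrite /bilin linearZ/= -scalemxAr mxE. Qed.

Lemma bilin_le M v (b m : R) : (forall i j, `|M i j| <= b) ->
  (forall i, `|v 0 i| <= m) -> bilin M v v <= n%:R ^+ 2 * b * m ^+ 2.
Proof.
move=> Mb vm; rewrite bilinE.
have [n0|n0] := posnP n.
  rewrite big1 => [|i _]; last by have := ltn_ord i; rewrite [X in (_ < X)%N]n0.
  by rewrite [n%:R](_ : _ = 0) ?n0// expr0n/= !mul0r.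
have m0 : 0 <= m by apply: le_trans (vm (Ordinal n0)); rewrite normr_ge0.
have b0 : 0 <= b by apply: le_trans (Mb (Ordinal n0) (Ordinal n0)); rewrite normr_ge0.
apply: (@le_trans _ _ (\sum_(i < n) \sum_(j < n) (m * b * m))).
  apply: ler_sum => i _; apply: ler_sum => j _; apply: le_trans (ler_norm _) _.
  by rewrite !normrM !ler_pM// mulr_ge0.
rewrite !sumr_const !card_ord -mulrnA -[leLHS]mulr_natr natrM.
by rewrite le_eqVlt; apply/orP; left; apply/eqP; ring.
Qed.

Section posdef.
Variable M : 'M[R]_n.
Hypothesis Msym : forall v w, bilin M v w = bilin M w v.
Hypothesis Mpos : forall v, v != 0 -> 0 < bilin M v v.

Lemma bilin_ge0 v : 0 <= bilin M v v.
Proof.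
have [->|/Mpos/ltW//] := eqVneq v 0.
by rewrite -{1}(scale0r (0 : 'rV[R]_n)) bilinZl mul0r.
Qed.

Lemma bilin_comb (x y : R) v w :
  bilin M (x *: v + y *: w) (x *: v + y *: w) <=
  (x ^+ 2 + y ^+ 2) * (bilin M v v + bilin M w w).
Proof.
have := bilin_ge0 (y *: v - x *: w).
rewrite -scaleNr !(bilinDl, bilinDr, bilinZl, bilinZr) (Msym w v).
by set A := bilin M v v; set B := bilin M w w; set C := bilin M v w; lra.
Qed.

Lemma bilin_rot (x y : R) v w :
  bilin M (x *: v + y *: w) (x *: v + y *: w) +
  bilin M (- y *: v + x *: w) (- y *: v + x *: w) =
  (x ^+ 2 + y ^+ 2) * (bilin M v v + bilin M w w).
Proof.
rewrite !(bilinDl, bilinDr, bilinZl, bilinZr) (Msym w v).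
by set A := bilin M v v; set B := bilin M w w; set C := bilin M v w; ring.
Qed.

Lemma posdef_unit : M \in unitmx.
Proof.
rewrite -row_free_unit -kermx_eq0; apply/eqP/row_matrixP => i; rewrite row0.
apply/eqP; apply: contraT => /Mpos.
have -> : bilin M (row i (kermx M)) (row i (kermx M)) = 0.
  by rewrite /bilin -row_mul mulmx_ker row0 mul0mx mxE.
by rewrite ltxx.
Qed.

(** Cauchy-Schwarz for the form [M], applied to [v] and the [k]-th row [w] of the inverse: the
    product of [v] and [w] is the entry of [v], and the square of [w] is a diagonal entry of the
    inverse. *)
Lemma entry_le_bilin v (b : R) k : 0 < b -> (forall i j, `|invmx M i j| <= b) ->
  v 0 k ^+ 2 <= b * bilin M v v.
Proof.
move=> b0 Mb; have Mu := posdef_unit.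
have MT : M^T = M.
  apply/matrixP => i j; rewrite mxE; have := Msym (delta_mx 0 j) (delta_mx 0 i).
  by rewrite /bilin -!rowE !trmx_delta -!colE !mxE.
pose w := row k (invmx M).
have wE : w = (delta_mx 0 k : 'rV_n) *m invmx M by rewrite /w rowE.
have vw : bilin M v w = v 0 k.
  rewrite /bilin wE trmx_mul trmx_inv MT -!mulmxA (mulmxA M) mulmxV// mul1mx.
  by rewrite trmx_delta -colE mxE.
have ww : bilin M w w <= b.
  rewrite /bilin wE trmx_mul trmx_inv MT mulmxKV// mulmxA -rowE trmx_delta -colE !mxE.
  by apply: le_trans (Mb k k); rewrite ler_norm.
have := bilin_ge0 (b *: v - v 0 k *: w).
rewrite -scaleNr !(bilinDl, bilinDr, bilinZl, bilinZr) (Msym w v) vw.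
set V := bilin M v v; set W := bilin M w w in ww *; set x := v 0 k => h.
have : x ^+ 2 * W <= x ^+ 2 * b by rewrite ler_wpM2l// sqr_ge0.
move=> h2; rewrite -(ler_pM2l b0); lra.
Qed.

End posdef.
End bilin_theory.

Section norm_on_charts.
Variables (R : realType) (n : nat) (X : tamed_manifold R n).
Implicit Types c : chart R n X.

Lemma metric_sym c y : atlas c -> cimg c y ->
  forall v w, bilin (metric c y) v w = bilin (metric c y) w v.
Proof. by move=> ac cy; have [_ /(_ c y ac cy)[]] := metric_riemannian X. Qed.

Lemma metric_pos c y : atlas c -> cimg c y ->
  forall v, v != 0 -> 0 < bilin (metric c y) v v.
Proof. by move=> ac cy; have [_ /(_ c y ac cy)[]] := metric_riemannian X. Qed.

Lemma velocity_norm_chart c c' (q : R -> X) (t : R) (v : 'rV[R]_n) :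
  atlas c -> atlas c' -> {for t, continuous q} -> cdom c (q t) -> cdom c' (q t) ->
  is_derive t 1 (fun s => cmap c (q s)) v ->
  exists2 v', is_derive t 1 (fun s => cmap c' (q s)) v' &
  bilin (metric c' (cmap c' (q t))) v' v' = bilin (metric c (cmap c (q t))) v v.
Proof.
move=> ac ac' cq cd cd' dv; exists (v *m Defs.jacobian c c' (cmap c (q t))).
  exact: velocity_change.
by apply: velocity_norm_change => //; have [] := metric_riemannian X.
Qed.

(** Gathering these bounds in a single [b], later at least 1, makes all analytic constants functions
    of [n] and [b] alone. *)
Definition bchart c (x : X) (b : R) :=
  [/\ atlas c, cdom c x, cmap c x = 0, cimg c = unit_ball R n &
    forall y, unit_ball R n y ->
      [/\ forall i j, `|metric c y i j| <= b,
          forall i j, `|invmx (metric c y) i j| <= b,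
          forall i j, `|acs c y i j| <= b &
          forall l i j, `|partial l (fun w => acs c w i j) y| <= b]].

Lemma bounded_geometry_bchart (j : nat) (B : R) (x : X) : (3 <= j)%N ->
  bounded_geometry X j B -> exists c, bchart c x (`|B| + 1).
Proof.
move=> j3 [/(_ x)[c [[ac cx] c0 ci cB]] _]; exists c; split => // y uy.
have le1 r : r <= B -> r <= `|B| + 1.
  by move=> /le_trans; apply; rewrite (le_trans (ler_norm B))// lerDl ler01.
have [mB imB] := cB (@metric _ _ X c) (Or33 _ _ erefl).
have [jB _] := cB (@acs _ _ X c) (Or32 _ _ erefl).
split=> [i i'|i i'|i i'|l i i']; apply: le1.
- exact: (mB i i' [::] y).
- exact: (imB i i' [::] y).
- exact: (jB i i' [::] y).
- by apply: (jB i i' [:: l] y) => //; rewrite (leq_trans _ j3).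
Qed.

Lemma dpartial_derive (F : 'rV[R]_2 -> X) c a y : Jhol_local F -> atlas c -> cdom c (F y) ->
  is_derive (0 : R) 1 (fun h => cmap c (F (y + h *: delta_mx 0 a))) (dpartial c F a y).
Proof.
move=> JF ac cy; apply: is_derive_rV => l; rewrite mxE.
have := @is_derive_line R _ _ (fun z => cmap c (F z) 0 l) y (delta_mx 0 a) 0.
rewrite scale0r addr0; apply.
by have [_ +] := @Jhol_smooth _ _ _ _ JF _ ac l [::] y cy; apply.
Qed.

(** The energy density is defined in the arbitrary chart [chart_at]. Each partial derivative is the
    velocity of a curve [h |-> F (y + h e_a)], and the norm of a velocity is the same in all
    charts. *)
Lemma energy_density_chart (F : 'rV[R]_2 -> X) c y : Jhol_local F -> atlas c -> cdom c (F y) ->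
  energy_density F y = \sum_(a < 2) bilin (metric c (cmap c (F y)))
     (dpartial c F a y) (dpartial c F a y).
Proof.
move=> JF ac cy; rewrite /energy_density; apply: eq_bigr => a _.
set c0 := chart_at (F y).
have ac0 : atlas c0 by exact: chart_at_atlas.
have c0y : cdom c0 (F y) by exact: chart_at_dom.
have d0 := dpartial_derive a JF ac0 c0y.
have d := dpartial_derive a JF ac cy.
have cq : {for (0 : R), continuous (fun h : R => F (y + h *: delta_mx 0 a))}.
  apply: (@continuous_comp _ _ _ (fun h : R => y + h *: delta_mx 0 a) F); last first.
    by case: JF => + _; exact.
  apply: differentiable_continuous; apply/derivable1_diffP.
  have := @is_derive_line R 'rV[R]_2 'rV[R]_2 id y (delta_mx 0 a) 0.
  by move=> /(_ (@derivable_id _ _ _ _))[].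
have := velocity_norm_chart ac ac0 cq; rewrite scale0r addr0.
move=> /(_ _ cy c0y d)[v' dv' <-].
by rewrite (is_derive_uniq d0 dv').
Qed.

Lemma energy_density_ge0 (F : 'rV[R]_2 -> X) y : 0 <= energy_density F y.
Proof.
apply: sumr_ge0 => a _; apply: bilin_ge0.
move=> v; apply: metric_pos; first exact: chart_at_atlas.
exact/chart_img/chart_at_dom.
Qed.

End norm_on_charts.

(* Multiplication by i, under the identification of the plane with C. *)
Definition rot (R : realType) (w : 'rV[R]_2) : 'rV[R]_2 :=
  \row_i (if i == 0 then - w 0 1 else w 0 0).

Definition nrm2 (R : realType) (w : 'rV[R]_2) : R := w 0 0 ^+ 2 + w 0 1 ^+ 2.

(** A relation instead of an iterated derivative: values for sums, multiples and reflections can be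
    combined directly, and each barrier comes with the formula of its second derivative. *)
Definition d2at (R : realType) (f : R -> R) (x a : R) : Prop :=
  exists g : R -> R, nbhs x (fun z : R => is_derive z 1 f (g z)) /\ is_derive x 1 g a.

Lemma comb_aux (R : realType) (w v : 'rV[R]_2) (D : 'I_2 -> 'I_2 -> R) :
  w 0 0 * (\sum_j v 0 j * D 0 j) + w 0 1 * (\sum_j v 0 j * D 1 j) =
  \sum_i \sum_j w 0 i * v 0 j * D i j.
Proof. by rewrite !sum2; congr (_ + _); rewrite mulrDr !mulrA. Qed.

Lemma lap_aux (R : realType) (w : 'rV[R]_2) (D : 'I_2 -> 'I_2 -> R) :
  \sum_i \sum_j w 0 i * w 0 j * D i j + \sum_i \sum_j rot w 0 i * rot w 0 j * D i j =
  nrm2 w * (D 0 0 + D 1 1).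
Proof. by rewrite !sum2 !mxE eqxx /= /nrm2; ring. Qed.

Section Jholomorphic_in_chart.
Variables (R : realType) (n : nat) (X : tamed_manifold R n) (F : 'rV[R]_2 -> X).
Hypothesis JF : Jhol_local F.
Variables (c : chart R n X) (x0 : X) (b : R).
Hypothesis bc : bchart c x0 b.
Hypothesis b1 : 1 <= b.

Let ac : atlas c. Proof. by case: bc. Qed.
Let U := F @^-1` cdom c.
Let u k := fun y => cmap c (F y) 0 k.

Definition ddir (w : 'rV[R]_2) k y := w 0 0 * partial 0 (u k) y + w 0 1 * partial 1 (u k) y.

Lemma is_derive_chart_line (a v : 'rV[R]_2) (x : R) k : U (a + x *: v) ->
  is_derive x 1 (fun x => u k (a + x *: v)) (ddir v k (a + x *: v)).
Proof.
move=> Ux; have [df dE] := smooth_C1 [::] (Jhol_open JF ac) (@Jhol_smooth _ _ _ _ JF _ ac k) Ux.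
have := is_derive_line (diff_derivable df (v := v)); rewrite dE.
by rewrite sum2.
Qed.

Lemma is_derive_ddir_line (w a v : 'rV[R]_2) (x : R) k : U (a + x *: v) ->
  is_derive x 1 (fun x => ddir w k (a + x *: v))
   (\sum_i \sum_j w 0 i * v 0 j * partial j (partial i (u k)) (a + x *: v)).
Proof.
move=> Ux.
have d i : is_derive x 1 (fun x => partial i (u k) (a + x *: v))
   (\sum_j v 0 j * partial j (partial i (u k)) (a + x *: v)).
  have [df dE] := smooth_C1 [:: i] (Jhol_open JF ac) (@Jhol_smooth _ _ _ _ JF _ ac k) Ux.
  by have := is_derive_line (diff_derivable df (v := v)); rewrite dE.
apply: is_derive_eq.
exact: (comb_aux w v (fun i j => partial j (partial i (u k)) (a + x *: v))).
Qed.

Lemma ddir_laplacian (w y : 'rV[R]_2) k : U y ->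
  (\sum_i \sum_j w 0 i * w 0 j * partial j (partial i (u k)) y) +
  (\sum_i \sum_j rot w 0 i * rot w 0 j * partial j (partial i (u k)) y) =
  nrm2 w * (partial 0 (partial 0 (u k)) y + partial 1 (partial 1 (u k)) y).
Proof.
move=> Uy; exact: (lap_aux w (fun i j => partial j (partial i (u k)) y)).
Qed.

Lemma ddir_rot (w y : 'rV[R]_2) k : U y ->
  ddir (rot w) k y = \sum_i ddir w i y * acs c (cmap c (F y)) i k.
Proof.
move=> Uy; rewrite /ddir !mxE eqxx/= (Jhol_CR JF ac k Uy) (Jhol_CR' JF ac k Uy).
rewrite mulrNN 2!mulr_sumr -big_split/=; apply: eq_bigr => i _.
rewrite /u; move: (partial 0 _ y) (partial 1 _ y) (acs _ _ _ _) (w 0 0) (w 0 1) => A B C p q.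
by ring.
Qed.

Lemma ddir_rot2 (w y : 'rV[R]_2) k : ddir (rot (rot w)) k y = - ddir w k y.
Proof.
rewrite /ddir !mxE eqxx/=.
by move: (partial 0 _ y) (partial 1 _ y) (w 0 0) (w 0 1) => A B p q; ring.
Qed.

Let dvec w y := \row_k ddir w k y.

Lemma dvecE w y : dvec w y = w 0 0 *: dpartial c F 0 y + w 0 1 *: dpartial c F 1 y.
Proof.
by apply/rowP => k; rewrite [LHS]mxE [RHS]mxE [X in _ = X + _]mxE [X in _ = _ + X]mxE
  [dpartial c F 0 y 0 k]mxE [dpartial c F 1 y 0 k]mxE.
Qed.

Lemma chart_pos y : U y -> [/\ unit_ball R n (cmap c (F y)),
  forall v w, bilin (metric c (cmap c (F y))) v w = bilin (metric c (cmap c (F y))) w v &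
  forall v, v != 0 -> 0 < bilin (metric c (cmap c (F y))) v v].
Proof.
move=> Uy; case: bc => _ _ _ ci _; split.
- by rewrite -ci; exact: chart_img.
- by apply: metric_sym => //; exact: chart_img.
- by apply: metric_pos => //; exact: chart_img.
Qed.

Lemma energy_density_U y : U y -> energy_density F y =
  bilin (metric c (cmap c (F y))) (dpartial c F 0 y) (dpartial c F 0 y) +
  bilin (metric c (cmap c (F y))) (dpartial c F 1 y) (dpartial c F 1 y).
Proof. by move=> Uy; rewrite (energy_density_chart JF ac Uy) sum2. Qed.

Lemma ddir_le (w y : 'rV[R]_2) k : U y ->
  ddir w k y ^+ 2 <= b * (nrm2 w * energy_density F y).
Proof.
move=> Uy; have [uy ms mp] := chart_pos Uy; case: bc => _ _ _ _ /(_ _ uy)[_ im _ _].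
have b0 : 0 < b by rewrite (lt_le_trans ltr01).
have -> : ddir w k y = dvec w y 0 k by rewrite mxE.
apply: le_trans (entry_le_bilin ms mp _ k b0 im) _.
rewrite ler_pM2l// dvecE energy_density_U//; exact: bilin_comb.
Qed.

(** By the Cauchy-Riemann equation the derivative along [w] is, up to sign, J applied to the
    derivative along [rot w]. Hence one directional derivative bounds the whole density, and the
    comparison arguments only have to estimate a derivative in [t]. *)
Lemma energy_le_ddir (w y : 'rV[R]_2) (m : R) : U y ->
  (forall k, `|ddir (rot w) k y| <= m) ->
  nrm2 w * energy_density F y <= 2 * n.+1%:R ^+ 4 * b ^+ 3 * m ^+ 2.
Proof.
move=> Uy wm; have [uy ms mp] := chart_pos Uy; case: bc => _ _ _ _ /(_ _ uy)[gb _ jb _].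
have b0 : 0 < b by rewrite (lt_le_trans ltr01).
have wm' k : `|ddir w k y| <= n.+1%:R * b * `|m|.
  rewrite -normrN -ddir_rot2 ddir_rot//.
  apply: le_trans (ler_norm_sum _ _ _) _.
  apply: (@le_trans _ _ (\sum_(i < n) `|m| * b)).
    apply: ler_sum => i _; rewrite normrM ler_pM//.
    exact: le_trans (wm i) (ler_norm m).
  rewrite sumr_const card_ord -[leLHS]mulr_natl [`|m| * b]mulrC mulrA ler_wpM2r//.
  by rewrite ler_wpM2r ?(ltW b0)// ler_nat.
have -> : nrm2 w * energy_density F y =
   bilin (metric c (cmap c (F y))) (dvec w y) (dvec w y) +
   bilin (metric c (cmap c (F y))) (dvec (rot w) y) (dvec (rot w) y).
  rewrite energy_density_U// !dvecE.
  have -> : rot w 0 0 = - w 0 1 by rewrite mxE eqxx.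
  have -> : rot w 0 1 = w 0 0 by rewrite mxE.
  by rewrite bilin_rot.
have h1 := @bilin_le R n (metric c (cmap c (F y))) (dvec w y) b _ gb
  (fun k => eq_ind_r (fun z => `|z| <= _) (wm' k) (mxE _ _ 0 k)).
have h2 := @bilin_le R n (metric c (cmap c (F y))) (dvec (rot w) y) b _ gb
  (fun k => eq_ind_r (fun z => `|z| <= _) (wm k) (mxE _ _ 0 k)).
apply: le_trans (lerD h1 h2) _.
have n1 : (n%:R : R) ^+ 2 <= n.+1%:R ^+ 2 by rewrite lerXn2r ?nnegrE// ler_nat.
have N1 : (1 : R) <= n.+1%:R ^+ 2 by rewrite expr_ge1// ler1n.
rewrite exprMn real_normK ?num_real// exprMn.
have := sqr_ge0 m; move: (m ^+ 2) => M M0.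
rewrite (_ : n.+1%:R ^+ 4 = n.+1%:R ^+ 2 * n.+1%:R ^+ 2); last by rewrite -exprD.
have n0 : 0 <= (n%:R : R) ^+ 2 by exact: sqr_ge0.
move: (n%:R ^+ 2) (n.+1%:R ^+ 2) n0 n1 N1 => s N s0 sN N1.
have bM : 0 <= b * M by rewrite mulr_ge0// ltW.
have b2 : 1 <= b ^+ 2 by rewrite expr_ge1// ltW.
have -> : 2 * (N * N) * b ^+ 3 * M = N * N * b ^+ 2 * (b * M) + N * (N * b ^+ 2) * (b * M) by ring.
apply: lerD.
  rewrite (_ : s * b * _ = s * N * b ^+ 2 * (b * M)); last by ring.
  rewrite ler_wpM2r// ler_wpM2r ?(le_trans ler01)// ler_wpM2r ?(le_trans ler01)//.
rewrite (_ : s * b * M = s * 1 * (b * M)); last by ring.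
rewrite ler_wpM2r// ler_pM//.
by rewrite -[1]mulr1 ler_pM.
Qed.

(** The left side is the Laplacian in the frame [w], [rot w], hence [nrm2 w] times the standard one.
    Each product in [Jhol_laplacian] consists of two first derivatives, at most sqrt(b E) each, and
    a derivative of J, at most b. *)
Lemma laplacian_le (w y : 'rV[R]_2) k : U y ->
  `|(\sum_i \sum_j w 0 i * w 0 j * partial j (partial i (u k)) y) +
  (\sum_i \sum_j rot w 0 i * rot w 0 j * partial j (partial i (u k)) y)| <=
  2 * n.+1%:R ^+ 2 * b ^+ 2 * (nrm2 w * energy_density F y).
Proof.
move=> Uy; have [uy ms mp] := chart_pos Uy; case: bc => _ _ _ _ /(_ _ uy)[_ _ _ pb].
have b0 : 0 < b by rewrite (lt_le_trans ltr01).
have w0 : 0 <= nrm2 w by rewrite addr_ge0// sqr_ge0.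
rewrite ddir_laplacian// normrM (ger0_norm w0) mulrCA ler_wpM2l//.
rewrite (Jhol_laplacian JF ac k Uy).
set E := energy_density F y.
have E0 : 0 <= E by exact: energy_density_ge0.
have pE (a : 'I_2) l : `|partial a (u l) y| <= Num.sqrt (b * E).
  rewrite -ler_sqr ?nnegrE ?sqrtr_ge0// sqr_sqrtr ?mulr_ge0 ?(ltW b0)//.
  rewrite real_normK ?num_real//.
  have := @ddir_le (delta_mx 0 a) y l Uy.
  rewrite /ddir /nrm2 !mxE !eqxx/=.
  by case: (eqVneq a 0) => [->|]; [|case: a => [[|[|//]] i] ai //; rewrite (_ : Ordinal i = 1) //; last exact: val_inj];
    rewrite ?(mul0r, mul1r, add0r, addr0, expr0n, expr1n)/=.
have lb a i : `|\sum_l partial a (u l) y * partial l (fun w => acs c w i k) (cmap c (F y))|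
   <= n%:R * (Num.sqrt (b * E) * b).
  apply: le_trans (ler_norm_sum _ _ _) _.
  apply: (@le_trans _ _ (\sum_(i < n) Num.sqrt (b * E) * b)).
    by apply: ler_sum => l _; rewrite normrM ler_pM//; exact: pE.
  by rewrite sumr_const card_ord mulr_natl.
apply: le_trans (ler_norm_sum _ _ _) _.
apply: (@le_trans _ _ (\sum_(i < n) (2 * (Num.sqrt (b * E) * (n%:R * (Num.sqrt (b * E) * b)))))).
  apply: ler_sum => i _; rewrite mulr_natl mulr2n.
  exact: norm_cross_le (pE _ _) (lb _ _) (pE _ _) (lb _ _).
rewrite sumr_const card_ord -[leLHS]mulr_natl.
have -> : n%:R * (2 * (Num.sqrt (b * E) * (n%:R * (Num.sqrt (b * E) * b)))) =
  2 * (n%:R * n%:R) * (Num.sqrt (b * E) ^+ 2) * b by move: (n%:R) (Num.sqrt _) => p q; ring.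
rewrite sqr_sqrtr ?mulr_ge0 ?(ltW b0)//.
have -> : 2 * (n%:R * n%:R) * (b * E) * b = 2 * (n%:R * n%:R) * b ^+ 2 * E by move: (n%:R) => p; ring.
rewrite ler_wpM2r// ler_wpM2r ?sqr_ge0// ler_wpM2l// expr2 ler_pM//; by rewrite ler_nat.
Qed.

End Jholomorphic_in_chart.

(** * Comparison functions and the maximum principle *)

Section second_derivatives.
Variable R : realType.
Implicit Types (f g : R -> R) (x a : R).

Lemma d2atD f g x a b : d2at f x a -> d2at g x b -> d2at (fun z => f z + g z) x (a + b).
Proof.
move=> [f' [f1 f2]] [g' [g1 g2]]; exists (fun z => f' z + g' z); split.
  by apply: filterS2 f1 g1 => z d1 d2; apply: is_deriveD.
exact: is_deriveD.
Qed.

Lemma d2atZ f x a k : d2at f x a -> d2at (fun z => k * f z) x (k * a).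
Proof.
move=> [f' [f1 f2]]; exists (fun z => k * f' z); split.
  by apply: filterS f1 => z d1; exact: is_deriveZ.
exact: is_deriveZ.
Qed.

Lemma d2at_opp f x a : d2at f (- x) a -> d2at (fun z => f (- z)) x a.
Proof.
have dopp (h : R -> R) (z b : R) : is_derive (- z) 1 h b -> is_derive z 1 (fun y => h (- y)) (- b).
  move=> dh; have dN : is_derive z 1 (fun y : R => - y) (-1 : R).
    by apply: is_deriveN.
  have := @is_derive1_comp _ h (fun y : R => - y) z _ _ dh dN.
  by rewrite mulrN1.
move=> [f' [f1 f2]]; exists (fun z => - f' (- z)); split.
  have : nbhs x (fun z : R => is_derive (- z) 1 f (f' (- z))).
    by move: f1; apply: (@continuousN _ R^o R^o id x (@cvg_id _ _)).
  by apply: filterS => z; exact: dopp.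
rewrite -[a]opprK; apply: is_deriveN; exact: dopp.
Qed.

(** The derivative vanishes at the maximum. If [a] were positive, the derivative would be positive
    just to the right of [x], and [f] would exceed [f x] there by the mean value theorem. *)
Lemma d2at_max f x a : d2at f x a -> (\forall z \near x, f z <= f x) -> a <= 0.
Proof.
move=> [g [fg ga]] fmax; rewrite leNgt; apply/negP => a0.
have /nbhs_ballP[d /= d0 dP] : nbhs x (fun z : R => is_derive z 1 f (g z) /\ f z <= f x).
  exact: filterI.
have inb z : `|x - z| < d -> is_derive z 1 f (g z) /\ f z <= f x by apply: dP.
have gx0 : g x = 0.
  have h0 : x \in `]x - d, x + d[ by rewrite in_itv/=; lra.
  have hin z : z \in `]x - d, x + d[ -> `|x - z| < d.
    by rewrite in_itv/= ltr_norml; lra.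
  have [_ <-] : is_derive x 1 f 0.
    apply: (derive1_at_max _ _ h0) => [|z /hin/inb[[]]//|z /hin/inb[]//].
    by lra.
  by have [|[_ <-] _] := inb x; rewrite ?subrr ?normr0.
have gcv : h^-1 *: (g (h *: 1 + x) - g x) @[h --> 0^'] --> a.
  by have [dg <-] := ga; exact: dg.
have /nbhs_ballP[r /= r0 rP] : \forall h \near (0 : R), h != 0 -> 0 < h^-1 *: (g (h *: 1 + x) - g x).
  exact: (cvgr_gt _ gcv _ a0).
pose h := Num.min (d / 2) (r / 2).
have h0 : 0 < h by rewrite lt_min !divr_gt0.
have hd : h < d by rewrite gt_min ltr_pdivrMr// mulr_natr mulr2n ltrDl d0.
have hr : h < r by rewrite gt_min [r / 2 < r]ltr_pdivrMr// mulr_natr mulr2n ltrDl r0 orbT.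
have inh z : x <= z <= x + h -> `|x - z| < d.
  move=> /andP[z1 z2]; rewrite distrC ger0_norm ?subr_ge0//.
  by rewrite ltrBlDl (le_lt_trans z2)// ltrD2l.
have [| | |c' cin E] := @MVT R f g x (x + h).
- by rewrite ltrDl.
- by move=> z; rewrite in_itv/= => /andP[/ltW z1 /ltW z2]; have [] := inb z (inh z _); rewrite ?z1.
- apply: derivable_within_continuous => z; rewrite in_itv/= => zin.
  by have [[]] := inb z (inh z zin).
have [|_ fle] := inb (x + h); first by apply: inh; lra.
move: cin; rewrite in_itv/= => /andP[c1 c2].
have c'0 : 0 < c' - x by rewrite subr_gt0.
have := rP (c' - x); rewrite /ball/= /ball_ sub0r normrN gtr0_norm// => /(_ _ (lt0r_neq0 c'0)).
rewrite [(c' - x) *: 1]mulr1 subrK gx0 subr0 pmulr_rgt0 ?invr_gt0// => gc.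
have : 0 < f (x + h) - f x by rewrite E mulr_gt0//; [apply: gc; lra|lra].
by rewrite subr_gt0 ltNge fle.
Qed.

End second_derivatives.

Lemma within_contB (R : realType) (T : topologicalType) (D : set T) (f g : T -> R) :
  {within D, continuous f} -> {within D, continuous g} ->
  {within D, continuous (fun p => f p - g p)}.
Proof. by move=> cf cg x; exact: (continuousB (cf x) (cg x)). Qed.

Lemma within_contZ (R : realType) (T : topologicalType) (D : set T) (k : R) (f : T -> R) :
  {within D, continuous f} -> {within D, continuous (fun p => k * f p)}.
Proof. by move=> cf x; exact: (continuousM (@cst_continuous _ _ _ _) (cf x)). Qed.

Definition lap2 (R : realType) (f : R -> R -> R) (s t a : R) : Prop :=
  exists x y, [/\ d2at (f^~ t) s x, d2at (f s) t y & a = x + y].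

Section lap2_theory.
Variable R : realType.
Implicit Types (f g : R -> R -> R).

Lemma lap2D f g s t a b : lap2 f s t a -> lap2 g s t b ->
  lap2 (fun s t => f s t + g s t) s t (a + b).
Proof.
move=> [x [y [fx fy ->]]] [x' [y' [gx gy ->]]]; exists (x + x'), (y + y').
by split; [exact: d2atD|exact: d2atD|rewrite addrACA].
Qed.

Lemma lap2Z f s t a k : lap2 f s t a -> lap2 (fun s t => k * f s t) s t (k * a).
Proof.
move=> [x [y [fx fy ->]]]; exists (k * x), (k * y).
by split; [exact: d2atZ|exact: d2atZ|rewrite mulrDr].
Qed.

Lemma lap2N f s t a : lap2 f s t a -> lap2 (fun s t => - f s t) s t (- a).
Proof.
move=> h; rewrite -mulN1r (_ : (fun s t => _) = (fun s t => -1 * f s t)); first exact: lap2Z.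
by apply/funext => ?; apply/funext => ?; rewrite mulN1r.
Qed.

Lemma lap2B f g s t a b : lap2 f s t a -> lap2 g s t b ->
  lap2 (fun s t => f s t - g s t) s t (a - b).
Proof. by move=> fa gb; apply: lap2D => //; exact: lap2N. Qed.

Lemma lap2_reflect f s t a : lap2 f s (- t) a -> lap2 (fun s t => f s (- t)) s t a.
Proof.
by move=> [x [y [fx fy ->]]]; exists x, y; split => //; exact: (d2at_opp fy).
Qed.

(** At a positive maximum both second derivatives are at most 0, against the positive Laplacian. The
    boundary condition is hidden in the hypothesis: points where [h] is positive have to be
    interior. *)
Lemma max_principle (D : set (R * R)) (h : R -> R -> R) : compact D ->
  {within D, continuous (fun p => h p.1 p.2)} ->
  (forall p, D p -> 0 < h p.1 p.2 ->
    nbhs p D /\ exists2 a, 0 < a & lap2 h p.1 p.2 a) ->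
  forall p, D p -> h p.1 p.2 <= 0.
Proof.
move=> cD ch hD p0 Dp0; rewrite leNgt; apply/negP => hp0.
have [[s t] /set_mem Dq qmax] := compact_EVT_max (ex_intro _ p0 Dp0) cD ch.
have hq : 0 < h s t by rewrite (lt_le_trans hp0)// (qmax p0)// inE.
have [nD [a a0 [x [y [dx dy E]]]]] := hD _ Dq hq.
have x0 : x <= 0.
  apply: (d2at_max dx).
  have : \forall z \near s, D (z, t).
    move: nD => [[P Q] /= [Ps Qt] PQ]; apply: filterS Ps => z Pz.
    by apply: PQ; split => //; exact: nbhs_singleton.
  by apply: filterS => z Dz; apply: (qmax (z, t)); rewrite inE.
have y0 : y <= 0.
  apply: (d2at_max dy).
  have : \forall z \near t, D (s, z).
    move: nD => [[P Q] /= [Ps Qt] PQ]; apply: filterS Qt => z Qz.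
    by apply: PQ; split => //; exact: nbhs_singleton.
  by apply: filterS => z Dz; apply: (qmax (s, z)); rewrite inE.
by lra.
Qed.

(** The odd part of [U] has a Laplacian of absolute value at most [2 N], while that of [w] is below
    [- 2 N]. So the odd part minus [w], and its negative minus [w], are strictly subharmonic
    wherever the inequality is not given; the first alternative of the hypothesis serves at the
    boundary. *)
Lemma reflection_barrier (D : set (R * R)) (U w : R -> R -> R) : compact D ->
  {within D, continuous (fun p => U p.1 p.2)} ->
  {within D, continuous (fun p => U p.1 (- p.2))} ->
  {within D, continuous (fun p => w p.1 p.2)} ->
  (forall s t, D (s, t) -> `|U s t - U s (- t)| <= w s t \/
    [/\ nbhs (s, t) D & exists N, [/\
       exists2 a, `|a| <= N & lap2 U s t a,
       exists2 a, `|a| <= N & lap2 U s (- t) a &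
       exists2 c, c < - (2 * N) & lap2 w s t c]]) ->
  forall s t, D (s, t) -> `|U s t - U s (- t)| <= w s t.
Proof.
move=> cD cU cU' cw H.
have key (e : R) : `|e| = 1 -> forall p, D p ->
    e * (U p.1 p.2 - U p.1 (- p.2)) - w p.1 p.2 <= 0.
  move=> e1; apply: (@max_principle D (fun s t => e * (U s t - U s (- t)) - w s t)) => //.
    apply: within_contB => //; apply: within_contZ; exact: within_contB.
  move=> [s t] /= Dst pos; have [le|[nD [N [[a aN la] [a' a'N la'] [c cN lw]]]]] := H _ _ Dst.
    move: pos; rewrite subr_gt0 ltNge => /negP; case; apply: le_trans le.
    by rewrite (le_trans (ler_norm _))// normrM e1 mul1r.
  split => //; exists (e * (a - a') - c).
    rewrite subr_gt0 (lt_le_trans cN)// lerNl -mulrN.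
    rewrite (le_trans (ler_norm _))// normrM normrN e1 mul1r.
    by rewrite (le_trans (ler_normB _ _))// mulr_natl mulr2n lerD.
  apply: lap2B => //; apply: lap2Z; apply: lap2B => //; exact: (lap2_reflect la').
move=> s t Dst; rewrite ler_norml; apply/andP; split.
  by have := key (-1) (normrN1 _) _ Dst; rewrite /= mulN1r subr_le0 lerNl.
by have := key 1 (normr1 _) _ Dst; rewrite /= mul1r subr_le0.
Qed.

End lap2_theory.

Section barriers.
Variable R : realType.

Lemma is_derive_sq (x : R) : is_derive x 1 (fun x : R => x ^+ 2) (2 * x).
Proof.
have := @is_deriveX R R^o id 2 x 1 1 (is_derive_id _ _).
by move=> h; apply: is_derive_eq h _; rewrite [_%:A]mulr1 expr1.
Qed.

Definition qpow (a s t : R) : R := (s ^+ 2 + t ^+ 2) `^ a.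

Lemma is_derive_qpow1 (a s t : R) : 0 < s ^+ 2 + t ^+ 2 ->
  is_derive s 1 (fun s => qpow a s t) (2 * a * s * qpow (a - 1) s t).
Proof.
move=> q0; have dq : is_derive s 1 (fun s : R => s ^+ 2 + t ^+ 2) (2 * s).
  have := is_deriveD (is_derive_sq s) (is_derive_cst (t ^+ 2 : R^o) s 1).
  by rewrite addr0.
have := @is_derive1_comp R (fun x => x `^ a) (fun s : R => s ^+ 2 + t ^+ 2) s _ _ (is_derive1_powR a q0) dq.
by move=> h; apply: is_derive_eq h _; rewrite /qpow; ring.
Qed.

Lemma qpowC (a s t : R) : qpow a s t = qpow a t s.
Proof. by rewrite /qpow addrC. Qed.

Lemma is_derive_qpow2 (a s t : R) : 0 < s ^+ 2 + t ^+ 2 ->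
  is_derive t 1 (fun t => qpow a s t) (2 * a * t * qpow (a - 1) s t).
Proof.
rewrite addrC => q0; have := @is_derive_qpow1 a t s q0; rewrite qpowC.
by under eq_fun do rewrite qpowC.
Qed.

Lemma near_q1 (s t : R) : 0 < s ^+ 2 + t ^+ 2 -> nbhs s (fun z : R => 0 < z ^+ 2 + t ^+ 2).
Proof.
move=> q0; have c : z ^+ 2 + t ^+ 2 @[z --> s] --> s ^+ 2 + t ^+ 2.
  by apply: cvgD; [exact: exprn_continuous|exact: cvg_cst].
exact: (cvgr_gt _ c _ q0).
Qed.

Lemma qpow_gt0 (a s t : R) : 0 < s ^+ 2 + t ^+ 2 -> 0 < qpow a s t.
Proof. by move=> q0; exact: powR_gt0. Qed.

Lemma qpowD (a b s t : R) : 0 < s ^+ 2 + t ^+ 2 -> qpow (a + b) s t = qpow a s t * qpow b s t.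
Proof. by move=> q0; rewrite /qpow powRD// (gt_eqF q0) implybT. Qed.

Lemma qpow1 (s t : R) : qpow 1 s t = s ^+ 2 + t ^+ 2.
Proof. by rewrite /qpow powRr1// addr_ge0// sqr_ge0. Qed.

Lemma qpowS (a s t : R) : 0 < s ^+ 2 + t ^+ 2 ->
  (s ^+ 2 + t ^+ 2) * qpow (a - 1 - 1) s t = qpow (a - 1) s t.
Proof. by move=> q0; rewrite -{1}qpow1 -qpowD// addrCA subrr addr0. Qed.

(** In polar coordinates [bT a] is r^(2a+1) sin and [bS a] is r^(2a+2) sin^2. Both vanish on t = 0,
    like an odd part. [bT 0] and [bT (-1)] are harmonic. The Laplacian of [bS a] contains
    [2 * qpow a], which does not vanish on t = 0 and can therefore compensate a bound that does not
    vanish there either. *)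
Definition bT (a s t : R) := t * qpow a s t.
Definition bS (a s t : R) := t ^+ 2 * qpow a s t.

Lemma d2at_qpow1 (a s t : R) : 0 < s ^+ 2 + t ^+ 2 ->
  d2at (fun s => qpow a s t) s
    (2 * a * qpow (a - 1) s t + 4 * a * (a - 1) * s ^+ 2 * qpow (a - 1 - 1) s t).
Proof.
move=> q0; exists (fun s => 2 * a * s * qpow (a - 1) s t); split.
  by apply: filterS (near_q1 q0) => z; exact: is_derive_qpow1.
have d1 : is_derive s 1 (fun s : R => 2 * a * s) (2 * a).
  by have := is_deriveZ (2 * a) (is_derive_id s (1 : R)); rewrite [_ *: 1]mulr1.
have := is_deriveM d1 (@is_derive_qpow1 (a - 1) s t q0).
by move=> h; apply: is_derive_eq h _; rewrite /GRing.scale/=; ring.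
Qed.

Lemma lap_bT (a s t : R) : 0 < s ^+ 2 + t ^+ 2 ->
  lap2 (bT a) s t (4 * a * (a + 1) * t * qpow (a - 1) s t).
Proof.
move=> q0; set P1 := qpow (a - 1) s t; set P2 := qpow (a - 1 - 1) s t.
exists (t * (2 * a * P1 + 4 * a * (a - 1) * s ^+ 2 * P2)).
exists (6 * a * t * P1 + 4 * a * (a - 1) * t ^+ 3 * P2); split.
- exact: d2atZ (d2at_qpow1 a q0).
- exists (fun t => qpow a s t + 2 * a * t ^+ 2 * qpow (a - 1) s t); split.
    have := near_q1 (eq_ind _ (fun x => 0 < x) q0 _ (addrC _ _)).
    apply: filterS => z; rewrite addrC => z0.
    have := is_deriveM (is_derive_id z (1:R)) (@is_derive_qpow2 a s z z0).
    by move=> h; apply: is_derive_eq h _; rewrite /GRing.scale/=; ring.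
  have d1 : is_derive t 1 (fun t : R => 2 * a * t ^+ 2) (2 * a * (2 * t)).
    by have := is_deriveZ (2 * a) (is_derive_sq t).
  have := is_deriveD (@is_derive_qpow2 a s t q0) (is_deriveM d1 (@is_derive_qpow2 (a - 1) s t q0)).
  by move=> h; apply: is_derive_eq h _; rewrite /GRing.scale/= -/P1 -/P2; ring.
- have <- : (s ^+ 2 + t ^+ 2) * P2 = P1 by exact: qpowS.
  ring.
Qed.

Lemma lap_bS (a s t : R) : 0 < s ^+ 2 + t ^+ 2 ->
  lap2 (bS a) s t (2 * qpow a s t + 4 * a * (a + 2) * t ^+ 2 * qpow (a - 1) s t).
Proof.
move=> q0; set P0 := qpow a s t; set P1 := qpow (a - 1) s t; set P2 := qpow (a - 1 - 1) s t.
exists (t ^+ 2 * (2 * a * P1 + 4 * a * (a - 1) * s ^+ 2 * P2)).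
exists (2 * P0 + 10 * a * t ^+ 2 * P1 + 4 * a * (a - 1) * t ^+ 4 * P2); split.
- exact: d2atZ (d2at_qpow1 a q0).
- exists (fun t => 2 * t * qpow a s t + 2 * a * t ^+ 3 * qpow (a - 1) s t); split.
    have := near_q1 (eq_ind _ (fun x => 0 < x) q0 _ (addrC _ _)).
    apply: filterS => z; rewrite addrC => z0.
    have := is_deriveM (is_derive_sq z) (@is_derive_qpow2 a s z z0).
    by move=> h; apply: is_derive_eq h _; rewrite /GRing.scale/=; ring.
  have d0 : is_derive t 1 (fun t : R => 2 * t) 2.
    by have := is_deriveZ 2 (is_derive_id t (1 : R)); rewrite [_ *: 1]mulr1.
  have d1 : is_derive t 1 (fun t : R => 2 * a * t ^+ 3) (2 * a * (3 * t ^+ 2)).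
    have := is_deriveZ (2 * a) (@is_deriveX R R^o id 3 t 1 1 (is_derive_id _ _)).
    by move=> h; apply: is_derive_eq h _; rewrite [_%:A]mulr1.
  have := is_deriveD (is_deriveM d0 (@is_derive_qpow2 a s t q0)) (is_deriveM d1 (@is_derive_qpow2 (a - 1) s t q0)).
  by move=> h; apply: is_derive_eq h _; rewrite /GRing.scale/= -/P0 -/P1 -/P2; ring.
- have <- : (s ^+ 2 + t ^+ 2) * P2 = P1 by exact: qpowS.
  ring.
Qed.

Lemma qpow_continuous (a s t : R) : 0 < s ^+ 2 + t ^+ 2 ->
  {for (s, t), continuous (fun p : R * R => qpow a p.1 p.2)}.
Proof.
move=> q0; apply: (@continuous_comp _ _ _ (fun p : R * R => p.1 ^+ 2 + p.2 ^+ 2) (fun x => x `^ a)) => /=.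
  apply: cvgD.
    by apply: (@continuous_comp _ _ _ (fun p : R * R => p.1) (fun x : R => x ^+ 2)); [exact: cvg_fst|exact: exprn_continuous].
  by apply: (@continuous_comp _ _ _ (fun p : R * R => p.2) (fun x : R => x ^+ 2)); [exact: cvg_snd|exact: exprn_continuous].
by have [d _] := is_derive1_powR a q0; apply: differentiable_continuous; exact/derivable1_diffP.
Qed.

Lemma bT_continuous (a s t : R) : 0 < s ^+ 2 + t ^+ 2 ->
  {for (s, t), continuous (fun p : R * R => bT a p.1 p.2)}.
Proof. by move=> q0; apply: cvgM; [exact: cvg_snd|exact: qpow_continuous]. Qed.

Lemma bS_continuous (a s t : R) : 0 < s ^+ 2 + t ^+ 2 ->
  {for (s, t), continuous (fun p : R * R => bS a p.1 p.2)}.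
Proof.
move=> q0; apply: cvgM; last exact: qpow_continuous.
by apply: (@continuous_comp _ _ _ (fun p : R * R => p.2) (fun x : R => x ^+ 2)); [exact: cvg_snd|exact: exprn_continuous].
Qed.

Lemma bS_le_bT (a s t : R) : 0 < s ^+ 2 + t ^+ 2 -> 0 <= t ->
  bS a s t <= bT (a + 2^-1) s t.
Proof.
move=> q0 t0; rewrite /bS /bT qpowD// expr2 -mulrA ler_wpM2l//.
rewrite mulrC; apply: ler_wpM2l; first exact/ltW/qpow_gt0.
rewrite /qpow powR12_sqrt ?(ltW q0)// -[leLHS]ger0_norm// -sqrtr_sqr ler_wsqrtr//.
by rewrite lerDr sqr_ge0.
Qed.

Lemma derive_bound (f : R -> R) (a K d : R) : 0 < d -> is_derive (0 : R) 1 f a -> f 0 = 0 ->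
  (forall t, 0 < t <= d -> `|f t| <= K * t) -> `|a| <= K.
Proof.
move=> d0 [df <-] f0 fK; set l := 'D_1 f 0.
have gcv : h^-1 *: (f (h *: 1 + 0) - f 0) @[h --> 0^'] --> l by exact: df.
apply/ler_addgt0Pr => e e0.
have /nbhs_ballP[r /= r0 rP] : \forall h \near (0 : R), h != 0 -> `|l - h^-1 *: (f (h *: 1 + 0) - f 0)| < e.
  by have /cvgrPdist_lt/(_ _ e0) := gcv.
pose h := Num.min d (r / 2).
have h0 : 0 < h by rewrite lt_min d0 divr_gt0.
have := rP h; rewrite /ball/= /ball_ sub0r normrN gtr0_norm//.
rewrite gt_min [r / 2 < r]ltr_pdivrMr// mulr_natr mulr2n ltrDl r0 orbT.
move=> /(_ isT (lt0r_neq0 h0)).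
rewrite f0 subr0 addr0 [h *: 1]mulr1 => /ltW lt1.
have : `|h^-1 *: f h| <= K.
  rewrite normrM normfV (gtr0_norm h0) mulrC ler_pdivrMr// fK// h0 ge_min lexx.
  by [].
move=> lt2; rewrite -[l](subrK (h^-1 *: f h)) addrC.
by rewrite (le_trans (ler_normD _ _))// lerD.
Qed.

End barriers.

Lemma d2at_poly2 (R : realType) (a b c x : R) : d2at (fun s : R => a * s ^+ 2 + b * s + c) x (2 * a).
Proof.
exists (fun s => a * (2 * s) + b); split.
  apply: (@filterS _ (nbhs x) _ setT) => [z _|]; last exact: filterT.
  have := is_deriveD (is_deriveD (is_deriveZ a (is_derive_sq z)) (is_deriveZ b (is_derive_id z (1 : R)))) (is_derive_cst (c : R^o) z 1).
  by move=> h; apply: is_derive_eq h _; rewrite addr0 [b *: 1]mulr1.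
have := is_deriveD (is_deriveZ (a * 2) (is_derive_id x (1 : R))) (is_derive_cst (b : R^o) x 1).
rewrite addr0 [_ *: 1]mulr1 [a * 2]mulrC.
by rewrite (_ : (2 * a) \*: id + cst b = fun s : R => a * (2 * s) + b)//; apply/funext => s; rewrite mulrA [a * 2]mulrC.
Qed.

Lemma reflect_continuous (R : realType) : continuous (fun p : R * R => (p.1, - p.2)).
Proof.
move=> p; have c2 : - q.2 @[q --> p] --> - p.2 by apply: cvgN; exact: cvg_snd.
exact: (cvg_pair cvg_fst c2).
Qed.

(* Comparison of the odd part of U with a quadratic barrier. *)
Lemma gradient_bound (R : realType) (U : R -> R -> R) (d M N U' : R) :
  0 < d -> 0 <= M -> 0 < N ->
  (forall s t, `|s| <= d -> `|t| <= d ->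
    [/\ {for (s, t), continuous (fun p : R * R => U p.1 p.2)}, `|U s t| <= M &
        exists2 a, `|a| <= N & lap2 U s t a]) ->
  is_derive (0 : R) 1 (U 0) U' -> `|U'| <= 2 * M / d + N * d.
Proof.
move=> d0 M0 N0 HU dU.
pose k := 2 * M / d ^+ 2.
have k0 : 0 <= k by rewrite divr_ge0 ?sqr_ge0// mulr_ge0.
(* The first summand is harmonic and at least k d^2 = 2 M on the sides |s| = d and t = d of the
   half-square; the second one is nonnegative with Laplacian - 4 N. Both vanish at s = t = 0. *)
pose w s t := k * (s ^+ 2 + t * (2 * d - t)) + 2 * N * (t * (d - t)).
pose D : set (R * R) := [set p | `|p.1| <= d /\ 0 <= p.2 <= d].
have DE : D = `[- d, d]%classic `*` `[0, d]%classic.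
  by apply/seteqP; split => -[s t] /=; rewrite /D/= !in_itv/= -ler_norml => -[].
have cD : compact D by rewrite DE; apply: compact_setX; exact: segment_compact.
have kd : k * d ^+ 2 = 2 * M by rewrite /k divfK// expf_neq0// gt_eqF.
have cwp : continuous (fun p : R * R => w p.1 p.2).
  have c1 : continuous (fun p : R * R => p.1) by move=> p; exact: cvg_fst.
  have c2 : continuous (fun p : R * R => p.2) by move=> p; exact: cvg_snd.
  have cM (f g : R * R -> R) : continuous f -> continuous g -> continuous (fun p => f p * g p).
    by move=> cf cg p; exact: cvgM (cf p) (cg p).
  have cA (f g : R * R -> R) : continuous f -> continuous g -> continuous (fun p => f p + g p).
    by move=> cf cg p; exact: cvgD (cf p) (cg p).
  have cN (f : R * R -> R) : continuous f -> continuous (fun p => - f p).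
    by move=> cf p; exact: cvgN (cf p).
  have cc (x : R) : continuous (fun p : R * R => x) by move=> p; exact: cvg_cst.
  have -> : (fun p : R * R => w p.1 p.2) = (fun p => k * (p.1 * p.1 + p.2 * (2 * d - p.2)) + 2 * N * (p.2 * (d - p.2))).
    by apply/funext => p; rewrite /w; ring.
  exact: (cA _ _ (cM _ _ (cc k) (cA _ _ (cM _ _ c1 c1) (cM _ _ c2 (cA _ _ (cc _) (cN _ c2)))))
    (cM _ _ (cc (2 * N)) (cM _ _ c2 (cA _ _ (cc d) (cN _ c2))))).
have tn t : 0 <= t <= d -> `|t| <= d /\ `|- t| <= d.
  by move=> /andP[t0 td]; rewrite normrN ger0_norm.
have cUr : {within D, continuous (fun p : R * R => U p.1 p.2)}.
  apply: continuous_in_subspaceT => -[s t] /set_mem[/= sd /tn[td _]].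
  by have [] := HU s t sd td.
have cUn : {within D, continuous (fun p : R * R => U p.1 (- p.2))}.
  apply: continuous_in_subspaceT => -[s t] /set_mem[/= sd /tn[_ td]].
  have [cU _ _] := HU s (- t) sd td.
  apply: (@continuous_comp _ _ _ (fun p : R * R => (p.1, - p.2)) (fun p : R * R => U p.1 p.2)) => //.
  exact: reflect_continuous.
have lw s t : lap2 w s t (- (4 * N)).
  exists (2 * k), (2 * (- k - 2 * N)); split.
  - rewrite (_ : w^~ t = fun s => k * s ^+ 2 + 0 * s + (k * (t * (2 * d - t)) + 2 * N * (t * (d - t)))); first exact: d2at_poly2.
    by apply/funext => z; rewrite /w; ring.
  - rewrite (_ : w s = fun t => (- k - 2 * N) * t ^+ 2 + (k * 2 * d + 2 * N * d) * t + k * s ^+ 2); first exact: d2at_poly2.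
    by apply/funext => z; rewrite /w; ring.
  - by ring.
have main := @reflection_barrier R D U w cD cUr cUn (continuous_subspaceT cwp).
have {}main : forall s t, D (s, t) -> `|U s t - U s (- t)| <= w s t.
  apply: main => s t [/= sd tin]; have [td td'] := tn _ tin.
  have [_ Mt lt] := HU s t sd td; have [_ Mt' lt'] := HU s (- t) sd td'.
  have v2 : `|U s t - U s (- t)| <= 2 * M.
    by rewrite (le_trans (ler_normB _ _))// mulr_natl mulr2n lerD.
  case/andP: tin => t0 t1.
  have nn1 : 0 <= t * (d - t) by rewrite mulr_ge0// subr_ge0.
  have nn2 : 0 <= t * (2 * d - t) by rewrite mulr_ge0// subr_ge0; lra.
  have nn3 : 0 <= N * (t * (d - t)) by rewrite mulr_ge0// ltW.
  have nn4 : 0 <= k * (t * (2 * d - t)) by rewrite mulr_ge0.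
  have nn5 : 0 <= k * s ^+ 2 by rewrite mulr_ge0// sqr_ge0.
  have [sd1|sd1] := eqVneq `|s| d.
    have s2 : s ^+ 2 = d ^+ 2 by rewrite -sd1 real_normK ?num_real.
    by left; rewrite (le_trans v2)// /w s2 -kd; lra.
  have [td1|td1] := eqVneq t d.
    by left; rewrite (le_trans v2)// /w td1 -kd; lra.
  have [t00|t00] := eqVneq t 0.
    by left; rewrite /w t00 oppr0 subrr normr0; lra.
  right; split.
    have slt : `|s| < d by rewrite lt_neqAle sd1.
    have tlt : t < d by rewrite lt_neqAle td1.
    have tgt : 0 < t by rewrite lt_neqAle eq_sym t00.
    exists ([set z : R | `|z| < d], [set z : R | 0 < z < d]) => /=.
      split.
        apply: open_nbhs_nbhs; split => //.
        rewrite (_ : [set _ | _] = `]- d, d[%classic); first exact: interval_open.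
        by apply/seteqP; split => z /=; rewrite in_itv/= ltr_norml.
      apply: open_nbhs_nbhs; split; last by rewrite /= tgt.
      rewrite (_ : [set _ | _] = `]0, d[%classic); first exact: interval_open.
      by apply/seteqP; split => z /=; rewrite in_itv.
    by move=> [z1 z2] /= [/ltW z1d /andP[/ltW z20 /ltW z2d]]; split => //=; rewrite z20.
  exists N; split => //; exists (- (4 * N)) => //; move: N0; clear; move=> *; lra.
have := @derive_bound R (fun t => U 0 t - U 0 (- t)) (2 * U') (k * 2 * d + 2 * N * d) d d0.
have dV : is_derive (0 : R) 1 (fun t => U 0 t - U 0 (- t)) (2 * U').
  have dN : is_derive (0 : R) 1 (fun y : R => - y) (-1 : R) by apply: is_deriveN.
  have dU0 : is_derive (- (0 : R)) 1 (U 0) U' by rewrite oppr0.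
  have := is_deriveB dU (@is_derive1_comp R (U 0) (fun y : R => - y) 0 _ _ dU0 dN).
  by move=> h; apply: is_derive_eq h _; rewrite mulrN1 opprK mulr_natl mulr2n.
move=> /(_ dV); rewrite oppr0 subrr => /(_ erefl).
have -> : 2 * M / d = k * d by rewrite /k expr2 invfM mulrA divfK// gt_eqF.
rewrite normrM (ger0_norm (ler0n _ 2)) => bd.
rewrite -(ler_pM2l (ltr0n R 2)).
have -> : 2 * (k * d + N * d) = k * 2 * d + 2 * N * d by ring.
apply: bd => t /andP[t0 td].
have /main : D (0, t) by split; rewrite /= ?normr0 ?(ltW d0)// (ltW t0).
move=> /le_trans; apply.
rewrite /w expr0n/= add0r -subr_ge0.
have -> : (k * 2 * d + 2 * N * d) * t - (k * (t * (2 * d - t)) + 2 * N * (t * (d - t))) = k * t ^+ 2 + 2 * (N * t ^+ 2) by ring.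
have nn := mulr_ge0 (ltW N0) (sqr_ge0 t).
by have nn' := mulr_ge0 k0 (sqr_ge0 t); lra.
Qed.

Lemma bS_le_bT' (R : realType) (a b s t : R) : 0 < s ^+ 2 + t ^+ 2 -> 0 <= t -> b = a + 2^-1 ->
  bS a s t <= bT b s t.
Proof. by move=> q0 t0 ->; exact: bS_le_bT. Qed.

Lemma lap_bT' (R : realType) (a k b s t : R) : 0 < s ^+ 2 + t ^+ 2 ->
  k = 4 * a * (a + 1) -> b = a - 1 -> lap2 (bT a) s t (k * bT b s t).
Proof. by move=> q0 -> ->; rewrite mulrA; exact: lap_bT. Qed.

Lemma lap_bS' (R : realType) (a k b s t : R) : 0 < s ^+ 2 + t ^+ 2 ->
  k = 4 * a * (a + 2) -> b = a - 1 ->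
  lap2 (bS a) s t (2 * qpow a s t + k * bS b s t).
Proof. by move=> q0 -> ->; rewrite mulrA; exact: lap_bS. Qed.

(* Comparison of the odd part of U with sums of functions r^p sin and r^p sin^2
   of the polar coordinates. *)
Lemma annulus_barrier (R : realType) (U : R -> R -> R) (Q1 Q2 C1 N1 N2 N3 U' : R) :
  0 < Q1 < 1 -> 1 < Q2 -> 0 <= C1 -> 0 <= N1 -> 0 <= N2 -> 0 < N3 ->
  (forall s t, Q1 <= s ^+ 2 + t ^+ 2 <= Q2 ->
    {for (s, t), continuous (fun p : R * R => U p.1 p.2)} /\
    exists2 a, `|a| <= N1 * qpow (- 4^-1) s t + N2 * qpow (- (7 / 4)) s t + N3 * qpow (- 1) s t
        & lap2 U s t a) ->
  (forall s t, 0 <= t -> (s ^+ 2 + t ^+ 2 = Q1) \/ (s ^+ 2 + t ^+ 2 = Q2) ->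
     `|U s t - U s (- t)| <= C1 * t * qpow (- 2^-1) s t) ->
  is_derive (0 : R) 1 (U 1) U' ->
  `|U'| <= C1 * (Q2 `^ (- 2^-1) + Q1 `^ (2^-1)) +
     5 * (N1 * Q2 `^ (4^-1) + N2 * Q1 `^ (- 4^-1)) + 8 * N3.
Proof.
move=> /andP[Q10 Q1l1] Q2g1 C10 N10 N20 N30 HU HB dU.
have Q20 : 0 < Q2 by exact: lt_trans Q2g1.
(* [A] and [B] are the coefficients of the harmonic functions t and t / r^2. Their first summands
   dominate the boundary values C1 t / r on the outer and on the inner circle. The second summands
   make up for the negative functions [X1] and [X2], which are at least - 12/5 times a [bT] and
   enter with factors [2 * N1] and [2 * N2]; and 24/5 <= 5. *)
pose A := C1 * Q2 `^ (- 2^-1) + 5 * N1 * Q2 `^ (4^-1).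
pose B := C1 * Q1 `^ (2^-1) + 5 * N2 * Q1 `^ (- 4^-1).
have A0 : 0 <= A by rewrite addr_ge0 ?mulr_ge0 ?powR_ge0.
have B0 : 0 <= B by rewrite addr_ge0 ?mulr_ge0 ?powR_ge0.
(* Each [X] has Laplacian at most - 2 times the matching power of r^2. The [bS] term produces this
   power and an error of the wrong sign; the coefficients 7/5 and 4 of [bT] are such that its
   Laplacian cancels the error, since sin^2 <= sin: 7/5 * 5/4 = 7/4 for [X1] and [X2], and 4 * 1 = 4
   for [X3]. *)
pose X1 s t := - ((7 / 5) * bT (4^-1) s t + bS (- 4^-1) s t) : R.
pose X2 s t := - ((7 / 5) * bT (- (5 / 4)) s t + bS (- (7 / 4)) s t) : R.
pose X3 s t := 4 * bT (- 2^-1) s t - bS (- 1) s t : R.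
pose w s t := A * bT 0 s t + B * bT (- 1) s t +
  (2 * N1 * X1 s t + (2 * N2 * X2 s t + 2 * N3 * X3 s t)).
pose D : set (R * R) := [set p | Q1 <= p.1 ^+ 2 + p.2 ^+ 2 <= Q2 /\ 0 <= p.2].
have Dq s t : D (s, t) -> 0 < s ^+ 2 + t ^+ 2 by move=> [/= /andP[/(lt_le_trans Q10)]].
have cq : continuous (fun p : R * R => p.1 ^+ 2 + p.2 ^+ 2).
  move=> p; apply: cvgD.
    by apply: (@continuous_comp _ _ _ (fun p : R * R => p.1) (fun x : R => x ^+ 2)); [exact: cvg_fst|exact: exprn_continuous].
  by apply: (@continuous_comp _ _ _ (fun p : R * R => p.2) (fun x : R => x ^+ 2)); [exact: cvg_snd|exact: exprn_continuous].
have cD : compact D.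
  have DE : D = (`[- Num.sqrt Q2, Num.sqrt Q2]%classic `*` `[- Num.sqrt Q2, Num.sqrt Q2]%classic) `&`
     ((fun p : R * R => p.1 ^+ 2 + p.2 ^+ 2) @^-1` `[Q1, Q2]%classic `&` snd @^-1` [set x | 0 <= x]).
    apply/seteqP; split => [[s t]|[s t] /=]; last by rewrite !in_itv => -[_ []].
    rewrite /D/= => -[qin t0]; split; last by rewrite in_itv.
    case/andP: qin => _ q2; rewrite !in_itv/= -!ler_norml -!sqrtr_sqr !ler_wsqrtr//.
      by rewrite (le_trans _ q2)// lerDr sqr_ge0.
    by rewrite (le_trans _ q2)// lerDl sqr_ge0.
  rewrite DE; apply: compact_closedI; first by apply: compact_setX; exact: segment_compact.
  apply: closedI; apply: preimage_closed.
  - by move=> p _; exact: cq.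
  - exact: interval_closed.
  - by move=> p _; exact: cvg_snd.
  - exact: closed_ge.
have cw : {within D, continuous (fun p => w p.1 p.2)}.
  apply: continuous_in_subspaceT => -[s t] /set_mem/Dq q0.
  have Z (k : R) (f : R * R -> R) : {for (s, t), continuous f} -> {for (s, t), continuous (fun p => k * f p)}.
    by move=> cf; apply: cvgM => //; exact: cvg_cst.
  have S (f g : R * R -> R) : {for (s, t), continuous f} -> {for (s, t), continuous g} -> {for (s, t), continuous (fun p => f p + g p)}.
    by move=> cf cg; exact: cvgD.
  have M (f : R * R -> R) : {for (s, t), continuous f} -> {for (s, t), continuous (fun p => - f p)}.
    by move=> cf; exact: cvgN.
  have cT a := @bT_continuous R a s t q0.
  have cS a := @bS_continuous R a s t q0.
  exact: (S _ _ (S _ _ (Z _ _ (cT 0)) (Z _ _ (cT _))) (S _ _ (Z _ _ (M _ (S _ _ (Z _ _ (cT _)) (cS _))))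
   (S _ _ (Z _ _ (M _ (S _ _ (Z _ _ (cT _)) (cS _)))) (Z _ _ (S _ _ (Z _ _ (cT _)) (M _ (cS _))))))).
have cUr : {within D, continuous (fun p : R * R => U p.1 p.2)}.
  by apply: continuous_in_subspaceT => -[s t] /set_mem[/= /HU[]].
have cUn : {within D, continuous (fun p : R * R => U p.1 (- p.2))}.
  apply: continuous_in_subspaceT => -[s t] /set_mem[/= qin _].
  have [cU _] : {for (s, - t), continuous (fun p : R * R => U p.1 p.2)} /\ True.
    by split => //; have [|+ _] := HU s (- t); rewrite ?sqrrN.
  apply: (@continuous_comp _ _ _ (fun p : R * R => (p.1, - p.2)) (fun p : R * R => U p.1 p.2)) => //.
  exact: reflect_continuous.
have bT0 (a s t : R) : 0 <= t -> 0 <= bT a s t.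
  by move=> t0; rewrite mulr_ge0// powR_ge0.
have bS0 (a s t : R) : 0 <= bS a s t by rewrite mulr_ge0 ?sqr_ge0// powR_ge0.
have wlow s t : D (s, t) -> A * bT 0 s t + B * bT (- 1) s t -
    5 * (N1 * bT (4^-1) s t) - 5 * (N2 * bT (- (5 / 4)) s t) <= w s t.
  move=> Dst; have q0 := Dq _ _ Dst; have [_ t0] := Dst.
  have h1 : bS (- 4^-1) s t <= bT (4^-1) s t by apply: bS_le_bT' => //; clear; lra.
  have h2 : bS (- (7 / 4)) s t <= bT (- (5 / 4)) s t by apply: bS_le_bT' => //; clear; lra.
  have h3 : bS (- 1) s t <= bT (- 2^-1) s t by apply: bS_le_bT' => //; clear; lra.
  have p1 := bT0 (4^-1) s t t0; have p2 := bT0 (- (5 / 4)) s t t0; have p3 := bT0 (- 2^-1) s t t0.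
  have g1 : 0 <= N1 * (bT (4^-1) s t - bS (- 4^-1) s t) by rewrite mulr_ge0// subr_ge0.
  have g2 : 0 <= N2 * (bT (- (5 / 4)) s t - bS (- (7 / 4)) s t) by rewrite mulr_ge0// subr_ge0.
  have g3 : 0 <= N3 * (bT (- 2^-1) s t - bS (- 1) s t) by rewrite mulr_ge0 ?subr_ge0// ltW.
  have g4 := mulr_ge0 N10 p1; have g5 := mulr_ge0 N20 p2; have g6 := mulr_ge0 (ltW N30) p3.
  rewrite /w /X1 /X2 /X3.
  move: (bT _ _ _) (bT _ _ _) (bT _ _ _) (bT _ _ _) (bT _ _ _) (bS _ _ _) (bS _ _ _) (bS _ _ _) g1 g2 g3 g4 g5 g6.
  move: A B {A0 B0 h1 h2 h3 p1 p2 p3 cw w} => A B; clear; move=> *; lra.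
have Q1a (a : R) : a <= 0 -> 1 <= Q1 `^ a.
  by move=> a0; rewrite -[leLHS](powRr0 Q1) ger_powR// Q10 ltW.
have Q1b (a : R) : 0 <= a -> Q1 `^ a <= 1.
  by move=> a0; rewrite -[leRHS](powRr0 Q1) ger_powR// Q10 ltW.
have Q2a (a : R) : a <= 0 -> Q2 `^ a <= 1.
  by move=> a0; rewrite -[leRHS](powRr0 Q2) ler_powR// ltW.
have Q2b (a : R) : 0 <= a -> 1 <= Q2 `^ a.
  by move=> a0; rewrite -[leLHS](powRr0 Q2) ler_powR// ltW.
have main : forall s t, D (s, t) -> `|U s t - U s (- t)| <= w s t.
  apply: (reflection_barrier cD cUr cUn cw) => s t Dst.
  have q0 := Dq _ _ Dst; have [/= qin t0] := Dst.
  have [qQ1|qQ1] := eqVneq (s ^+ 2 + t ^+ 2) Q1.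
    left; apply: le_trans (HB s t t0 (or_introl qQ1)) _; apply: le_trans (wlow s t Dst).
    rewrite /bT /qpow qQ1 powRr0.
    have e1 : Q1 `^ (2^-1) * Q1 `^ (- 1) = Q1 `^ (- 2^-1).
      by rewrite -powRD ?(gt_eqF Q10) ?implybT//; congr (_ `^ _); clear; lra.
    have e2 : Q1 `^ (- 4^-1) * Q1 `^ (- 1) = Q1 `^ (- (5 / 4)).
      by rewrite -powRD ?(gt_eqF Q10) ?implybT//; congr (_ `^ _); clear; lra.
    have e3 : B * Q1 `^ (-1) = C1 * Q1 `^ (- 2^-1) + 5 * N2 * Q1 `^ (- (5 / 4)).
      by rewrite /B mulrDl -!mulrA e1 e2 !mulrA.
    have -> : B * (t * Q1 `^ (-1)) = t * (B * Q1 `^ (-1)) by ring.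
    rewrite e3.
    have g1 : 0 <= t * (A - 5 * N1 * Q1 `^ (4^-1)).
      rewrite mulr_ge0// subr_ge0 /A; apply: (@le_trans _ _ (5 * N1 * Q2 `^ (4^-1))).
        by rewrite ler_wpM2l ?mulr_ge0// (@le_trans _ _ 1) ?Q1b ?Q2b.
      by rewrite lerDr mulr_ge0// powR_ge0.
    by move: g1; move: (Q1 `^ _) (Q1 `^ _) (Q1 `^ _) => a1 a2 a3; clear; move=> *; lra.
  have [qQ2|qQ2] := eqVneq (s ^+ 2 + t ^+ 2) Q2.
    left; apply: le_trans (HB s t t0 (or_intror qQ2)) _; apply: le_trans (wlow s t Dst).
    rewrite /bT /qpow qQ2 powRr0.
    have e2 : Q2 `^ (- 4^-1) * Q2 `^ (- 1) = Q2 `^ (- (5 / 4)).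
      by rewrite -powRD ?(gt_eqF Q20) ?implybT//; congr (_ `^ _); clear; lra.
    have g1 : 0 <= t * (B * Q2 `^ (-1) - 5 * N2 * Q2 `^ (- (5 / 4))).
      rewrite mulr_ge0// subr_ge0 -e2 mulrA ler_wpM2r ?powR_ge0//.
      apply: (@le_trans _ _ (5 * N2 * Q1 `^ (- 4^-1))).
        rewrite ler_wpM2l ?mulr_ge0// (@le_trans _ _ 1)//; first by apply: Q2a; clear; lra.
        by apply: Q1a; clear; lra.
      by rewrite /B lerDr mulr_ge0// powR_ge0.
    by move: g1; rewrite /A; move: (Q2 `^ _) (Q2 `^ _) (Q2 `^ _) (Q2 `^ _) => a1 a2 a3 a4; clear; move=> *; lra.
  have [t00|t00] := eqVneq t 0.
    left; rewrite t00 oppr0 subrr normr0 /w /X1 /X2 /X3 /bT /bS expr0n/= !(mul0r, mulr0).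
    by rewrite !(add0r, oppr0, mulr0, subr0).
  right; split.
    have o1 : open [set p : R * R | Q1 < p.1 ^+ 2 + p.2 ^+ 2 < Q2].
      rewrite (_ : [set _ | _] = (fun p : R * R => p.1 ^+ 2 + p.2 ^+ 2) @^-1` `]Q1, Q2[%classic).
        by apply: open_comp => [p _|]; [exact: cq|exact: interval_open].
      by apply/seteqP; split => p /=; rewrite in_itv.
    have o2 : open [set p : R * R | 0 < p.2].
      rewrite (_ : [set _ | _] = snd @^-1` [set x : R | 0 < x])//.
      by apply: open_comp => [p _|]; [exact: cvg_snd|exact: open_gt].
    apply: (filterS _ (open_nbhs_nbhs (conj (openI o1 o2) _))).
      by move=> p [/= /andP[/ltW p1 /ltW p2] /ltW p3]; split => //; rewrite p1.
    split => /=; last by rewrite lt_neqAle eq_sym t00.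
    by case/andP: qin => q1 q2; rewrite !lt_neqAle q1 q2 eq_sym qQ1 qQ2.
  pose NN := N1 * qpow (- 4^-1) s t + N2 * qpow (- (7 / 4)) s t + N3 * qpow (- 1) s t.
  exists NN; split.
  - by have [_ [a]] := HU s t qin; exists a.
  - have [|_ [a aN la]] := HU s (- t); first by rewrite sqrrN.
    by exists a => //; move: aN; rewrite /NN /qpow sqrrN.
  have h1 : bS (- (5 / 4)) s t <= bT (- (3 / 4)) s t by apply: bS_le_bT' => //; clear; lra.
  have h2 : bS (- (11 / 4)) s t <= bT (- (9 / 4)) s t by apply: bS_le_bT' => //; clear; lra.
  have h3 : bS (- 2) s t <= bT (- (3 / 2)) s t by apply: bS_le_bT' => //; clear; lra.
  exists (A * (0 * bT (- 1) s t) + B * (0 * bT (- 2) s t) +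
    (2 * N1 * - ((7 / 5) * ((5 / 4) * bT (- (3 / 4)) s t) + (2 * qpow (- 4^-1) s t + (- (7 / 4)) * bS (- (5 / 4)) s t))
    + (2 * N2 * - ((7 / 5) * ((5 / 4) * bT (- (9 / 4)) s t) + (2 * qpow (- (7 / 4)) s t + (- (7 / 4)) * bS (- (11 / 4)) s t))
    + 2 * N3 * (4 * ((- 1) * bT (- (3 / 2)) s t) - (2 * qpow (- 1) s t + (- 4) * bS (- 2) s t))))).
    have P0 a := @qpow_gt0 R a s t q0.
    have g1 : 0 <= N1 * (bT (- (3 / 4)) s t - bS (- (5 / 4)) s t) by rewrite mulr_ge0// subr_ge0.
    have g2 : 0 <= N2 * (bT (- (9 / 4)) s t - bS (- (11 / 4)) s t) by rewrite mulr_ge0// subr_ge0.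
    have g3 : 0 <= N3 * (bT (- (3 / 2)) s t - bS (- 2) s t) by rewrite mulr_ge0 ?subr_ge0// ltW.
    have g4 := mulr_ge0 N10 (ltW (P0 (- 4^-1))); have g5 := mulr_ge0 N20 (ltW (P0 (- (7 / 4)))).
    have g6 := mulr_gt0 N30 (P0 (- 1)).
    rewrite /NN !mul0r !mulr0 !add0r; move: g1 g2 g3 g4 g5 g6 {h1 h2 h3 P0 NN}.
    move: (bT _ _ _) (bT _ _ _) (bT _ _ _) (bS _ _ _) (bS _ _ _) (bS _ _ _) (qpow _ _ _) (qpow _ _ _) (qpow _ _ _) => a1 a2 a3 a4 a5 a6 a7 a8 a9; clear; move=> *; lra.
  apply: lap2D.
    by apply: lap2D; apply: lap2Z; apply: lap_bT' => //; clear; lra.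
  apply: lap2D.
    by apply: lap2Z; apply: lap2N; apply: lap2D; [apply: lap2Z; apply: lap_bT' => //; clear; lra|apply: lap_bS' => //; clear; lra].
  apply: lap2D.
    by apply: lap2Z; apply: lap2N; apply: lap2D; [apply: lap2Z; apply: lap_bT' => //; clear; lra|apply: lap_bS' => //; clear; lra].
  by apply: lap2Z; apply: lap2B; [apply: lap2Z; apply: lap_bT' => //; clear; lra|apply: lap_bS' => //; clear; lra].
pose d := Num.min 1 (Q2 - 1).
have d0 : 0 < d by rewrite lt_min ltr01 subr_gt0.
suff : `|2 * U'| <= A + B + 8 * N3.
  by rewrite normrM (ger0_norm (ler0n _ 2)) /A /B => h; have := normr_ge0 U'; lra.
apply: (@derive_bound R (fun t => U 1 t - U 1 (- t)) (2 * U') _ d d0).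
- have dN : is_derive (0 : R) 1 (fun y : R => - y) (-1 : R) by apply: is_deriveN.
  have dU0 : is_derive (- (0 : R)) 1 (U 1) U' by rewrite oppr0.
  have := is_deriveB dU (@is_derive1_comp R (U 1) (fun y : R => - y) 0 _ _ dU0 dN).
  by move=> h; apply: is_derive_eq h _; rewrite mulrN1 opprK mulr_natl mulr2n.
- by rewrite oppr0 subrr.
- move=> t /andP[t0]; rewrite le_min => /andP[t1 tQ].
  have t2 : t ^+ 2 <= t by rewrite expr2 ler_piMr// ltW.
  have q1 : 1 <= 1 + t ^+ 2 by rewrite lerDl sqr_ge0.
  have D1 : D (1, t).
    split => /=; last exact: ltW.
    by rewrite expr1n; apply/andP; split; lra.
  apply: le_trans (main _ _ D1) _.
  have qle (a : R) : a <= 0 -> bT a 1 t <= t.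
    move=> a0; rewrite /bT ler_piMr ?(ltW t0)// /qpow expr1n.
    by rewrite -[leRHS](powRr0 (1 + t ^+ 2)) ler_powR.
  have l1 : B * bT (- 1) 1 t <= B * t by rewrite ler_wpM2l// qle// oppr_le0 ler01.
  have l2 : N3 * bT (- 2^-1) 1 t <= N3 * t by rewrite ler_wpM2l ?(ltW N30)// qle// oppr_le0 invr_ge0.
  have l0 : A * bT 0 1 t <= A * t by rewrite ler_wpM2l// qle.
  have g1 := mulr_ge0 N10 (bT0 (4^-1) 1 t (ltW t0)).
  have g2 := mulr_ge0 N10 (bS0 (- 4^-1) 1 t).
  have g3 := mulr_ge0 N20 (bT0 (- (5 / 4)) 1 t (ltW t0)).
  have g4 := mulr_ge0 N20 (bS0 (- (7 / 4)) 1 t).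
  have g5 := mulr_ge0 (ltW N30) (bS0 (- 1) 1 t).
  rewrite /w /X1 /X2 /X3; move: l0 l1 l2 g1 g2 g3 g4 g5.
  move: (bT _ _ _) (bT _ _ _) (bT _ _ _) (bT _ _ _) (bT _ _ _) (bS _ _ _) (bS _ _ _) (bS _ _ _) => a1 a2 a3 a4 a5 a6 a7 a8; clear; move=> *; lra.
Qed.

Lemma derive_compare (R : realType) (f f' phi phi' : R -> R) (x y : R) : x <= y ->
  (forall t, x <= t <= y -> is_derive t 1 f (f' t)) ->
  (forall t, x <= t <= y -> is_derive t 1 phi (phi' t)) ->
  (forall t, x <= t <= y -> `|f' t| <= phi' t) ->
  `|f y - f x| <= phi y - phi x.
Proof.
move=> xy df dphi le.
have key (e : R) : `|e| = 1 -> 0 <= (phi y - e * f y) - (phi x - e * f x).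
  move=> e1; have d t : x <= t <= y -> is_derive t 1 (fun t => phi t - e * f t) (phi' t - e * f' t).
    by move=> tin; exact: is_deriveB (dphi t tin) (is_deriveZ e (df t tin)).
  have [| |c cin ->] := @MVT_segment R (fun t => phi t - e * f t) (fun t => phi' t - e * f' t) x y xy.
  - by move=> z; rewrite in_itv/= => /andP[/ltW z1 /ltW z2]; apply: d; rewrite z1.
  - apply: derivable_within_continuous => z; rewrite in_itv/= => zin.
    by have [] := d z zin.
  - have lc : `|f' c| <= phi' c by apply: le; move: cin; rewrite in_itv.
    rewrite mulr_ge0 ?subr_ge0//; have := ler_norm (e * f' c); rewrite normrM e1 mul1r.
    by move=> /le_trans; apply.
rewrite ler_norml; have := key 1 (normr1 _); have := key (-1) (normrN1 _).
by rewrite !mul1r !mulN1r => h1 h2; apply/andP; split; lra.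
Qed.

Section chart_escape.
Variables (R : realType) (n : nat) (X : tamed_manifold R n) (c : chart R n X) (x0 : X) (b : R).
Hypothesis bc : bchart c x0 b.

Let ac : atlas c. Proof. by case: bc. Qed.

(** A cube with this half-side lies in the unit ball, and cubes suit bounds that are proved
    coordinate by coordinate. *)
Definition half : R := n.+1%:R^-1.

Lemma half_gt0 : 0 < half. Proof. by rewrite invr_gt0. Qed.

Lemma cube_in_ball (y : 'rV[R]_n) : (forall k, `|y 0 k| <= half) -> unit_ball R n y.
Proof.
move=> yh; rewrite /unit_ball/=; apply: (@le_lt_trans _ _ (\sum_(i < n) half ^+ 2)).
  apply: ler_sum => i _; rewrite -[leLHS]ger0_norm ?sqr_ge0// normrX.
  by rewrite lerXn2r// nnegrE ltW// half_gt0.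
rewrite sumr_const card_ord -[ltLHS]mulr_natl /half expr2 mulrA.
rewrite -ltr_pdivlMr ?invr_gt0// invrK mul1r ltr_pdivrMr//.
by rewrite -natrM ltr_nat mulnS ltnS (leq_trans _ (leq_addr _ _)).
Qed.

(** The set is the image of a compact cube under the inverse chart, and X is Hausdorff. Therefore a
    curve that keeps to the cube cannot leave the chart in the limit. *)
Lemma chart_ball_closed : closed [set x | cdom c x /\ forall k, `|cmap c x 0 k| <= half].
Proof.
have ci : cimg c = unit_ball R n by case: bc.
pose Q : set 'rV[R]_n := [set y | forall k, y 0 k \in `[- half, half]].
have Qub y : Q y -> cimg c y.
  move=> Qy; rewrite ci; apply: cube_in_ball => k.
  by have := Qy k; rewrite in_itv/= ler_norml.
have cQ : compact Q.
  have -> : Q = [set v | forall i, `[- half, half]%classic (v ord0 i)] by [].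
  by apply: (@rV_compact R n (fun=> `[- half, half]%classic)) => _; exact: segment_compact.
rewrite (_ : [set x | _] = cinv c @` Q).
  apply: compact_closed; first exact: points_hausdorff.
  apply: continuous_compact => //.
  apply: continuous_in_subspaceT => y /set_mem/Qub; exact: chart_inv_continuous.
apply/seteqP; split => [x [cx xh]|_ [y Qy <-]].
  exists (cmap c x); last exact: chartK.
  by move=> k; rewrite in_itv/= -ler_norml.
have [cy yK] := chart_invK ac (Qub y Qy); split => // k.
by rewrite yK; have := Qy k; rewrite in_itv/= ler_norml.
Qed.

(** Continuous induction on time. Before the supremum [s] of the times up to which the curve stays
    in the chart, the bound keeps it in the cube; the cube is closed, so [q s] is in it, and the
    domain of the chart is open, so the curve stays a little longer unless [s = T]. *)
Lemma chart_escape (q : R -> X) (phi phi' : R -> R) (T b0 : R) :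
  continuous q -> 0 <= T ->
  (forall t, 0 <= t <= T -> is_derive t 1 phi (phi' t)) ->
  (forall t, 0 <= t <= T -> cdom c (q t) -> forall k,
    exists2 w, is_derive t 1 (fun s => cmap c (q s) 0 k) w & `|w| <= phi' t) ->
  cdom c (q 0) -> (forall k, `|cmap c (q 0) 0 k| <= b0) ->
  (forall t, 0 <= t <= T -> b0 + (phi t - phi 0) <= half) ->
  forall t, 0 <= t <= T -> cdom c (q t) /\ forall k, `|cmap c (q t) 0 k| <= b0 + (phi t - phi 0).
Proof.
move=> cq T0 dphi dq cq0 q0 bh.
pose good t := cdom c (q t) /\ forall k, `|cmap c (q t) 0 k| <= b0 + (phi t - phi 0).
(* Once the curve stays in the chart, the bound follows from the mean value
   theorem. *)
have indom t : 0 <= t <= T -> (forall s, 0 <= s <= t -> cdom c (q s)) -> good t.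
  move=> /andP[t0 tT] ind; split=> [|k]; first by apply: ind; rewrite t0 lexx.
  have /choice[f' f'P] : forall s, exists w, 0 <= s <= t ->
     is_derive s 1 (fun s => cmap c (q s) 0 k) w /\ `|w| <= phi' s.
    move=> s; have [sin|] := boolP (0 <= s <= t); last by exists 0.
    have sT : 0 <= s <= T by case/andP: sin => -> /le_trans; apply.
    by have [w w1 w2] := dq s sT (ind s sin) k; exists w.
  have := @derive_compare R (fun s => cmap c (q s) 0 k) f' phi phi' 0 t t0
    (fun s sin => (f'P s sin).1) _ (fun s sin => (f'P s sin).2).
  move=> /(_ _)/wrap[|h].
    by move=> s /andP[s0 st]; apply: dphi; rewrite s0 (le_trans st).
  rewrite -[X in `|X|](subrK (cmap c (q 0) 0 k)) addrC.
  by apply: le_trans (ler_normD _ _) _; apply: lerD.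
pose S := [set t | 0 <= t <= T /\ forall s, 0 <= s <= t -> cdom c (q s)].
have S0 : S 0.
  by split=> [|s]; [rewrite lexx|rewrite -eq_le => /eqP <-].
have hS : has_sup S by split; [exists 0|exists T => t [/andP[]]].
set s := sup S.
have s0 : 0 <= s by apply: (ub_le_sup hS.2).
have sT : s <= T by apply: ge_sup; [exists 0|move=> t [/andP[]]].
have below t : 0 <= t < s -> S t.
  move=> /andP[t0 ts]; have [r [/andP[r0 rT] rP] tr] := sup_gt (ex_intro _ _ S0) ts.
  split; first by rewrite t0 (ltW (lt_le_trans ts sT)).
  by move=> z /andP[z0 zt]; apply: rP; rewrite z0 (le_trans zt)// ltW.
have cs : cdom c (q s).
  have [s00|s00] := eqVneq s 0; first by rewrite s00.
  have sgt0 : 0 < s by rewrite lt_neqAle eq_sym s00.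
  suff : [set x | cdom c x /\ forall k, `|cmap c x 0 k| <= half] (q s) by case.
  apply: chart_ball_closed => B /cq sB.
  have /nbhs_ballP[d /= d0 dB] := sB.
  pose t := Num.max 0 (s - d / 2).
  have t0 : 0 <= t by rewrite le_max lexx.
  have ts : t < s by rewrite gt_max sgt0 ltrBlDr ltrDl divr_gt0.
  have St := below t (introT andP (conj t0 ts)).
  have tT : 0 <= t <= T by rewrite t0 (ltW (lt_le_trans ts sT)).
  exists (q t); split.
    have [gt gk] := indom t tT St.2; split => // k.
    exact: le_trans (gk k) (bh t tT).
  apply: dB; rewrite /ball/= /ball_ gtr0_norm ?subr_gt0// ltrBlDr -ltrBlDl lt_max.
  by apply/orP; right; lra.
have /nbhs_ballP[d /= d0 dP] : nbhs s (fun z => cdom c (q z)).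
  by apply: cq; apply: open_nbhs_nbhs; split => //; exact: chart_open.
have near z : 0 <= z <= T -> z < s + d -> S z.
  move=> zin zd; split => // y /andP[y0 yz].
  have [ys|sy] := ltP y s.
    by have [_] := below y (introT andP (conj y0 ys)); apply; rewrite y0 lexx.
  by apply: dP; rewrite /ball/= /ball_ distrC ger0_norm ?subr_ge0// ltrBlDl (le_lt_trans yz).
have sTe : s = T.
  apply/eqP; rewrite eq_le sT/= leNgt; apply/negP => lt.
  pose z := Num.min T (s + d / 2).
  have zs : s < z by rewrite lt_min lt ltrDl divr_gt0.
  have : S z.
    apply: near; first by rewrite (le_trans s0 (ltW zs)) ge_min lexx.
    by rewrite gt_min; apply/orP; right; lra.
  by move=> /(ub_le_sup hS.2); rewrite leNgt zs.
move=> t tin; apply: indom => // z /andP[z0 zt].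
have [_] : S t by apply: near => //; case/andP: tin => _ tT; rewrite sTe (le_lt_trans tT)// ltrDl.
by apply; rewrite z0.
Qed.

End chart_escape.

(** * Gradient estimates *)

Section plane.
Variable R : realType.
Implicit Types v w : 'rV[R]_2.

Definition len v : R := Num.sqrt (nrm2 v).

Lemma nrm2_ge0 v : 0 <= nrm2 v. Proof. by rewrite addr_ge0 ?sqr_ge0. Qed.

Lemma len_ge0 v : 0 <= len v. Proof. exact: sqrtr_ge0. Qed.

Lemma len_sqr v : len v ^+ 2 = nrm2 v. Proof. by rewrite sqr_sqrtr ?nrm2_ge0. Qed.

Lemma nrm2Z (x : R) v : nrm2 (x *: v) = x ^+ 2 * nrm2 v.
Proof. by rewrite /nrm2 !mxE !exprMn mulrDr. Qed.

Lemma lenZ (x : R) v : len (x *: v) = `|x| * len v.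
Proof. by rewrite /len nrm2Z sqrtrM ?sqr_ge0// sqrtr_sqr. Qed.

Lemma lenN v : len (- v) = len v.
Proof. by rewrite -scaleN1r lenZ normrN1 mul1r. Qed.

Lemma lenB v w : len (v - w) = len (w - v).
Proof. by rewrite -lenN opprB. Qed.

Lemma nrm2_rot v : nrm2 (rot v) = nrm2 v.
Proof. by rewrite /nrm2 !mxE /= sqrrN addrC. Qed.

Lemma len_rot v : len (rot v) = len v.
Proof. by rewrite /len nrm2_rot. Qed.

Lemma nrm2_comb (s t : R) v : nrm2 (s *: v + t *: rot v) = (s ^+ 2 + t ^+ 2) * nrm2 v.
Proof. by rewrite /nrm2 !mxE /=; ring. Qed.

Lemma lenD v w : len (v + w) <= len v + len w.
Proof.
rewrite -ler_sqr ?nnegrE ?len_ge0 ?addr_ge0 ?len_ge0// len_sqr sqrrD !len_sqr.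
have cs : v 0 0 * w 0 0 + v 0 1 * w 0 1 <= len v * len w.
  apply: (le_trans (ler_norm _)); rewrite -ler_sqr ?nnegrE ?mulr_ge0 ?len_ge0//.
  rewrite real_normK ?num_real// exprMn !len_sqr /nrm2 -subr_ge0.
  move: (v 0 0) (v 0 1) (w 0 0) (w 0 1) => p q r s.
  rewrite (_ : _ - _ = (p * s - q * r) ^+ 2); last by ring.
  exact: sqr_ge0.
rewrite /nrm2 !mxE; move: cs; rewrite -mulr_natr.
by move: (len v * len w) (v 0 0) (v 0 1) (w 0 0) (w 0 1) => l p q r s; lra.
Qed.

Lemma len_eq0 v : (len v == 0) = (v == 0).
Proof.
rewrite sqrtr_eq0; apply/idP/eqP => [|->]; last by rewrite /nrm2 !mxE expr0n addr0.
move=> h; have : nrm2 v == 0 by rewrite eq_le h nrm2_ge0.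
rewrite paddr_eq0 ?sqr_ge0// !sqrf_eq0 => /andP[/eqP v0 /eqP v1].
apply/rowP => i; rewrite mxE; have := ord1; case: i => [[|[|//]]] i.
  by rewrite -[RHS]v0; move=> _; congr (v 0 _); exact: val_inj.
by rewrite -[RHS]v1; move=> _; congr (v 0 _); exact: val_inj.
Qed.

Lemma len_gt0 v : (0 < len v) = (v != 0).
Proof. by rewrite lt_neqAle len_ge0 andbT eq_sym len_eq0. Qed.

Lemma len_tri u v w : len (u - w) <= len (u - v) + len (v - w).
Proof. by rewrite -[u - w](subrKA v) lenD. Qed.

End plane.

Section planar_map.
Variables (R : realType) (n : nat) (X : tamed_manifold R n) (F : 'rV[R]_2 -> X).
Hypothesis JF : Jhol_local F.
Variable b : R.
Hypothesis b1 : 1 <= b.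

Definition dens (y : 'rV[R]_2) : R := Num.sqrt (energy_density F y).

Lemma dens_ge0 y : 0 <= dens y. Proof. exact: sqrtr_ge0. Qed.

Lemma dens_sqr y : dens y ^+ 2 = energy_density F y.
Proof. by rewrite sqr_sqrtr// energy_density_ge0. Qed.

Let b0 : 0 < b. Proof. exact: lt_le_trans b1. Qed.

(** Coordinates in the frame [w], [rot w] at [a]. With w = z - a the point z becomes (1, 0), and
    estimates at all scales and in all directions become estimates near the unit circle. *)
Definition pt (a w : 'rV[R]_2) (s t : R) := a + s *: w + t *: rot w.

Lemma pt_len a w s t : len (pt a w s t - a) = Num.sqrt (s ^+ 2 + t ^+ 2) * len w.
Proof.
have -> : pt a w s t - a = s *: w + t *: rot w by apply/rowP => i; rewrite !mxE; ring.
rewrite /len nrm2_comb sqrtrM//.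
by rewrite addr_ge0 ?sqr_ge0.
Qed.

Lemma pt_swap a w s t : pt a w s t = a + t *: rot w + s *: w.
Proof. by rewrite /pt addrAC. Qed.

Section in_chart.
Variables (c : chart R n X) (x0 : X).
Hypothesis bc : bchart c x0 b.

Lemma ddir_le_dens w k y : cdom c (F y) -> `|ddir F c w k y| <= Num.sqrt b * len w * dens y.
Proof.
move=> cy; rewrite -ler_sqr ?nnegrE ?mulr_ge0 ?sqrtr_ge0//.
rewrite real_normK ?num_real// !exprMn sqr_sqrtr ?(ltW b0)// len_sqr dens_sqr -mulrA.
exact: (ddir_le JF bc b1).
Qed.

Let u k s t a w := cmap c (F (pt a w s t)) 0 k.

Lemma chart_ds a w s t k : cdom c (F (pt a w s t)) ->
  is_derive s 1 (fun s => cmap c (F (pt a w s t)) 0 k) (ddir F c w k (pt a w s t)).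
Proof.
rewrite pt_swap (_ : (fun s => _) = (fun s => cmap c (F (a + t *: rot w + s *: w)) 0 k)).
  by move=> cd; exact: (@is_derive_chart_line _ _ _ _ JF c x0 b bc (a + t *: rot w) w s k).
by apply/funext => z; rewrite pt_swap.
Qed.

Lemma chart_dt a w s t k : cdom c (F (pt a w s t)) ->
  is_derive t 1 (fun t => cmap c (F (pt a w s t)) 0 k) (ddir F c (rot w) k (pt a w s t)).
Proof. exact: (@is_derive_chart_line _ _ _ _ JF c x0 b bc (a + s *: w) (rot w) t k). Qed.

Lemma line_continuous (y v : 'rV[R]_2) : continuous (fun t : R => y + t *: v).
Proof.
move=> t; apply: differentiable_continuous; apply/derivable1_diffP.
have := @is_derive_line R 'rV[R]_2 'rV[R]_2 id y v t.
by move=> /(_ (@derivable_id _ _ _ _))[].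
Qed.

Lemma pt_continuous a w : continuous (fun p : R * R => pt a w p.1 p.2).
Proof.
move=> p; apply: cvgD.
  apply: (@continuous_comp _ _ _ (fun p : R * R => p.1) (fun s : R => a + s *: w)); first exact: cvg_fst.
  exact: line_continuous.
apply: (@continuous_comp _ _ _ (fun p : R * R => p.2) (fun s : R => s *: rot w)); first exact: cvg_snd.
have := @line_continuous 0 (rot w) p.2.
by under eq_fun do rewrite add0r.
Qed.

Lemma chart_cont a w s t k : cdom c (F (pt a w s t)) ->
  {for (s, t), continuous (fun p : R * R => cmap c (F (pt a w p.1 p.2)) 0 k)}.
Proof.
move=> cd; case: (bc) => ac _ _ _ _.
apply: (@continuous_comp _ _ _ (fun p : R * R => pt a w p.1 p.2) (fun y => cmap c (F y) 0 k)).
  exact: pt_continuous.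
apply: differentiable_continuous.
by have [+ _] := smooth_C1 [::] (Jhol_open JF ac) (@Jhol_smooth _ _ _ _ JF _ ac k) cd.
Qed.

Definition lapC : R := 2 * n.+1%:R ^+ 2 * b ^+ 2.

Lemma chart_lap a w s t k : cdom c (F (pt a w s t)) ->
  exists2 x, `|x| <= lapC * (len w * dens (pt a w s t)) ^+ 2 &
    lap2 (fun s t => cmap c (F (pt a w s t)) 0 k) s t x.
Proof.
move=> cd; case: (bc) => ac _ _ _ _.
have op : open (F @^-1` cdom c) by exact: Jhol_open.
pose D (v : 'rV[R]_2) := \sum_i \sum_j v 0 i * v 0 j *
  partial j (partial i (fun y => cmap c (F y) 0 k)) (pt a w s t).
exists (D w + D (rot w)); last first.
  exists (D w), (D (rot w)); split => //.
  - exists (fun s => ddir F c w k (pt a w s t)); split.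
      have : nbhs s (fun s => cdom c (F (pt a w s t))).
        have cs := @line_continuous (a + t *: rot w) w s.
        have cd' := cd; rewrite pt_swap in cd'.
        have h : nbhs s (fun z => cdom c (F (a + t *: rot w + z *: w))).
          exact: cs _ (open_nbhs_nbhs (conj op cd')).
        by apply: filterS h => z; rewrite pt_swap.
      by apply: filterS => z; exact: chart_ds.
    rewrite (_ : (fun s => _) = (fun s => ddir F c w k (a + t *: rot w + s *: w))).
      have cd' := cd; rewrite pt_swap in cd'.
      apply: is_derive_eq (@is_derive_ddir_line _ _ _ _ JF c x0 b bc w (a + t *: rot w) w s k cd') _.
      by rewrite /D pt_swap.
    by apply/funext => z; rewrite pt_swap.
  - exists (fun t => ddir F c (rot w) k (pt a w s t)); split.
      have : nbhs t (fun t => cdom c (F (pt a w s t))).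
        exact: (@line_continuous (a + s *: w) (rot w) t _ (open_nbhs_nbhs (conj op cd))).
      by apply: filterS => z; exact: chart_dt.
    exact: (@is_derive_ddir_line _ _ _ _ JF c x0 b bc (rot w) (a + s *: w) (rot w) t k).
by rewrite exprMn len_sqr dens_sqr; exact: (laplacian_le JF bc b1).
Qed.

Lemma escape_segment (y v : 'rV[R]_2) (phi phi' : R -> R) (beta : R) :
  (forall t : R, 0 <= t <= 1 -> is_derive t 1 phi (phi' t)) ->
  (forall t : R, 0 <= t <= 1 -> Num.sqrt b * len v * dens (y + t *: v) <= phi' t) ->
  cdom c (F y) -> (forall k, `|cmap c (F y) 0 k| <= beta) ->
  (forall t, 0 <= t <= 1 -> beta + (phi t - phi 0) <= half R n) ->
  cdom c (F (y + v)) /\ forall k, `|cmap c (F (y + v)) 0 k| <= beta + (phi 1 - phi 0).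
Proof.
move=> dphi le cy yb bh.
have := @chart_escape R n X c x0 b bc (fun t => F (y + t *: v)) phi phi' 1 beta.
rewrite scale0r addr0 => /(_ _ ler01 dphi _ cy yb bh 1); rewrite scale1r; apply.
- move=> t; apply: continuous_comp; first exact: line_continuous.
  by case: JF => + _; exact.
- move=> t tin ct k; exists (ddir F c v k (y + t *: v)).
    exact: (is_derive_chart_line JF bc).
  exact: le_trans (ddir_le_dens _ _ ct) (le t tin).
- by rewrite ler01 lexx.
Qed.

Lemma escape_const (y v : 'rV[R]_2) (K beta : R) :
  (forall t, 0 <= t <= 1 -> Num.sqrt b * len v * dens (y + t *: v) <= K) ->
  cdom c (F y) -> (forall k, `|cmap c (F y) 0 k| <= beta) ->
  beta + K <= half R n ->
  cdom c (F (y + v)) /\ forall k, `|cmap c (F (y + v)) 0 k| <= beta + K.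
Proof.
move=> le cy yb bh.
have K0 : 0 <= K.
  by apply: le_trans (le 0 _); rewrite ?lexx ?ler01// mulr_ge0 ?dens_ge0// mulr_ge0 ?sqrtr_ge0.
have := @escape_segment y v (fun t => K * t) (fun=> K) beta _ le cy yb.
rewrite mulr1 mulr0 subr0; apply.
  move=> t _; have := is_deriveZ K (is_derive_id t (1 : R)).
  by rewrite [_ *: 1]mulr1.
move=> t /andP[t0 t1]; rewrite subr0; apply: le_trans bh.
by rewrite lerD2l ler_piMr.
Qed.

End in_chart.
End planar_map.

Lemma osc_le (R : realType) (f : R -> R) (f' : R -> R) (e t0 t1 : R) :
  (forall t, Num.min t0 t1 <= t <= Num.max t0 t1 -> is_derive t 1 f (f' t) /\ `|f' t| <= e) ->
  `|f t1 - f t0| <= e * `|t1 - t0|.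
Proof.
move=> h; have := @mvt_bound R f f' 0 e t0 t1; rewrite mul0r subr0; apply=> t tin.
  by have [] := h t tin.
by rewrite subr0; have [] := h t tin.
Qed.

Lemma between_bound (R : realType) (x y z : R) : `|x| <= 1 -> `|y| <= 1 ->
  Num.min x (x + y) <= z <= Num.max x (x + y) -> `|z| <= 2.
Proof.
rewrite !ler_norml ge_min le_max => /andP[? ?] /andP[? ?] /andP[/orP[?|?] /orP[?|?]].
all: by apply/andP; split; lra.
Qed.

Section constants.
Variables (R : realType) (n : nat) (b : R).
Hypothesis b1 : 1 <= b.

Definition enC : R := 2 * n.+1%:R ^+ 4 * b ^+ 3.

Lemma enC_ge1 : 1 <= enC.
Proof.
have h1 : 1 <= n.+1%:R ^+ 4 :> R by rewrite exprn_ege1// ler1n.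
have h2 : 1 <= b ^+ 3 by rewrite exprn_ege1.
by have := ler_pM ler01 ler01 h1 h2; rewrite /enC mulr1; lra.
Qed.

Lemma lapC_gt0 : 0 < lapC n b.
Proof.
by rewrite /lapC mulr_gt0 ?mulr_gt0 ?exprn_gt0// (lt_le_trans ltr01).
Qed.

Lemma sqrtb_ge1 : 1 <= Num.sqrt b.
Proof. by rewrite -[leLHS]sqrtr1 ler_wsqrtr. Qed.

End constants.

Section spread.
Variables (R : realType) (n : nat) (b eps : R).
Hypothesis b1 : 1 <= b.
Hypothesis eps0 : 0 < eps.

(** [c1] is the share of [r] that some coordinate derivative must have at the centre. The three
    bounds on [r] serve, in this order, to stay where the density is at most doubled (3 r / e <= eps
    / (4 e)), to stay in the cube of the chart, and to make the Laplacian term at most c1 / 4. The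
    relative displacement [k1] makes the remaining error at most c1 / 4 as well. *)
Let c1 : R := (2 * enC n b)^-1.
Let r : R := Num.min (eps / 12) (Num.min (half R n / (8 * Num.sqrt b)) (c1 / (32 * lapC n b))).
Let k1 : R := c1 / (32 * Num.sqrt b).
Definition spread_size : R := k1 * r.
Definition spread_dens : R := c1 / (2 * Num.sqrt b).

Let sb1 : 1 <= Num.sqrt b. Proof. exact: sqrtb_ge1. Qed.
Let sb0 : 0 < Num.sqrt b. Proof. exact: lt_le_trans sb1. Qed.
Let C1 : 1 <= enC n b. Proof. exact: enC_ge1. Qed.
Let C0 : 0 < enC n b. Proof. exact: lt_le_trans C1. Qed.
Let c10 : 0 < c1. Proof. by rewrite invr_gt0 mulr_gt0. Qed.
Let L0 : 0 < lapC n b. Proof. exact: lapC_gt0. Qed.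
Let r0 : 0 < r.
Proof.
rewrite !lt_min; apply/andP; split; first exact: divr_gt0.
apply/andP; split; first by rewrite divr_gt0 ?half_gt0 ?mulr_gt0.
by apply: divr_gt0 => //; apply: mulr_gt0.
Qed.
Let k10 : 0 < k1. Proof. by rewrite divr_gt0 ?mulr_gt0. Qed.
Let k1l1 : k1 <= 1.
Proof.
rewrite ler_pdivrMr ?mulr_gt0// mul1r (@le_trans _ _ 1)//; last by move: sb1; lra.
have h : 1 <= 2 * enC n b by move: C1; lra.
by rewrite /c1 invf_le1 ?(lt_le_trans ltr01 h).
Qed.

Lemma spread_size_gt0 : 0 < spread_size.
Proof. by rewrite /spread_size mulr_gt0. Qed.
Lemma spread_dens_gt0 : 0 < spread_dens. Proof. by rewrite divr_gt0 ?mulr_gt0. Qed.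

Lemma spread_size_le : spread_size <= eps / 12.
Proof.
rewrite /spread_size -[leRHS]mul1r ler_pM ?(ltW k10) ?(ltW r0) ?k1l1//.
by rewrite /r ge_min lexx.
Qed.

(** At [z0] some coordinate has a large derivative. To show that it persists at [z],
    [gradient_bound] is applied to the difference of the map and its translate by z - z0: this
    difference is small because the displacement is, and its Laplacian is bounded by the squares of
    the densities. *)
Lemma dens_spread (X : tamed_manifold R n) (F : 'rV[R]_2 -> X) (z0 z : 'rV[R]_2) :
  Jhol_local F -> (forall x : X, exists c, bchart c x b) -> 0 < dens F z0 ->
  (forall y, len (y - z0) <= eps / (4 * dens F z0) -> dens F y <= 2 * dens F z0) ->
  (forall i, `|z 0 i - z0 0 i| <= spread_size / dens F z0) ->
  spread_dens * dens F z0 <= dens F z.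
Proof.
move=> JF bg e0 near zin; set e := dens F z0 in e0 near zin *.
have re : r <= eps / 12 by rewrite /r ge_min lexx.
have rh : 8 * Num.sqrt b * r <= half R n.
  rewrite mulrC -ler_pdivlMr ?mulr_gt0// /r !ge_min lexx /=.
  by rewrite orbT.
have rl : 8 * lapC n b * r <= c1 / 4.
  have : r <= c1 / (32 * lapC n b) by rewrite /r !ge_min lexx !orbT.
  by rewrite ler_pdivlMr; [lra|exact: mulr_gt0].
have [c bc] := bg (F z0); have [ac cz0 c0 ci _] := bc.
pose w : 'rV[R]_2 := (r / e) *: delta_mx 0 0.
have rotw : rot w = (r / e) *: delta_mx 0 1.
  apply/rowP => i; rewrite !mxE /=; case: i => [[|[|//]]] i /=.
    by rewrite mulr0 oppr0.
  by [].
have lw : len w = r / e.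
  rewrite lenZ /len /nrm2 !mxE/= expr1n expr0n addr0 sqrtr1 mulr1 ger0_norm//.
  by rewrite divr_ge0 ?(ltW r0)// ltW.
have lrw : len (rot w) = r / e by rewrite len_rot.
have re0 : 0 < r / e by rewrite divr_gt0.
have d2 s t : `|s| <= 2 -> `|t| <= 2 -> dens F (pt z0 w s t) <= 2 * e.
  move=> s2 t2; apply: near; rewrite pt_len lw.
  apply: (@le_trans _ _ (3 * (r / e))).
    rewrite ler_wpM2r ?(ltW re0)// -[leRHS]ger0_norm// -sqrtr_sqr ler_wsqrtr//.
    have := lerXn2r 2 (normr_ge0 s) (ler0n R 2) s2.
    have := lerXn2r 2 (normr_ge0 t) (ler0n R 2) t2.
    by rewrite !real_normK ?num_real//; lra.
  rewrite invfM !mulrA ler_wpM2r ?invr_ge0 ?(ltW e0)//; lra.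
have m2 (s : R) : `|s| <= 2 -> forall t, 0 <= t <= 1 -> `|t * s| <= 2.
  move=> s2 t /andP[t0 t1]; rewrite normrM (ger0_norm t0) (le_trans _ s2)//.
  by rewrite ler_piMl.
have incb s t : `|s| <= 2 -> `|t| <= 2 -> cdom c (F (pt z0 w s t)) /\ forall k, `|cmap c (F (pt z0 w s t)) 0 k| <= half R n.
  move=> s2 t2; have K v y : len v <= 2 * (r / e) -> dens F y <= 2 * e ->
      Num.sqrt b * len v * dens F y <= 4 * Num.sqrt b * r.
    move=> lv dy; apply: (@le_trans _ _ (Num.sqrt b * (2 * (r / e)) * (2 * e))).
      by apply: ler_pM; rewrite ?mulr_ge0 ?sqrtr_ge0// ler_wpM2l ?sqrtr_ge0.
    rewrite le_eqVlt; apply/orP; left; apply/eqP.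
    by field; rewrite gt_eqF.
  have [cd1 ub1] : cdom c (F (z0 + s *: w)) /\ forall k, `|cmap c (F (z0 + s *: w)) 0 k| <= 0 + 4 * Num.sqrt b * r.
    apply: (escape_const JF b1 bc) => //.
    - move=> t' t'in; apply: K; first by rewrite lenZ lw ler_wpM2r ?(ltW re0).
      have -> : z0 + t' *: (s *: w) = pt z0 w (t' * s) 0 by rewrite /pt scale0r addr0 scalerA.
      by apply: d2; rewrite ?normr0// m2.
    - by move=> k; rewrite c0 mxE normr0.
    - have := mulr_gt0 sb0 r0; lra.
  have [cd2 ub2] : cdom c (F (z0 + s *: w + t *: rot w)) /\ forall k, `|cmap c (F (z0 + s *: w + t *: rot w)) 0 k| <= 0 + 4 * Num.sqrt b * r + 4 * Num.sqrt b * r.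
    apply: (escape_const JF b1 bc) => //.
    - move=> t' t'in; apply: K; first by rewrite lenZ lrw ler_wpM2r ?(ltW re0).
      have -> : z0 + s *: w + t' *: (t *: rot w) = pt z0 w s (t' * t).
        by rewrite /pt [t' *: (t *: _)]scalerA.
      by apply: d2; rewrite // m2.
    - lra.
  by split => // k; apply: le_trans (ub2 k) _; lra.
have gradb v k s t : len v = r / e -> `|s| <= 2 -> `|t| <= 2 ->
    `|ddir F c v k (pt z0 w s t)| <= 2 * Num.sqrt b * r.
  move=> lv s2 t2; have [cd _] := incb s t s2 t2.
  apply: le_trans (ddir_le_dens JF b1 bc _ _ cd) _; rewrite lv.
  apply: (@le_trans _ _ (Num.sqrt b * (r / e) * (2 * e))).
    by rewrite ler_wpM2l ?d2// mulr_ge0 ?sqrtr_ge0// ltW.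
  by rewrite le_eqVlt; apply/orP; left; apply/eqP; field; rewrite gt_eqF.
have ptS a s t s0 t0 : pt (pt a w s0 t0) w s t = pt a w (s + s0) (t + t0).
  by rewrite /pt; apply/rowP => i; rewrite !mxE; ring.
have z0E : z0 = pt z0 w 0 0 by rewrite /pt !scale0r !addr0.
have n0 : `|(0 : R)| <= 2 by rewrite normr0.
(* Otherwise [energy_le_ddir] would give r^2 <= enC (c1 r)^2 = r^2 / (4 enC), but enC >= 1. *)
have [k hk] : exists k, c1 * r < `|ddir F c (rot w) k z0|.
  apply: contrapT => hn.
  have hn' k : `|ddir F c (rot w) k z0| <= c1 * r.
    by rewrite leNgt; apply/negP => h; apply: hn; exists k.
  have := energy_le_ddir JF bc b1 cz0 hn'.
  rewrite -/(enC n b) -len_sqr lw -dens_sqr -/e -exprMn divfK ?gt_eqF//.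
  have -> : enC n b * (c1 * r) ^+ 2 = (4 * enC n b)^-1 * r ^+ 2.
    by rewrite /c1; field; rewrite gt_eqF.
  have h4 : 0 < 4 * enC n b by exact: mulr_gt0.
  rewrite -{1}[r ^+ 2]mul1r (ler_pM2r (exprn_gt0 2 r0)) leNgt (invf_lt1 h4).
  by rewrite (le_lt_trans C1)// ltr_pMl// ltr1n.
pose s0 := (z 0 0 - z0 0 0) / (r / e); pose t0 := (z 0 1 - z0 0 1) / (r / e).
have zE : z = pt z0 w s0 t0.
  have er : e != 0 by rewrite gt_eqF.
  have rr : r != 0 by rewrite gt_eqF.
  apply/rowP => i; rewrite /pt rotw !mxE /=; case: i => [[|[|//]]] i /=.
    rewrite (_ : Ordinal i = 0); last exact: val_inj.
    by rewrite /s0; field; rewrite er rr.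
  rewrite (_ : Ordinal i = 1); last exact: val_inj.
  by rewrite /t0; field; rewrite er rr.
have ks i : `|(z 0 i - z0 0 i) / (r / e)| <= k1.
  rewrite normrM normfV (gtr0_norm re0) ler_pdivrMr//.
  by apply: le_trans (zin i) _; rewrite /spread_size mulrA.
have ks0 : `|s0| <= k1 := ks 0.
have kt0 : `|t0| <= k1 := ks 1.
have add2 (x y : R) : `|x| <= 1 -> `|y| <= k1 -> `|x + y| <= 2.
  by move=> x1 y1; apply: le_trans (ler_normD _ _) _; move: (k1l1); lra.
have w2 (x : R) : `|x| <= 1 -> `|x| <= 2 by move=> /le_trans; apply; rewrite ler1n.
pose G s t := cmap c (F (pt z w s t)) 0 k - cmap c (F (pt z0 w s t)) 0 k.
have Gd : is_derive (0 : R) 1 (G 0) (ddir F c (rot w) k z - ddir F c (rot w) k z0).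
  have -> : ddir F c (rot w) k z - ddir F c (rot w) k z0 =
     ddir F c (rot w) k (pt z w 0 0) - ddir F c (rot w) k (pt z0 w 0 0).
    by rewrite /pt !scale0r !addr0.
  apply: is_deriveB; apply: (chart_dt JF bc).
    by rewrite zE ptS !add0r; apply: (incb _ _ _ _).1; exact: le_trans (le_trans _ k1l1) (ler1n _ 2).
  by apply: (incb _ _ _ _).1.
have := @gradient_bound R G 1 (4 * Num.sqrt b * r * k1) (8 * lapC n b * r ^+ 2) _ ltr01 _ _ _ Gd.
move=> /(_ _ _ _)/wrap[||s t s1 t1|].
- by apply: (mulr_ge0 _ (ltW k10)); apply: (mulr_ge0 _ (ltW r0)); apply: mulr_ge0 => //; exact: sqrtr_ge0.
- by apply: (mulr_gt0 _ (exprn_gt0 _ r0)); exact: mulr_gt0.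
- have in1 : cdom c (F (pt z w s t)) by rewrite zE ptS; apply: (incb _ _ _ _).1; exact: add2.
  have in2 : cdom c (F (pt z0 w s t)) by apply: (incb _ _ _ _).1; exact: w2.
  split.
  + by apply: continuousB; exact: (chart_cont JF bc).
  + have -> : G s t = (cmap c (F (pt z0 w (s + s0) (t + t0))) 0 k - cmap c (F (pt z0 w s (t + t0))) 0 k)
       + (cmap c (F (pt z0 w s (t + t0))) 0 k - cmap c (F (pt z0 w s t)) 0 k).
      by rewrite subrKA /G zE ptS.
    apply: le_trans (ler_normD _ _) _.
    have btw (x y z' : R) : `|x| <= 1 -> `|y| <= k1 -> Num.min x (x + y) <= z' <= Num.max x (x + y) -> `|z'| <= 2.
      by move=> x1 y1; apply: between_bound => //; exact: le_trans k1l1.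
    have o1 := @osc_le R (fun s => cmap c (F (pt z0 w s (t + t0))) 0 k) (fun s => ddir F c w k (pt z0 w s (t + t0)))
       (2 * Num.sqrt b * r) s (s + s0).
    have o2 := @osc_le R (fun t => cmap c (F (pt z0 w s t)) 0 k) (fun t => ddir F c (rot w) k (pt z0 w s t))
       (2 * Num.sqrt b * r) t (t + t0).
    rewrite (addrC s s0) addrK (addrC s0 s) in o1; rewrite (addrC t t0) addrK (addrC t0 t) in o2.
    have sr0 : 0 <= 2 * Num.sqrt b * r.
      by apply: (mulr_ge0 _ (ltW r0)); apply: mulr_ge0 => //; exact: sqrtr_ge0.
    have -> : 4 * Num.sqrt b * r * k1 = 2 * Num.sqrt b * r * k1 + 2 * Num.sqrt b * r * k1 by ring.
    apply: lerD.
      apply: le_trans (o1 _) _; last by rewrite ler_wpM2l.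
      move=> x xin; split; last by apply: gradb => //; [exact: btw xin|exact: add2].
      by apply: (chart_ds JF bc); apply: (incb _ _ _ _).1; [exact: btw xin|exact: add2].
    apply: le_trans (o2 _) _; last by rewrite ler_wpM2l.
    move=> x xin; split; last by apply: gradb => //; [exact: w2|exact: btw xin].
    by apply: (chart_dt JF bc); apply: (incb _ _ _ _).1; [exact: w2|exact: btw xin].
  + have lb a' (y : 'rV_2) : dens F y <= 2 * e -> `|a'| <= lapC n b * (len w * dens F y) ^+ 2 ->
        `|a'| <= 4 * lapC n b * r ^+ 2.
      move=> dy /le_trans; apply; rewrite lw.
      have -> : 4 * lapC n b * r ^+ 2 = lapC n b * (r / e * (2 * e)) ^+ 2 by field; rewrite gt_eqF.
      apply: (ler_wpM2l (ltW L0)); apply: lerXn2r; rewrite ?nnegrE.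
      - exact: mulr_ge0 (ltW re0) (dens_ge0 _ _).
      - by apply: (mulr_ge0 (ltW re0)); apply: mulr_ge0 => //; exact: ltW.
      - exact: ler_wpM2l (ltW re0) _ _ dy.
    have [a1 a1l L1] := chart_lap JF b1 bc k in1.
    have [a2 a2l L2] := chart_lap JF b1 bc k in2.
    exists (a1 - a2); last exact: lap2B.
    have -> : 8 * lapC n b * r ^+ 2 = 4 * lapC n b * r ^+ 2 + 4 * lapC n b * r ^+ 2 by ring.
    apply: le_trans (ler_normB _ _) _; apply: lerD.
      by apply: lb a1l; rewrite zE ptS d2// add2.
    by apply: lb a2l; rewrite d2// w2.
- rewrite divr1 mulr1 => gb.
  have in0 : cdom c (F z) by rewrite zE; apply: (incb _ _ _ _).1; apply: w2; exact: le_trans k1l1.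
  have up := ddir_le_dens JF b1 bc (rot w) k in0; rewrite lrw in up.
  have k1E : 8 * (Num.sqrt b * k1) = c1 / 4 by rewrite /k1; field; rewrite gt_eqF.
  have gb2 : `|ddir F c (rot w) k z - ddir F c (rot w) k z0| <= c1 / 2 * r.
    apply: le_trans gb _; have -> : 2 * (4 * Num.sqrt b * r * k1) = 8 * (Num.sqrt b * k1) * r by ring.
    rewrite k1E; have : 8 * lapC n b * r * r <= c1 / 4 * r by rewrite ler_wpM2r// ltW.
    by rewrite -mulrA -expr2; lra.
  have low : c1 / 2 * r <= Num.sqrt b * (r / e) * dens F z.
    apply: le_trans up; have := ler_normB (ddir F c (rot w) k z) (ddir F c (rot w) k z - ddir F c (rot w) k z0).
    by rewrite opprB addrC subrK; lra.
  rewrite /spread_dens -subr_ge0.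
  have -> : dens F z - c1 / (2 * Num.sqrt b) * e = (Num.sqrt b * (r / e) * dens F z - c1 / 2 * r) * (e / (r * Num.sqrt b)).
    by field; rewrite !gt_eqF.
  apply: mulr_ge0; first by rewrite subr_ge0.
  by apply: divr_ge0; [exact: ltW|apply: mulr_ge0; [exact: ltW|exact: sqrtr_ge0]].
Qed.

End spread.

Lemma sq_range (R : realType) (s t r : R) : 0 <= r -> `|s| <= r -> `|t| <= r ->
  (`|s| = r \/ `|t| = r) -> r ^+ 2 <= s ^+ 2 + t ^+ 2 <= 2 * r ^+ 2.
Proof.
move=> r0 sr tr h.
have sq x : `|x| <= r -> x ^+ 2 <= r ^+ 2.
  by move=> xr; rewrite -[x ^+ 2]real_normK ?num_real// lerXn2r ?nnegrE.
have se x : `|x| = r -> x ^+ 2 = r ^+ 2 by move=> <-; rewrite real_normK ?num_real.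
have := sq _ sr; have := sq _ tr; have := sqr_ge0 s; have := sqr_ge0 t.
case: h => /se ->; clear; move=> *; apply/andP; split; lra.
Qed.

(** * Annuli of small density in a single chart *)

Section annulus_in_chart.
Variables (R : realType) (n : nat) (X : tamed_manifold R n) (F : 'rV[R]_2 -> X) (b : R).
Hypothesis JF : Jhol_local F.
Hypothesis b1 : 1 <= b.
Variables (c : chart R n X) (x0 : X) (a w : 'rV[R]_2) (q1 q2 M beta : R) (phi phi' : R -> R).
Hypothesis bc : bchart c x0 b.
Hypothesis q11 : 0 < q1 < 1.
Hypothesis q21 : 1 < q2.
Hypothesis H1 : forall s t, q1 / 2 <= s ^+ 2 + t ^+ 2 <= 2 * q2 ->
  Num.sqrt b * len w * dens F (pt a w s t) * Num.sqrt (s ^+ 2 + t ^+ 2) <= M.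
Hypothesis H2 : forall s, 0 < s -> q1 / 2 <= s ^+ 2 <= 2 * q2 ->
  [/\ is_derive s 1 phi (phi' s), Num.sqrt b * len w * dens F (pt a w s 0) <= phi' s &
      `|phi s - phi 1| <= beta].
Hypothesis cdom1 : cdom c (F (pt a w 1 0)).
Hypothesis cmap1 : cmap c (F (pt a w 1 0)) = 0.
Hypothesis small : beta + 5 * M <= half R n.

Let q10 : 0 < q1. Proof. by case/andP: q11. Qed.
Let q1l : q1 < 1. Proof. by case/andP: q11. Qed.

Let M0 : 0 <= M.
Proof.
apply: le_trans (H1 (s := 1) (t := 0) _).
  by rewrite !mulr_ge0 ?sqrtr_ge0 ?dens_ge0.
by rewrite expr1n expr0n addr0; move: q10 q1l q21; move=> *; apply/andP; split; lra.
Qed.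

Let inrange (r s t : R) := [/\ 0 < r, q1 / 2 <= r ^+ 2 <= q2, `|s| <= r, `|t| <= r & `|s| = r \/ `|t| = r].

Let speed_le r s t : inrange r s t -> Num.sqrt b * len w * dens F (pt a w s t) <= M / r.
Proof.
move=> [r0 /andP[ra rb] sr tr h]; have /andP[h1 h2] := sq_range (ltW r0) sr tr h.
rewrite ler_pdivlMr//; apply: le_trans (H1 (s := s) (t := t) _); last first.
  by move: ra rb h1 h2; move=> *; apply/andP; split; lra.
rewrite ler_wpM2l ?mulr_ge0 ?sqrtr_ge0 ?dens_ge0//.
by rewrite -[leLHS]ger0_norm ?(ltW r0)// -sqrtr_sqr ler_wsqrtr.
Qed.

Let step (r : R) (y v : 'rV[R]_2) (x j B : R) : 0 <= j -> len v = `|x| * len w -> `|x| <= j * r ->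
  (forall t', 0 <= t' <= 1 -> exists s t, y + t' *: v = pt a w s t /\ inrange r s t) ->
  0 < r -> cdom c (F y) -> (forall k, `|cmap c (F y) 0 k| <= B) -> B + j * M <= half R n ->
  cdom c (F (y + v)) /\ forall k, `|cmap c (F (y + v)) 0 k| <= B + j * M.
Proof.
move=> j0 lv xj path r0; apply: (escape_const JF b1 bc) => t' /path[s [t [-> sp]]].
rewrite lv mulrCA -[leLHS]mulrA.
have -> : j * M = j * r * (M / r) by field; rewrite gt_eqF.
apply: ler_pM => //; first by rewrite mulr_ge0 ?dens_ge0// mulr_ge0 ?sqrtr_ge0.
exact: speed_le sp.
Qed.

(** From (1, 0) one goes radially to (r, 0), with variation [beta], and then along the square of
    radius [r]: to (r, r) or (r, -r), to (s, r) or (s, -r), and vertically to (s, t). These segments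
    have lengths at most r, 2 r and 2 r, and a length r costs [M]; this is the [5 * M] of the
    smallness hypothesis. Squares are within a factor 2 of circles in r^2, whence the margins q1 / 2
    and 2 q2. *)
Lemma annulus_chart_sq r s t : inrange r s t -> cdom c (F (pt a w s t)).
Proof.
move=> rst; have [r0 /andP[ra rb] sr tr h] := rst.
have [cd1 u1] : cdom c (F (pt a w r 0)) /\ forall k, `|cmap c (F (pt a w r 0)) 0 k| <= beta.
  pose sg : R := if 1 <= r then 1 else -1.
  pose sig t' := 1 + t' * (r - 1).
  have sgr : sg * (r - 1) = `|r - 1|.
    rewrite /sg; case: leP => r1; first by rewrite mul1r ger0_norm// subr_ge0.
    by rewrite mulN1r ler0_norm// subr_le0 ltW.
  have sigP t' : 0 <= t' <= 1 -> 0 < sig t' /\ q1 / 2 <= sig t' ^+ 2 <= 2 * q2.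
    move=> /andP[t0 t1]; have s0 : 0 < sig t'.
      have -> : sig t' = (1 - t') + t' * r by rewrite /sig; ring.
      have [->|tn] := eqVneq t' 0; first by rewrite subr0 mul0r addr0.
      have tp : 0 < t' by rewrite lt_neqAle eq_sym tn.
      by rewrite ltr_wpDl ?subr_ge0// mulr_gt0.
    split => //; have [r1|r1] := leP 1 r.
      have u1 : 1 <= sig t' by rewrite lerDl mulr_ge0// subr_ge0.
      have u2 : sig t' <= r by rewrite /sig -lerBrDl ler_piMl// subr_ge0.
      have := lerXn2r 2 ler01 (ltW s0) u1; have := lerXn2r 2 (ltW s0) (ltW r0) u2.
      by rewrite expr1n; move: ra rb q10 q1l q21; move=> *; apply/andP; split; lra.
    have u1 : sig t' <= 1 by rewrite gerDl mulr_ge0_le0// subr_le0 ltW.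
    have u2 : r <= sig t'.
      have -> : sig t' = r + (1 - t') * (1 - r) by rewrite /sig; ring.
      by rewrite lerDl mulr_ge0// subr_ge0// ltW.
    have := lerXn2r 2 (ltW s0) ler01 u1; have := lerXn2r 2 (ltW r0) (ltW s0) u2.
    by rewrite expr1n; move: ra rb q10 q1l q21; move=> *; apply/andP; split; lra.
  have E t' : pt a w 1 0 + t' *: ((r - 1) *: w) = pt a w (sig t') 0.
    by rewrite /pt /sig; apply/rowP => i; rewrite !mxE; ring.
  have Er : pt a w 1 0 + (r - 1) *: w = pt a w r 0.
    by rewrite /pt; apply/rowP => i; rewrite !mxE; ring.
  have bb t' : 0 <= t' <= 1 -> sg * phi (sig t') - sg * phi (sig 0) <= beta.
    move=> /sigP[s0 sq]; have [_ _ h'] := H2 s0 sq.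
    rewrite -mulrBr {2}/sig mul0r addr0 (le_trans (ler_norm _))// normrM.
    by rewrite (_ : `|sg| = 1) ?mul1r// /sg; case: ifP; rewrite ?normrN normr1.
  have := @escape_segment R n X F JF b b1 c x0 bc (pt a w 1 0) ((r - 1) *: w)
    (fun t' => sg * phi (sig t')) (fun t' => sg * (phi' (sig t') * (r - 1))) 0.
  rewrite Er => /(_ _ _ cdom1 _ _)/wrap[| | | |[cd ub]].
  - move=> t' /sigP[s0 sq]; have [d _ _] := H2 s0 sq.
    have ds : is_derive t' 1 sig (r - 1).
      have := is_deriveD (is_derive_cst (1 : R^o) t' (1 : R)) (is_deriveM (is_derive_id t' (1 : R)) (is_derive_cst (r - 1 : R^o) t' (1 : R))).
      by move=> h'; apply: is_derive_eq h' _; rewrite scaler0 !add0r [_ *: 1]mulr1.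
    by have := is_deriveZ sg (@is_derive1_comp R phi sig t' _ _ d ds).
  - move=> t' /sigP[s0 sq]; have [_ le _] := H2 s0 sq.
    rewrite E lenZ [sg * _]mulrCA sgr [phi' _ * _]mulrC.
    rewrite [Num.sqrt b * (_ * _)]mulrCA -mulrA ler_wpM2l//.
  - by move=> k; rewrite cmap1 mxE normr0.
  - by move=> t' tin; rewrite add0r (le_trans (bb t' tin))//; move: M0 small; move=> *; lra.
  - split => // k; apply: le_trans (ub k) _; rewrite add0r bb//.
    by rewrite ler01 lexx.
pose sg : R := if 0 <= t then 1 else -1.
have sg1 : `|sg| = 1 by rewrite /sg; case: ifP; rewrite ?normrN normr1.
have tE : t = sg * `|t|.
  by rewrite /sg; case: leP => t0; [rewrite mul1r ger0_norm|rewrite mulN1r ltr0_norm// opprK].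
have rr : `|r| = r by rewrite gtr0_norm.
have rsg : `|r * sg| = r by rewrite normrM sg1 mulr1.
have absM (x y : R) : 0 <= x <= 1 -> `|y| <= r -> `|x * y| <= r.
  by move=> /andP[xa xb] yr; rewrite normrM (ger0_norm xa) (le_trans _ yr)// ler_piMl.
have rng : q1 / 2 <= r ^+ 2 <= q2 by rewrite ra.
have := small; have := M0 => M0' small'.
have [cd2 u2] : cdom c (F (pt a w r 0 + (r * sg) *: rot w)) /\
    forall k, `|cmap c (F (pt a w r 0 + (r * sg) *: rot w)) 0 k| <= beta + 1 * M.
  apply: (@step r _ _ (r * sg)) => //.
  - by rewrite lenZ len_rot.
  - by rewrite rsg mul1r.
  - move=> t' t'in; exists r, (t' * (r * sg)); split.
      by rewrite /pt; apply/rowP => i; rewrite !mxE; ring.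
    by split; rewrite ?rr//; [apply: absM => //; rewrite rsg|left].
  - by move: M0' small'; move=> *; lra.
have E2 : pt a w r 0 + (r * sg) *: rot w = pt a w r (r * sg).
  by rewrite /pt; apply/rowP => i; rewrite !mxE; ring.
rewrite E2 in cd2 u2.
have conv (x y : R) t' : 0 <= t' <= 1 -> `|x| <= r -> `|y| <= r -> `|x + t' * (y - x)| <= r.
  move=> /andP[t0 t1] xr yr; rewrite (_ : _ + _ = (1 - t') * x + t' * y); last by ring.
  apply: le_trans (ler_normD _ _) _; rewrite !normrM (ger0_norm t0) ger0_norm ?subr_ge0//.
  have := ler_wpM2l t0 yr; have t1' : 0 <= 1 - t' by rewrite subr_ge0.
  by have := ler_wpM2l t1' xr; move=> *; lra.
have dif (x y : R) : `|x| <= r -> `|y| <= r -> `|x - y| <= 2 * r.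
  by move=> xr yr; rewrite (le_trans (ler_normB _ _))// mulr_natl mulr2n lerD.
have [cd3 u3] : cdom c (F (pt a w r (r * sg) + (s - r) *: w)) /\
    forall k, `|cmap c (F (pt a w r (r * sg) + (s - r) *: w)) 0 k| <= beta + 1 * M + 2 * M.
  apply: (@step r _ _ (s - r)) => //.
  - by rewrite lenZ.
  - by apply: dif; rewrite ?rr.
  - move=> t' t'in; exists (r + t' * (s - r)), (r * sg); split.
      by rewrite /pt; apply/rowP => i; rewrite !mxE; ring.
    by split => //; rewrite ?rsg//; [apply: conv; rewrite ?rr|right].
  - by move: M0' small'; move=> *; lra.
have E3 : pt a w r (r * sg) + (s - r) *: w = pt a w s (r * sg).
  by rewrite /pt; apply/rowP => i; rewrite !mxE; ring.
rewrite E3 in cd3 u3.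
have [cd4 _] : cdom c (F (pt a w s (r * sg) + (t - r * sg) *: rot w)) /\
    forall k, `|cmap c (F (pt a w s (r * sg) + (t - r * sg) *: rot w)) 0 k| <= beta + 1 * M + 2 * M + 2 * M.
  apply: (@step r _ _ (t - r * sg)) => //.
  - by rewrite lenZ len_rot.
  - by apply: dif; rewrite ?rsg.
  - move=> t' t'in; exists s, (r * sg + t' * (t - r * sg)); split.
      by rewrite /pt; apply/rowP => i; rewrite !mxE; ring.
    split => //; first by apply: conv; rewrite ?rsg.
    case: h => h; [by left|right].
    have -> : r * sg = t by rewrite [in RHS]tE h mulrC.
    by rewrite subrr mulr0 addr0.
  - by move: M0' small'; move=> *; lra.
have E4 : pt a w s (r * sg) + (t - r * sg) *: rot w = pt a w s t.
  by rewrite /pt; apply/rowP => i; rewrite !mxE; ring.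
by rewrite E4 in cd4.
Qed.

Lemma max_range (s t : R) : q1 <= s ^+ 2 + t ^+ 2 <= q2 -> inrange (Num.max `|s| `|t|) s t.
Proof.
move=> /andP[h1 h2]; set r := Num.max _ _.
have r0 : 0 <= r by rewrite le_max normr_ge0.
have sr : `|s| <= r by rewrite le_max lexx.
have tr : `|t| <= r by rewrite le_max lexx orbT.
have h : `|s| = r \/ `|t| = r by rewrite /r; case: leP => _; [right|left].
have /andP[g1 g2] := sq_range r0 sr tr h.
split => //.
  rewrite lt_neqAle r0 andbT eq_sym; apply/eqP => r00; move: g2; rewrite r00 expr0n mulr0.
  by move=> /(le_trans h1); rewrite leNgt q10.
by move: g1 g2 h1 h2; move=> *; apply/andP; split; lra.
Qed.

Lemma annulus_chart s t : q1 <= s ^+ 2 + t ^+ 2 <= q2 -> cdom c (F (pt a w s t)).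
Proof. by move=> /max_range/annulus_chart_sq. Qed.

(** A path from (s, t) to (s, -t) on the square through these points: the vertical segment if |t| <=
    |s|, and otherwise the way round over three sides, whose length is comparable to t = r. The two
    cases give the factors 3 and 9. *)
Lemma annulus_odd s t k : 0 <= t -> q1 <= s ^+ 2 + t ^+ 2 <= q2 ->
  `|cmap c (F (pt a w s t)) 0 k - cmap c (F (pt a w s (- t))) 0 k| <=
  10 * M * t * qpow (- 2^-1) s t.
Proof.
move=> t0 q; have [r0 rng sr tr h] := max_range q.
set r := Num.max _ _ in r0 rng sr tr h.
have q0 : 0 < s ^+ 2 + t ^+ 2 by case/andP: q => /(lt_le_trans q10).
have qE : qpow (- 2^-1) s t = (Num.sqrt (s ^+ 2 + t ^+ 2))^-1.
  by rewrite /qpow powRN powR12_sqrt ?ltW.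
set rho := Num.sqrt (s ^+ 2 + t ^+ 2) in qE.
have rho0 : 0 < rho by rewrite sqrtr_gt0.
have rhor : rho <= 3 / 2 * r.
  rewrite -ler_sqr ?nnegrE ?(ltW rho0) ?mulr_ge0 ?(ltW r0)// sqr_sqrtr ?(ltW q0)// exprMn.
  have /andP[_] := sq_range (ltW r0) sr tr h; have := sqr_ge0 r.
  by move=> *; lra.
have gr v x y : len v = len w -> inrange r x y -> cdom c (F (pt a w x y)) /\ `|ddir F c v k (pt a w x y)| <= M / r.
  move=> lv rxy; have cd := annulus_chart_sq rxy; split => //.
  by apply: le_trans (ddir_le_dens JF b1 bc _ _ cd) _; rewrite lv; exact: speed_le.
rewrite qE ler_pdivlMr//.
have [ts|st] := leP `|t| `|s|.
  have sE : `|s| = r by rewrite /r (max_idPl ts).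
  have := @osc_le R (fun t => cmap c (F (pt a w s t)) 0 k) (fun t => ddir F c (rot w) k (pt a w s t)) (M / r) (- t) t.
  move=> /(_ _)/wrap[z|ole].
    rewrite (min_idPl _) ?(max_idPr _) ?ge0_cp// => /andP[z1 z2].
    have zt : `|z| <= t by rewrite ler_norml z1.
    have rz : inrange r s z by split => //; [rewrite (le_trans zt)// -(ger0_norm t0)|left].
    have [cd g] := gr (rot w) s z (len_rot _) rz; split => //.
    exact: (chart_dt JF bc).
  apply: (@le_trans _ _ (M / r * `|t - - t| * rho)); first by rewrite ler_wpM2r// ltW.
  have -> : `|t - - t| = 2 * t by rewrite opprK -mulr2n normrMn (ger0_norm t0) mulr_natl.
  apply: (@le_trans _ _ (M / r * (2 * t) * (3 / 2 * r))).
    by rewrite ler_wpM2l// !mulr_ge0// invr_ge0 ltW.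
  have -> : M / r * (2 * t) * (3 / 2 * r) = 3 * (M * t) by field; rewrite gt_eqF.
  by have := mulr_ge0 M0 t0; move=> *; lra.
have tE : t = r by rewrite /r (max_idPr (ltW st)) ger0_norm.
have horiz y : `|y| = r -> `|cmap c (F (pt a w r y)) 0 k - cmap c (F (pt a w s y)) 0 k| <= 2 * M.
  move=> yr; have := @osc_le R (fun s => cmap c (F (pt a w s y)) 0 k) (fun s => ddir F c w k (pt a w s y)) (M / r) s r.
  have sr' : s <= r by rewrite (le_trans (ler_norm _)).
  move=> /(_ _)/wrap[z|ole].
    rewrite (min_idPl sr') (max_idPr sr') => /andP[z1 z2].
    have rz : inrange r z y.
      split => //; [|by rewrite yr|by right]; rewrite ler_norml z2 andbT (le_trans _ z1)//.
      by rewrite lerNl (le_trans (ler_norm _))// normrN.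
    have [cd g] := gr w z y erefl rz; split => //.
    exact: (chart_ds JF bc).
  apply: le_trans ole _; apply: (@le_trans _ _ (M / r * (2 * r))).
    rewrite ler_wpM2l ?divr_ge0 ?(ltW r0)//.
    by rewrite (le_trans (ler_normB _ _))// (gtr0_norm r0) mulr_natl mulr2n lerD2l.
  by rewrite mulrCA mulfVK ?gt_eqF.
have vert : `|cmap c (F (pt a w r r)) 0 k - cmap c (F (pt a w r (- r))) 0 k| <= 2 * M.
  have := @osc_le R (fun t => cmap c (F (pt a w r t)) 0 k) (fun t => ddir F c (rot w) k (pt a w r t)) (M / r) (- r) r.
  move=> /(_ _)/wrap[z|ole].
    rewrite (min_idPl _) ?(max_idPr _) ?ge0_cp ?(ltW r0)// => /andP[z1 z2].
    have rz : inrange r r z by split => //; rewrite ?(gtr0_norm r0)//; [rewrite ler_norml z1|left].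
    have [cd g] := gr (rot w) r z (len_rot _) rz; split => //.
    exact: (chart_dt JF bc).
  apply: le_trans ole _; have -> : `|r - - r| = 2 * r by rewrite opprK -mulr2n normrMn (gtr0_norm r0) mulr_natl.
  by rewrite mulrCA mulfVK ?gt_eqF.
have h1 := horiz r (gtr0_norm r0).
have h2 := horiz (- r) _; rewrite normrN (gtr0_norm r0) in h2; have {}h2 := h2 erefl.
rewrite tE; apply: (@le_trans _ _ (6 * M * rho)).
  rewrite ler_wpM2r ?(ltW rho0)//; move: h1 h2 vert.
  move: (cmap c _ 0 k) (cmap c _ 0 k) (cmap c _ 0 k) (cmap c _ 0 k) => A B C D.
  rewrite !ler_norml => /andP[? ?] /andP[? ?] /andP[? ?]; apply/andP; split; lra.
apply: (@le_trans _ _ (6 * M * (3 / 2 * r))); first by rewrite ler_wpM2l// mulr_ge0.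
by have := mulr_ge0 M0 (ltW r0); move=> *; lra.
Qed.

End annulus_in_chart.

(** * Decay on annuli *)

Lemma unit_differences (R : realType) (x y x' y' : R) : 0 <= x -> x <= 1 -> 0 <= y -> y <= 1 ->
  0 <= x' -> x' <= 1 -> 0 <= y' -> y' <= 1 -> `|x - y - (x' - y')| <= 2.
Proof. by move=> *; rewrite ler_norml; apply/andP; split; lra. Qed.

Lemma eight_thirds_le3 (R : realType) : 4 / 3 * 2 <= 3 :> R.
Proof. by lra. Qed.

Lemma widen_annulus (R : realType) (q1 q2 q : R) : 0 < q1 -> 1 < q2 -> q1 <= q <= q2 -> q1 / 2 <= q <= 2 * q2.
Proof. by move=> *; apply/andP; split; lra. Qed.

Lemma sqrD_le (R : realType) (x y : R) : (x + y) ^+ 2 <= 2 * x ^+ 2 + 2 * y ^+ 2.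
Proof. by have := sqr_ge0 (x - y); rewrite sqrrB sqrrD => ?; lra. Qed.

Lemma powR_ge1 (R : realType) (x p : R) : 0 <= p -> 1 <= x -> 1 <= x `^ p.
Proof.
move=> p0 x1; rewrite -[leLHS](powRr0 x); apply: ler_powR => //.
Qed.

Lemma sqr_powR (R : realType) (x p : R) : (x `^ p) ^+ 2 = x `^ (p * 2).
Proof. by rewrite -powR_mulrn ?powR_ge0// -powRrM. Qed.

Lemma powR_le1 (R : realType) (x p : R) : 0 <= p -> 0 <= x -> x <= 1 -> x `^ p <= 1.
Proof.
move=> p0 x0 x1; rewrite (_ : 1 = 1 `^ p); last by rewrite powR1.
by apply: ge0_ler_powR; rewrite ?nnegrE.
Qed.

Section annulus_decay.
Variables (R : realType) (n : nat) (b : R).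
Hypothesis b1 : 1 <= b.

Let sb := Num.sqrt b.
Let L := lapC n b.
Let sb1 : 1 <= sb. Proof. exact: sqrtb_ge1. Qed.
Let sb0 : 0 < sb. Proof. exact: lt_le_trans sb1. Qed.
Let C0 : 0 < enC n b. Proof. exact: lt_le_trans ltr01 (enC_ge1 n b1). Qed.
Let C1 : 1 <= enC n b. Proof. exact: enC_ge1. Qed.
Let L0 : 0 < L. Proof. exact: lapC_gt0. Qed.

Section one_map.
Variables (X : tamed_manifold R n) (F : 'rV[R]_2 -> X).
Hypothesis JF : Jhol_local F.
Hypothesis bg : forall x : X, exists c, bchart c x b.

Lemma dens_le_dt (c : chart R n X) x0 (w y : 'rV[R]_2) (m : R) : bchart c x0 b ->
  0 <= m -> cdom c (F y) -> (forall k, `|ddir F c (rot w) k y| <= m) ->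
  len w * dens F y <= enC n b * m.
Proof.
move=> bc m0 cd h; rewrite -ler_sqr ?nnegrE ?(mulr_ge0 (len_ge0 _) (dens_ge0 _ _)) ?(mulr_ge0 (ltW C0) m0)//.
rewrite [(len w * _) ^+ 2]exprMn [(enC n b * m) ^+ 2]exprMn len_sqr dens_sqr.
apply: le_trans (energy_le_ddir JF bc b1 cd h) _.
have C1' := C1; have C0' := ltW C0.
have -> : 2 * n.+1%:R ^+ 4 * b ^+ 3 * m ^+ 2 = enC n b * m ^+ 2 by [].
by move: (enC n b) C1' C0' => e e1 e0; rewrite ler_wpM2r ?sqr_ge0// expr2 ler_peMr.
Qed.

(** One comparison on an annulus about the circle of [z]. The boundary values contribute mu / Th,
    and the Laplacian, quadratic in the density, contributes mu^2. Hence wide windows and small [mu]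
    improve the bound. *)
Lemma window_decay (a z : 'rV[R]_2) (Th mu : R) : 2 < Th -> 0 < mu -> 0 < len (z - a) ->
  sb * mu * (Th ^+ 2 + 5) <= half R n ->
  (forall y, len (z - a) / Th <= len (y - a) <= Th * len (z - a) ->
     dens F y * len (y - a) <= mu) ->
  dens F z * len (z - a) <= enC n b * (40 * sb * mu / Th + 8 * L * mu ^+ 2).
Proof.
move=> Th2 mu0; set w := z - a => lw0 sm win.
have Th0 : 0 < Th by lra.
pose q1 := (2 / Th) ^+ 2; pose q2 := (Th / 2) ^+ 2.
have t1 : 0 < 2 / Th < 1 by rewrite divr_gt0//= ltr_pdivrMr// mul1r.
have t2 : 1 < Th / 2 by rewrite ltr_pdivlMr// mul1r.
have q11 : 0 < q1 < 1.
  by case/andP: t1 => t1 t1'; rewrite exprn_gt0// expr_lt1// ltW.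
have q21 : 1 < q2 by rewrite expr_gt1// ltW// (lt_trans ltr01).
have zE : pt a w 1 0 = z by rewrite /pt scale1r scale0r addr0 /w addrC subrK.
have key s t : q1 / 2 <= s ^+ 2 + t ^+ 2 <= 2 * q2 ->
    len w * dens F (pt a w s t) * Num.sqrt (s ^+ 2 + t ^+ 2) <= mu.
  move=> /andP[h1 h2]; apply: le_trans (win (pt a w s t) _); rewrite pt_len.
    by rewrite le_eqVlt; apply/orP; left; apply/eqP; ring.
  have T1 : Th^-1 <= Num.sqrt (s ^+ 2 + t ^+ 2).
    rewrite -[leLHS]ger0_norm ?invr_ge0 ?(ltW Th0)// -sqrtr_sqr ler_wsqrtr// (le_trans _ h1)//.
    have -> : q1 / 2 = 2 * Th^-1 ^+ 2 by rewrite /q1; field; rewrite gt_eqF.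
    by have := sqr_ge0 (Th^-1); lra.
  have T2 : Num.sqrt (s ^+ 2 + t ^+ 2) <= Th.
    rewrite -[leRHS]ger0_norm ?(ltW Th0)// -sqrtr_sqr ler_wsqrtr// (le_trans h2)//.
    have -> : 2 * q2 = Th ^+ 2 / 2 by rewrite /q2; field.
    by have := sqr_ge0 Th; lra.
  by rewrite [len w / Th]mulrC !ler_wpM2r ?(ltW lw0).
have [c bc] := bg (F z); have [ac cz c0 _ _] := bc.
pose M := sb * mu.
have M0 : 0 < M by rewrite mulr_gt0.
have H1 s t : q1 / 2 <= s ^+ 2 + t ^+ 2 <= 2 * q2 ->
    Num.sqrt b * len w * dens F (pt a w s t) * Num.sqrt (s ^+ 2 + t ^+ 2) <= M.
  by move=> /key h; rewrite -!mulrA /M ler_pM2l// mulrA.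
have H2 s : 0 < s -> q1 / 2 <= s ^+ 2 <= 2 * q2 ->
    [/\ is_derive s 1 (fun s => M * Th * s) (M * Th), Num.sqrt b * len w * dens F (pt a w s 0) <= M * Th &
      `|M * Th * s - M * Th * 1| <= M * Th ^+ 2].
  move=> s0 sq; have /andP[h1 h2] := sq.
  have T1 : Th^-1 <= s.
    rewrite -[leLHS]ger0_norm ?invr_ge0 ?(ltW Th0)// -[leRHS]ger0_norm ?(ltW s0)// -!sqrtr_sqr ler_wsqrtr// (le_trans _ h1)//.
    have -> : q1 / 2 = 2 * Th^-1 ^+ 2 by rewrite /q1; field; rewrite gt_eqF.
    by have := sqr_ge0 (Th^-1); lra.
  have T2 : s <= Th.
    rewrite -[leLHS]ger0_norm ?(ltW s0)// -[leRHS]ger0_norm ?(ltW Th0)// -!sqrtr_sqr ler_wsqrtr// (le_trans h2)//.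
    have -> : 2 * q2 = Th ^+ 2 / 2 by rewrite /q2; field.
    by have := sqr_ge0 Th; lra.
  split.
  - by have := is_deriveZ (M * Th) (is_derive_id s (1 : R)); rewrite [_ *: 1]mulr1.
  - have := H1 s 0; rewrite expr0n addr0 => /(_ sq); rewrite sqrtr_sqr gtr0_norm// => h.
    have : Num.sqrt b * len w * dens F (pt a w s 0) * s * Th <= M * Th by rewrite ler_wpM2r// ltW.
    have g0 : 0 <= Num.sqrt b * len w * dens F (pt a w s 0).
      by rewrite (mulr_ge0 (mulr_ge0 (sqrtr_ge0 _) (len_ge0 _)) (dens_ge0 _ _)).
    have sT : 1 <= s * Th by rewrite -ler_pdivrMr// div1r.
    move=> h'; apply: le_trans h'; rewrite -[leRHS]mulrA; exact: ler_peMr.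
  - rewrite -mulrBr normrM gtr0_norm ?mulr_gt0// expr2 mulrA ler_wpM2l ?mulr_ge0 ?ltW//.
    by rewrite ltr_norml; apply/andP; split; lra.
have small : M * Th ^+ 2 + 5 * M <= half R n by apply: le_trans sm; rewrite /M; lra.
have cd1 : cdom c (F (pt a w 1 0)) by rewrite zE.
have cm1 : cmap c (F (pt a w 1 0)) = 0 by rewrite zE.
have inD s t : q1 <= s ^+ 2 + t ^+ 2 <= q2 -> cdom c (F (pt a w s t)).
  exact: (annulus_chart JF b1 bc q11 q21 H1 H2 cd1 cm1 small).
have odd s t k : 0 <= t -> q1 <= s ^+ 2 + t ^+ 2 <= q2 -> _ :=
  @annulus_odd _ _ _ _ _ JF b1 c _ a w q1 q2 M _ _ _ bc q11 q21 H1 H2 cd1 cm1 small s t k.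
have [q10 q1l] := andP q11.
rewrite mulrC; apply: (dens_le_dt bc) => //.
  rewrite (addr_ge0 (mulr_ge0 (mulr_ge0 (mulr_ge0 (ler0n _ 40) (ltW sb0)) (ltW mu0)) _)
    (mulr_ge0 (mulr_ge0 (ler0n _ 8) (ltW L0)) (sqr_ge0 _)))//.
  by rewrite invr_ge0 ltW.
move=> k; rewrite -[in X in ddir _ _ _ _ X]zE.
have N30 : 0 < L * mu ^+ 2 by rewrite mulr_gt0 ?exprn_gt0.
have C10 : 0 <= 10 * M by rewrite mulr_ge0// ltW.
have := @annulus_barrier R (fun s t => cmap c (F (pt a w s t)) 0 k) q1 q2 (10 * M) 0 0 (L * mu ^+ 2)
  (ddir F c (rot w) k (pt a w 1 0)) q11 q21 C10 (lexx _) (lexx _) N30.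
move=> /(_ _ _ _)/wrap[s t q|s t t0 q||].
- have cd := inD s t q; split; first exact: (chart_cont JF bc).
  have [x xle lx] := chart_lap JF b1 bc k cd; exists x => //.
  apply: le_trans xle _; rewrite !mul0r !add0r -mulrA ler_wpM2l ?(ltW L0)//.
  have q0 : 0 < s ^+ 2 + t ^+ 2 by case/andP: q => /(lt_le_trans q10).
  rewrite /qpow powR_inv1 ?(ltW q0)// ler_pdivlMr//.
  rewrite -[X in _ * X]sqr_sqrtr ?(ltW q0)// -exprMn lerXn2r ?nnegrE ?(ltW mu0)//.
    by rewrite !mulr_ge0 ?len_ge0 ?dens_ge0 ?sqrtr_ge0.
  by apply: key; exact: widen_annulus q10 q21 q.
- by apply: odd => //; case: q => ->; rewrite lexx ltW// (lt_trans q1l).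
- exact: (chart_dt JF bc).
move=> /le_trans; apply.
rewrite !mul0r addr0 mulr0 addr0 mulrA lerD2r.
have -> : q2 `^ (- 2^-1) = 2 / Th.
  rewrite powRN powR12_sqrt ?sqr_ge0// sqrtr_sqr gtr0_norm ?divr_gt0// invf_div.
  by [].
rewrite powR12_sqrt ?sqr_ge0// sqrtr_sqr gtr0_norm ?divr_gt0//.
by rewrite /M le_eqVlt; apply/orP; left; apply/eqP; ring.
Qed.

Variables (T mu0 r1 r2 : R) (a : 'rV[R]_2).
Hypothesis TE : T = 160 * enC n b * sb.
Hypothesis mu00 : 0 < mu0.
Hypothesis muL : 32 * enC n b * L * T ^+ 3 * mu0 <= 1.
Hypothesis muh : sb * mu0 * (T ^+ 8 + 5) <= half R n.
Hypothesis r10 : 0 < r1.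
Hypothesis small : forall y, r1 < len (y - a) < r2 -> dens F y * len (y - a) <= mu0.

Let T160 : 160 <= T.
Proof. by rewrite TE -mulrA ler_peMr// -[leLHS]mulr1 ler_pM. Qed.
Let T1 : 1 <= T. Proof. by move: T160; move=> *; lra. Qed.
Let T0 : 0 < T. Proof. exact: lt_le_trans T1. Qed.

(** With T = 160 enC sqrt(b) each of the two terms of [window_decay] is at most mu / (4 T^3). A gain
    of T^3 over a window of ratio T^4 is decay with exponent 3/4; the additional factor 2 makes the
    iteration converge. *)
Lemma window_decay_small (z : 'rV[R]_2) (mu : R) : 0 < mu -> mu <= mu0 -> 0 < len (z - a) ->
  (forall y, len (z - a) / T ^+ 4 <= len (y - a) <= T ^+ 4 * len (z - a) ->
     dens F y * len (y - a) <= mu) ->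
  dens F z * len (z - a) <= mu / (2 * T ^+ 3).
Proof.
move=> mu_0 mule l0 win; have T30 : 0 < T ^+ 3 by rewrite exprn_gt0.
have T4 : 2 < T ^+ 4.
  by apply: lt_le_trans (_ : T <= _); [move: T160; move=> *; lra|rewrite exprS ler_peMr ?exprn_ege1// ltW].
apply: le_trans (window_decay T4 mu_0 l0 _ win) _.
  rewrite -exprM; apply: le_trans muh; rewrite ler_wpM2r ?ler_wpM2l ?(ltW sb0)//.
  by rewrite addr_ge0// exprn_ge0// ltW.
have e1 : enC n b * (40 * sb * mu / T ^+ 4) = mu / (4 * T ^+ 3).
  rewrite (_ : enC n b * _ = T * mu / (4 * T ^+ 4)); last first.
    by rewrite {2}TE; field; rewrite gt_eqF.
  by field; rewrite gt_eqF.
have e2 : enC n b * (8 * L * mu ^+ 2) <= mu / (4 * T ^+ 3).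
  rewrite ler_pdivlMr ?mulr_gt0//.
  rewrite (_ : _ * (4 * T ^+ 3) = mu * (32 * enC n b * L * T ^+ 3 * mu)); last by ring.
  rewrite ler_piMr ?(ltW mu_0)//; apply: le_trans muL; rewrite ler_wpM2l//.
  exact: (mulr_ge0 (mulr_ge0 (mulr_ge0 (ler0n _ 32) (ltW C0)) (ltW L0)) (ltW T30)).
rewrite mulrDr e1 (le_trans (lerD (lexx _) e2))// le_eqVlt; apply/orP; left; apply/eqP.
by field; rewrite gt_eqF.
Qed.

Let D := mu0 * T ^+ 3.
Let G (rho : R) := D * ((rho / r2) `^ (3 / 4) + (r1 / rho) `^ (3 / 4)).

Let D0 : 0 < D. Proof. by rewrite mulr_gt0// exprn_gt0. Qed.

Let T34 : (T ^+ 4) `^ (3 / 4) = T ^+ 3.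
Proof.
rewrite -!powR_mulrn ?(ltW T0)// -powRrM; congr (_ `^ _).
by field.
Qed.

Let G_ge0 rho : 0 <= G rho.
Proof. by rewrite /G mulr_ge0 ?(ltW D0)// addr_ge0// powR_ge0. Qed.

(** Within a factor T^4 of either end of the annulus [G] is at least [mu0]. Elsewhere the induction
    hypothesis holds on the window of [z], where [G] is at most T^3 times its value at [z]; the gain
    2 T^3 cancels this factor and halves the error term. *)
Lemma decay_iter (k : nat) (z : 'rV[R]_2) : r1 < len (z - a) < r2 ->
  dens F z * len (z - a) <= 2^-1 ^+ k * mu0 + G (len (z - a)).
Proof.
have T40 : 0 < T ^+ 4 by rewrite exprn_gt0.
have T30 : 0 < T ^+ 3 by rewrite exprn_gt0.
elim: k z => [|k IH] z zin.
  by rewrite expr0 mul1r (le_trans (small zin))// lerDl.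
have /andP[z1 z2] := zin; set rho := len (z - a) in z1 z2 zin *.
have rho0 : 0 < rho by apply: lt_trans z1.
have r20 : 0 < r2 by apply: lt_trans z2.
have k0 : 0 <= 2^-1 ^+ k :> R by rewrite exprn_ge0.
have big (x : R) : 0 <= x -> 1 <= T ^+ 4 * x -> mu0 <= D * x `^ (3 / 4).
  move=> x0 h; rewrite /D -T34 -mulrA -powRM ?(ltW T40)//.
  rewrite ler_peMr ?(ltW mu00)//.
  by apply: powR_ge1.
have [b2|b2] := leP r2 (T ^+ 4 * rho).
  apply: (le_trans (small zin)); rewrite -[leLHS]add0r lerD//.
    by rewrite (mulr_ge0 _ (ltW mu00))// exprn_ge0.
  rewrite /G mulrDr -[leLHS]addr0 lerD ?(mulr_ge0 (ltW D0) (powR_ge0 _ _))//.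
  apply: big; first by rewrite divr_ge0 ?(ltW rho0) ?(ltW r20).
  by rewrite mulrA ler_pdivlMr// mul1r.
have [b1'|b1'] := leP rho (T ^+ 4 * r1).
  apply: (le_trans (small zin)); rewrite -[leLHS]add0r lerD//.
    by rewrite (mulr_ge0 _ (ltW mu00))// exprn_ge0.
  rewrite /G mulrDr -[leLHS]add0r lerD ?(mulr_ge0 (ltW D0) (powR_ge0 _ _))//.
  apply: big; first by rewrite divr_ge0 ?(ltW rho0) ?(ltW r10).
  by rewrite mulrA ler_pdivlMr// mul1r.
pose m1 := 2^-1 ^+ k * mu0 + T ^+ 3 * G rho.
have m10 : 0 < m1.
  by rewrite ltr_pwDl// ?mulr_gt0// ?exprn_gt0// mulr_ge0// ltW.
pose mu := Num.min mu0 m1.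
have mu_0 : 0 < mu by rewrite lt_min mu00.
have := @window_decay_small z mu mu_0 _ rho0.
rewrite ge_min lexx => /(_ isT)/(_ _)/wrap[y /andP[y1 y2]|h].
  have yin : r1 < len (y - a) < r2.
    rewrite (le_lt_trans y2 b2) andbT (lt_le_trans _ y1)//.
    by rewrite ltr_pdivlMr// mulrC.
  have y0 : 0 < len (y - a) by case/andP: yin => /(lt_trans r10).
  rewrite le_min small//= (le_trans (IH y yin))// lerD2l /G mulrCA ler_wpM2l ?(ltW D0)//.
  rewrite mulrDr -T34 -!powRM ?(ltW T40) ?divr_ge0 ?(ltW rho0) ?(ltW r20) ?(ltW r10)//.
  have p34 : 0 <= (3 / 4 : R) by [].
  have g0 (x x' : R) : 0 < x -> 0 < x' -> 0 <= x / x' by move=> x0 x'0; rewrite divr_ge0 ?(ltW x0) ?(ltW x'0).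
  apply: lerD; apply: ge0_ler_powR => //; rewrite ?nnegrE ?g0// ?(mulr_ge0 (ltW T40) (g0 _ _ _ _))//.
    by rewrite mulrA ler_wpM2r ?invr_ge0 ?(ltW r20).
  have le1 : rho <= T ^+ 4 * len (y - a) by rewrite mulrC -ler_pdivrMr.
  have -> : T ^+ 4 * (r1 / rho) = r1 / (rho / T ^+ 4) by rewrite invfM invrK; ring.
  by rewrite ler_wpM2l ?(ltW r10)// lef_pV2 ?posrE ?divr_gt0.
apply: le_trans h _; apply: (@le_trans _ _ (m1 / (2 * T ^+ 3))).
  by rewrite (ler_wpM2r _ (_ : mu <= m1)) ?invr_ge0 ?(mulr_ge0 (ler0n _ 2) (ltW T30))// ge_min lexx orbT.
rewrite ler_pdivrMr ?(mulr_gt0 (ltr0n _ 2) T30)//.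
have -> : (2^-1 ^+ k.+1 * mu0 + G rho) * (2 * T ^+ 3) = 2^-1 ^+ k * mu0 * T ^+ 3 + T ^+ 3 * G rho + T ^+ 3 * G rho.
  by rewrite exprS; field.
rewrite -addrA lerD//; first by rewrite ler_peMr ?mulr_ge0 ?(ltW mu00)// exprn_ege1.
by rewrite lerDl mulr_ge0 ?(ltW T30).
Qed.

Lemma annulus_decay (z : 'rV[R]_2) : r1 < len (z - a) < r2 ->
  dens F z * len (z - a) <= G (len (z - a)).
Proof.
move=> zin; apply/ler_addgt0Pr => e e0.
have [k kP] : exists k : nat, 2^-1 ^+ k * mu0 <= e.
  have : (fun k : nat => 2^-1 ^+ k : R) @ \oo --> (0 : R).
    by apply: cvg_expr; rewrite ger0_norm// invf_lt1// ltr1n.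
  move=> /cvgrPdist_le/(_ (e / mu0)); rewrite divr_gt0// => /(_ isT)[k _ /(_ k (leqnn k))].
  rewrite /= sub0r normrN ger0_norm ?exprn_ge0// ler_pdivlMr// => h; by exists k.
by apply: le_trans (decay_iter k zin) _; rewrite addrC lerD2l.
Qed.

Hypothesis muh' : (3 * T ^+ 3 + 5) * sb * mu0 <= half R n.

(** The decay with exponent 3/4 is inserted into the quadratic bound of the Laplacian. Its square,
    divided by r^2, consists of the powers -1/4 and -7/4 of r^2 for which [annulus_barrier] is made,
    and their contributions have the optimal order r / r2 + r1 / r. *)
Lemma annulus_interior (z : 'rV[R]_2) : 2 * r1 < len (z - a) -> 2 * len (z - a) < r2 ->
  dens F z <= enC n b * (20 * sb * mu0 + 20 * L * D ^+ 2 + 8) * (r2^-1 + r1 / len (z - a) ^+ 2).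
Proof.
set w := z - a => z1 z2.
have w0 : 0 < len w by apply: lt_trans z1; rewrite mulr_gt0.
have r20 : 0 < r2 by apply: lt_trans z2; rewrite mulr_gt0.
pose p1 := r1 / len w; pose p2 := r2 / len w.
have p10 : 0 < p1 by rewrite divr_gt0.
have p1h : p1 < 2^-1 by rewrite ltr_pdivrMr// mulrC ltr_pdivlMr// mulrC.
have p22 : 2 < p2 by rewrite ltr_pdivlMr.
have p20 : 0 < p2 by apply: lt_trans p22.
pose q1 := (2 * p1) ^+ 2; pose q2 := (p2 / 2) ^+ 2.
have t1 : 0 < 2 * p1 < 1 by rewrite mulr_gt0//= mulrC -ltr_pdivlMr// mul1r.
have t2 : 1 < p2 / 2 by rewrite ltr_pdivlMr// mul1r.
have q11 : 0 < q1 < 1.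
  by case/andP: t1 => t1 t1'; rewrite exprn_gt0// expr_lt1// ltW.
have q21 : 1 < q2 by rewrite expr_gt1// ltW// (lt_trans ltr01).
have zE : pt a w 1 0 = z by rewrite /pt scale1r scale0r addr0 /w addrC subrK.
have q1E : q1 / 2 = 2 * p1 ^+ 2 by rewrite /q1; move: (p1) => p; field.
have q2E : 2 * q2 = p2 ^+ 2 / 2 by rewrite /q2; move: (p2) => p; field.
have rE1 (s : R) : r1 / (s * len w) = p1 / s.
  by rewrite /p1 invfM; ring.
have rE2 (s : R) : s * len w / r2 = s / p2.
  by rewrite /p2 invf_div; ring.
have key s t : q1 / 2 <= s ^+ 2 + t ^+ 2 <= 2 * q2 ->
    len w * dens F (pt a w s t) * Num.sqrt (s ^+ 2 + t ^+ 2) <= mu0 /\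
    len w * dens F (pt a w s t) * Num.sqrt (s ^+ 2 + t ^+ 2) <=
     D * ((Num.sqrt (s ^+ 2 + t ^+ 2) / p2) `^ (3 / 4) + (p1 / Num.sqrt (s ^+ 2 + t ^+ 2)) `^ (3 / 4)).
  move=> /andP[h1 h2].
  have T1' : p1 < Num.sqrt (s ^+ 2 + t ^+ 2).
    rewrite -[ltLHS]ger0_norm ?(ltW p10)// -sqrtr_sqr ltr_sqrt.
      by apply: lt_le_trans h1; rewrite q1E; have := exprn_gt0 2 p10; move=> *; lra.
    by apply: lt_le_trans h1; rewrite divr_gt0//; case/andP: q11.
  have T2' : Num.sqrt (s ^+ 2 + t ^+ 2) < p2.
    rewrite -[ltRHS]ger0_norm ?(ltW p20)// -sqrtr_sqr ltr_sqrt ?exprn_gt0//.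
    by apply: le_lt_trans h2 _; rewrite q2E; have := exprn_gt0 2 p20; move=> *; lra.
  have yin : r1 < len (pt a w s t - a) < r2.
    by rewrite pt_len -ltr_pdivrMr// T1' -ltr_pdivlMr.
  have := annulus_decay yin; have := small yin; rewrite /G pt_len rE1 rE2.
  rewrite [dens _ _ * _]mulrC -[_ * len w * _]mulrA [_ * (len w * _)]mulrC.
  by split.
have [c bc] := bg (F z); have [ac cz c0 _ _] := bc.
pose M := sb * mu0.
have M0 : 0 < M by rewrite mulr_gt0.
have H1 s t : q1 / 2 <= s ^+ 2 + t ^+ 2 <= 2 * q2 ->
    Num.sqrt b * len w * dens F (pt a w s t) * Num.sqrt (s ^+ 2 + t ^+ 2) <= M.
  by move=> /key[h _]; rewrite -!mulrA /M ler_pM2l// mulrA.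
pose A := p2 `^ (- (3 / 4)); pose B := p1 `^ (3 / 4).
(* A primitive of the bound of the speed along the ray. Its variation is at most [3 * sb * D]
   however large the ratio of the radii is, so one chart contains the image of the annulus. *)
pose phi s := sb * D * (4 / 3) * (A * s `^ (3 / 4) - B * s `^ (- (3 / 4))).
pose phi' s := sb * D * (A * s `^ (- 4^-1) + B * s `^ (- (7 / 4))).
have powA (s : R) : 0 < s -> (s / p2) `^ (3 / 4) = A * s `^ (3 / 4).
  move=> s0; rewrite powRM ?invr_ge0 ?(ltW s0) ?(ltW p20)// mulrC; congr (_ * _).
  by rewrite /A -powR_inv1 ?(ltW p20)// -powRrM; congr (_ `^ _); ring.
have powB (s : R) : 0 < s -> (p1 / s) `^ (3 / 4) = B * s `^ (- (3 / 4)).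
  move=> s0; rewrite powRM ?invr_ge0 ?(ltW s0) ?(ltW p10)//; congr (_ * _).
  by rewrite -powR_inv1 ?(ltW s0)// -powRrM; congr (_ `^ _); ring.
have A0 : 0 <= A by exact: powR_ge0.
have B0 : 0 <= B by exact: powR_ge0.
have range s : 0 < s -> p1 <= s -> s <= p2 -> 0 <= A * s `^ (3 / 4) <= 1 /\ 0 <= B * s `^ (- (3 / 4)) <= 1.
  move=> s0 h1 h2; rewrite -powA// -powB// !powR_ge0/=; split.
    apply: powR_le1 => //; first by rewrite divr_ge0 ?(ltW s0) ?(ltW p20).
    by rewrite ler_pdivrMr// mul1r.
  apply: powR_le1 => //; first by rewrite divr_ge0 ?(ltW s0) ?(ltW p10).
  by rewrite ler_pdivrMr// mul1r.
have H2 s : 0 < s -> q1 / 2 <= s ^+ 2 <= 2 * q2 ->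
    [/\ is_derive s 1 phi (phi' s), Num.sqrt b * len w * dens F (pt a w s 0) <= phi' s &
      `|phi s - phi 1| <= 3 * sb * D].
  move=> s0 sq; have /andP[h1 h2] := sq.
  have T1' : p1 <= s.
    rewrite -[leLHS]ger0_norm ?(ltW p10)// -[leRHS]ger0_norm ?(ltW s0)// -!sqrtr_sqr ler_wsqrtr// (le_trans _ h1)//.
    by rewrite q1E mulr_natl mulr2n lerDl sqr_ge0.
  have T2' : s <= p2.
    rewrite -[leLHS]ger0_norm ?(ltW s0)// -[leRHS]ger0_norm ?(ltW p20)// -!sqrtr_sqr ler_wsqrtr// (le_trans h2)//.
    by rewrite q2E ler_pdivrMr// mulr_natr mulr2n lerDl sqr_ge0.
  split.
  - have d1 := is_derive1_powR (3 / 4) s0; have d2 := is_derive1_powR (- (3 / 4)) s0.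
    have := is_deriveZ (sb * D * (4 / 3)) (is_deriveB (is_deriveZ A d1) (is_deriveZ B d2)).
    move=> d; apply: is_derive_eq d _.
    have -> : (3 / 4 - 1 : R) = - 4^-1 by field.
    have -> : (- (3 / 4) - 1 : R) = - (7 / 4) by field.
    rewrite /phi' -![_ *: _]/(_ * _).
    by move: (s `^ _) (s `^ _) => x y; field.
  - have := key s 0; rewrite expr0n addr0 => /(_ sq)[_]; rewrite sqrtr_sqr gtr0_norm// => h.
    rewrite powA// powB// in h.
    rewrite -(ler_pM2r s0).
    have -> : phi' s * s = sb * (D * (A * s `^ (3 / 4) + B * s `^ (- (3 / 4)))).
      have e1 : s `^ (3 / 4) = s `^ (- 4^-1) * s.
        rewrite -[X in _ = _ * X]powRr1 ?(ltW s0)// -powRD ?(gt_eqF s0) ?implybT//.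
        by congr (_ `^ _); field.
      have e2 : s `^ (- (3 / 4)) = s `^ (- (7 / 4)) * s.
        rewrite -[X in _ = _ * X]powRr1 ?(ltW s0)// -powRD ?(gt_eqF s0) ?implybT//.
        by congr (_ `^ _); field.
      by rewrite e1 e2 /phi'; ring.
    by rewrite -!mulrA ler_pM2l// mulrA; move: h; rewrite -!mulrA.
  - have [/andP[a1 a2] /andP[b1' b2]] := range s s0 T1' T2'.
    have h1' : p1 <= 1 by rewrite (le_trans (ltW p1h))// invf_le1// ler1n.
    have h2' : 1 <= p2 by rewrite (le_trans _ (ltW p22))// ler1n.
    have [/andP[c1 c2] /andP[d1 d2]] := range 1 ltr01 h1' h2'.
    rewrite /phi -mulrBr normrM ger0_norm; last first.
      by rewrite mulr_ge0// mulr_ge0 ?(ltW sb0) ?(ltW D0).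
    apply: (@le_trans _ _ (sb * D * (4 / 3) * 2)).
      have sD0 : 0 <= sb * D * (4 / 3) by rewrite (mulr_ge0 (mulr_ge0 (ltW sb0) (ltW D0))).
      by rewrite ler_wpM2l//; exact: unit_differences.
    rewrite -[3 * sb * D]mulrA -!(mulrA (sb * D)) mulrC ler_wpM2r ?(ltW (mulr_gt0 sb0 D0))//.
    exact: eight_thirds_le3.
have small' : 3 * sb * D + 5 * M <= half R n.
  by apply: le_trans muh'; rewrite /M /D le_eqVlt; apply/orP; left; apply/eqP; ring.
have cd1 : cdom c (F (pt a w 1 0)) by rewrite zE.
have cm1 : cmap c (F (pt a w 1 0)) = 0 by rewrite zE.
have inD s t : q1 <= s ^+ 2 + t ^+ 2 <= q2 -> cdom c (F (pt a w s t)).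
  exact: (annulus_chart JF b1 bc q11 q21 H1 H2 cd1 cm1 small').
have odd s t k : 0 <= t -> q1 <= s ^+ 2 + t ^+ 2 <= q2 -> _ :=
  @annulus_odd _ _ _ _ _ JF b1 c _ a w q1 q2 M _ _ _ bc q11 q21 H1 H2 cd1 cm1 small' s t k.
have [q10 q1l] := andP q11.
(* [N1] and [N2] come from (x + y)^2 <= 2 x^2 + 2 y^2. [S] has the size of the final bound and is
   also used for the coefficient [N3], which has to be positive. *)
pose N1 := 2 * L * D ^+ 2 * p2 `^ (- (3 / 2)).
pose N2 := 2 * L * D ^+ 2 * p1 `^ (3 / 2).
pose S := p2^-1 + p1.
have S0 : 0 < S by rewrite addr_gt0// invr_gt0.
have LD0 : 0 <= 2 * L * D ^+ 2.
  exact: (mulr_ge0 (mulr_ge0 (ler0n _ 2) (ltW L0)) (sqr_ge0 D)).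
have N10 : 0 <= N1 by rewrite /N1 mulr_ge0// powR_ge0.
have N20 : 0 <= N2 by rewrite /N2 mulr_ge0// powR_ge0.
have C10 : 0 <= 10 * M by rewrite mulr_ge0// ltW.
have main : len w * dens F z <= enC n b * ((20 * sb * mu0 + 20 * L * D ^+ 2 + 8) * S).
  apply: (dens_le_dt bc) => //.
    rewrite (mulr_ge0 _ (ltW S0))// addr_ge0// addr_ge0//.
      exact: (mulr_ge0 (mulr_ge0 (ler0n _ 20) (ltW sb0)) (ltW mu00)).
    exact: (mulr_ge0 (mulr_ge0 (ler0n _ 20) (ltW L0)) (sqr_ge0 D)).
  move=> k; rewrite -[in X in ddir _ _ _ _ X]zE.
  have := @annulus_barrier R (fun s t => cmap c (F (pt a w s t)) 0 k) q1 q2 (10 * M) N1 N2 S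
    (ddir F c (rot w) k (pt a w 1 0)) q11 q21 C10 N10 N20 S0.
  move=> /(_ _ _ _)/wrap[s t q|s t t0 q||].
  - have cd := inD s t q; split; first exact: (chart_cont JF bc).
    have [x xle lx] := chart_lap JF b1 bc k cd; exists x => //.
    have q0 : 0 < s ^+ 2 + t ^+ 2 by case/andP: q => /(lt_le_trans q10).
    have qin : q1 / 2 <= s ^+ 2 + t ^+ 2 <= 2 * q2.
      by exact: widen_annulus q10 q21 q.
    apply: le_trans xle _; rewrite -[leLHS]addr0 lerD ?mulr_ge0 ?powR_ge0 ?(ltW S0)//.
    have [_] := key s t qin; set q' := s ^+ 2 + t ^+ 2 in q0 *.
    have s0 : 0 < Num.sqrt q' by rewrite sqrtr_gt0.
    rewrite powA// powB// -powR12_sqrt ?(ltW q0)// => h.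
    have h' : (len w * dens F (pt a w s t)) ^+ 2 * q' <= 2 * D ^+ 2 * (p2 `^ (- (3 / 2)) * q' `^ (3 / 4) + p1 `^ (3 / 2) * q' `^ (- (3 / 4))).
      have -> : (len w * dens F (pt a w s t)) ^+ 2 * q' = (len w * dens F (pt a w s t) * q' `^ 2^-1) ^+ 2.
        by rewrite [RHS]exprMn sqr_powR mulVf ?pnatr_eq0// powRr1 ?(ltW q0).
      have sq : (len w * dens F (pt a w s t) * q' `^ 2^-1) ^+ 2 <= (D * (A * (q' `^ 2^-1) `^ (3 / 4) + B * (q' `^ 2^-1) `^ (- (3 / 4)))) ^+ 2.
        apply: lerXn2r h; rewrite nnegrE.
          by rewrite (mulr_ge0 (mulr_ge0 (len_ge0 _) (dens_ge0 _ _)) (powR_ge0 _ _)).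
        by rewrite (mulr_ge0 (ltW D0) (addr_ge0 (mulr_ge0 A0 (powR_ge0 _ _)) (mulr_ge0 B0 (powR_ge0 _ _)))).
      apply: le_trans sq _.
      have -> : p2 `^ (- (3 / 2)) * q' `^ (3 / 4) = (A * (q' `^ 2^-1) `^ (3 / 4)) ^+ 2.
        by rewrite exprMn /A !sqr_powR -powRrM; congr (_ `^ _ * _ `^ _); field.
      have -> : p1 `^ (3 / 2) * q' `^ (- (3 / 4)) = (B * (q' `^ 2^-1) `^ (- (3 / 4))) ^+ 2.
        by rewrite exprMn /B !sqr_powR -powRrM; congr (_ `^ _ * _ `^ _); field.
      move: (A * _) (B * _) => x0 y0; rewrite [(D * _) ^+ 2]exprMn [2 * _]mulrC -[leRHS]mulrA ler_wpM2l ?sqr_ge0//.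
      by rewrite mulrDr; exact: sqrD_le.
    rewrite -(ler_pM2r q0) -mulrA mulrDl /qpow -/q'.
    have -> : N1 * q' `^ (- 4^-1) * q' + N2 * q' `^ (- (7 / 4)) * q' =
        L * (2 * D ^+ 2 * (p2 `^ (- (3 / 2)) * q' `^ (3 / 4) + p1 `^ (3 / 2) * q' `^ (- (3 / 4)))).
      have e1 : q' `^ (3 / 4) = q' `^ (- 4^-1) * q'.
        rewrite -[X in _ = _ * X]powRr1 ?(ltW q0)// -powRD ?(gt_eqF q0) ?implybT//.
        by congr (_ `^ _); field.
      have e2 : q' `^ (- (3 / 4)) = q' `^ (- (7 / 4)) * q'.
        rewrite -[X in _ = _ * X]powRr1 ?(ltW q0)// -powRD ?(gt_eqF q0) ?implybT//.
        by congr (_ `^ _); field.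
      by rewrite e1 e2 /N1 /N2; ring.
    by rewrite ler_wpM2l// ltW.
  - by apply: odd => //; case: q => ->; rewrite lexx ltW// (lt_trans q1l).
  - exact: (chart_dt JF bc).
  move=> /le_trans; apply.
  have e2 : q2 `^ (- 2^-1) = 2 / p2.
    by rewrite powRN powR12_sqrt ?sqr_ge0// sqrtr_sqr gtr0_norm ?divr_gt0// invf_div.
  have e1 : q1 `^ 2^-1 = 2 * p1.
    by rewrite (powR12_sqrt (sqr_ge0 _)) sqrtr_sqr gtr0_norm//; case/andP: t1.
  have e3 : N1 * q2 `^ 4^-1 <= 2 * L * D ^+ 2 * p2^-1.
    have h0 : 0 <= p2 / 2 by rewrite (ltW (lt_trans ltr01 t2)).
    rewrite /N1 -mulrA ler_wpM2l// /q2 -(powR_mulrn 2 h0) -powRrM.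
    have -> : p2^-1 = p2 `^ (- (3 / 2)) * p2 `^ (2 * 4^-1).
      rewrite -powRD ?(gt_eqF p20) ?implybT// -powR_inv1 ?(ltW p20)//.
      by congr (_ `^ _); field.
    rewrite ler_wpM2l ?powR_ge0// ge0_ler_powR ?nnegrE ?(ltW p20)//.
    by rewrite ler_pdivrMr// ler_peMr ?(ltW p20)// ler1n.
  have e4 : N2 * q1 `^ (- 4^-1) <= 2 * L * D ^+ 2 * p1.
    have h0 : 0 <= 2 * p1 by case/andP: t1 => /ltW.
    rewrite /N2 -mulrA ler_wpM2l// /q1 -(powR_mulrn 2 h0) -powRrM.
    have e5 : p1 `^ (3 / 2) * p1 `^ (2 * - 4^-1) = p1.
      rewrite -powRD ?(gt_eqF p10) ?implybT//.
      by rewrite (_ : _ + _ = 1) ?powRr1 ?(ltW p10)//; field.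
    rewrite -[leRHS]e5 ler_wpM2l ?powR_ge0// mulrN !powRN lef_pV2 ?posrE ?powR_gt0//; last by case/andP: t1.
    by rewrite ge0_ler_powR ?nnegrE ?(ltW p10)// ler_peMl ?(ltW p10)// ler1n.
  rewrite e1 e2 /M.
  have := lerD e3 e4; move: (N1 * _) (N2 * _) => x y; rewrite -mulrDr -/S => h.
  have -> : (20 * sb * mu0 + 20 * L * D ^+ 2 + 8) * S = 10 * (sb * mu0) * (2 / p2 + 2 * p1) + 5 * (2 * L * D ^+ 2 * S) + 5 * (2 * L * D ^+ 2 * S) + 8 * S.
    by rewrite /S; ring.
  have := mulr_ge0 LD0 (ltW S0); move: h; move: (10 * _ * _) (2 * L * _ * _) => u v.
  by move=> *; lra.
rewrite -(ler_pM2l w0); apply: le_trans main _; rewrite le_eqVlt; apply/orP; left; apply/eqP.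
rewrite /S /p1 /p2 invf_div; field.
by rewrite (gt_eqF w0) (gt_eqF r20).
Qed.

End one_map.

Lemma annulus_estimate : exists mu0 K : R, [/\ 0 < mu0, 0 < K &
  forall (X : tamed_manifold R n) (F : 'rV[R]_2 -> X), Jhol_local F ->
    (forall x : X, exists c, bchart c x b) ->
  forall (a : 'rV[R]_2) r1 r2, 0 < r1 ->
    (forall y, r1 < len (y - a) < r2 -> dens F y * len (y - a) <= mu0) ->
  forall z, r1 < len (z - a) < r2 -> dens F z <= K * (r2^-1 + r1 / len (z - a) ^+ 2)].
Proof.
pose T := 160 * enC n b * sb.
have T0 : 0 < T by rewrite (mulr_gt0 (mulr_gt0 _ C0) sb0).
have T1 : 1 <= T.
  by rewrite /T mulr_ege1// mulr_ege1// ler1n.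
have T30 : 0 < T ^+ 3 by rewrite exprn_gt0.
have T80 : 0 < T ^+ 8 by rewrite exprn_gt0.
have T81 : 1 <= T ^+ 8 by rewrite exprn_ege1.
have hn0 := half_gt0 R n.
pose P := 32 * enC n b * L * T ^+ 3.
have P0 : 0 < P by rewrite (mulr_gt0 (mulr_gt0 (mulr_gt0 _ C0) L0) T30).
pose Q := sb * (T ^+ 8 + 5).
have Q0 : 0 < Q by rewrite (mulr_gt0 sb0)// addr_gt0.
pose S := (3 * T ^+ 3 + 5) * sb.
have S0 : 0 < S by rewrite (mulr_gt0 _ sb0)// addr_gt0// mulr_gt0.
(* The inverse of a sum is below the inverse of each summand, so the three smallness conditions hold
   together. *)
pose mu0 := (P + Q / half R n + S / half R n)^-1.
have Qh : 0 < Q / half R n by rewrite divr_gt0.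
have Sh : 0 < S / half R n by rewrite divr_gt0.
have mu0i : 0 < P + Q / half R n + S / half R n by rewrite addr_gt0// addr_gt0.
have mu00 : 0 < mu0 by rewrite invr_gt0.
have muL : 32 * enC n b * L * T ^+ 3 * mu0 <= 1.
  by rewrite -/P /mu0 ler_pdivrMr// mul1r -addrA lerDl addr_ge0// ltW.
have key W : W / half R n <= P + Q / half R n + S / half R n -> W * mu0 <= half R n.
  by move=> h; rewrite /mu0 ler_pdivrMr// -ler_pdivrMl// mulrC.
have muh : sb * mu0 * (T ^+ 8 + 5) <= half R n.
  rewrite mulrAC -/Q; apply: key; move: P0 Qh Sh; move: (Q / _) (S / _) => u v.
  by move=> *; lra.
have muh' : (3 * T ^+ 3 + 5) * sb * mu0 <= half R n.
  rewrite -/S; apply: key; move: P0 Qh Sh; move: (Q / _) (S / _) => u v.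
  by move=> *; lra.
pose K := Num.max (enC n b * (20 * sb * mu0 + 20 * L * (mu0 * T ^+ 3) ^+ 2 + 8)) (4 * mu0).
exists mu0, K; split => //; first by rewrite lt_max (mulr_gt0 _ mu00) ?orbT.
move=> X F JF bg a r1 r2 r10 sm z zin; have /andP[z1 z2] := zin.
have l0 : 0 < len (z - a) by apply: lt_trans z1.
have r20 : 0 < r2 by apply: lt_trans z2.
have S1 : 0 <= r2^-1 + r1 / len (z - a) ^+ 2.
  by rewrite addr_ge0 ?invr_ge0 ?divr_ge0 ?sqr_ge0 ?(ltW r10) ?(ltW r20).
have triv : mu0 / len (z - a) <= 4 * mu0 * (r2^-1 + r1 / len (z - a) ^+ 2) -> dens F z <= K * (r2^-1 + r1 / len (z - a) ^+ 2).
  move=> h; apply: (@le_trans _ _ (mu0 / len (z - a))); first by rewrite ler_pdivlMr// sm.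
  by apply: le_trans h _; rewrite ler_wpM2r// le_max lexx orbT.
have [h|z1'] := leP (len (z - a)) (2 * r1).
  apply: triv; rewrite [4 * _]mulrC -mulrA ler_wpM2l ?(ltW mu00)// mulrDr.
  apply: (@le_trans _ _ (4 * (r1 / len (z - a) ^+ 2))).
    rewrite mulrA ler_pdivlMr ?exprn_gt0// expr2 mulrA mulVf ?gt_eqF// mul1r.
    by move=> *; lra.
  by rewrite lerDr mulr_ge0// invr_ge0 ltW.
have [h|z2'] := leP r2 (2 * len (z - a)).
  apply: triv; rewrite [4 * _]mulrC -mulrA ler_wpM2l ?(ltW mu00)// mulrDr.
  apply: (@le_trans _ _ (4 * r2^-1)); last first.
    by rewrite lerDl mulr_ge0// divr_ge0 ?sqr_ge0 ?(ltW r10).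
  rewrite ler_pdivlMr// mulrC ler_pdivrMr//.
  by move=> *; lra.
apply: le_trans (annulus_interior JF bg (erefl T) mu00 muL muh r10 sm muh' z1' z2') _.
by rewrite ler_wpM2r// le_max lexx.
Qed.

End annulus_decay.

(** * The Riemannian distance *)

(** The integral of a nonnegative function is a supremum over the simple functions below it, so it
    is monotone on arbitrary functions, such as speeds and energy densities. *)
Lemma le_integral_nonneg (d : measure_display) (T : measurableType d) (R : realType) (mu : {measure set T -> \bar R})
    (D : set T) (f g : T -> \bar R) : (forall x, D x -> (0 <= f x)%E) -> (forall x, D x -> (f x <= g x)%E) ->
  (\int[mu]_(x in D) f x <= \int[mu]_(x in D) g x)%E.
Proof.
move=> f0 fg; have g0 x : D x -> (0 <= g x)%E by move=> Dx; apply: le_trans (f0 x Dx) (fg x Dx).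
have pf : forall x, (0 <= (f \_ D) x)%E by move=> x; rewrite patchE; case: ifPn => // /set_mem/f0.
have pg : forall x, (0 <= (g \_ D) x)%E by move=> x; rewrite patchE; case: ifPn => // /set_mem/g0.
rewrite integral_mkcond [leRHS]integral_mkcond !ge0_integralTE//.
apply: le_ereal_sup => _ [h hf <-]; exists h => // x; apply: le_trans (hf x) _.
by rewrite !patchE; case: ifPn => // /set_mem/fg.
Qed.

Lemma cvg_sum_fin (R : realType) (T : Type) (F : set_system T) (n : nat) (f : 'I_n -> T -> R) (l : 'I_n -> R) :
  Filter F -> (forall i, f i x @[x --> F] --> l i) -> \sum_i f i x @[x --> F] --> \sum_i l i.
Proof. by move=> FF h; apply: cvg_big => //; exact: add_continuous. Qed.

Lemma near_continuous_at (T U : topologicalType) (f g : T -> U) (t : T) :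
  nbhs t (fun s => f s = g s) -> {for t, continuous f} -> {for t, continuous g}.
Proof.
move=> e cf; rewrite /prop_for /continuous_at -(nbhs_singleton e); apply: cvg_trans cf.
exact: near_eq_cvg.
Qed.

(** The square of the positive part is C^1 and constant on a half-line; composing with it lets a
    curve stop smoothly, for concatenations. *)
Lemma is_derive_possq (R : realType) (x : R) :
  is_derive x 1 (fun x : R => Num.max x 0 ^+ 2) (2 * Num.max x 0).
Proof.
have [x0|x0|->] := ltgtP x 0.
- rewrite mulr0.
  apply: (near_eq_is_derive (f := fun=> 0)).
    by apply: filterS (lt_nbhsl x0) => y y0; rewrite (max_idPr (ltW y0)) expr0n.
- apply: (near_eq_is_derive (f := fun x : R => x ^+ 2)).
    by apply: filterS (lt_nbhsr x0) => y y0; rewrite (max_idPl (ltW y0)).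
  exact: is_derive_sq.
rewrite ?(max_idPl (lexx _)) mulr0.
have lim0 : (fun h : R => h^-1 *: (Num.max (h *: (1 : R) + 0) 0 ^+ 2 - Num.max 0 0 ^+ 2)) @ 0^' --> (0 : R).
  apply/cvgrPdist_le => e e0; apply/nbhs_ballP; exists e => //= h.
  rewrite /ball/= sub0r normrN => he hn.
  rewrite sub0r normrN (max_idPl (lexx _)) expr0n subr0 addr0 [h *: 1]mulr1.
  change (`|h^-1 * (Num.max h 0 ^+ 2)| <= e).
  have [h0|] := boolP (h <= 0); first by rewrite (max_idPr h0) expr0n mulr0 normr0 ltW.
  by rewrite -ltNge => h0; rewrite (max_idPl (ltW h0)) expr2 mulKf ?gt_eqF// ltW.
apply: DeriveDef; first by apply/cvg_ex; exists 0.
by apply: cvg_lim => //; exact: Rhausdorff.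
Qed.

Section curves.
Variables (R : realType) (n : nat) (X : tamed_manifold R n).
Implicit Types (c : chart R n X) (p : R -> X).

Lemma C1_velocity p c t : C1_curve p -> atlas c -> cdom c (p t) ->
  is_derive t 1 (fun s => cmap c (p s)) (\row_i derive1 (fun s => cmap c (p s) 0 i) t).
Proof.
move=> [_ h] ac cd; apply: is_derive_rV => i; rewrite mxE derive1E.
by have [d _] := h c t i ac cd; apply/derivableP.
Qed.

Lemma speedE p c t (v : 'rV[R]_n) : {for t, continuous p} -> atlas c -> cdom c (p t) ->
  is_derive t 1 (fun s => cmap c (p s)) v ->
  speed p t = Num.sqrt (bilin (metric c (cmap c (p t))) v v).
Proof.
move=> cp ac cd dv; rewrite /speed; set c' := chart_at (p t).
have ac' : atlas c' by exact: chart_at_atlas.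
have cd' : cdom c' (p t) by exact: chart_at_dom.
have [v' d' <-] := velocity_norm_chart ac ac' cp cd cd' dv.
have -> : \row_i derive1 (fun s => cmap c' (p s) 0 i) t = v' => //.
apply/rowP => i; rewrite mxE derive1E; have := is_derive_coord i d'.
exact: @derive_val.
Qed.

(** [C1_curve] quantifies over all charts; one chart around each time suffices, because the
    coordinate changes have continuous jacobians. *)
Lemma C1_curveP p : continuous p ->
  (forall t, exists c, [/\ atlas c, cdom c (p t) & exists vel : R -> 'rV[R]_n,
     nbhs t (fun s : R => is_derive s 1 (fun s => cmap c (p s)) (vel s)) /\ {for t, continuous vel}]) ->
  C1_curve p.
Proof.
move=> cp H; split => // c' t i ac' cd'.
have [c [ac cd [vel [dv cv]]]] := H t.
pose U := cmap c @` (cdom c `&` cdom c').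
have oU : open U by exact: overlap_open.
have cont_c : {for t, continuous (fun s => cmap c (p s))}.
  by apply: continuous_comp; [exact: cp|exact: chart_continuous].
pose D s := vel s *m Defs.jacobian c c' (cmap c (p s)).
have near_dom : nbhs t (fun s : R => cdom c (p s) /\ cdom c' (p s)).
  have o1 : nbhs (p t) (cdom c) by apply: open_nbhs_nbhs; split => //; exact: chart_open.
  have o2 : nbhs (p t) (cdom c') by apply: open_nbhs_nbhs; split => //; exact: chart_open.
  have f1 : nbhs t (fun s : R => cdom c (p s)) := cp t _ o1.
  have f2 : nbhs t (fun s : R => cdom c' (p s)) := cp t _ o2.
  by apply: filterS2 f1 f2 => s ? ?; split.
have dD : nbhs t (fun s : R => is_derive s 1 (fun s => cmap c' (p s)) (D s)).
  apply: filterS2 near_dom dv => s [d1 d2] ds.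
  exact: velocity_change ac ac' (cp s) d1 d2 ds.
have dDi : nbhs t (fun s : R => is_derive s 1 (fun s => cmap c' (p s) 0 i) (D s 0 i)).
  by apply: filterS dD => s ds; exact: is_derive_coord.
split; first by have d := nbhs_singleton dDi; apply: ex_derive.
have eq1 : nbhs t (fun s : R => D s 0 i = derive1 (fun s => cmap c' (p s) 0 i) s).
  by apply: filterS dDi => s ds; rewrite derive1E derive_val.
have cD : {for t, continuous (fun s => D s 0 i)}.
  have -> : (fun s => D s 0 i) = (fun s => \sum_j vel s 0 j * partial j (fun y => transition c c' y 0 i) (cmap c (p s))).
    by apply/funext => s; rewrite /D mxE; apply: eq_bigr => j _; rewrite !mxE.
  apply: cvg_sum_fin => j.
  apply: cvgM.
    have : {for (vel t), continuous (fun v : 'rV[R]_n => v 0 j)} by exact: coord_continuous.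
    by move=> h; apply: (@cvg_comp _ _ _ vel (fun v : 'rV[R]_n => v 0 j)) cv h.
  have Ut : U (cmap c (p t)) by exists (p t).
  have [+ _] := @atlas_compatible _ _ X c c' ac ac' 0 i [:: j] (cmap c (p t)) Ut.
  by move=> h; apply: (@cvg_comp _ _ _ (fun s => cmap c (p s))) cont_c h.
exact: near_continuous_at eq1 cD.
Qed.

Lemma C1_near p c t : C1_curve p -> atlas c -> cdom c (p t) ->
  nbhs t (fun s : R => is_derive s 1 (fun s => cmap c (p s)) (\row_i derive1 (fun s => cmap c (p s) 0 i) s)) /\
  {for t, continuous (fun s => \row_i derive1 (fun s => cmap c (p s) 0 i) s : 'rV[R]_n)}.
Proof.
move=> Cp ac cd; have [cp h] := Cp; split.
  have o1 : nbhs (p t) (cdom c) by apply: open_nbhs_nbhs; split => //; exact: chart_open.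
  have f1 : nbhs t (fun s : R => cdom c (p s)) := cp t _ o1.
  by apply: filterS f1 => s ds; exact: C1_velocity.
apply/cvgrPdist_le => e e0.
have : nbhs t (fun s : R => forall i : 'I_n, `|derive1 (fun s => cmap c (p s) 0 i) t - derive1 (fun s => cmap c (p s) 0 i) s| <= e).
  apply: (@filter_forall R _ (fun (i : 'I_n) (s : R) => `|derive1 (fun s => cmap c (p s) 0 i) t - derive1 (fun s => cmap c (p s) 0 i) s| <= e) (nbhs t) (nbhs_filter t)) => i; have [_ ci] := h c t i ac cd.
  by move/cvgrPdist_le : ci; apply.
apply: filterS => s hs; apply: rv_norm_le (ltW e0) _ => i; rewrite !mxE; exact: hs.
Qed.

Lemma speed_continuous p : C1_curve p -> continuous (speed p).
Proof.
move=> Cp t; have [cp _] := Cp; set c := chart_at (p t).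
have ac : atlas c by exact: chart_at_atlas.
have cd : cdom c (p t) by exact: chart_at_dom.
have [] := C1_near Cp ac cd.
pose vel := fun s : R => \row_i derive1 (fun s => cmap c (p s) 0 i) s : 'rV[R]_n.
rewrite -/vel => dv cv.
have o1 : nbhs t (fun s : R => cdom c (p s)).
  by apply: (cp t); apply: open_nbhs_nbhs; split => //; exact: chart_open.
have eq1 : nbhs t (fun s : R => Num.sqrt (bilin (metric c (cmap c (p s))) (vel s) (vel s)) = speed p s).
  by apply: filterS2 o1 dv => s ds d; rewrite (speedE (cp s) ac ds d).
apply: near_continuous_at eq1 _.
have : {for t, continuous (fun s => bilin (metric c (cmap c (p s))) (vel s) (vel s))}.
  rewrite (_ : (fun s => _) = fun s => \sum_i \sum_j vel s 0 i * metric c (cmap c (p s)) i j * vel s 0 j); last first.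
    by apply/funext => s; rewrite bilinE.
  have cvi i : {for t, continuous (fun s => vel s 0 i)}.
    by apply: (@cvg_comp _ _ _ vel (fun v : 'rV[R]_n => v 0 i)) cv _; exact: coord_continuous.
  apply: cvg_sum_fin => i.
  apply: cvg_sum_fin => j.
  apply: cvgM (cvi j); apply: cvgM (cvi i) _.
  have [[gs _] _] := metric_riemannian X.
  have [+ _] := gs c ac i j [::] (cmap c (p t)) (chart_img cd).
  move=> h; apply: (@cvg_comp _ _ _ (fun s => cmap c (p s))) h.
  exact: (continuous_comp (cp t) (chart_continuous ac cd)).
by move=> h; apply: (@cvg_comp _ _ _ _ (@Num.sqrt R)) h _; exact: sqrt_continuous.
Qed.

Lemma rdist_ge0 (x y : X) : (0 <= rdist x y)%E.
Proof.
apply/ereal_infP => _ [p [_ _ _ ->]]; apply: integral_ge0 => t _.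
by rewrite lee_fin sqrtr_ge0.
Qed.

Lemma integral_primitive (phi phi' : R -> R) :
  (forall t : R, 0 <= t <= 1 -> {for t, continuous phi'}) ->
  (forall t : R, 0 <= t <= 1 -> is_derive t 1 phi (phi' t)) ->
  (\int[@lebesgue_measure R]_(t in `[0%R, 1%R]) (phi' t)%:E = (phi 1 - phi 0)%:E)%E.
Proof.
move=> cphi dphi.
have cp (t : R) : 0 <= t <= 1 -> {for t, continuous phi}.
  by move=> /dphi d; apply: differentiable_continuous; apply/derivable1_diffP; exact: ex_derive.
rewrite (@continuous_FTC2 R phi' phi 0 1)// ?ltr01//.
- by apply: continuous_in_subspaceT => t /set_mem /=; rewrite in_itv/=; exact: cphi.
- split.
  + move=> t; rewrite in_itv/= => /andP[t0 t1].
    have d : is_derive t 1 phi (phi' t) by apply: dphi; rewrite !ltW.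
    exact: ex_derive.
  + by apply: cvg_at_right_filter; apply: cp; rewrite lexx ler01.
  + by apply: cvg_at_left_filter; apply: cp; rewrite lexx ler01.
- move=> t; rewrite in_itv/= => /andP[t0 t1].
  have d : is_derive t 1 phi (phi' t) by apply: dphi; rewrite !ltW.
  by rewrite derive1E derive_val.
Qed.

Lemma primitive (g : R -> R) : continuous g ->
  exists Phi : R -> R, forall x : R, 0 <= x <= 1 -> is_derive x 1 Phi (g x).
Proof.
(* The integral starts at -1, so that 0 is an interior point and the derivative there is
   two-sided. *)
move=> cg; exists (fun x => \int[lebesgue_measure]_(t in `[- 1, x]) (g t))%R => x /andP[x0 x1].
have x2 : x < 2 by lra.
have ix : (@lebesgue_measure R).-integrable `[- 1, 2] (EFin \o g).
  apply: continuous_compact_integrable; first exact: segment_compact.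
  exact: continuous_subspaceT.
have m1x : - 1 < x by lra.
have [d <-] := continuous_FTC1_closed x2 ix m1x (cg x).
by rewrite derive1E; apply/derivableP.
Qed.

Lemma rdist_le (p : R -> X) (phi phi' : R -> R) : C1_curve p ->
  (forall t : R, 0 <= t <= 1 -> {for t, continuous phi'}) ->
  (forall t : R, 0 <= t <= 1 -> is_derive t 1 phi (phi' t)) ->
  (forall t : R, 0 <= t <= 1 -> speed p t <= phi' t) ->
  (rdist (p 0%R) (p 1%R) <= (phi 1 - phi 0)%:E)%E.
Proof.
move=> Cp cphi dphi h; rewrite -(integral_primitive cphi dphi).
apply: (@le_trans _ _ (\int[@lebesgue_measure R]_(t in `[0%R, 1%R]) (speed p t)%:E)%E).
  by apply: ereal_inf_lbound; exists p.
apply: le_integral_nonneg => t /=; rewrite in_itv/= => t01; rewrite lee_fin; first exact: sqrtr_ge0.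
exact: h.
Qed.

Lemma rdist_curve (x y : X) (a : R) : (rdist x y < a%:E)%E ->
  exists p Phi, [/\ C1_curve p, p 0 = x, p 1 = y,
    forall t : R, 0 <= t <= 1 -> is_derive t 1 Phi (speed p t) & Phi 1 - Phi 0 < a].
Proof.
move=> /ereal_inf_lt[_ [p [Cp p0 p1 ->]]] la.
have [Phi dPhi] := primitive (speed_continuous Cp).
exists p, Phi; split => //; rewrite -lte_fin -integral_primitive// => t _; exact: speed_continuous.
Qed.

Section reparametrize.
Variables (p : R -> X) (sg sg' : R -> R).
Hypothesis Cp : C1_curve p.
Hypothesis dsg : forall t : R, is_derive t 1 sg (sg' t).
Hypothesis csg : continuous sg'.

Let cont_sg : continuous sg.
Proof. by move=> t; apply: differentiable_continuous; apply/derivable1_diffP; exact: ex_derive. Qed.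

Let derive_comp c t v : is_derive (sg t) 1 (fun s => cmap c (p s)) v ->
  is_derive t 1 (fun s => cmap c (p (sg s))) (sg' t *: v).
Proof.
move=> d; apply: is_derive_rV => i; rewrite mxE.
have di := is_derive_coord i d.
have := @is_derive1_comp R (fun s => cmap c (p s) 0 i) sg t _ _ di (dsg t).
by move=> h; apply: is_derive_eq h _; rewrite mulrC.
Qed.

Lemma reparam_C1 : C1_curve (p \o sg).
Proof.
have [cp _] := Cp; apply: C1_curveP.
  by move=> t; apply: continuous_comp; [exact: cont_sg|exact: cp].
move=> t; exists (chart_at (p (sg t))); set c := chart_at _.
have ac : atlas c by exact: chart_at_atlas.
have cd : cdom c (p (sg t)) by exact: chart_at_dom.
split => //; have [] := C1_near Cp ac cd.
pose vel := fun s : R => \row_i derive1 (fun s => cmap c (p s) 0 i) s : 'rV[R]_n.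
rewrite -/vel => dv cv; exists (fun s => sg' s *: vel (sg s)); split.
  have h : nbhs t (fun s : R => is_derive (sg s) 1 (fun s => cmap c (p s)) (vel (sg s))) := cont_sg dv.
  by apply: filterS h => s; exact: derive_comp.
apply: cvgZ; first exact: csg.
exact: (@continuous_comp _ _ _ sg vel t (@cont_sg t) cv).
Qed.

Lemma reparam_speed t : speed (p \o sg) t = `|sg' t| * speed p (sg t).
Proof.
have [cp _] := Cp; have [cps _] := reparam_C1.
pose c := chart_at (p (sg t)).
have ac : atlas c by exact: chart_at_atlas.
have cd : cdom c (p (sg t)) by exact: chart_at_dom.
have dv := C1_velocity Cp ac cd.
rewrite (speedE (cps t) ac cd (derive_comp dv)) (speedE (cp _) ac cd dv).
by rewrite bilinZl bilinZr mulrA -expr2 sqrtrM ?sqr_ge0// sqrtr_sqr.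
Qed.

End reparametrize.

Section glue.
Variables (r1 r2 : R -> X) (h : R) (y : X).
Hypothesis C1 : C1_curve r1.
Hypothesis C2 : C1_curve r2.
Hypothesis y1 : forall t, h <= t -> r1 t = y.
Hypothesis y2 : forall t, t <= h -> r2 t = y.
Hypothesis s1 : speed r1 h = 0.
Hypothesis s2 : speed r2 h = 0.
Let r t := if t <= h then r1 t else r2 t.

Let near_lt t : t < h -> nbhs t (fun s : R => r1 s = r s).
Proof.
move=> th; have : nbhs t (fun s : R => s < h) by apply: lt_nbhsl.
by apply: filterS => s sh; rewrite /r ltW.
Qed.

Let near_gt t : h < t -> nbhs t (fun s : R => r2 s = r s).
Proof.
move=> th; have : nbhs t (fun s : R => h < s) by apply: lt_nbhsr.
by apply: filterS => s sh; rewrite /r leNgt sh.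
Qed.

Let derive_near c (p q : R -> X) t v : nbhs t (fun s : R => p s = q s) ->
  is_derive t 1 (fun s => cmap c (p s)) v -> is_derive t 1 (fun s => cmap c (q s)) v.
Proof.
move=> e d; apply: (near_eq_is_derive (f := fun s => cmap c (p s))) => //.
by apply: filterS e => s ->.
Qed.

Let sumE c s : cmap c (r s) = cmap c (r1 s) + cmap c (r2 s) - cmap c y.
Proof.
rewrite /r; case: leP => sh; first by rewrite (y2 sh) addrK.
by rewrite (y1 (ltW sh)) [cmap c y + _]addrC addrK.
Qed.

Let rh : r h = y. Proof. by rewrite /r lexx y1. Qed.

Let near_C1 (q : R -> X) t : C1_curve q -> nbhs t (fun s : R => q s = r s) ->
  exists c, [/\ atlas c, cdom c (r t) & exists vel : R -> 'rV[R]_n,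
     nbhs t (fun s : R => is_derive s 1 (fun s => cmap c (r s)) (vel s)) /\ {for t, continuous vel}].
Proof.
move=> Cq e; exists (chart_at (r t)); set c := chart_at _.
have ac : atlas c by exact: chart_at_atlas.
have cd : cdom c (r t) by exact: chart_at_dom.
split => //; have := cd; rewrite -(nbhs_singleton e) => /(C1_near Cq ac)[].
pose vel := fun s : R => \row_i derive1 (fun s => cmap c (q s) 0 i) s : 'rV[R]_n.
rewrite -/vel => dv cv; exists vel; split => //.
have e' : nbhs t (fun s : R => nbhs s (fun s : R => q s = r s)) by apply: nbhs_interior.
by apply: filterS2 e' dv => s es ds; apply: derive_near es ds.
Qed.

(** At every time one of the two curves rests at [y], so near the junction [r] is r1 + r2 - y in a
    chart. This sum is differentiable at [h] without a discussion of one-sided derivatives. *)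
Lemma glue_C1 : C1_curve r.
Proof.
have [c1 _] := C1; have [c2 _] := C2.
apply: C1_curveP => t; have [th|th|->] := ltgtP t h.
- exact: near_continuous_at (near_lt th) (c1 t).
- exact: near_continuous_at (near_gt th) (c2 t).
- move=> A; rewrite rh => Ay.
  have f1 : nbhs h (fun s : R => A (r1 s)) by apply: (c1 h); rewrite y1.
  have f2 : nbhs h (fun s : R => A (r2 s)) by apply: (c2 h); rewrite y2.
  by apply: filterS2 f1 f2 => s a1 a2; rewrite /preimage/= /r; case: ifP.
- exact: near_C1 (near_lt th).
- exact: near_C1 (near_gt th).
exists (chart_at y); set c := chart_at _.
have ac : atlas c by exact: chart_at_atlas.
have cd : cdom c y by exact: chart_at_dom.
rewrite rh; split => //.
have cd1 : cdom c (r1 h) by rewrite y1.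
have cd2 : cdom c (r2 h) by rewrite y2.
have [d1 k1] := C1_near C1 ac cd1; have [d2 k2] := C1_near C2 ac cd2.
exists (fun s : R => \row_i derive1 (fun s => cmap c (r1 s) 0 i) s + \row_i derive1 (fun s => cmap c (r2 s) 0 i) s); split.
  apply: filterS2 d1 d2 => s e1 e2; rewrite (_ : (fun s => cmap c (r s)) = (fun s => cmap c (r1 s) + cmap c (r2 s) - cmap c y)); last first.
    by apply/funext => s'; exact: sumE.
  have := is_deriveB (is_deriveD e1 e2) (is_derive_cst (cmap c y) s (1 : R)).
  by rewrite subr0.
exact: cvgD k1 k2.
Qed.

Let speed0 q : C1_curve q -> q h = y -> speed q h = 0 ->
  is_derive h 1 (fun s => cmap (chart_at y) (q s)) 0.
Proof.
move=> Cq qh; have [cq _] := Cq; set c := chart_at y.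
have ac : atlas c by exact: chart_at_atlas.
have cd : cdom c (q h) by rewrite qh; exact: chart_at_dom.
have := C1_velocity Cq ac cd; set v := \row_i _ => dv; rewrite (speedE (cq h) ac cd dv).
move=> /eqP; rewrite sqrtr_eq0 => v0.
have [<-//|vn] := eqVneq v 0.
by have := metric_pos ac (chart_img cd) vn; rewrite ltNge v0.
Qed.

Lemma glue_speed t : speed r t <= speed r1 t + speed r2 t.
Proof.
have [c1 _] := C1; have [c2 _] := C2; have [cr _] := glue_C1.
have near_speed (q : R -> X) s : C1_curve q -> nbhs s (fun s : R => q s = r s) -> speed r s = speed q s.
  move=> Cq e; pose c := chart_at (r s).
  have ac : atlas c by exact: chart_at_atlas.
  have cd : cdom c (r s) by exact: chart_at_dom.
  have cd' : cdom c (q s) by rewrite (nbhs_singleton e).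
  have dv := C1_velocity Cq ac cd'; have [cq _] := Cq.
  by rewrite (speedE (cr s) ac cd (derive_near e dv)) (speedE (cq s) ac cd' dv) (nbhs_singleton e).
have [th|th|->] := ltgtP t h.
- by rewrite (near_speed _ _ C1 (near_lt th)) lerDl sqrtr_ge0.
- by rewrite (near_speed _ _ C2 (near_gt th)) lerDr sqrtr_ge0.
pose c := chart_at y.
have ac : atlas c by exact: chart_at_atlas.
have cd : cdom c (r h) by rewrite rh; exact: chart_at_dom.
have dv : is_derive h 1 (fun s => cmap c (r s)) 0.
  rewrite (_ : (fun s => cmap c (r s)) = (fun s => cmap c (r1 s) + cmap c (r2 s) - cmap c y)); last first.
    by apply/funext => s'; exact: sumE.
  have := is_deriveB (is_deriveD (speed0 C1 (y1 (lexx _)) s1) (speed0 C2 (y2 (lexx _)) s2)) (is_derive_cst (cmap c y) h (1 : R)).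
  by rewrite subr0 addr0.
rewrite (speedE (cr h) ac cd dv) -[X in bilin _ X _](scale0r 0) bilinZl mul0r sqrtr0.
by rewrite addr_ge0 ?sqrtr_ge0.
Qed.

End glue.

(** Two almost shortest curves are reparametrized by [sg1] and [sg2], which run through [0, 1] on
    one half of the interval, are constant on the other and have derivative 0 at 1/2. The curves can
    then be glued, and the lengths add up. *)
Lemma rdist_triangle (x y z : X) (a b : R) :
  (rdist x y <= a%:E)%E -> (rdist y z <= b%:E)%E -> (rdist x z <= (a + b)%:E)%E.
Proof.
move=> xa yb; apply/lee_addgt0Pr => e e0.
have e20 : 0 < e / 2 by rewrite divr_gt0.
have [|p [P [Cp p0 p1 dP Pa]]] := @rdist_curve x y (a + e / 2).
  by apply: le_lt_trans xa _; rewrite lte_fin ltrDl.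
have [|q [Q [Cq q0 q1 dQ Qb]]] := @rdist_curve y z (b + e / 2).
  by apply: le_lt_trans yb _; rewrite lte_fin ltrDl.
pose pos (x : R) := Num.max x 0.
have cpos : continuous pos by move=> t; apply: continuous_max; [exact: cvg_id|exact: cvg_cst].
have pos0 t : 0 <= pos t by rewrite le_max lexx orbT.
pose sg1 (t : R) := 1 - pos (1 - 2 * t) ^+ 2; pose sg2 (t : R) := pos (2 * t - 1) ^+ 2.
pose sg1' (t : R) := 4 * pos (1 - 2 * t); pose sg2' (t : R) := 4 * pos (2 * t - 1).
have dl1 (t : R) : is_derive t 1 (fun t : R => 1 - 2 * t) (- 2).
  have := is_deriveB (is_derive_cst (1 : R^o) t (1 : R)) (is_deriveZ 2 (is_derive_id t (1 : R))).
  by move=> h; apply: is_derive_eq h _; rewrite [_ *: _]mulr1 sub0r.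
have dl2 (t : R) : is_derive t 1 (fun t : R => 2 * t - 1) 2.
  have := is_deriveB (is_deriveZ 2 (is_derive_id t (1 : R))) (is_derive_cst (1 : R^o) t (1 : R)).
  by move=> h; apply: is_derive_eq h _; rewrite [_ *: _]mulr1 subr0.
have d1 (t : R) : is_derive t 1 sg1 (sg1' t).
  have := is_deriveB (is_derive_cst (1 : R^o) t (1 : R)) (@is_derive1_comp R _ _ t _ _ (is_derive_possq (1 - 2 * t)) (dl1 t)).
  by move=> h; apply: is_derive_eq h _; rewrite /sg1' /pos; ring.
have d2 (t : R) : is_derive t 1 sg2 (sg2' t).
  have := @is_derive1_comp R _ _ t _ _ (is_derive_possq (2 * t - 1)) (dl2 t).
  by move=> h; apply: is_derive_eq h _; rewrite /sg2' /pos; ring.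
have cl (f f' : R -> R) : (forall t : R, is_derive t 1 f (f' t)) -> continuous f.
  by move=> df t; apply: differentiable_continuous; apply/derivable1_diffP; exact: ex_derive.
have c1 : continuous sg1'.
  move=> t; apply: cvgM; first exact: cvg_cst.
  exact: (@continuous_comp _ _ _ (fun t : R => 1 - 2 * t) pos t (cl _ _ dl1 t) (cpos _)).
have c2 : continuous sg2'.
  move=> t; apply: cvgM; first exact: cvg_cst.
  exact: (@continuous_comp _ _ _ (fun t : R => 2 * t - 1) pos t (cl _ _ dl2 t) (cpos _)).
have C1 := reparam_C1 Cp d1 c1; have C2 := reparam_C1 Cq d2 c2.
have e21 : 2 - 1 = 1 :> R by rewrite (natrD _ 1 1) addrK.
have pos_le (t : R) : t <= 0 -> pos t = 0 by move=> t0; rewrite /pos (max_idPr t0).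
have pos_ge (t : R) : 0 <= t -> pos t = t by move=> t0; rewrite /pos (max_idPl t0).
have y1 t : 2^-1 <= t -> (p \o sg1) t = y.
  by move=> th; rewrite /= /sg1 pos_le ?expr0n ?subr0//; lra.
have y2 t : t <= 2^-1 -> (q \o sg2) t = y.
  by move=> th; rewrite /= /sg2 pos_le ?expr0n//; lra.
have z1 : speed (p \o sg1) 2^-1 = 0.
  by rewrite (reparam_speed Cp d1 c1) /sg1' pos_le ?mulr0 ?normr0 ?mul0r//; lra.
have z2 : speed (q \o sg2) 2^-1 = 0.
  by rewrite (reparam_speed Cq d2 c2) /sg2' pos_le ?mulr0 ?normr0 ?mul0r//; lra.
have Cr := glue_C1 C1 C2 y1 y2; have sr := glue_speed C1 C2 y1 y2 z1 z2.
set r := (fun t => _) in Cr sr.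
have r0 : r 0 = x by rewrite /r invr_ge0 ler0n /= /sg1 mulr0 subr0 pos_ge// expr1n subrr.
have r1 : r 1 = z.
  rewrite /r ifF; last by apply/negbTE; rewrite -ltNge invf_lt1// ltr1n.
  by rewrite /= /sg2 mulr1 e21 pos_ge ?expr1n.
have in1 (t : R) : 0 <= t <= 1 -> 0 <= sg1 t <= 1.
  move=> /andP[t0 t1]; rewrite /sg1 subr_ge0 gerBl sqr_ge0 andbT expr_le1// /pos ge_max ler01 andbT.
  by rewrite gerBl mulr_ge0.
have in2 (t : R) : 0 <= t <= 1 -> 0 <= sg2 t <= 1.
  move=> /andP[t0 t1]; rewrite /sg2 sqr_ge0/= expr_le1// /pos ge_max ler01 andbT.
  by rewrite lerBlDr -mulr2n ler_piMr.
have := @rdist_le r (fun t => P (sg1 t) + Q (sg2 t)) (fun t => speed p (sg1 t) * sg1' t + speed q (sg2 t) * sg2' t) Cr.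
rewrite r0 r1 => /(_ _ _ _)/wrap[t1 _|t t01|t t01|].
- have k1 (t : R) : {for t, continuous (fun t => speed p (sg1 t))}.
    by apply: continuous_comp; [exact: (cl _ _ d1)|exact: speed_continuous].
  have k2 (t : R) : {for t, continuous (fun t => speed q (sg2 t))}.
    by apply: continuous_comp; [exact: (cl _ _ d2)|exact: speed_continuous].
  by apply: cvgD; apply: cvgM; [exact: k1|exact: c1|exact: k2|exact: c2].
- have e1 := @is_derive1_comp R P sg1 t _ _ (dP _ (in1 t t01)) (d1 t).
  have e2 := @is_derive1_comp R Q sg2 t _ _ (dQ _ (in2 t t01)) (d2 t).
  exact: (is_deriveD e1 e2).
- apply: le_trans (sr t) _; rewrite (reparam_speed Cp d1 c1) (reparam_speed Cq d2 c2).
  by rewrite !ger0_norm ?mulr_ge0// ![_ * speed _ _]mulrC.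
move=> h; apply: le_trans h _; rewrite -EFinD lee_fin.
have -> : sg1 1 = 1 by rewrite /sg1 mulr1 pos_le ?expr0n ?subr0// -opprB e21 oppr_le0.
have -> : sg1 0 = 0 by rewrite /sg1 mulr0 subr0 pos_ge// expr1n subrr.
have -> : sg2 0 = 0 by rewrite /sg2 mulr0 sub0r pos_le ?expr0n// oppr_le0.
have -> : sg2 1 = 1 by rewrite /sg2 mulr1 e21 pos_ge ?expr1n.
by move: Pa Qb; move: (P 1) (P 0) (Q 1) (Q 0) => u1 u2 u3 u4; clear; move=> *; lra.
Qed.

Lemma const_C1 (x : X) : C1_curve (fun=> x : X).
Proof.
apply: C1_curveP => [t|t]; first exact: cvg_cst.
exists (chart_at x); split; [exact: chart_at_atlas|exact: chart_at_dom|].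
by exists (fun=> 0); split; [apply: (@filterE _ (nbhs t) (nbhs_filter t)) => s; exact: is_derive_cst|exact: cvg_cst].
Qed.

Lemma rdistxx (x : X) : rdist x x = 0%E.
Proof.
apply/eqP; rewrite eq_le rdist_ge0 andbT.
have h := @rdist_le (fun=> x) (fun=> 0) (fun=> 0) (const_C1 x).
rewrite subrr in h; apply: h.
- by move=> t _; exact: cvg_cst.
move=> t _; have ac := chart_at_atlas x; have cd := chart_at_dom x.
have c0 : {for t, continuous (fun _ : R => x : X)} by exact: cvg_cst.
have d0 : is_derive t 1 (fun s => cmap (chart_at x) x) (0 : 'rV[R]_n) by exact: is_derive_cst.
rewrite (speedE c0 ac cd d0).
by rewrite -[X in bilin _ X _](scale0r 0) bilinZl mul0r sqrtr0.
Qed.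

Lemma rdist_le_sym (x y : X) (a : R) : (rdist x y <= a%:E)%E -> (rdist y x <= a%:E)%E.
Proof.
move=> xa; apply/lee_addgt0Pr => e e0.
have [|p [P [Cp p0 p1 dP Pa]]] := @rdist_curve x y (a + e).
  by apply: le_lt_trans xa _; rewrite lte_fin ltrDl.
have d1 (t : R) : is_derive t 1 (fun t : R => 1 - t) (- 1).
  have := is_deriveB (is_derive_cst (1 : R^o) t (1 : R)) (is_derive_id t (1 : R)).
  by rewrite sub0r.
have c1 : continuous (fun _ : R => - 1 : R) by move=> t; exact: cvg_cst.
have in1 (t : R) : 0 <= t <= 1 -> 0 <= 1 - t <= 1 by move=> /andP[t0 t1]; rewrite subr_ge0 t1 gerBl t0.
have := @rdist_le (p \o (fun t => 1 - t)) (fun t => - P (1 - t)) (fun t => speed p (1 - t)) (reparam_C1 Cp d1 c1).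
rewrite /= subrr subr0 p0 p1 => /(_ _ _ _)/wrap[t _|t t01|t t01|].
- apply: (@continuous_comp _ _ _ (fun t : R => 1 - t) (speed p) t); last exact: speed_continuous.
  by apply: cvgB; [exact: cvg_cst|exact: cvg_id].
- have := is_deriveN (@is_derive1_comp R P (fun t => 1 - t) t _ _ (dP _ (in1 t t01)) (d1 t)).
  by rewrite mulrN1 opprK.
- by rewrite (reparam_speed Cp d1 c1) normrN1 mul1r.
by move/le_trans; apply; rewrite -EFinD lee_fin opprK addrC ltW.
Qed.

Lemma rdist_sym (x y : X) : rdist x y = rdist y x.
Proof.
suff le (u v : X) : (rdist u v <= rdist v u)%E by apply/eqP; rewrite eq_le !le.
have := rdist_ge0 v u; case E : (rdist v u) => [r||]//= _; last by rewrite leey.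
by apply: rdist_le_sym; rewrite E.
Qed.

End curves.

Lemma continuous_sum_at (R : realType) (T : topologicalType) (y : T) (n : nat) (f : 'I_n -> T -> R) :
  (forall i, {for y, continuous (f i)}) -> {for y, continuous (fun z => \sum_i f i z)}.
Proof. by move=> h; apply: cvg_sum_fin. Qed.

Lemma is_derive_continuous (R : realType) (f : R -> R) (t d : R) : is_derive t 1 f d ->
  {for t, continuous f}.
Proof. by move=> df; apply: differentiable_continuous; apply/derivable1_diffP; exact: ex_derive. Qed.

Lemma continuous_row (R : realType) (T : topologicalType) (y : T) (n : nat) (f : T -> 'rV[R]_n) :
  (forall k, {for y, continuous (fun z => f z 0 k)}) -> {for y, continuous f}.
Proof.
move=> h; apply/cvgrPdist_le => e e0.
have : nbhs y (fun z => forall k : 'I_n, `|f y 0 k - f z 0 k| <= e).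
  apply: (@filter_forall T _ (fun (k : 'I_n) z => `|f y 0 k - f z 0 k| <= e) (nbhs y) (nbhs_filter y)) => k.
  by have /cvgrPdist_le/(_ e e0) := h k.
by apply: filterS => z hz; apply: rv_norm_le (ltW e0) _ => k; rewrite !mxE.
Qed.

Section charts_and_distance.
Variables (R : realType) (n : nat) (X : tamed_manifold R n) (b : R).
Hypothesis b1 : 1 <= b.
Let b0 : 0 < b. Proof. exact: lt_le_trans b1. Qed.

Lemma entry_le_speed (c : chart R n X) x0 (p : R -> X) t (v : 'rV[R]_n) k : bchart c x0 b ->
  {for t, continuous p} -> cdom c (p t) ->
  is_derive t 1 (fun s => cmap c (p s)) v -> `|v 0 k| <= Num.sqrt b * speed p t.
Proof.
move=> [ac _ _ ci bb] cp cd dv; rewrite (speedE cp ac cd dv).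
have im : cimg c (cmap c (p t)) by exact: chart_img.
have := im; rewrite {1}ci => /bb[_ inv _ _].
have := entry_le_bilin (metric_sym ac im) (metric_pos ac im) v k b0 inv.
rewrite -sqrtrM ?(ltW b0)// -sqrtr_sqr; exact: ler_wsqrtr.
Qed.

(** Coordinates move at most sqrt(b) times as fast as the curve, so [chart_escape] applies with
    sqrt(b) times the arc length. *)
Lemma rdist_in_chart (c : chart R n X) (x y : X) (a : R) : bchart c x b ->
  (rdist x y < a%:E)%E -> Num.sqrt b * a <= half R n ->
  cdom c y /\ forall k, `|cmap c y 0 k| <= Num.sqrt b * a.
Proof.
move=> bc /rdist_curve[p [P [Cp p0 p1 dP Pa]]] sm; have [ac cx cx0 ci bb] := bc.
have [cp _] := Cp.
pose q (t : R) := p t.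
have dPhi (t : R) : 0 <= t <= 1 -> is_derive t 1 (fun t => Num.sqrt b * P t) (Num.sqrt b * speed p t).
  by move=> /dP d; have := is_deriveZ (Num.sqrt b) d.
have mono (t : R) : 0 <= t <= 1 -> P t - P 0 <= P 1 - P 0.
  move=> /andP[t0 t1]; rewrite lerD2r -subr_ge0.
  have := @derive_compare R (fun=> 0) (fun=> 0) P (speed p) t 1 t1.
  rewrite subrr normr0; apply.
  - by move=> s /andP[s0 s1]; apply: dP; rewrite s1 (le_trans t0).
  - by move=> s _; rewrite ?normr0 sqrtr_ge0.
have := @chart_escape R n X c x b bc p (fun t => Num.sqrt b * P t) (fun t => Num.sqrt b * speed p t) 1 0 cp ler01 dPhi.
move=> /(_ _ _ _ _ 1)/wrap[t t01 cd k| | |t t01|].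
- exists (derive1 (fun s => cmap c (p s) 0 k) t).
    rewrite derive1E; have [_ h] := Cp; have [d _] := h c t k ac cd; exact/derivableP.
  have := entry_le_speed k bc (cp t) cd (C1_velocity Cp ac cd); by rewrite mxE.
- by rewrite p0.
- by move=> k; rewrite p0 cx0 mxE normr0.
- rewrite add0r -mulrBr; apply: le_trans sm; rewrite ler_wpM2l ?sqrtr_ge0//.
  by apply: le_trans (mono t t01) _; exact: ltW.
rewrite ler01 lexx p1 add0r => /(_ isT)[cd h]; split => // k; apply: le_trans (h k) _.
by rewrite -mulrBr ler_wpM2l ?sqrtr_ge0// ltW.
Qed.

(** Curves are parametrized by the whole line. With sin^2 as parameter a segment is run through on
    [0, 1] and the curve never leaves it afterwards. *)
Let sn (t : R) := sin (pi / 2 * t) ^+ 2.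
Let sn' (t : R) := pi * (sin (pi / 2 * t) * cos (pi / 2 * t)).

Let sn_derive (t : R) : is_derive t 1 sn (sn' t).
Proof.
have dl : is_derive t 1 (fun t : R => pi / 2 * t) (pi / 2).
  by have := is_deriveZ (pi / 2) (is_derive_id t (1 : R)); rewrite [_ *: 1]mulr1.
have ds := @is_derive1_comp R (@sin R) (fun t => pi / 2 * t) t _ _ (is_derive_sin _) dl.
have := @is_derive1_comp R (fun x => x ^+ 2) (fun t => sin (pi / 2 * t)) t _ _ (is_derive_sq _) ds.
by move=> h; apply: is_derive_eq h _; rewrite /sn'; field.
Qed.

Let sn_range (t : R) : 0 <= sn t <= 1.
Proof. by rewrite /sn sqr_ge0/= sin2cos2 gerBl sqr_ge0. Qed.

Lemma chart_segment_dist (c : chart R n X) (x : X) (u v : 'rV[R]_n) (m : R) : bchart c x b -> 0 <= m ->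
  (forall k, `|u 0 k| <= half R n) -> (forall k, `|v 0 k| <= half R n) ->
  (forall k, `|v 0 k - u 0 k| <= m) ->
  (rdist (cinv c u) (cinv c v) <= (n%:R * Num.sqrt b * m)%:E)%E.
Proof.
move=> bc m0 uh vh uv; have [ac cx cx0 ci bb] := bc.
pose L t := u + sn t *: (v - u).
have Lin t : unit_ball R n (L t).
  apply: cube_in_ball => k; rewrite !mxE; have /andP[s0 s1] := sn_range t.
  rewrite (_ : u 0 k + _ = (1 - sn t) * u 0 k + sn t * v 0 k); last by ring.
  apply: le_trans (ler_normD _ _) _; rewrite [`|_ * u 0 k|]normrM [`|_ * v 0 k|]normrM (ger0_norm s0) ger0_norm ?subr_ge0//.
  have t1' : 0 <= 1 - sn t by rewrite subr_ge0.
  by have := ler_wpM2l s0 (vh k); have := ler_wpM2l t1' (uh k); move=> *; lra.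
have Lim t : cimg c (L t) by rewrite ci.
have dL (t : R) : is_derive t 1 L (sn' t *: (v - u)).
  apply: is_derive_rV => i; rewrite mxE.
  rewrite (_ : (fun s => _) = (fun s => u 0 i + (v - u) 0 i * sn s)); last first.
    by apply/funext => s; rewrite /L mxE [X in _ + X]mxE mulrC.
  have := is_deriveD (is_derive_cst (u 0 i : R^o) t (1 : R)) (is_deriveZ ((v - u) 0 i) (sn_derive t)).
  by move=> h; apply: is_derive_eq h _; rewrite add0r mulrC.
have csn : continuous sn.
  by move=> t; exact: is_derive_continuous (sn_derive t).
have csn' : continuous sn'.
  move=> t; apply: cvgM; first exact: cvg_cst.
  have cl : {for t, continuous (fun t : R => pi / 2 * t)} by apply: cvgM; [exact: cvg_cst|exact: cvg_id].
  by apply: cvgM; apply: continuous_comp => //; [exact: continuous_sin|exact: continuous_cos].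
have cL : continuous L.
  move=> t; apply: cvgD; first exact: cvg_cst.
  by apply: cvgZ; [exact: csn|exact: cvg_cst].
pose p t := cinv c (L t).
have pd t : cdom c (p t) /\ cmap c (p t) = L t by exact: chart_invK.
have cp : continuous p.
  by move=> t; apply: continuous_comp; [exact: cL|exact: chart_inv_continuous].
have mapE : (fun t => cmap c (p t)) = L by apply/funext => t; have [] := pd t.
have Cp : C1_curve p.
  apply: C1_curveP => // t; exists c; split => //; first by have [] := pd t.
  exists (fun t => sn' t *: (v - u)); split.
    by rewrite mapE; apply: (@filterE _ (nbhs t) (nbhs_filter t)) => s; exact: dL.
  by apply: cvgZ; [exact: csn'|exact: cvg_cst].
pose C := n%:R * Num.sqrt b * m.
have C0 : 0 <= C by rewrite mulr_ge0// mulr_ge0 ?sqrtr_ge0.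
have := @rdist_le R n X p (fun t => C * sn t) (fun t => C * sn' t) Cp.
have -> : p 0 = cinv c u by rewrite /p /L /sn mulr0 sin0 expr0n scale0r addr0.
have -> : p 1 = cinv c v by rewrite /p /L /sn mulr1 sin_pihalf expr1n scale1r addrC subrK.
have -> : sn 1 = 1 by rewrite /sn mulr1 sin_pihalf expr1n.
have -> : sn 0 = 0 by rewrite /sn mulr0 sin0 expr0n.
rewrite mulr0 mulr1 subr0; apply.
- by move=> t _; apply: cvgM; [exact: cvg_cst|exact: csn'].
- by move=> t _; have := is_deriveZ C (sn_derive t).
move=> t /andP[t0 t1]; have [cd pE] := pd t.
have dv : is_derive t 1 (fun t => cmap c (p t)) (sn' t *: (v - u)) by rewrite mapE; exact: dL.
rewrite (speedE (cp t) ac cd dv) bilinZl bilinZr mulrA -expr2 sqrtrM ?sqr_ge0// sqrtr_sqr.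
have s0 : 0 <= sn' t.
  have p0 := pi_ge0 R; rewrite /sn' mulr_ge0// mulr_ge0//.
    apply: sin_ge0_pi; apply/andP; split; first by rewrite mulr_ge0// divr_ge0.
    by apply: le_trans (_ : pi / 2 * 1 <= _); [rewrite ler_wpM2l// divr_ge0|lra].
  apply: cos_ge0_pihalf; apply/andP; split.
    by apply: le_trans (_ : 0 <= _); [lra|rewrite mulr_ge0// divr_ge0].
  by rewrite ger_pMr// divr_gt0// pi_gt0.
rewrite (ger0_norm s0) mulrC ler_wpM2r//.
have [bm _ _ _] := bb _ (Lin t); rewrite -pE in bm.
have h := @bilin_le R n (metric c (cmap c (p t))) (v - u) b m bm.
rewrite /C -[leRHS]ger0_norm// -sqrtr_sqr ler_wsqrtr//; apply: le_trans (h _) _.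
  by move=> i; rewrite !mxE.
by rewrite /C [leRHS]exprMn [(n%:R * _) ^+ 2]exprMn sqr_sqrtr ?(ltW b0).
Qed.

Lemma rdist_small (x : X) (e : R) : (exists c, bchart c x b) -> 0 < e ->
  nbhs x (fun y => (rdist x y <= e%:E)%E).
Proof.
move=> [c bc] e0; have [ac cx cx0 ci bb] := bc.
pose C := n%:R * Num.sqrt b + 1.
have C1 : 1 <= C by rewrite lerDr mulr_ge0 ?sqrtr_ge0.
pose m := Num.min (half R n) (e / C).
have C0 : 0 < C by exact: lt_le_trans C1.
have m0 : 0 < m by rewrite lt_min half_gt0 divr_gt0.
have o1 : nbhs x (cdom c) by apply: open_nbhs_nbhs; split => //; exact: chart_open.
have h : nbhs x (fun y => `|cmap c y| <= m).
  have /cvgrPdist_le/(_ m m0) := chart_continuous ac cx; rewrite cx0.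
  by apply: filterS => y; rewrite sub0r normrN.
apply: filterS2 o1 h => y cy hm.
have hk k : `|cmap c y 0 k| <= m := le_trans (entry_norm _ _) hm.
have mh : m <= half R n by rewrite ge_min lexx.
have := @chart_segment_dist c x 0 (cmap c y) m bc (ltW m0).
rewrite -cx0 !chartK// cx0; move/(_ _ _ _)/wrap; case.
- by move=> k; rewrite mxE normr0 ltW// half_gt0.
- by move=> k; rewrite (le_trans (hk k)).
- by move=> k; rewrite mxE subr0.
move/le_trans; apply; rewrite lee_fin; apply: (@le_trans _ _ (C * m)).
  by rewrite ler_wpM2r ?(ltW m0)// lerDl.
by rewrite mulrC -ler_pdivlMr// ge_min lexx orbT.
Qed.

End charts_and_distance.

Section planar_map_distance.
Variables (R : realType) (n : nat) (X : tamed_manifold R n) (F : 'rV[R]_2 -> X).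
Hypothesis JF : Jhol_local F.

Lemma Jhol_continuous : continuous F. Proof. by case: JF. Qed.

Lemma chart_line_derive (c : chart R n X) (a v : 'rV[R]_2) (x : R) : atlas c -> cdom c (F (a + x *: v)) ->
  is_derive x 1 (fun t : R => cmap c (F (a + t *: v)))
    (v 0 0 *: dpartial c F 0 (a + x *: v) + v 0 1 *: dpartial c F 1 (a + x *: v)).
Proof.
move=> ac cd; apply: is_derive_rV => k.
have [df Df] := smooth_C1 [::] (Jhol_open JF ac) (Jhol_smooth JF ac k) cd.
have dd : derivable (fun y => cmap c (F y) 0 k) (a + x *: v) v by exact: diff_derivable.
have := is_derive_line dd; rewrite Df sum2.
by move=> h; apply: is_derive_eq h _; rewrite [in RHS]mxE; congr (_ + _); rewrite !mxE.
Qed.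

Lemma line_C1 (a v : 'rV[R]_2) : C1_curve (fun t : R => F (a + t *: v)).
Proof.
have cl := @line_continuous R a v.
have cF : continuous (fun t : R => F (a + t *: v)).
  by move=> t; apply: (@continuous_comp _ _ _ (fun t : R => a + t *: v) F t (cl t)); exact: Jhol_continuous.
apply: C1_curveP => // t; exists (chart_at (F (a + t *: v))); set c := chart_at _.
have ac : atlas c by exact: chart_at_atlas.
have cd : cdom c (F (a + t *: v)) by exact: chart_at_dom.
split => //.
exists (fun t : R => v 0 0 *: dpartial c F 0 (a + t *: v) + v 0 1 *: dpartial c F 1 (a + t *: v)); split.
  have o1 : nbhs t (fun t : R => cdom c (F (a + t *: v))).
    by apply: (cF t); apply: open_nbhs_nbhs; split => //; exact: chart_open.
  by apply: filterS o1 => s; exact: chart_line_derive.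
have cdp i : {for t, continuous (fun t : R => dpartial c F i (a + t *: v))}.
  apply: (@continuous_comp _ _ _ (fun t : R => a + t *: v) (dpartial c F i) t (cl t)).
  apply: continuous_row => k; have [ck _] := Jhol_smooth JF ac k [:: i] cd.
  by rewrite (_ : (fun z => _) = iter_partial [:: i] (fun z => cmap c (F z) 0 k))//; apply/funext => z; rewrite mxE.
by apply: cvgD; apply: cvgZ; [exact: cvg_cst|exact: cdp|exact: cvg_cst|exact: cdp].
Qed.

Lemma line_speed (a v : 'rV[R]_2) (t : R) :
  speed (fun t : R => F (a + t *: v)) t <= len v * dens F (a + t *: v).
Proof.
have [cF _] := line_C1 a v.
pose c := chart_at (F (a + t *: v)).
have ac : atlas c by exact: chart_at_atlas.
have cd : cdom c (F (a + t *: v)) by exact: chart_at_dom.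
rewrite (speedE (cF t) ac cd (chart_line_derive ac cd)).
have im := chart_img cd.
rewrite /len /dens -sqrtrM ?nrm2_ge0//; apply: ler_wsqrtr.
apply: le_trans (bilin_comb (metric_sym ac im) (metric_pos ac im) _ _ _ _) _.
by rewrite (energy_density_chart JF ac cd) sum2.
Qed.

Lemma segment_dist (a v : 'rV[R]_2) (phi phi' : R -> R) :
  (forall t : R, 0 <= t <= 1 -> {for t, continuous phi'}) ->
  (forall t : R, 0 <= t <= 1 -> is_derive t 1 phi (phi' t)) ->
  (forall t : R, 0 <= t <= 1 -> len v * dens F (a + t *: v) <= phi' t) ->
  (rdist (F a) (F (a + v)%R) <= (phi 1 - phi 0)%:E)%E.
Proof.
move=> cphi dphi h; have := rdist_le (line_C1 a v) cphi dphi.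
rewrite scale0r addr0 scale1r; apply => t t01.
exact: le_trans (line_speed a v t) (h t t01).
Qed.

Lemma dens_locally_bounded (y : 'rV[R]_2) : exists M : R, nbhs y (fun z => dens F z <= M).
Proof.
pose c := chart_at (F y).
have ac : atlas c by exact: chart_at_atlas.
have cd : cdom c (F y) by exact: chart_at_dom.
pose g z := \sum_(a < 2) bilin (metric c (cmap c (F z))) (dpartial c F a z) (dpartial c F a z).
have o1 : nbhs y (fun z => cdom c (F z)).
  by apply: (Jhol_continuous); apply: open_nbhs_nbhs; split => //; exact: chart_open.
have cg : {for y, continuous g}.
  apply: continuous_sum_at => a.
  rewrite (_ : (fun z => _) = fun z => \sum_i \sum_j dpartial c F a z 0 i * metric c (cmap c (F z)) i j * dpartial c F a z 0 j); last first.
    by apply/funext => z; rewrite bilinE.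
  apply: continuous_sum_at => i; apply: continuous_sum_at => j.
  have cp k : {for y, continuous (fun z => dpartial c F a z 0 k)}.
    have [ck _] := Jhol_smooth JF ac k [:: a] cd.
    by rewrite (_ : (fun z => _) = iter_partial [:: a] (fun z => cmap c (F z) 0 k))//; apply/funext => z; rewrite mxE.
  apply: continuousM (cp j); apply: continuousM (cp i) _.
  have [[gs _] _] := metric_riemannian X.
  have [+ _] := gs c ac i j [::] (cmap c (F y)) (chart_img cd).
  move=> h; apply: (@continuous_comp _ _ _ (fun s => cmap c (F s)) (fun y => metric c y i j) y _ h).
  by apply: continuous_comp; [exact: Jhol_continuous|exact: chart_continuous].
exists (Num.sqrt (g y + 1)).
have /cvgrPdist_le/(_ 1 ltr01) := cg.
move=> h; apply: filterS2 o1 h => z cz hz; rewrite /dens (energy_density_chart JF ac cz) ler_wsqrtr//.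
by move: hz; rewrite -/(g z) ler_distlC => /andP[_].
Qed.

End planar_map_distance.

(** * Selection of the marked points of a sphere *)

Section selection.
Variables (R : realType) (e : 'rV[R]_2 -> R) (eps M : R).
Hypothesis eps0 : 0 < eps.
Hypothesis e_le : forall z, e z <= M.

(** The third clause is the hypothesis of [dens_spread], and the last one makes the squares around
    the points disjoint. The factor 9/10 reflects that the next point is chosen with [e] within a
    factor 10/9 of the supremum. *)
Definition admissible (P : seq 'rV[R]_2) := [/\ uniq P,
  forall p, p \in P -> 0 < e p,
  forall p, p \in P -> forall y, len (y - p) <= eps / (4 * e p) -> e y <= 2 * e p &
  forall p q, p \in P -> q \in P -> p != q -> 9 / 10 * (eps / e p) <= len (p - q)].

Let free (P : seq 'rV[R]_2) z := 0 < e z /\ forall p, p \in P -> eps <= e z * len (z - p).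

(* The next point is chosen among the points that are not yet controlled, with
   a value of [e] that is almost the largest one. *)
Lemma selection_step (P : seq 'rV[R]_2) : admissible P ->
  (forall p z, p \in P -> free P z -> e z <= 10 / 9 * e p) ->
  (exists z, free P z) ->
  exists q, admissible (q :: P) /\ forall p z, p \in q :: P -> free (q :: P) z -> e z <= 10 / 9 * e p.
Proof.
move=> [uP Pgt P2 Psep] P4 [z0 fz0].
have [q [q0 fq] qsup] : exists2 q, free P q & forall z, free P z -> e z <= 10 / 9 * e q.
  pose E := [set e z | z in [set z | free P z]].
  have hE : has_sup E by split; [exists (e z0), z0|exists M => _ [z _ <-]].
  have s0 : 0 < sup E.
    by apply: lt_le_trans (proj1 fz0) _; apply: ub_le_sup; [case: hE|exists z0].
  have s10 : 0 < sup E / 10 by rewrite divr_gt0.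
  have [_ [q fq <-] hq] := sup_adherent s10 hE.
  exists q => // z fz; have : e z <= sup E by apply: ub_le_sup; [case: hE|exists z].
  by move: hq; move=> *; lra.
exists q.
have qP : q \notin P.
  by apply/negP => /fq; rewrite subrr (_ : len 0 = 0) ?mulr0 ?leNgt ?eps0//; apply/eqP; rewrite len_eq0.
have sepq p : p \in P -> eps / e q <= len (q - p) by move=> /fq; rewrite mulrC -ler_pdivrMr.
have sq0 : 0 < eps / e q by rewrite divr_gt0.
split; first split.
- by rewrite /= qP.
- by move=> p; rewrite inE => /orP[/eqP->|/Pgt].
- move=> p; rewrite inE => /orP[/eqP-> y yq|/P2//].
  have [ey0|ey0] := leP (e y) 0; first by apply: le_trans ey0 _; rewrite mulr_ge0// ltW.
  have [fy|] := EM (free P y); first by have := qsup y fy; move: q0; move=> *; lra.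
  (* If [y] is not free, it is controlled by an earlier point [p']. As [y] is near [q] and [q] is
     far from [p'], the distance of [y] and [p'] is at least 3/4 of eps / e(q), whence e(y) < 4/3
     e(q). *)
  move=> nf; have [p' p'P lt] : exists2 p', p' \in P & e y * len (y - p') < eps.
    apply: contrapT => h; apply: nf; split => // p' p'P; rewrite leNgt; apply/negP => lt.
    by apply: h; exists p'.
  have yq' : len (y - q) <= eps / e q / 4 by rewrite (le_trans yq)// le_eqVlt; apply/orP; left; apply/eqP; rewrite invfM; ring.
  have h1 : 3 / 4 * (eps / e q) <= len (y - p').
    by have := len_tri q y p'; have := sepq _ p'P; rewrite (lenB q y); move: yq'; move: (eps / e q) => s; move=> *; lra.
  have h2 : e y * (3 / 4 * (eps / e q)) < eps by apply: le_lt_trans lt; rewrite ler_wpM2l// ltW.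
  have h3 : e y * (3 / 4 * (eps / e q)) * e q = e y * (3 / 4) * eps by field; rewrite gt_eqF.
  have h4 : e y * (3 / 4) * eps < eps * e q by rewrite -h3 ltr_pM2r.
  rewrite mulrC ltr_pM2l// in h4.
  by move: h4 q0; move=> *; lra.
- move=> p p'; rewrite !inE => /orP[/eqP->|pP] /orP[/eqP->|p'P] pp'.
  + by rewrite eqxx in pp'.
  + by have := sepq _ p'P; move: sq0; move: (eps / e q) => s; move=> *; lra.
  + have := sepq _ pP; rewrite lenB; have := P4 p q pP (conj q0 fq) => h1; apply: le_trans.
    have p0 := Pgt _ pP.
    rewrite ler_pdivlMr// (_ : _ * e q = eps * (9 / 10 * e q / e p)); last by ring.
    rewrite ler_piMr ?(ltW eps0)// ler_pdivrMr// mul1r.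
    by move: h1; move=> *; lra.
  + exact: Psep.
move=> p z; rewrite inE => pq [z0' fz].
have fz' : free P z by split => // p' p'P; apply: fz; rewrite inE p'P orbT.
by case/orP: pq => [/eqP->|pP]; [exact: qsup|exact: P4].
Qed.

(** As long as some point is free the selection goes on; if it never ended, there would be
    admissible sets of every size. *)
Lemma selection (N : R) : (forall P, admissible P -> (size P)%:R <= N) ->
  exists2 P, admissible P & forall z, 0 < e z -> exists2 p, p \in P & e z * len (z - p) < eps.
Proof.
move=> bound; apply: contrapT => no.
have step P : admissible P -> exists z, free P z.
  move=> aP; apply: contrapT => nf; apply: no; exists P => // z z0.
  apply: contrapT => np; apply: nf; exists z; split => // p pP; rewrite leNgt; apply/negP => lt.
  by apply: np; exists p.
have all k : exists P, [/\ admissible P, size P = k & forall p z, p \in P -> free P z -> e z <= 10 / 9 * e p].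
  elim: k => [|k [P [aP sP P4]]]; first by exists [::]; split.
  have [q [aq q4]] := selection_step aP P4 (step P aP).
  by exists (q :: P); split => //=; rewrite sP.
have [P [aP sP _]] := all (Num.truncn `|N|).+1.
have := bound P aP; rewrite sP leNgt => /negP; apply.
by apply: le_lt_trans (ler_norm _) _; rewrite truncnS_gt// normr_ge0.
Qed.

End selection.

(** * Energy carried by the selected points *)

Section energy_of_boxes.
Variable R : realType.
Let mu := (@lebesgue_measure R \x @lebesgue_measure R)%E.

Let box (p : 'rV[R]_2) (r : R) : set (R * R) :=
  `[p 0 0 - r, p 0 0 + r]%classic `*` `[p 0 1 - r, p 0 1 + r]%classic.

Let box_measurable p r : measurable (box p r).
Proof. by apply: measurableX; exact: measurable_itv. Qed.

Let box_measure p r : 0 < r -> mu (box p r) = ((2 * r) ^+ 2)%:E.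
Proof.
move=> r0; rewrite /mu /box product_measure1E//=; try exact: measurable_itv.
rewrite !lebesgue_measure_itv/= !lte_fin !ifT; [|lra|lra].
by rewrite -!EFinB -EFinM; congr (_%:E); ring.
Qed.

Lemma boxes_integral (g : R * R -> R) (P : seq 'rV[R]_2) (d r : 'rV[R]_2 -> R) :
  (forall z, 0 <= g z) -> uniq P -> (forall p, p \in P -> 0 <= d p /\ 0 < r p) ->
  (forall p z, p \in P -> `|z.1 - p 0 0| <= r p -> `|z.2 - p 0 1| <= r p -> d p <= g z) ->
  (forall p q z, p \in P -> q \in P -> `|z.1 - p 0 0| <= r p -> `|z.2 - p 0 1| <= r p ->
    `|z.1 - q 0 0| <= r q -> `|z.2 - q 0 1| <= r q -> p = q) ->
  ((\sum_(p <- P) d p * (2 * r p) ^+ 2)%:E <= \int[mu]_z (g z)%:E)%E.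
Proof.
move=> g0 uP dr dg disj.
pose D p := Num.max 0 (d p).
have DE p : p \in P -> D p = d p by move=> /dr[d0 _]; rewrite /D (max_idPr d0).
have D0 p : 0 <= D p by rewrite le_max lexx.
have boxP p z : z \in box p (r p) -> `|z.1 - p 0 0| <= r p /\ `|z.2 - p 0 1| <= r p.
  rewrite inE /box /= !in_itv/= => -[/andP[h1 h2] /andP[h3 h4]]; rewrite !ler_norml; split; apply/andP; split; lra.
apply: (@le_trans _ _ (\int[mu]_z (\sum_(p <- P) (D p * \1_(box p (r p)) z)%:E))%E); last first.
  apply: le_integral_nonneg => z _; first by rewrite sume_ge0// => p _; rewrite lee_fin mulr_ge0.
  rewrite sumEFin lee_fin; have [/hasP[p pP zp]|] := boolP (has (fun p => z \in box p (r p)) P).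
    rewrite (bigD1_seq p)//= big_seq_cond big1 ?addr0; last first.
      move=> q /andP[qP qp]; rewrite indicE; case E: (_ \in _); last by rewrite mulr0.
      have zq : z \in box q (r q) by exact: E.
      have [h1 h2] := boxP _ _ zp; have [h3 h4] := boxP _ _ zq.
      by rewrite (disj q p z) ?eqxx in qp.
    by rewrite indicE zp mulr1 DE//; have [h1 h2] := boxP _ _ zp; exact: dg.
  move/hasPn => h; rewrite big_seq big1 ?g0// => p /h/negbTE zn.
  by rewrite indicE zn mulr0.
rewrite ge0_integral_sum//; last 2 first.
- by move=> p; apply/measurable_EFinP; apply: measurable_funM; [exact: measurable_cst|apply: measurable_indic; exact: box_measurable].
- by move=> p z _; rewrite lee_fin mulr_ge0.
rewrite -sumEFin big_seq [leRHS]big_seq; apply: lee_sum => p pP.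
under eq_integral do rewrite EFinM.
rewrite ge0_integralZl//; last 2 first.
- by apply/measurable_EFinP; apply: measurable_indic; exact: box_measurable.
- by rewrite lee_fin.
have [_ rp] := dr _ pP.
have -> : (\int[mu]_x (\1_(box p (r p)) x)%:E = ((2 * r p) ^+ 2)%:E)%E.
  rewrite (@integral_indic _ _ _ mu setT measurableT (box p (r p)) (box_measurable _ _)) setIT.
  exact: box_measure.
by rewrite -EFinM DE.
Qed.

End energy_of_boxes.

Section energy_quantum.
Variables (R : realType) (n : nat) (b eps : R).
Hypothesis b1 : 1 <= b.
Hypothesis eps0 : 0 < eps.

(** The area (2 ss / e)^2 of a square around a selected point, times the lower bound (sd e)^2 of the
    energy density on it; the scale e cancels. *)
Definition quantum : R := (2 * spread_size n b eps * spread_dens n b) ^+ 2.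

Lemma quantum_gt0 : 0 < quantum.
Proof. by rewrite exprn_gt0// mulr_gt0 ?spread_dens_gt0// mulr_gt0// spread_size_gt0. Qed.

Lemma coord_le_len (v : 'rV[R]_2) (r : R) : `|v 0 0| <= r -> `|v 0 1| <= r -> len v <= 2 * r.
Proof.
move=> h0 h1; have r0 : 0 <= r := le_trans (normr_ge0 _) h0.
rewrite -ler_sqr ?nnegrE ?len_ge0 ?mulr_ge0// len_sqr /nrm2 exprMn.
have s x : `|x| <= r -> x ^+ 2 <= r ^+ 2 by move=> h; rewrite -real_normK ?num_real// lerXn2r ?nnegrE.
by have := s _ h0; have := s _ h1; have := sqr_ge0 r; move=> *; lra.
Qed.

Lemma separation_contra (u1 u2 u3 u4 u5 : R) : u5 <= 2 * u3 + 2 * u4 ->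
  9 / 10 * u1 <= u5 -> 9 / 10 * u2 <= u5 -> 0 < u1 -> 0 < u2 -> u4 <= u2 / 12 -> u3 <= u1 / 12 -> False.
Proof. by move=> *; lra. Qed.

(** The square around p has half-side at most 1/12 of eps / e(p), and the distance of p to the other
    points is at least 9/10 of it. So the squares are disjoint, and each carries the energy
    [quantum]. *)
Lemma energy_count (X : tamed_manifold R n) (F : 'rV[R]_2 -> X) (P : seq 'rV[R]_2) (E : R) :
  Jhol_local F -> (forall x : X, exists c, bchart c x b) ->
  (\int[@lebesgue_measure R \x @lebesgue_measure R]_z
     (energy_density F (\row_(i < 2) [:: z.1; z.2]`_i))%:E <= E%:E)%E ->
  admissible (dens F) eps P -> (size P)%:R * quantum <= E.
Proof.
move=> JF bg EE [uP Pgt P2 Psep]; rewrite -lee_fin; apply: le_trans EE.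
have spread z0 z := @dens_spread R n b eps b1 eps0 X F z0 z JF bg.
have ss0 := @spread_size_gt0 R n b eps b1 eps0.
have sd0 := @spread_dens_gt0 R n b b1.
have s1 := spread_size_le n b1 eps0.
rewrite /quantum; set ss := spread_size n b eps in spread ss0 s1 *; set sd := spread_dens n b in spread sd0 *.
clearbody ss sd.
apply: le_trans (@boxes_integral R _ P (fun p => (sd * dens F p) ^+ 2) (fun p => ss / dens F p) _ uP _ _ _).
- rewrite lee_fin le_eqVlt; apply/orP; left; apply/eqP.
  rewrite big_seq (eq_bigr (fun=> (2 * ss * sd) ^+ 2)).
    by rewrite -big_seq big_const_seq count_predT iter_addr addr0 mulr_natl.
  move=> p /Pgt p0; rewrite -exprMn; congr (_ ^+ 2); field; rewrite gt_eqF//.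
- by move=> z; exact: energy_density_ge0.
- by move=> p /Pgt p0; rewrite sqr_ge0 divr_gt0.
- move=> p z pP h1 h2; rewrite -dens_sqr lerXn2r ?nnegrE ?dens_ge0 ?(mulr_ge0 (ltW sd0) (dens_ge0 _ _))//.
  apply: (spread _ _ (Pgt _ pP)); first by move=> y; exact: P2.
  move=> i; have [->|->] : i = 0 \/ i = 1 by case: i => [[|[|//]] hi]; [left|right]; apply/val_inj.
    by rewrite mxE.
  by rewrite mxE.
- move=> p q z pP qP h1 h2 h3 h4; apply/eqP; apply: contrapT => /negP pq.
  have p0 := Pgt _ pP; have q0 := Pgt _ qP.
  have [y [y0 y1]] : exists y : 'rV[R]_2, y 0 0 = z.1 /\ y 0 1 = z.2.
    by exists (\row_(i < 2) [:: z.1; z.2]`_i); rewrite !mxE.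
  have tri (v : 'rV[R]_2) : `|z.1 - v 0 0| <= ss / dens F v -> `|z.2 - v 0 1| <= ss / dens F v ->
      len (y - v) <= 2 * (ss / dens F v).
    by rewrite -y0 -y1 => k1 k2; apply: coord_le_len; rewrite !mxE.
  have d1 := Psep p q pP qP pq.
  have d : len (p - q) <= 2 * (ss / dens F p) + 2 * (ss / dens F q).
    apply: le_trans (len_tri p y q) _; rewrite (lenB p y).
    exact: lerD (tri p h1 h2) (tri q h3 h4).
  have bnd (v : 'rV[R]_2) : 0 < dens F v -> ss / dens F v <= eps / dens F v / 12.
    by move=> v0; rewrite [leRHS]mulrAC ler_wpM2r// invr_ge0 ltW.
  have ep : 0 < eps / dens F p := divr_gt0 eps0 p0.
  have eq : 0 < eps / dens F q := divr_gt0 eps0 q0.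
  have d2' : 9 / 10 * (eps / dens F q) <= len (p - q).
    by rewrite lenB; apply: Psep => //; rewrite eq_sym.
  exact: (separation_contra d d1 d2' ep eq (bnd q q0) (bnd p p0)).
Qed.

End energy_quantum.

Lemma compact_bounded_above (R : realType) (T : topologicalType) (A : set T) (g : T -> R) :
  compact A -> (forall y, A y -> exists M, nbhs y (fun z => g z <= M)) -> exists M, forall z, A z -> g z <= M.
Proof.
move=> /compact_near_coveringP cA h.
have [|M [_ hM]] := cA R (+oo)%R (fun M z => g z <= M) _.
  move=> y /h[M hM]; exists ([set z | g z <= M], [set m : R | M <= m]); first by split => //=; apply: nbhs_pinfty_ge; exact: num_real.
  by move=> [z m] [/= zM Mm]; exact: le_trans zM Mm.
by exists (M + 1) => z Az; apply: (hM (M + 1)) => //; rewrite ltrDl.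
Qed.

(** * The density in the two coordinates of the sphere *)

Section inversion.
Variable R : realType.
Implicit Types y : 'rV[R]_2.

(* The complex inverse, under the identification of the plane with C. *)
Definition plane_inv y : 'rV[R]_2 := \row_i (if i == 0 then y 0 0 / nrm2 y else - (y 0 1 / nrm2 y)).

Lemma nrm2_gt0 y : y != 0 -> 0 < nrm2 y.
Proof. by rewrite -len_gt0 -len_sqr => h; rewrite exprn_gt0. Qed.

Lemma nrm2_plane_inv y : y != 0 -> nrm2 (plane_inv y) = (nrm2 y)^-1.
Proof.
move=> /nrm2_gt0 q0; rewrite {1}/nrm2 !mxE/= sqrrN !exprMn -mulrDl -/(nrm2 y).
by field; rewrite gt_eqF.
Qed.

Lemma wcoord_plane_inv y : y != 0 -> wcoord (plane_inv y) = zcoord y.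
Proof.
move=> yn; have q0 := nrm2_gt0 yn; have i0 : 0 < nrm2 (plane_inv y) by rewrite nrm2_plane_inv// invr_gt0.
rewrite /wcoord /zcoord /moebius !mul1r !mul0r add0r addr0 !mxE/=.
rewrite ifF; last first.
  apply/negbTE/eqP => -[h1 h2]; move: i0; rewrite /nrm2 !mxE/= h1 h2 expr0n addr0 ltxx.
  by [].
congr Some; rewrite mul1r; apply/eqP; rewrite eq_complex /= sqrrN.
have -> : (y 0 0 / nrm2 y) ^+ 2 + (y 0 1 / nrm2 y) ^+ 2 = (nrm2 y)^-1.
  by rewrite !exprMn -mulrDl -/(nrm2 y); field; rewrite gt_eqF.
by apply/andP; split; apply/eqP; field; rewrite gt_eqF.
Qed.

(** Real and, below, imaginary part of - 1 / y^2, the complex derivative of 1 / y. *)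
Definition inv_re y : R := (y 0 1 ^+ 2 - y 0 0 ^+ 2) / nrm2 y ^+ 2.
Definition inv_im y : R := 2 * y 0 0 * y 0 1 / nrm2 y ^+ 2.

Lemma inv_sqr y : y != 0 -> inv_re y ^+ 2 + inv_im y ^+ 2 = (nrm2 y ^+ 2)^-1.
Proof.
move=> /nrm2_gt0 q0; have q0' := gt_eqF q0; rewrite /inv_re /inv_im.
have e : (y 0 1 ^+ 2 - y 0 0 ^+ 2) ^+ 2 + (2 * y 0 0 * y 0 1) ^+ 2 = nrm2 y ^+ 2 by rewrite /nrm2; ring.
move: (nrm2 y) q0' e => q q0' e; rewrite ![(_ / q ^+ 2) ^+ 2]exprMn -mulrDl e.
by field; rewrite q0'.
Qed.

Lemma is_derive_plane_inv y (v : 'rV[R]_2) : y != 0 ->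
  is_derive (0 : R) 1 (fun t : R => plane_inv (y + t *: v))
    (\row_i (if i == 0 then inv_re y * v 0 0 - inv_im y * v 0 1 else inv_im y * v 0 0 + inv_re y * v 0 1)).
Proof.
move=> yn; have q0 := nrm2_gt0 yn.
have lin (c d : R) : is_derive (0 : R) 1 (fun t : R => c + t * d) d.
  have := is_deriveD (is_derive_cst (c : R^o) (0 : R) (1 : R)) (is_deriveZ d (is_derive_id (0 : R) (1 : R))).
  rewrite add0r [_ *: 1]mulr1; congr (is_derive _ _ _ _); apply/funext => t /=.
  by congr (_ + _); exact: mulrC.
have E0 t : (y + t *: v) 0 0 = y 0 0 + t * v 0 0 by rewrite !mxE.
have E1 t : (y + t *: v) 0 1 = y 0 1 + t * v 0 1 by rewrite !mxE.
pose q t := (y 0 0 + t * v 0 0) ^+ 2 + (y 0 1 + t * v 0 1) ^+ 2.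
have nE t : nrm2 (y + t *: v) = q t by rewrite /nrm2 E0 E1.
have dn : is_derive (0 : R) 1 q (2 * y 0 0 * v 0 0 + 2 * y 0 1 * v 0 1).
  have h0 := @is_derive1_comp R (fun x => x ^+ 2) (fun t => y 0 0 + t * v 0 0) 0 _ _ (is_derive_sq _) (lin _ _).
  have h1 := @is_derive1_comp R (fun x => x ^+ 2) (fun t => y 0 1 + t * v 0 1) 0 _ _ (is_derive_sq _) (lin _ _).
  by apply: is_derive_eq (is_deriveD h0 h1) _; rewrite !mul0r !addr0.
have n0 : q 0 = nrm2 y by rewrite /q !mul0r !addr0.
have ni : q 0 != 0 by rewrite n0 gt_eqF.
have di := @is_deriveV R q 0 _ 1 ni dn.
have q0' := gt_eqF q0.
apply: is_derive_rV => i; rewrite mxE.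
have [->|->] : i = 0 \/ i = 1 by case: i => [[|[|//]] hi]; [left|right]; apply/val_inj.
- rewrite (_ : (fun t => _) = fun t => (y 0 0 + t * v 0 0) * (q t)^-1); last first.
    by apply/funext => t; rewrite mxE/= E0 nE.
  apply: is_derive_eq (is_deriveM (lin _ _) di) _.
  rewrite /= n0 mul0r addr0 /inv_re /inv_im {1}[nrm2 y ^+ 2]expr2 -![_ *: _]/(_ * _).
  have e := erefl (nrm2 y); rewrite {2}/nrm2 in e.
  move: (y 0 0) (y 0 1) (v 0 0) (v 0 1) (nrm2 y) q0' e => c0 c1 d0 d1 q1 q0' e.
  have -> : q1^-1 * d0 = (c0 ^+ 2 + c1 ^+ 2) * d0 / q1 ^+ 2 by rewrite -e; field; rewrite q0'.
  by field; rewrite q0'.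
- rewrite (_ : (fun t => _) = fun t => - ((y 0 1 + t * v 0 1) * (q t)^-1)); last first.
    by apply/funext => t; rewrite mxE/= E1 nE.
  apply: is_derive_eq (is_deriveN (is_deriveM (lin _ _) di)) _.
  rewrite /= n0 mul0r addr0 /inv_re /inv_im {1}[nrm2 y ^+ 2]expr2 -![_ *: _]/(_ * _).
  have e := erefl (nrm2 y); rewrite {2}/nrm2 in e.
  move: (y 0 0) (y 0 1) (v 0 0) (v 0 1) (nrm2 y) q0' e => c0 c1 d0 d1 q1 q0' e.
  have -> : q1^-1 * d1 = (c0 ^+ 2 + c1 ^+ 2) * d1 / q1 ^+ 2 by rewrite -e; field; rewrite q0'.
  by field; rewrite q0'.
Qed.

End inversion.

Lemma sqrt_bilin_conformal (R : realType) (n : nat) (M : 'M[R]_n) (x y q : R) (v w : 'rV[R]_n) :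
  (forall v w, bilin M v w = bilin M w v) -> 0 < q -> x ^+ 2 + y ^+ 2 = (q ^+ 2)^-1 ->
  Num.sqrt (bilin M (x *: v + y *: w) (x *: v + y *: w) + bilin M (x *: w + y *: - v) (x *: w + y *: - v)) =
  Num.sqrt (bilin M v v + bilin M w w) / q.
Proof.
move=> Ms q0 xy; have <- : - y *: v + x *: w = x *: w + y *: - v by rewrite scalerN scaleNr addrC.
rewrite bilin_rot// xy sqrtrM ?invr_ge0 ?sqr_ge0// mulrC; congr (_ * _).
by rewrite -exprVn sqrtr_sqr ger0_norm// invr_ge0 ltW.
Qed.

Section density_bound.
Variables (R : realType) (n : nat) (X : tamed_manifold R n) (f : P1 R -> X).
Hypothesis Jf : Jhol f.
Let F := f \o @zcoord R.
Let G := f \o @wcoord R.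
Let JF : Jhol_local F. Proof. by case: Jf. Qed.
Let JG : Jhol_local G. Proof. by case: Jf. Qed.

Lemma dens_inversion (y : 'rV[R]_2) : y != 0 -> dens F y = dens G (plane_inv y) / nrm2 y.
Proof.
move=> yn; have q0 := nrm2_gt0 yn.
have FG z : z != 0 -> F z = G (plane_inv z) by move=> zn; rewrite /G /= wcoord_plane_inv.
pose c := chart_at (F y).
have ac : atlas c by exact: chart_at_atlas.
have cF : cdom c (F y) by exact: chart_at_dom.
have cG : cdom c (G (plane_inv y)) by rewrite -FG.
have near_n (v : 'rV[R]_2) : nbhs (0 : R) (fun t : R => y + t *: v != 0).
  have h : {for (0 : R), continuous (fun t : R => y + t *: v)} by exact: line_continuous.
  have y0 : 0 < `|y| by rewrite normr_gt0.
  move/cvgrPdist_lt/(_ _ y0) : h; apply: filterS => t; rewrite scale0r addr0.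
  by apply: contraPneq => ->; rewrite subr0 ltxx.
have dF (a : 'I_2) : dpartial c F a y = inv_re y *: dpartial c G a (plane_inv y) +
   inv_im y *: (if a == 0 then dpartial c G 1 (plane_inv y) else - dpartial c G 0 (plane_inv y)).
  apply/rowP => k; have [dG DG] := smooth_C1 [::] (Jhol_open JG ac) (Jhol_smooth JG ac k) cG.
  pose v : 'rV[R]_2 := delta_mx 0 a.
  have dc := @is_derive_coord _ _ _ _ _ k (dpartial_derive a JF ac cF).
  have dp := is_derive_plane_inv v yn.
  have dg' : differentiable (iter_partial [::] (fun z => cmap c (G z) 0 k)) (plane_inv (y + (0 : R) *: v)).
    by rewrite scale0r addr0.
  have h := chain_curve dg' dp.
  have e : nbhs (0 : R) (fun t : R => cmap c (G (plane_inv (y + t *: v))) 0 k = cmap c (F (y + t *: v)) 0 k).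
    by apply: filterS (near_n v) => t tn; rewrite FG.
  have h' := near_eq_is_derive e h.
  rewrite (is_derive_uniq dc h') scale0r addr0 DG sum2 ![in RHS]mxE/=.
  have ? : a = 0 \/ a = 1 by case: a {v dc dp dg' h e h'} => [[|[|//]] hi]; [left|right]; apply/val_inj.
  rewrite !mxE /v ?mxE/=.
  have gen (r i A B x y' : R) : x = A -> y' = B -> (r * 1 - i * 0) * A + (i * 1 + r * 0) * B = r * x + i * y'.
    by move=> -> ->; rewrite mulr0 mulr1 subr0 mulr0 addr0 mulr1.
  have gen' (r i A B x y' : R) : x = B -> y' = - A -> (r * 0 - i * 1) * A + (i * 0 + r * 1) * B = r * x + i * y'.
    by move=> -> ->; rewrite !mulr0 !mulr1 sub0r add0r mulrN mulNr addrC.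
  have [{dp dc dg' h e h' v}->|{dp dc dg' h e h' v}->] : a = 0 \/ a = 1 by [].
    by apply: gen => //=; rewrite mxE.
  by apply: gen' => //=; rewrite !mxE.
have im := chart_img cG.
rewrite /dens (energy_density_chart JF ac cF) (energy_density_chart JG ac cG) !sum2 !dF/=.
have -> : cmap c (F y) = cmap c (G (plane_inv y)) by rewrite FG.
exact: sqrt_bilin_conformal (metric_sym ac im) q0 (inv_sqr yn).
Qed.

(** Closed squares in the coordinates z and 1/z cover the sphere, and where |z| >= 1 the factor 1 /
    |z|^2 of [dens_inversion] is at most 1. The selection takes a supremum of the density and
    therefore needs it bounded. *)
Lemma dens_bounded : exists M, forall z, dens F z <= M.
Proof.
pose A := [set v : 'rV[R]_2 | forall i, `[-1, 1]%classic (v ord0 i)].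
have cA : compact A by exact: (@rV_compact R _ (fun=> `[-1, 1]%classic) (fun=> @segment_compact R _ _)).
have [M1 h1] := compact_bounded_above cA (fun y _ => dens_locally_bounded JF y).
have [M2 h2] := compact_bounded_above cA (fun y _ => dens_locally_bounded JG y).
exists (Num.max M1 M2) => z; have [Az|nAz] := pselect (A z); first by rewrite le_max h1.
have n1 : 1 <= nrm2 z.
  apply: contra_notT nAz; rewrite -ltNge => z1 i.
  rewrite /= in_itv /= -ler_norml -ler_sqr ?nnegrE// real_normK ?num_real// expr1n (le_trans _ (ltW z1))//.
  by have [->|->] : i = 0 \/ i = 1 by [case: i => [[|[|//]] hi]; [left|right]; apply/val_inj]; rewrite /nrm2 ?lerDl ?lerDr sqr_ge0.
have zn : z != 0 by apply: contraTneq n1 => ->; rewrite /nrm2 !mxE expr0n addr0 -ltNge.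
rewrite dens_inversion//; apply: (@le_trans _ _ (dens G (plane_inv z))).
  by rewrite ler_pdivrMr ?nrm2_gt0// ler_peMr ?dens_ge0.
rewrite le_max h2 ?orbT// => i; rewrite /= in_itv /= -ler_norml -ler_sqr ?nnegrE// real_normK ?num_real// expr1n.
have le1 : nrm2 (plane_inv z) <= 1 by rewrite nrm2_plane_inv// invf_le1// nrm2_gt0.
apply: le_trans le1; by have [->|->] : i = 0 \/ i = 1 by [case: i => [[|[|//]] hi]; [left|right]; apply/val_inj]; rewrite /nrm2 ?lerDl ?lerDr sqr_ge0.
Qed.

End density_bound.

Lemma seq_argmin (R : realType) (T : eqType) (s : seq T) (f : T -> R) : s != [::] ->
  exists2 x, x \in s & forall y, y \in s -> f x <= f y.
Proof.
elim: s => [//|a s IH] _; have [->|/IH[x xs xmin]] := eqVneq s [::].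
  by exists a; rewrite ?mem_head// => y; rewrite inE => /eqP->.
have [ax|xa] := leP (f a) (f x).
  exists a; rewrite ?mem_head// => y; rewrite inE => /orP[/eqP->//|/xmin].
  exact: le_trans.
exists x; first by rewrite inE xs orbT.
by move=> y; rewrite inE => /orP[/eqP->|/xmin//]; exact: ltW.
Qed.

Section density_of_pairs.
Variables (R : realType).
Implicit Types p q z : 'rV[R]_2.

(* Up to constants, the conformal factor at [z] of the round metric for which
   [p], [q] and infinity are in standard position. *)
Definition rho p q z : R := len (p - q) / (len (z - p) ^+ 2 + len (z - q) ^+ 2 + len (p - q) ^+ 2).

Lemma rho_ge0 p q z : 0 <= rho p q z.
Proof. by rewrite divr_ge0 ?len_ge0// !addr_ge0 ?sqr_ge0. Qed.

Lemma rho_lower p q z (c d : R) : 0 < len (p - q) -> 0 < c -> len (z - p) ^+ 2 + len (z - q) ^+ 2 + len (p - q) ^+ 2 <= c * d ->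
  len (p - q) <= c * d * rho p q z.
Proof.
move=> pq0 c0 h; rewrite /rho mulrA ler_pdivlMr; last first.
  by rewrite ltr_wpDl ?exprn_gt0// addr_ge0 ?sqr_ge0.
by rewrite mulrC ler_wpM2r// ltW.
Qed.

End density_of_pairs.

(** A mark at distance eps / e(p) records the size of the bubble at [p]: with [p], its tip and
    infinity in standard position the bubble has bounded scale. *)
Definition bubble_tip (R : realType) (e : 'rV[R]_2 -> R) (eps : R) (p : 'rV[R]_2) : 'rV[R]_2 :=
  p + (eps / e p) *: delta_mx 0 0.
Definition marked_points (R : realType) (e : 'rV[R]_2 -> R) (eps : R) (P : seq 'rV[R]_2) : seq 'rV[R]_2 :=
  P ++ map (bubble_tip e eps) P.

Lemma tip_len (R : realType) (e : 'rV[R]_2 -> R) (eps : R) p : 0 < eps -> 0 < e p ->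
  len (p - bubble_tip e eps p) = eps / e p.
Proof.
move=> eps0 p0; rewrite /bubble_tip opprD addrA subrr add0r lenN lenZ gtr0_norm ?divr_gt0//.
have -> : len (delta_mx 0 0 : 'rV[R]_2) = 1 by rewrite /len /nrm2 !mxE/= expr1n expr0n addr0 sqrtr1.
by rewrite mulr1.
Qed.

(** Let [p] be the selected point nearest to [z], at distance [d]. If [d] is small against the scale
    [s] of the bubble, [p] is paired with its tip. If a marked point [q] has distance between d/10
    and 10 d from [p], it is paired with [p], since e(z) d <= eps. Otherwise [z] lies in an annulus
    about [p] without marked points, where e(y) |y - p| <= 2 eps. The two terms of the annulus
    estimate are then bounded by [rho] for [p] and the outermost marked point [qa] inside, and for
    [p] and the innermost one [qb] outside. *)
Lemma dens_le_rho (R : realType) (e : 'rV[R]_2 -> R) (eps mu0 K : R) (P : seq 'rV[R]_2) :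
  0 < eps -> 0 < K ->
  (forall (a : 'rV[R]_2) (r1 r2 : R), 0 < r1 ->
    (forall y, r1 < len (y - a) < r2 -> e y * len (y - a) <= mu0) ->
    forall z, r1 < len (z - a) < r2 -> e z <= K * (r2^-1 + r1 / len (z - a) ^+ 2)) ->
  2 * eps <= mu0 -> admissible e eps P ->
  (forall z, 0 < e z -> exists2 p, p \in P & e z * len (z - p) < eps) -> P != [::] ->
  forall z, exists p q, [/\ p \in marked_points e eps P, q \in marked_points e eps P, p != q &
  e z <= (12 * K + 2220 * eps) * rho p q z].
Proof.
move=> eps0 K0 annulus eps_mu admP ctrl Pn z.
pose marked_points := marked_points e eps P; pose bubble_tip := bubble_tip e eps.
rewrite -/marked_points.
have [_ Pgt P2 _] := admP.
have c1 : 0 < 2220 :> R by rewrite ltr0n.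
have c2 : 0 < 12 :> R by rewrite ltr0n.
have C0 : 0 < 12 * K + 2220 * eps := addr_gt0 (mulr_gt0 c2 K0) (mulr_gt0 c1 eps0).
have [p pP pmin] := @seq_argmin R _ P (fun p => len (z - p)) Pn.
have p0 := Pgt p pP; have [s sE] : {s : R | s = eps / e p} by exists (eps / e p).
have s0 : 0 < s by rewrite sE divr_gt0.
have pQ : p \in marked_points by rewrite mem_cat pP.
have tQ : bubble_tip p \in marked_points by rewrite mem_cat map_f ?orbT.
have pt : len (p - bubble_tip p) = s by rewrite sE; exact: tip_len.
have ne q : 0 < len (p - q) -> p != q by rewrite len_gt0 subr_eq0.
have PQ q : q \in P -> q \in marked_points by rewrite mem_cat => ->.
have finish q (x : R) : q \in marked_points -> 0 < len (p - q) -> x <= 12 * K + 2220 * eps ->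
   e z <= x * rho p q z -> exists p q, [/\ p \in marked_points, q \in marked_points, p != q &
  e z <= (12 * K + 2220 * eps) * rho p q z].
  move=> qQ pq xle ez; exists p, q; split => //; first exact: ne.
  by apply: le_trans ez _; rewrite ler_wpM2r// rho_ge0.
have [ez|ez] := leP (e z) 0.
  apply: (finish (bubble_tip p) (12 * K + 2220 * eps)) => //; first by rewrite pt.
  exact: le_trans ez (mulr_ge0 (ltW C0) (rho_ge0 _ _ _)).
have [d dE] : {d : R | d = len (z - p)} by exists (len (z - p)).
have d0 : 0 <= d by rewrite dE; exact: len_ge0.
have near y : 0 < e y -> (forall q, q \in P -> len (y - p) / 2 <= len (y - q)) -> e y * len (y - p) <= 2 * eps.
  move=> ey0 h; have [q qP lt] := ctrl _ ey0; have := h q qP.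
  rewrite ler_pdivrMr// => h'; apply: (@le_trans _ _ (e y * (len (y - q) * 2))).
    by rewrite ler_wpM2l// ltW.
  by rewrite mulrA mulrC ler_pM2l// ltW.
have ezd : e z * d <= eps.
  have [q qP lt] := ctrl _ ez; apply/ltW; apply: le_lt_trans lt.
  by rewrite ler_wpM2l ?(ltW ez)// dE pmin.
have tri q : len (z - q) <= d + len (p - q) by rewrite dE; exact: len_tri.
have K1 : 0 <= K * 12 := mulr_ge0 (ltW K0) (ltW c2).
have E1 : 0 <= eps by exact: ltW.
have sq_le (x y : R) : 0 <= x -> x <= y -> x ^+ 2 <= y ^+ 2.
  by move=> x0 xy; rewrite lerXn2r ?nnegrE// (le_trans x0).
have [ds|ds] := leP d (s / 10).
  have e2 : e z <= 2 * e p.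
    apply: P2 => //; rewrite -dE (le_trans ds)// (_ : eps / (4 * e p) = s / 4); last by rewrite sE; field; rewrite gt_eqF.
    by move: s0; clear; move=> *; lra.
  apply: (finish (bubble_tip p) (6 * eps)) => //; [by rewrite pt|by move: K1 E1; clear; move=> *; lra|].
  have h : len (p - bubble_tip p) <= 3 * s ^+ 2 * rho p (bubble_tip p) z.
    apply: rho_lower; [by rewrite pt|by rewrite ltr0n|].
    rewrite pt -dE; have := sq_le _ _ d0 ds; have := tri (bubble_tip p); rewrite pt => h1.
    have h2 : len (z - bubble_tip p) <= 11 / 10 * s by move: h1 ds; clear; move=> *; lra.
    have := sq_le _ _ (len_ge0 _) h2; rewrite !exprMn; have := sqr_ge0 s; move: (s ^+ 2) (d ^+ 2) (len _ ^+ 2) => a b c.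
    by clear; move=> *; lra.
  rewrite pt in h; rewrite (le_trans e2)//.
  have ep : e p = eps / s by rewrite sE; field; rewrite !gt_eqF.
  rewrite ep -(ler_pM2r s0) (_ : 2 * (eps / s) * s = 2 * eps); last by field; rewrite gt_eqF.
  have h3 : s * 1 <= s * (3 * s * rho p (bubble_tip p) z).
    by rewrite mulr1 (le_trans h)// le_eqVlt; apply/orP; left; apply/eqP; ring.
  rewrite ler_pM2l// in h3.
  have := ler_wpM2l E1 h3; move: (rho _ _ _) => r; rewrite mulr1 => h4.
  by rewrite (_ : 6 * eps * r * s = 2 * (eps * (3 * s * r))); [move: h4; clear; move=> *; lra|ring].
have d1 : 0 < d by apply: lt_trans ds; rewrite divr_gt0.
have dd : 0 < d ^+ 2 by rewrite exprn_gt0.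
have [[q [qQ q1 q2]]|nocomp] := EM (exists q, [/\ q \in marked_points, d / 10 <= len (p - q) & len (p - q) <= 10 * d]).
  have pq0 : 0 < len (p - q) by apply: lt_le_trans q1; rewrite divr_gt0.
  apply: (finish q (2220 * eps)) => //; first by move: K1; clear; move=> *; lra.
  (* In units of d the three distances in the denominator of [rho] are at most 1, 11 and 10, and 1 +
     121 + 100 = 222. The lower bound d / 10 of |p - q| then turns 222 into 2220. *)
  have h : len (p - q) <= 222 * d ^+ 2 * rho p q z.
    apply: rho_lower; [by []|by rewrite ltr0n|]; rewrite -dE.
    have h1 : len (z - q) <= 11 * d by have := tri q; move: q2; clear; move=> *; lra.
    have := sq_le _ _ (len_ge0 _) h1; have := sq_le _ _ (ltW pq0) q2; rewrite !exprMn.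
    by move: dd; move: (d ^+ 2) (len _ ^+ 2) (len _ ^+ 2) => a b c; clear; move=> *; lra.
  have h2 : d * 1 <= d * (2220 * d * rho p q z).
    rewrite mulr1; have := le_trans q1 h => h3; apply: (@le_trans _ _ (10 * (222 * d ^+ 2 * rho p q z))).
      by move: h3; clear; move=> *; lra.
    by rewrite le_eqVlt; apply/orP; left; apply/eqP; ring.
  rewrite ler_pM2l// in h2; rewrite -(ler_pM2r d1) (le_trans ezd)//.
  by have := ler_wpM2l E1 h2; rewrite mulr1 => /le_trans; apply; rewrite le_eqVlt; apply/orP; left; apply/eqP; ring.
have sep q : q \in marked_points -> len (p - q) < d / 10 \/ 10 * d < len (p - q).
  move=> qQ; have [|h1] := ltP (len (p - q)) (d / 10); first by left.
  by have [h2|] := leP (len (p - q)) (10 * d); [case: nocomp; exists q|right].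
pose small := [seq q <- marked_points | len (p - q) < d / 10].
have ts : bubble_tip p \in small.
  rewrite mem_filter tQ andbT; case: (sep _ tQ) => //; rewrite pt => h.
  by move: h ds d1; clear; move=> *; lra.
have [|qa qas qamax] := @seq_argmin R _ small (fun q => - len (p - q)); first by case: small ts.
move: qas; rewrite mem_filter => /andP[ra qaQ]; have [r rE] : {r : R | r = len (p - qa)} by exists (len (p - qa)).
rewrite -rE in ra qamax.
have r_max q : q \in marked_points -> len (p - q) < d / 10 -> len (p - q) <= r.
  by move=> qQ h; have := qamax q; rewrite mem_filter h qQ lerN2; apply.
have r0 : 0 < r by apply: lt_le_trans (r_max (bubble_tip p) tQ _); [rewrite pt|move: ts; rewrite mem_filter => /andP[]].
have ha : r / d ^+ 2 <= 3 * rho p qa z.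
  rewrite ler_pdivrMr// mulrAC {1}rE; apply: rho_lower; [by rewrite -rE|by rewrite ltr0n|]; rewrite -dE -rE.
  have h1 : len (z - qa) <= 11 / 10 * d by have := tri qa; rewrite -rE; move: ra; clear; move=> *; lra.
  have := sq_le _ _ (len_ge0 _) h1; have := sq_le _ _ (ltW r0) (ltW ra); rewrite !exprMn.
  by move: dd; move: (d ^+ 2) (len _ ^+ 2) (r ^+ 2) => a b c; clear; move=> *; lra.
pose big := [seq q <- marked_points | 10 * d < len (p - q)].
have [bign|bign] := eqVneq big [::].
  (* With no marked point outside, the outer radius is free; this choice makes both terms of the
     estimate multiples of r / d^2. *)
  have := annulus p (2 * r) (d ^+ 2 / r).
  rewrite mulr_gt0// => /(_ isT)/(_ _ z)/wrap[y /andP[y1 y2]|].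
    have [ey|ey] := leP (e y) 0.
      by apply: le_trans (_ : 0 <= _); [rewrite mulr_le0_ge0 ?len_ge0|apply: le_trans eps_mu; rewrite mulr_ge0].
    apply: le_trans eps_mu; apply: near => // q qP.
    have qr : len (p - q) <= r.
      case: (sep q (PQ q qP)) => [|h]; first by apply: r_max; exact: PQ.
      suff : q \in big by rewrite bign.
      by rewrite mem_filter h PQ.
    have := len_tri y q p; rewrite (lenB q p); move: y1 qr; clear; move=> *; lra.
  rewrite -dE => h; apply: (finish qa (12 * K)) => //; [by rewrite -rE|by move: E1; clear; move=> *; lra|].
  apply: le_trans (h _) _.
    apply/andP; split; first by move: ra d1; clear; move=> *; lra.
    by rewrite ltr_pdivlMr// expr2 ltr_pM2l//; move: ra d1; clear; move=> *; lra.
  rewrite invf_div [12 * K]mulrC -[leRHS]mulrA ler_wpM2l ?(ltW K0)// -mulrA.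
  by have := rho_ge0 p qa z; move: ha; move: (r / _) (rho _ _ _) => u1 u2; clear; move=> *; lra.
have [qb qbs qbmin] := @seq_argmin R _ big (fun q => len (p - q)) bign.
move: qbs; rewrite mem_filter => /andP[rb qbQ]; have [r' r'E] : {r' : R | r' = len (p - qb)} by exists (len (p - qb)).
rewrite -r'E in rb qbmin.
have r'0 : 0 < r' by apply: lt_trans rb; rewrite mulr_gt0.
have hb : r'^-1 <= 3 * rho p qb z.
  rewrite -(ler_pM2l (exprn_gt0 2 r'0)) expr2 mulfK ?gt_eqF// mulrAC {1}r'E.
  rewrite (_ : r' * _ * r' = 3 * r' ^+ 2 * rho p qb z); last by ring.
  apply: rho_lower; [by rewrite -r'E|by rewrite ltr0n|]; rewrite -dE -r'E.
  have h1 : len (z - qb) <= 11 / 10 * r' by have := tri qb; rewrite -r'E; move: rb; clear; move=> *; lra.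
  have h2 : d <= r' / 10 by move: rb; clear; move=> *; lra.
  have := sq_le _ _ (len_ge0 _) h1; have := sq_le _ _ d0 h2; rewrite !exprMn; have := sqr_ge0 r'.
  by move: (d ^+ 2) (len _ ^+ 2) (r' ^+ 2) => a b c; clear; move=> *; lra.
have := annulus p (2 * r) (r' / 2).
rewrite mulr_gt0// => /(_ isT)/(_ _ z)/wrap[y /andP[y1 y2]|].
  have [ey|ey] := leP (e y) 0.
    by apply: le_trans (_ : 0 <= _); [rewrite mulr_le0_ge0 ?len_ge0|apply: le_trans eps_mu; rewrite mulr_ge0].
  apply: le_trans eps_mu; apply: near => // q qP.
  have t1 := len_tri y q p; have t2 := len_tri p y q; rewrite (lenB p y) in t2; rewrite (lenB q p) in t1.
  case: (sep q (PQ q qP)) => h.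
    by have := r_max q (PQ q qP) h; move: y1 t1; clear; move=> *; lra.
  have : r' <= len (p - q) by apply: qbmin; rewrite mem_filter h PQ.
  by have := len_ge0 (y - p); move: y2 t2; clear; move=> *; lra.
rewrite -dE => h; have {}h : e z <= K * (2 / r' + 2 * r / d ^+ 2).
  apply: le_trans (h _) _; last by rewrite invf_div.
  by apply/andP; split; move: ra rb d1; clear; move=> *; lra.
have [ab|ba] := leP (rho p qa z) (rho p qb z).
- apply: (finish qb (12 * K)) => //; [by rewrite -r'E|by move: E1; clear; move=> *; lra|].
  apply: le_trans h _; rewrite [12 * K]mulrC -[leRHS]mulrA ler_wpM2l ?(ltW K0)// -mulrA.
  by move: ab ha hb; move: (r / _) (r'^-1) (rho _ _ _) (rho _ _ _) => u1 u2 u3 u4; clear; move=> *; lra.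
- apply: (finish qa (12 * K)) => //; [by rewrite -rE|by move: E1; clear; move=> *; lra|].
  apply: le_trans h _; rewrite [12 * K]mulrC -[leRHS]mulrA ler_wpM2l ?(ltW K0)// -mulrA.
  by move: ba ha hb; move: (r / _) (r'^-1) (rho _ _ _) (rho _ _ _) => u1 u2 u3 u4; clear; move=> *; lra.
Qed.

(** * Paths and chords *)

Section planar_paths.
Variables (R : realType).
Implicit Types p q v w x y : 'rV[R]_2.

Definition cross v w : R := v 0 0 * w 0 1 - v 0 1 * w 0 0.

Lemma cross_le v w : `|cross v w| <= len v * len w.
Proof.
rewrite -ler_sqr ?nnegrE ?mulr_ge0 ?len_ge0// real_normK ?num_real// exprMn !len_sqr /cross /nrm2.
have := sqr_ge0 (v 0 0 * w 0 0 + v 0 1 * w 0 1).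
move: (v 0 0) (v 0 1) (w 0 0) (w 0 1) => a b c d h; rewrite -subr_ge0.
by rewrite (_ : _ - _ = (a * c + b * d) ^+ 2)//; ring.
Qed.

(* The ray from the origin in direction [v] leaves the direction of [u] fast
   enough, for all but one direction [v] in a family of separated directions. *)
Lemma two_bad_rays (v v' u : 'rV[R]_2) (h k D s s' : R) :
  0 < h -> len v <= h -> len v' <= h -> D * h ^+ 2 <= `|cross v v'| -> 0 < k -> k <= 1 -> 8 * k <= D ->
  0 <= s -> 0 <= s' -> len (s *: v - u) < k / 2 * len u -> len (s' *: v' - u) < k / 2 * len u -> False.
Proof.
move=> h0 vh vh' cr k0 k1 kD s0 s'0 b1 b2.
have u0 : 0 < len u.
  by have := le_lt_trans (len_ge0 _) b1; rewrite pmulr_rgt0// divr_gt0.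
have low (t : R) (z : 'rV[R]_2) : 0 <= t -> len z <= h -> len (t *: z - u) < k / 2 * len u -> len u / 2 <= t * h.
  move=> t0 zh b; apply: (@le_trans _ _ (len (t *: z))); last by rewrite lenZ ger0_norm// ler_wpM2l.
  have := len_tri (t *: z) u 0; have := len_tri u (t *: z) 0; rewrite !subr0 (lenB u) => h1 h2.
  have kk : k / 2 * len u <= 2^-1 * len u.
    by rewrite ler_wpM2r ?len_ge0//; move: k1; move=> *; lra.
  move: kk.
  by move: h1 b u0; move=> *; lra.
have l1 := low _ _ s0 vh b1; have l2 := low _ _ s'0 vh' b2.
have cE : s * s' * cross v v' = cross u (s' *: v' - u) + cross (s *: v - u) u + cross (s *: v - u) (s' *: v' - u).
  rewrite /cross !mxE; move: (v 0 0) (v 0 1) (v' 0 0) (v' 0 1) (u 0 0) (u 0 1) => a b c d e f.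
  by ring.
have kl : k / 2 * len u <= len u by rewrite ler_piMl ?(ltW u0)// ler_pdivrMr// mul1r (le_trans k1)// ler1n.
have up : `|s * s' * cross v v'| < 3 * (k / 2) * len u ^+ 2.
  have c1 : `|cross u (s' *: v' - u)| < len u * (k / 2 * len u).
    by apply: le_lt_trans (cross_le _ _) _; rewrite ltr_pM2l.
  have c2 : `|cross (s *: v - u) u| < (k / 2 * len u) * len u.
    by apply: le_lt_trans (cross_le _ _) _; rewrite ltr_pM2r.
  have c3 : `|cross (s *: v - u) (s' *: v' - u)| <= (k / 2 * len u) * len u.
    by apply: le_trans (cross_le _ _) _; apply: ler_pM; rewrite ?len_ge0 ?(ltW b1)// (le_trans (ltW b2)).
  rewrite cE; have := ler_normD (cross u (s' *: v' - u) + cross (s *: v - u) u) (cross (s *: v - u) (s' *: v' - u)).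
  have := ler_normD (cross u (s' *: v' - u)) (cross (s *: v - u) u).
  rewrite (_ : 3 * (k / 2) * len u ^+ 2 = len u * (k / 2 * len u) + k / 2 * len u * len u + k / 2 * len u * len u); last by ring.
  by move: c1 c2 c3; move: (len u * _) (k / 2 * _ * _) `|_ + _| `|_ + _| `|_| `|_| `|_| => a1 a2 a3 a4 a5 a6 a7; move=> *; lra.
have lo : 2 * k * len u ^+ 2 <= `|s * s' * cross v v'|.
  rewrite normrM ger0_norm ?mulr_ge0//.
  apply: (@le_trans _ _ (s * s' * (D * h ^+ 2))); last by rewrite ler_wpM2l// mulr_ge0.
  rewrite (_ : s * s' * _ = D * ((s * h) * (s' * h))); last by ring.
  apply: (@le_trans _ _ (8 * k * (len u / 2 * (len u / 2)))).
    by rewrite le_eqVlt; apply/orP; left; apply/eqP; field.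
  have u2 : 0 <= len u / 2 by rewrite divr_ge0// ltW.
  apply: ler_pM => //; [by rewrite mulr_ge0// ltW|by rewrite mulr_ge0|exact: ler_pM].
have := le_lt_trans lo up; rewrite ltr_pM2r ?exprn_gt0//.
by move: k0; move=> *; lra.
Qed.

Section choice_of_midpoint.
Variables (x x' : 'rV[R]_2) (Q : seq 'rV[R]_2).
Hypothesis xx : x != x'.
Let w := x' - x.
Let h := len w.
Let h0 : 0 < h. Proof. by rewrite len_gt0 subr_eq0 eq_sym. Qed.
Let N := (size Q).*2.+1.

(** Rays from the same endpoint to two different candidates have a cross product of at least h^2 /
    (4 N), and [two_bad_rays] asks for 8 times the clearance to be at most 1 / (4 N). *)
Definition clearance : R := (32 * N%:R)^-1.

Let N0 : 0 < N%:R :> R. Proof. by rewrite ltr0n. Qed.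

Lemma clearance_gt0 : 0 < clearance.
Proof. by rewrite invr_gt0 mulr_gt0 ?ltr0n. Qed.

Lemma clearance_le1 : clearance <= 1.
Proof.
rewrite invf_le1 ?mulr_gt0 ?ltr0n//; apply: (@le_trans _ _ (32 * 1)); first by rewrite mulr1 ler1n.
by rewrite ler_pM2l ?ltr0n// ler1n.
Qed.

Let t_ (j : 'I_N) : R := j%:R / (2 * N%:R).
Let y_ j : 'rV[R]_2 := x + 2^-1 *: w + t_ j *: rot w.
Let end_ (b : bool) := if b then x else x'.
Let sg (b : bool) : R := if b then 1 else - 1.

Let t_ge0 j : 0 <= t_ j. Proof. by rewrite divr_ge0// mulr_ge0. Qed.
Let t_le j : t_ j <= 2^-1.
Proof. by rewrite /t_ invfM mulrA mulrAC ler_piMl// ler_pdivrMr// mul1r ler_nat ltnW. Qed.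

Let dirE b j : y_ j - end_ b = (sg b / 2) *: w + t_ j *: rot w.
Proof.
rewrite /y_ /end_ /sg /w; by case: b; apply/rowP => i; rewrite !mxE; field.
Qed.

Let dir_len b j : h / 2 <= len (y_ j - end_ b) /\ len (y_ j - end_ b) <= h.
Proof.
rewrite dirE /len nrm2_comb (_ : (sg b / 2) ^+ 2 = 4^-1); last by rewrite /sg; case: b; field.
have E : nrm2 w = h ^+ 2 by rewrite -len_sqr.
rewrite E sqrtrM ?addr_ge0 ?sqr_ge0// sqrtr_sqr (gtr0_norm h0) [h / 2]mulrC ler_pM2r// ger_pMl//.
have hf : 0 <= 2^-1 :> R by [].
have tt : t_ j ^+ 2 <= 4^-1.
  by rewrite (_ : 4^-1 = 2^-1 ^+ 2); [rewrite lerXn2r ?nnegrE|field].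
split.
  rewrite -[leLHS]ger0_norm// -sqrtr_sqr ler_wsqrtr// (_ : 2^-1 ^+ 2 = 4^-1); last by field.
  by rewrite lerDl sqr_ge0.
by rewrite -[leRHS]sqrtr1 ler_wsqrtr//; move: tt; move=> *; lra.
Qed.

Let bad j b q := exists s, 0 <= s <= 1 /\ len (end_ b + s *: (y_ j - end_ b) - q) < clearance / 2 * len (end_ b - q).

Let bad_unique b q (j k : 'I_N) : bad j b q -> bad k b q -> j = k.
Proof.
move=> [s [/andP[s0 s1] bj]] [s' [/andP[s'0 s'1] bk]]; apply/eqP; apply: contrapT => /negP jk.
have [_ l1] := dir_len b j; have [_ l2] := dir_len b k.
have E (t : R) (v : 'rV[R]_2) : end_ b + t *: v - q = t *: v - (q - end_ b).
  by apply/rowP => i; rewrite !mxE; ring.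
rewrite E (lenB (end_ b)) in bj; rewrite E (lenB (end_ b)) in bk.
have c8 : 8 * clearance <= (4 * N%:R)^-1.
  by rewrite le_eqVlt /clearance; apply/orP; left; apply/eqP; field; rewrite gt_eqF.
apply: (two_bad_rays h0 l1 l2 _ clearance_gt0 clearance_le1 c8 s0 s'0 bj bk).
rewrite !dirE; have -> : cross (sg b / 2 *: w + t_ j *: rot w) (sg b / 2 *: w + t_ k *: rot w) = sg b / 2 * (t_ k - t_ j) * h ^+ 2.
  rewrite /h len_sqr /cross /nrm2 !mxE/=; move: (w 0 0) (w 0 1) (t_ j) (t_ k) (sg b) => a1 a2 a3 a4 a5.
  by field.
rewrite normrM [`|h ^+ 2|]ger0_norm ?sqr_ge0// ler_wpM2r ?sqr_ge0// normrM normf_div (_ : `|sg b| = 1); last first.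
  by rewrite /sg; case: b {l1 l2 E bj bk}; rewrite ?normrN normr1.
rewrite normr_nat /t_ -mulrBl [`|_ / _|]normrM [X in _ * (_ * X)]ger0_norm ?invr_ge0 ?mulr_ge0 ?(ltW N0)//.
have : 1 <= `|k%:R - j%:R : R|.
  have le1 (m n : nat) : (m < n)%N -> 1 <= `|n%:R - m%:R : R|.
    by move=> mn; rewrite -natrB ?(ltnW mn)// normr_nat ler1n subn_gt0.
  have : (j : nat) != k by [].
  by rewrite neq_ltn => /orP[/le1//|/le1]; rewrite distrC.
move: `|_ - _| => d d1; rewrite invfM mulrA.
have -> : 1 / 2 * d / (2 * N%:R) = 4^-1 * d / N%:R by field; rewrite gt_eqF.
by rewrite ler_wpM2r ?invr_ge0 ?(ltW N0)// ler_peMr.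
Qed.

(** Pigeonhole: there are 2 |Q| + 1 candidates on the perpendicular bisector of [x] and [x'], and
    each pair of an endpoint and a point of [Q] rules out at most one of them. *)
Lemma good_midpoint : exists y : 'rV[R]_2, forall b : bool, let a := if b then x else x' in
  [/\ len (x' - x) / 2 <= len (y - a), len (y - a) <= len (x' - x) &
  forall q, q \in Q -> forall s, 0 <= s <= 1 -> clearance / 2 * len (a - q) <= len (a + s *: (y - a) - q)].
Proof.
have [j hj] : exists j : 'I_N, forall b q, q \in Q -> ~ bad j b q.
  apply: contrapT => no.
  have all (j : 'I_N) : exists bi : bool * 'I_(size Q), bad j bi.1 (nth 0 Q bi.2).
    apply: contrapT => nb; apply: no; exists j => b q qQ bq; apply: nb.
    have iQ : (index q Q < size Q)%N by rewrite index_mem.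
    by exists (b, Ordinal iQ); rewrite /= nth_index.
  have [F hF] := choice all.
  have inj : injective F by move=> j k jk; apply: bad_unique (hF j) _; rewrite jk; exact: hF.
  by have := leq_card F inj; rewrite card_prod card_bool !card_ord /N mul2n ltnn.
exists (y_ j) => b /=; have [l1 l2] := dir_len b j; split => // q qQ s s01.
by rewrite leNgt; apply/negP => lt; apply: (hj b q qQ); exists s.
Qed.

End choice_of_midpoint.
End planar_paths.

Section chord_bound.
Variables (R : realType).
Implicit Types p q v x y z : 'rV[R]_2.

Definition spread2 p q z : R := len (z - p) ^+ 2 + len (z - q) ^+ 2 + len (p - q) ^+ 2.

Lemma spread2_ge0 p q z : 0 <= spread2 p q z.
Proof. by rewrite !addr_ge0 ?sqr_ge0. Qed.

Lemma spread2_gt0 p q z : p != q -> 0 < spread2 p q z.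
Proof. by move=> pq; rewrite ltr_wpDl ?addr_ge0 ?sqr_ge0// exprn_gt0// len_gt0 subr_eq0. Qed.

Lemma sqrD_ge (a b : R) : 0 <= a -> 0 <= b -> a ^+ 2 + b ^+ 2 <= (a + b) ^+ 2.
Proof. by move=> a0 b0; have := mulr_ge0 a0 b0; rewrite sqrrD => ?; lra. Qed.

Lemma sqr_mono (a b : R) : 0 <= a -> a <= b -> a ^+ 2 <= b ^+ 2.
Proof. by move=> a0 ab; rewrite lerXn2r ?nnegrE// (le_trans a0). Qed.

(** The clearance keeps [spread2] at least c^2 times its value at [a], and also of the order of the
    square of the distance travelled, because the segment cannot come back to [p]. The two bounds
    combine with the factor 2 * 1 + 2 * 4 = 10. *)
Lemma rho_on_segment (a v p q : 'rV[R]_2) (c s : R) : 0 < c -> c <= 1 -> 0 <= s -> p != q ->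
  (forall r, r = p \/ r = q -> c * len (a - r) <= len (a + s *: v - r)) ->
  rho p q (a + s *: v) <= 10 * len (p - q) / (c ^+ 2 * (Num.sqrt (spread2 p q a) + s * len v) ^+ 2).
Proof.
move=> c0 c1 s0 pq h; set z := a + s *: v.
have D0 : 0 < Num.sqrt (spread2 p q a) by rewrite sqrtr_gt0 spread2_gt0.
have DD : Num.sqrt (spread2 p q a) ^+ 2 = spread2 p q a by rewrite sqr_sqrtr// spread2_ge0.
set D := Num.sqrt _ in D0 DD *.
have sl : 0 <= s * len v by rewrite mulr_ge0 ?len_ge0.
have S0 : 0 < spread2 p q z by exact: spread2_gt0.
have T0 : 0 < c ^+ 2 * (D + s * len v) ^+ 2 by rewrite mulr_gt0 ?exprn_gt0// ltr_pwDl.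
rewrite /rho -/(spread2 p q z) ler_pdivrMr// mulrAC ler_pdivlMr// mulrC.
rewrite mulrC [10 * _]mulrC -[leRHS]mulrA ler_wpM2l ?len_ge0//.
have sq r : r = p \/ r = q -> c ^+ 2 * len (a - r) ^+ 2 <= len (z - r) ^+ 2.
  by move=> hr; rewrite -exprMn sqr_mono ?mulr_ge0 ?len_ge0 ?(ltW c0)// h.
have s1 : c ^+ 2 * D ^+ 2 <= spread2 p q z.
  rewrite DD /spread2 !mulrDr; apply: lerD; first by apply: lerD; apply: sq; [left|right].
  by rewrite ler_piMl ?sqr_ge0// expr_le1// ltW.
have s2 : c ^+ 2 * (s * len v) ^+ 2 <= 4 * spread2 p q z.
  apply: (@le_trans _ _ ((2 * len (z - p)) ^+ 2)).
    rewrite -exprMn; apply: sqr_mono; first exact: (mulr_ge0 (ltW c0) sl).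
    have t : s * len v <= len (z - p) + len (a - p).
      have -> : s * len v = len (z - a) by rewrite /z addrC addKr lenZ ger0_norm.
      by apply: le_trans (len_tri _ p _) _; rewrite (lenB p).
    have t1 := ler_wpM2l (ltW c0) t; rewrite mulrDr in t1.
    have t2 : c * len (z - p) <= len (z - p) by rewrite ler_piMl ?len_ge0.
    have t3 := h p (or_introl erefl); rewrite -/z in t3.
    by move: t1 t2 t3; move=> *; lra.
  rewrite exprMn /spread2; have := sqr_ge0 (len (z - q)); have := sqr_ge0 (len (p - q)).
  rewrite (_ : 2 ^+ 2 = 4); last by rewrite expr2 -natrM.
  by move: (len (z - p) ^+ 2) (len (z - q) ^+ 2) (len (p - q) ^+ 2) => u1 u2 u3; move=> *; lra.
have s3 := ler_wpM2l (sqr_ge0 c) (sqrD_le D (s * len v)).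
have s4 : c ^+ 2 * (D + s * len v) ^+ 2 <= 2 * (c ^+ 2 * D ^+ 2) + 2 * (c ^+ 2 * (s * len v) ^+ 2).
  by apply: le_trans s3 _; rewrite le_eqVlt; apply/orP; left; apply/eqP; ring.
by move: s1 s2 s4; move=> *; lra.
Qed.

Variables (n : nat) (X : tamed_manifold R n) (F : 'rV[R]_2 -> X) (Q : seq 'rV[R]_2) (C : R).
Hypothesis JF : Jhol_local F.
Hypothesis C0 : 0 <= C.
Hypothesis dens_rho : forall z, exists p q, [/\ p \in Q, q \in Q, p != q & dens F z <= C * rho p q z].

Let pairs := [seq pq <- [seq (p, q) | p <- Q, q <- Q] | pq.1 != pq.2].
Let m := size pairs.
Let fst_ (i : 'I_m) := (nth (0, 0) pairs i).1.
Let snd_ (i : 'I_m) := (nth (0, 0) pairs i).2.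

Let pairsP (i : 'I_m) : [/\ fst_ i \in Q, snd_ i \in Q & fst_ i != snd_ i].
Proof.
have := mem_nth (0, 0) (ltn_ord i); rewrite mem_filter => /andP[ne /allpairsP[[p q] /= [pQ qQ e]]].
by rewrite /fst_ /snd_ e in ne *.
Qed.

Let pairs_ex p q : p \in Q -> q \in Q -> p != q -> exists i, fst_ i = p /\ snd_ i = q.
Proof.
move=> pQ qQ pq; have iP : (p, q) \in pairs by rewrite mem_filter pq allpairs_f.
have ip : (index (p, q) pairs < m)%N by rewrite index_mem.
by exists (Ordinal ip); rewrite /fst_ /snd_ /= nth_index.
Qed.

Let m_le : (m <= size Q ^ 2)%N.
Proof. by apply: leq_trans (size_subseq (filter_subseq _ _)) _; rewrite size_allpairs mulnn. Qed.

(** The pair that bounds the density changes along the segment, so the sum over all pairs is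
    integrated. Each summand has the primitive - A / (D + s |v|), and its integral is a multiple of
    |p - q| |v| / (D (D + |v|)). The number of pairs gives the factor |Q|^2. *)
Lemma segment_chord (a v : 'rV[R]_2) (c d : R) : 0 < c -> c <= 1 -> v != 0 ->
  (forall q, q \in Q -> forall s, 0 <= s <= 1 -> c * len (a - q) <= len (a + s *: v - q)) ->
  (forall p q, p \in Q -> q \in Q -> p != q ->
    len (p - q) * len v <= d * (Num.sqrt (spread2 p q a) * (Num.sqrt (spread2 p q a) + len v))) ->
  (rdist (F a) (F (a + v)%R) <= (10 * (size Q)%:R ^+ 2 * C / c ^+ 2 * d)%:E)%E.
Proof.
move=> c0 c1 vn clr hd; have l0 : 0 < len v by rewrite len_gt0.
pose D i := Num.sqrt (spread2 (fst_ i) (snd_ i) a).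
have D0 i : 0 < D i by have [_ _ pq] := pairsP i; rewrite sqrtr_gt0 spread2_gt0.
pose A i := C * (10 * len (fst_ i - snd_ i)) / c ^+ 2.
have A0 i : 0 <= A i by rewrite /A !mulr_ge0 ?len_ge0 ?invr_ge0 ?sqr_ge0.
have pos i (s : R) : 0 <= s -> 0 < D i + s * len v by move=> s0; rewrite ltr_pwDl// mulr_ge0// ltW.
pose phi i s := A i * - (D i + s * len v)^-1.
pose phi' i s := A i * (len v / (D i + s * len v) ^+ 2).
have dlin i (s : R) : is_derive s 1 (fun s : R => D i + s * len v) (len v).
  have := is_deriveD (is_derive_cst (D i : R^o) s (1 : R)) (is_deriveZ (len v) (is_derive_id s (1 : R))).
  rewrite add0r [_ *: 1]mulr1; congr (is_derive _ _ _ _); apply/funext => t /=.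
  by congr (_ + _); exact: mulrC.
have dphi i (s : R) : 0 <= s -> is_derive s 1 (phi i) (phi' i s).
  move=> s0; have ne : D i + s * len v != 0 by rewrite gt_eqF// pos.
  have := is_deriveZ (A i) (is_deriveN (@is_deriveV R (fun s => D i + s * len v) s _ 1 ne (dlin i s))).
  move=> h; apply: is_derive_eq h _; rewrite /phi' -![_ *: _]/(_ * _).
  by rewrite mulNr opprK [_ ^- 2 * _]mulrC.
have := @segment_dist R n X F JF a v (fun s => \sum_(i < m) phi i s) (fun s => \sum_(i < m) phi' i s).
move=> /(_ _ _ _)/wrap[s /andP[s0 s1]|s /andP[s0 s1]|s /andP[s0 s1]|h].
- apply: continuous_sum_at => i; apply: continuousM; first exact: cvg_cst.
  apply: continuousM; first exact: cvg_cst.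
  have cl : {for s, continuous (fun s : R => (D i + s * len v) ^+ 2)}.
    rewrite (_ : (fun s => _) = fun s => (D i + s * len v) * (D i + s * len v)); last by apply/funext => t; rewrite expr2.
    by apply: continuousM; exact: is_derive_continuous (dlin i s).
  by apply: cvgV => //; rewrite gt_eqF// exprn_gt0// pos.
- rewrite (_ : (fun s => _) = \sum_(i < m) phi i); last by apply/funext => t; rewrite fct_sumE.
  by apply: is_derive_sum => i; exact: dphi.
- have [p [q [pQ qQ pq le]]] := dens_rho (a + s *: v).
  have [i [ip iq]] := pairs_ex pQ qQ pq.
  rewrite (bigD1 i)//= -[leLHS]addr0 lerD//; last first.
    by apply: sumr_ge0 => j _; rewrite /phi' mulr_ge0// divr_ge0 ?sqr_ge0// ltW.
  have s01 : 0 <= s <= 1 by rewrite s0 s1.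
  have hr : rho p q (a + s *: v) <= _ := @rho_on_segment a v p q c s c0 c1 s0 pq _.
  apply: (@le_trans _ _ (len v * (C * (10 * len (p - q) / (c ^+ 2 * (D i + s * len v) ^+ 2))))).
    rewrite ler_wpM2l ?(ltW l0)// (le_trans le)// ler_wpM2l// /D ip iq; apply: hr.
    by move=> r [->|->]; exact: clr.
  rewrite /phi' /A ip iq le_eqVlt; apply/orP; left; apply/eqP; field.
  by rewrite !gt_eqF ?pos.
apply: le_trans h _; rewrite lee_fin -sumrB.
apply: (@le_trans _ _ (\sum_(i < m) (10 * C / c ^+ 2 * d))).
  apply: ler_sum => i _; have [pQ qQ pq] := pairsP i.
  have := hd _ _ pQ qQ pq; rewrite -/(D i) => h.
  have -> : phi i 1 - phi i 0 = 10 * C / c ^+ 2 * (len (fst_ i - snd_ i) * len v / (D i * (D i + len v))).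
    rewrite /phi /A mul0r addr0 mul1r; field; rewrite !gt_eqF//.
    by rewrite addr_gt0.
  rewrite ler_wpM2l ?mulr_ge0 ?invr_ge0 ?sqr_ge0// ler_pdivrMr//.
  by rewrite mulr_gt0// addr_gt0.
rewrite sumr_const card_ord -[leLHS]mulr_natl.
have -> : 10 * (size Q)%:R ^+ 2 * C / c ^+ 2 * d = (size Q)%:R ^+ 2 * (10 * C / c ^+ 2 * d) by ring.
have [d0|d0] := leP 0 d.
  by rewrite ler_wpM2r ?mulr_ge0 ?invr_ge0 ?sqr_ge0// -natrX ler_nat.
have [m0|m0] := posnP m; last first.
  have [pQ qQ pq] := pairsP (Ordinal m0); have := hd _ _ pQ qQ pq.
  rewrite leNgt => /negP[]; apply: lt_le_trans (_ : 0 <= _).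
    by rewrite nmulr_rlt0//; exact: (mulr_gt0 (D0 (Ordinal m0)) (addr_gt0 (D0 (Ordinal m0)) l0)).
  by rewrite mulr_ge0 ?len_ge0.
have [p [q [pQ qQ pq _]]] := dens_rho a.
by have [i _] := pairs_ex pQ qQ pq; case: i => i /=; rewrite m0.
Qed.

(** Two segments with the factor 10 q^2 / c^2 and distance 4 d each; for c half of the clearance, 1
    / c is 64 (2 q + 1). *)
Definition chord_constant (q : nat) : R := 80 * q%:R ^+ 2 * (64 * q.*2.+1%:R) ^+ 2.

(** Up to a constant, [d] bounds the chords between [x] and [x'] once p, q and infinity are in
    standard position. On the way from [a] to the midpoint the spread at the other endpoint is
    replaced by 4 times that at [a] plus the length of the segment ([key]), which is what
    [segment_chord] asks for. *)
Lemma planar_chord_bound (x x' : 'rV[R]_2) (d : R) : 0 <= d ->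
  (forall p q, p \in Q -> q \in Q -> p != q ->
    len (p - q) * len (x - x') <= d * (Num.sqrt (spread2 p q x) * Num.sqrt (spread2 p q x'))) ->
  (rdist (F x) (F x') <= (C * chord_constant (size Q) * d)%:E)%E.
Proof.
move=> d0 hd; have [->|xx] := eqVneq x x'.
  by rewrite rdistxx lee_fin /chord_constant !mulr_ge0 ?sqr_ge0.
have [y hy] := good_midpoint Q xx.
set c := clearance Q / 2.
have cl0 := clearance_gt0 Q; have cl1 := clearance_le1 Q.
have c0 : 0 < c by rewrite divr_gt0.
have c1 : c <= 1 by rewrite ler_pdivrMr// (le_trans cl1)// mul1r ler1n.
have h0 : 0 < len (x' - x) by rewrite len_gt0 subr_eq0 eq_sym.
have half_dist (b : bool) : (rdist (F (if b then x else x')) (F y) <= (10 * (size Q)%:R ^+ 2 * C / c ^+ 2 * (4 * d))%:E)%E.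
  have [/= l1 l2 clr] := hy b; set a := if b then x else x' in l1 l2 clr *.
  pose a' := if b then x' else x.
  have aa' : len (a - a') = len (x' - x) by rewrite /a /a'; case: b {l1 l2 clr a a'} => //; rewrite lenB.
  have ya : y - a != 0.
    by rewrite -len_gt0 (lt_le_trans _ l1)// divr_gt0.
  have := @segment_chord a (y - a) c (4 * d) c0 c1 ya clr.
  rewrite (_ : a + (y - a) = y); last by rewrite addrC subrK.
  apply => p q pQ qQ pq.
  have D0 z : 0 < Num.sqrt (spread2 p q z) by rewrite sqrtr_gt0 spread2_gt0.
  have key : Num.sqrt (spread2 p q a') <= 4 * (Num.sqrt (spread2 p q a) + len (y - a)).
    rewrite -ler_sqr ?nnegrE ?mulr_ge0 ?addr_ge0 ?sqrtr_ge0 ?len_ge0//.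
    rewrite sqr_sqrtr ?spread2_ge0// exprMn.
    apply: (@le_trans _ _ (4 ^+ 2 * (spread2 p q a + len (y - a) ^+ 2))); last first.
      rewrite ler_wpM2l ?sqr_ge0// -[X in X + _ <= _](sqr_sqrtr (spread2_ge0 p q a)).
      exact: sqrD_ge (sqrtr_ge0 _) (len_ge0 _).
    have t r : len (a' - r) ^+ 2 <= 2 * len (a - r) ^+ 2 + 2 * len (x' - x) ^+ 2.
      apply: le_trans (sqrD_le _ _); apply: sqr_mono; rewrite ?len_ge0//.
      by rewrite [leRHS]addrC -aa' (lenB a) len_tri.
    have hh : len (x' - x) ^+ 2 <= 4 * len (y - a) ^+ 2.
      rewrite (_ : 4 = 2 ^+ 2); last by rewrite expr2 -natrM.
      rewrite -exprMn; apply: sqr_mono; rewrite ?len_ge0//; move: l1; move=> *; lra.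
    have := t p; have := t q; move: hh; rewrite /spread2 (_ : 4 ^+ 2 = 16); last by rewrite expr2 -natrM.
    have := sqr_ge0 (len (a - p)); have := sqr_ge0 (len (a - q)); have := sqr_ge0 (len (p - q)).
    have := sqr_ge0 (len (y - a)).
    move: (len (a' - p) ^+ 2) (len (a' - q) ^+ 2) (len (a - p) ^+ 2) (len (a - q) ^+ 2) (len (p - q) ^+ 2) (len (y - a) ^+ 2) (len (x' - x) ^+ 2).
    move=> u1 u2 u3 u4 u5 u6 u7; move=> *; lra.
  have main : len (p - q) * len (x' - x) <= d * (Num.sqrt (spread2 p q a) * Num.sqrt (spread2 p q a')).
    have := hd p q pQ qQ pq; rewrite (lenB x) /a /a'; case: b {l1 l2 clr a a' aa' ya key} => //.
    by rewrite [Num.sqrt (spread2 p q x') * _]mulrC.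
  apply: (@le_trans _ _ (len (p - q) * len (x' - x))); first by rewrite ler_wpM2l ?len_ge0.
  apply: le_trans main _; rewrite [4 * d]mulrC -mulrA ler_wpM2l// mulrCA ler_wpM2l ?sqrtr_ge0//.
have := rdist_triangle (half_dist true) (rdist_le_sym (half_dist false)).
move=> h; apply: le_trans h _; rewrite lee_fin le_eqVlt; apply/orP; left; apply/eqP.
rewrite /chord_constant /c /clearance; field.
by rewrite gt_eqF ?ltr0n.
Qed.

End chord_bound.

(** * Chords and cross-ratios on the sphere *)

Section brackets.
Variable R : realType.
Implicit Types (z w : R[i]) (x y a b c : P1 R).

Definition nsq z : R := complex.Re z ^+ 2 + complex.Im z ^+ 2.

Lemma nsqM z w : nsq (z * w) = nsq z * nsq w.
Proof. by case: z => a b; case: w => c d; rewrite /nsq /=; ring. Qed.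

Lemma nsq_ge0 z : 0 <= nsq z.
Proof. by rewrite addr_ge0 ?sqr_ge0. Qed.

Lemma nsq_eq0 z : (nsq z == 0) = (z == 0).
Proof.
case: z => a b; rewrite /nsq /= paddr_eq0 ?sqr_ge0// !sqrf_eq0.
by rewrite eq_complex.
Qed.

Lemma nsqN z : nsq (- z) = nsq z.
Proof. by case: z => a b; rewrite /nsq /= !sqrrN. Qed.

Lemma nsq1 : nsq 1 = 1.
Proof. by rewrite /nsq /= expr1n expr0n addr0. Qed.

(* The squared modulus of the determinant of homogeneous coordinates. *)
Definition br x y : R :=
  match x, y with
  | Some z, Some w => nsq (z - w)
  | None, None => 0
  | _, _ => 1
  end.

Lemma brC x y : br x y = br y x.
Proof. by case: x => [z|]; case: y => [w|] //=; rewrite -nsqN opprB. Qed.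

Lemma brxx x : br x x = 0.
Proof. by case: x => [z|] //=; apply/eqP; rewrite nsq_eq0 subrr. Qed.

Lemma br_ge0 x y : 0 <= br x y.
Proof. by case: x => [z|]; case: y => [w|] //=; exact: nsq_ge0. Qed.

Lemma br_gt0 x y : x != y -> 0 < br x y.
Proof.
move=> xy; rewrite lt_neqAle br_ge0 andbT eq_sym; apply: contra xy.
by case: x => [z|]; case: y => [w|] //=; rewrite ?oner_eq0 // nsq_eq0 subr_eq0 => /eqP->.
Qed.

Definition hsq x : R := if x is Some z then 1 + nsq z else 1.

Lemma hsq_gt0 x : 0 < hsq x.
Proof. by case: x => [z|] //=; rewrite ltr_pwDl// nsq_ge0. Qed.

Lemma sphere_inner x y : (stereo x *m (stereo y)^T) 0 0 = 1 - 2 * br x y / (hsq x * hsq y).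
Proof.
rewrite mxE !big_ord_recl big_ord0 addr0.
case: x => [[a b]|]; case: y => [[c d]|]; rewrite /stereo /br /hsq /nsq /= !mxE /=.
- have h1 : 1 + (a ^+ 2 + b ^+ 2) != 0 by rewrite gt_eqF// ltr_pwDl// addr_ge0 ?sqr_ge0.
  have h2 : 1 + (c ^+ 2 + d ^+ 2) != 0 by rewrite gt_eqF// ltr_pwDl// addr_ge0 ?sqr_ge0.
  by field; rewrite h1 h2.
- have h1 : 1 + (a ^+ 2 + b ^+ 2) != 0 by rewrite gt_eqF// ltr_pwDl// addr_ge0 ?sqr_ge0.
  by field.
- have h2 : 1 + (c ^+ 2 + d ^+ 2) != 0 by rewrite gt_eqF// ltr_pwDl// addr_ge0 ?sqr_ge0.
  by field.
- by field.
Qed.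

Lemma br_le x y : br x y <= hsq x * hsq y.
Proof.
case: x => [[a b]|]; case: y => [[c d]|]; rewrite /br /hsq /nsq /= ?mul1r ?mulr1 ?lerDl ?addr_ge0 ?sqr_ge0//.
rewrite -subr_ge0 (_ : _ - _ = (1 + a * c + b * d) ^+ 2 + (a * d - b * c) ^+ 2); last by ring.
by rewrite addr_ge0 ?sqr_ge0.
Qed.

Lemma sphere_inner_range x y : -1 <= (stereo x *m (stereo y)^T) 0 0 <= 1.
Proof.
have h : 0 < hsq x * hsq y by rewrite mulr_gt0 ?hsq_gt0.
have b1 : 0 <= 2 * br x y / (hsq x * hsq y) by rewrite divr_ge0 ?mulr_ge0 ?br_ge0 ?(ltW h) // ltW // hsq_gt0.
have b2 : 2 * br x y / (hsq x * hsq y) <= 2 by rewrite ler_pdivrMr// ler_pM2l// br_le.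
by rewrite sphere_inner; move: b1 b2; move: (_ / _) => u; clear; move=> *; apply/andP; split; lra.
Qed.

Lemma sin_le (t : R) : 0 <= t -> `|sin t| <= t.
Proof.
move=> t0; have := @mvt_bound R (@sin R) (@cos R) 0 1 0 t.
rewrite (min_idPl t0) (max_idPr t0) sin0 mul0r !subr0 mul1r (ger0_norm t0); apply.
by move=> s _; rewrite subr0 cos_max.
Qed.

Lemma sdist_ge0 x y : 0 <= sdist x y.
Proof. exact: (acos_ge0 (sphere_inner_range x y)). Qed.

(** The left side is the square of the Euclidean chord, 4 sin^2 (t / 2) for points at angle t. *)
Lemma chord_le_sdist x y : 4 * br x y / (hsq x * hsq y) <= sdist x y ^+ 2.
Proof.
have -> : 4 * br x y / (hsq x * hsq y) = 2 - 2 * (stereo x *m (stereo y)^T) 0 0.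
  by rewrite sphere_inner; ring.
have rg := sphere_inner_range x y; have t0 := sdist_ge0 x y.
rewrite -[X in 2 - 2 * X](acosK rg) -/(sdist x y); set t := sdist x y in t0 *.
have th : 0 <= t / 2 by rewrite divr_ge0.
have -> : 2 - 2 * cos t = 4 * sin (t / 2) ^+ 2.
  by rewrite {1}(splitr t) cosD -!expr2 cos2sin2; ring.
have : sin (t / 2) ^+ 2 <= (t / 2) ^+ 2.
  by rewrite -[leLHS]real_normK ?num_real// lerXn2r ?nnegrE// sin_le.
rewrite (_ : (t / 2) ^+ 2 = t ^+ 2 / 4); last by field.
by move: (sin _ ^+ 2) (t ^+ 2) => u v; clear; move=> *; lra.
Qed.

Section moebius.
Variables (a b c d : R[i]).
Hypothesis det0 : a * d - b * c != 0.
Let T := moebius a b c d.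

Let msq x : R := match x with
  | Some z => if c * z + d == 0 then nsq (a * z + b) else nsq (c * z + d)
  | None => if c == 0 then nsq a else nsq c
  end.

Let nsq_gt0 z : z != 0 -> 0 < nsq z.
Proof. by move=> z0; rewrite lt_neqAle nsq_ge0 eq_sym nsq_eq0 z0. Qed.

Let msq_gt0 x : 0 < msq x.
Proof.
case: x => [z|] /=.
- case: ifPn => [/eqP h|]; last exact: nsq_gt0.
  apply: nsq_gt0; apply: contraNneq det0 => h'; apply/eqP.
  have [c0|cn] := eqVneq c 0.
    by move: h; rewrite c0 mul0r add0r => ->; rewrite !mulr0 subr0.
  rewrite (_ : a * d - b * c = a * (c * z + d) - c * (a * z + b)); last by ring.
  by rewrite h h' !mulr0 subr0.
- case: ifPn => [/eqP h|]; last exact: nsq_gt0.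
  by apply: nsq_gt0; apply: contraNneq det0 => ->; rewrite h mul0r mulr0 subr0.
Qed.

(** A determinant of homogeneous coordinates is multiplied by that of the matrix. Since [br] uses
    normalized coordinates, with last entry 1 or equal to (1, 0), each point contributes the factor
    [msq] by which its image has to be rescaled. *)
Lemma br_moebius x y : br (T x) (T y) * (msq x * msq y) = nsq (a * d - b * c) * br x y.
Proof.
case: x => [z|]; case: y => [w|]; rewrite /T /=.
- case: ifPn => [/eqP h|h]; case: ifPn => [/eqP k|k] /=.
  + rewrite mul0r; have [->|zw] := eqVneq z w; first by rewrite subrr (_ : nsq 0 = 0) ?mulr0//; apply/eqP; rewrite nsq_eq0.
    have : c * (z - w) = 0 by rewrite mulrBr -[c * z](addrK d) -[c * w](addrK d) h k !sub0r subrr.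
    move/eqP; rewrite mulf_eq0 subr_eq0 (negbTE zw) orbF => /eqP c0.
    by move: h det0; rewrite c0 mul0r add0r => ->; rewrite !mulr0 subrr eqxx.
  + rewrite mul1r -!nsqM; congr nsq.
    rewrite (_ : (a * d - b * c) * (z - w) = (a * z + b) * (c * w + d) - (a * w + b) * (c * z + d)); last by ring.
    by rewrite h mulr0 subr0.
  + rewrite mul1r -!nsqM -nsqN; congr nsq.
    rewrite (_ : (a * d - b * c) * (z - w) = (a * z + b) * (c * w + d) - (a * w + b) * (c * z + d)); last by ring.
    by rewrite k mulr0 sub0r mulrC.
  + rewrite -!nsqM; congr nsq; field.
    by rewrite h k.
- case: ifPn => [/eqP h|h]; case: ifPn => [/eqP k|k] /=.
  + by move: h det0; rewrite k mul0r add0r => ->; rewrite !mulr0 subrr eqxx.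
  + rewrite mul1r mulr1 -!nsqM -[LHS]nsqN; congr nsq.
    by rewrite (_ : - ((a * z + b) * c) = a * d - b * c - a * (c * z + d)); [rewrite h mulr0 subr0|ring].
  + by rewrite mul1r mulr1 -!nsqM; congr nsq; rewrite k mul0r mulr0 add0r subr0 mulrC.
  + rewrite mulr1 -!nsqM -[LHS]nsqN; congr nsq; field.
    by rewrite h k.
- case: ifPn => [/eqP h|h]; case: ifPn => [/eqP k|k] /=.
  + by move: k det0; rewrite h mul0r add0r => ->; rewrite !mulr0 subrr eqxx.
  + by rewrite mul1r mulr1 -!nsqM; congr nsq; rewrite h mul0r mulr0 add0r subr0.
  + rewrite mul1r mulr1 -!nsqM -[LHS]nsqN; congr nsq.
    by rewrite (_ : - (c * (a * w + b)) = a * d - b * c - a * (c * w + d)); [rewrite k mulr0 subr0|ring].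
  + rewrite mulr1 -!nsqM; congr nsq; field.
    by rewrite h k.
- by rewrite brxx mul0r mulr0.
Qed.

Let wt x := hsq (T x) * msq x.

Lemma chord_weights : exists k : R, exists w : P1 R -> R, [/\ 0 < k, forall x, 0 < w x &
  forall x y, 4 * br (T x) (T y) / (hsq (T x) * hsq (T y)) = k * br x y / (w x * w y)].
Proof.
exists (4 * nsq (a * d - b * c)), wt; split.
- by rewrite mulr_gt0// nsq_gt0.
- by move=> x; rewrite mulr_gt0 ?hsq_gt0.
move=> x y; rewrite -[4 * _ * br x y]mulrA -br_moebius /wt; field.
by rewrite !gt_eqF ?hsq_gt0.
Qed.

End moebius.

(** For this angle t, cos t = cos (2 t), so that cos t is 1 or - 1/2; the positive sine excludes
    1. *)
Lemma cos_2pi3 : cos (2 * pi / 3) = - 2^-1 :> R.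
Proof.
have p0 := pi_gt0 R; set t := 2 * pi / 3.
have s0 : 0 < sin t by apply: sin_gt0_pi; rewrite /t; apply/andP; split; move: p0; clear; move=> *; lra.
have e : cos t = cos (t + t).
  rewrite -[LHS]cosN (_ : t + t = - t + pi *+ 2); last by rewrite /t -mulr_natl; field.
  by rewrite cosD2pi.
have cs := cos2Dsin2 t; have sq : 0 < sin t ^+ 2 by rewrite exprn_gt0.
have : (cos t - 1) * (2 * cos t + 1) = 0.
  move: e; rewrite cosD -!expr2 => e; have : 2 * cos t ^+ 2 - 1 = cos t.
    by move: e cs; move: (cos t ^+ 2) (sin t ^+ 2) (cos t) => u v c; clear; move=> *; lra.
  by move=> h; rewrite (_ : _ * _ = 2 * cos t ^+ 2 - 1 - cos t); [rewrite h subrr|ring].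
move/eqP; rewrite mulf_eq0 => /orP[/eqP h|/eqP h].
  have h1 : cos t = 1 by move: h; clear; move=> *; lra.
  by move: cs sq; rewrite h1 expr1n; clear; move=> *; lra.
by move: h; clear; move=> *; lra.
Qed.

Lemma root3_vectors : exists c s : R, [/\ c = - 2^-1, s ^+ 2 = 3 / 4,
  root3 R 0 = Some (1 +i* 0)%C, root3 R 1 = Some (c +i* s)%C & root3 R (-1) = Some (c +i* - s)%C].
Proof.
exists (cos (2 * pi / 3)), (sin (2 * pi / 3)); split.
- exact: cos_2pi3.
- by have := cos2Dsin2 (2 * pi / 3 : R); rewrite cos_2pi3 sqrrN exprVn; move: (sin _ ^+ 2) => u; rewrite (_ : 2 ^+ 2 = 4 :> R); [clear; move=> *; lra|rewrite expr2 -natrM].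
- by rewrite /root3 mulr0z cos0 sin0.
- by rewrite /root3 mulr1z.
- by rewrite /root3 mulrN1z cosN sinN.
Qed.

(** The three points form an equilateral triangle on a great circle. Its centroid is the centre of
    the sphere, and hence the squared chords from any point to the vertices have the sum 6. *)
Lemma root3_chords x : let ch x y := 4 * br x y / (hsq x * hsq y) in
  [/\ ch (root3 R 0) (root3 R 1) = 3, ch (root3 R 1) (root3 R (-1)) = 3,
      ch (root3 R (-1)) (root3 R 0) = 3 & ch x (root3 R 0) + ch x (root3 R 1) + ch x (root3 R (-1)) = 6].
Proof.
have [c [s [-> s2 -> -> ->]]] := root3_vectors; cbv zeta.
have h1 : hsq (Some (1 +i* 0)%C) = 2 :> R by rewrite /hsq /nsq /= expr1n expr0n addr0.
have h2 : hsq (Some (- 2^-1 +i* s)%C) = 2 :> R by rewrite /hsq /nsq /= s2; field.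
have h3 : hsq (Some (- 2^-1 +i* - s)%C) = 2 :> R by rewrite /hsq /nsq /= [(- s) ^+ 2]sqrrN s2; field.
rewrite h1 h2 h3; split.
- by rewrite /br /nsq /= sub0r sqrrN s2; field.
- by rewrite /br /nsq /= (_ : (s - - s) ^+ 2 = 4 * s ^+ 2); [rewrite s2; field|ring].
- by rewrite /br /nsq /= subr0 sqrrN s2; field.
case: x => [[a b]|] /=; last by field.
rewrite /hsq /br /nsq /=; have h : 1 + (a ^+ 2 + b ^+ 2) != 0 by rewrite gt_eqF// ltr_pwDl// addr_ge0 ?sqr_ge0.
rewrite (_ : (b - s) ^+ 2 = b ^+ 2 - 2 * b * s + 3 / 4); last by rewrite -s2; ring.
rewrite (_ : (b - - s) ^+ 2 = b ^+ 2 + 2 * b * s + 3 / 4); last by rewrite -s2; ring.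
by field.
Qed.

(** When a, b, c go to the three standard points, this is, up to the weights of [chord_weights], the
    sum of the squared chords from the image of x to them. As that sum is 6, [spread] expresses the
    weight of x in brackets alone. *)
Definition spread a b c x : R := br x a * br b c + br x b * br c a + br x c * br a b.

Lemma spread_ge0 a b c x : 0 <= spread a b c x.
Proof. by rewrite !addr_ge0 ?mulr_ge0 ?br_ge0. Qed.

(* In position (a, b, c), the chord between two points is a cross-ratio. *)
Lemma standard_chord (T : P1 R -> P1 R) a b c x y : is_moebius T ->
  T a = root3 R 0 -> T b = root3 R 1 -> T c = root3 R (-1) ->
  12 * br x y * (br a b * br b c * br c a) <= sdist (T x) (T y) ^+ 2 * (spread a b c x * spread a b c y).
Proof.
move=> [A [B [C [D [det0 TE]]]]]; rewrite !{}TE => Ta Tb Tc.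
have [k [w [k0 w0 chE]]] := chord_weights det0.
have [rab rbc rca _] := root3_chords (root3 R 0).
rewrite -Ta -Tb -Tc !chE in rab rbc rca.
have sum (z : P1 R) : k * br z a / (w z * w a) + k * br z b / (w z * w b) + k * br z c / (w z * w c) = 6.
  by have [_ _ _] := root3_chords (moebius A B C D z); rewrite -Ta -Tb -Tc !chE.
have wn (z : P1 R) : w z != 0 by rewrite gt_eqF.
have kn : k != 0 by rewrite gt_eqF.
have eab : br a b = 3 * (w a * w b) / k by rewrite -rab; field; rewrite kn !wn.
have ebc : br b c = 3 * (w b * w c) / k by rewrite -rbc; field; rewrite kn !wn.
have eca : br c a = 3 * (w c * w a) / k by rewrite -rca; field; rewrite kn !wn.
have spE (z : P1 R) : spread a b c z = 18 * w a * w b * w c * w z / k ^+ 2.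
  rewrite /spread eab ebc eca (_ : 18 = 3 * 6); last by rewrite -natrM.
  by rewrite -(sum z); field; rewrite kn !wn.
have := chord_le_sdist (moebius A B C D x) (moebius A B C D y); rewrite chE => h.
have s0 (z : P1 R) : 0 < spread a b c z.
  by rewrite spE !mulr_gt0 ?invr_gt0 ?exprn_gt0 ?mulr_gt0// ltr0n.
rewrite -ler_pdivrMr; last by rewrite mulr_gt0.
apply: le_trans h; rewrite le_eqVlt; apply/orP; left; apply/eqP.
rewrite !spE eab ebc eca; field.
by rewrite kn !wn.
Qed.

End brackets.

(** * The distance estimate for one sphere *)

Section spheres.
Variables (R : realType) (n : nat) (b : R).
Hypothesis b1 : 1 <= b.

Lemma br_zcoord (p q : 'rV[R]_2) : br (zcoord p) (zcoord q) = len (p - q) ^+ 2.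
Proof. by rewrite len_sqr /nrm2 /br /zcoord /nsq /= !mxE. Qed.

Lemma zcoord_inj : injective (@zcoord R).
Proof.
move=> p q [h0 h1]; apply/rowP => i.
by have [->|->] : i = 0 \/ i = 1 by case: i => [[|[|//]] hi]; [left|right]; apply/val_inj.
Qed.

Lemma zcoord_onto (z : R[i]) : exists p : 'rV[R]_2, zcoord p = Some z.
Proof.
exists (\row_(i < 2) [:: complex.Re z; complex.Im z]`_i).
by rewrite /zcoord !mxE /=; case: z.
Qed.

Lemma spread_zcoord (p q x : 'rV[R]_2) : spread (zcoord p) (zcoord q) None (zcoord x) = spread2 p q x.
Proof. by rewrite /spread !br_zcoord /= !mulr1 mul1r. Qed.

Lemma spread_infinity (p q : 'rV[R]_2) : spread (zcoord p) (zcoord q) None None = 2.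
Proof. by rewrite /spread /= !mul1r mul0r addr0. Qed.

Section one_sphere.
Variables (X : tamed_manifold R n) (f : P1 R -> X).
Hypothesis bg : forall x : X, exists c, bchart c x b.
Hypothesis Jf : Jhol f.
Let F := f \o @zcoord R.
Let JF : Jhol_local F. Proof. by case: Jf. Qed.
Let JG : Jhol_local (f \o @wcoord R). Proof. by case: Jf. Qed.

Lemma rdist_eq0 (x y : X) : (forall e : R, 0 < e -> (rdist x y <= e%:E)%E) -> x = y.
Proof.
move=> h; have [c bc] := bg x; have [ac cx cx0 _ _] := bc.
have sb : 0 < Num.sqrt b by rewrite sqrtr_gt0 (lt_le_trans ltr01).
have small (a : R) : 0 < a -> Num.sqrt b * a <= half R n -> cdom c y /\ forall k, `|cmap c y 0 k| <= Num.sqrt b * a.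
  move=> a0 sm; apply: (rdist_in_chart b1 bc _ sm).
  by apply: le_lt_trans (h (a / 2) _) _; rewrite ?divr_gt0// lte_fin ltr_pdivrMr// mulr_natr mulr2n ltrDl.
have hn := half_gt0 R n.
have [cy _] : cdom c y /\ forall k, `|cmap c y 0 k| <= Num.sqrt b * (half R n / Num.sqrt b).
  by apply: small; rewrite ?divr_gt0// mulrCA mulfV ?mulr1// gt_eqF.
have y0 : cmap c y = 0.
  apply/rowP => k; rewrite mxE; apply/eqP; rewrite -normr_le0; apply/ler_addgt0Pr => e e0; rewrite add0r.
  pose a := Num.min (half R n / Num.sqrt b) (e / Num.sqrt b).
  have a0 : 0 < a by rewrite lt_min !divr_gt0.
  have [] := small a a0.
    by rewrite mulrC -ler_pdivlMr// ge_min lexx.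
  by move=> _ /(_ k) /le_trans; apply; rewrite mulrC -ler_pdivlMr// ge_min lexx orbT.
by rewrite -(chartK ac cx) -(chartK ac cy) cx0 y0.
Qed.

Lemma near_infinity (M e : R) : 0 < e -> exists2 z : 'rV[R]_2, M <= len z & (rdist (f None) (F z) <= e%:E)%E.
Proof.
move=> e0; have G0 : (f \o @wcoord R) 0 = f None.
  by rewrite /= /wcoord /zcoord /moebius !mxE /= mul1r addr0 eqxx.
have cG : {for (0 : 'rV[R]_2), continuous (f \o @wcoord R)} by exact: Jhol_continuous JG _.
have : nbhs ((f \o @wcoord R) 0) (fun y => (rdist (f None) y <= e%:E)%E) by rewrite G0; exact: (rdist_small b1 (bg _) e0).
move/cG => /nbhs_ballP[r /= r0 hr].
pose t := Num.max `|M| (2 / r) + 1.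
have t0 : 0 < t by rewrite ltr_pwDr// le_max normr_ge0.
pose z : 'rV[R]_2 := t *: delta_mx 0 0.
have d1 : nrm2 (delta_mx 0 0 : 'rV[R]_2) = 1 by rewrite /nrm2 !mxE /= expr1n expr0n addr0.
have lz : len z = t by rewrite lenZ gtr0_norm// /len d1 sqrtr1 mulr1.
have zn : z != 0 by rewrite -len_gt0 lz.
exists z; first by rewrite lz (le_trans (ler_norm _))// -[leLHS]addr0 lerD// le_max lexx.
rewrite /F /= -(wcoord_plane_inv zn); apply: (hr (plane_inv z)).
split => // i j; rewrite ord1 /ball /= mxE sub0r normrN mxE.
have nz : nrm2 z = t ^+ 2 by rewrite -len_sqr lz.
have z0 : z 0 0 = t by rewrite !mxE /= mulr1.
have z1 : z 0 1 = 0 by rewrite !mxE /= mulr0.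
have tr : t^-1 < r.
  rewrite invf_plt ?posrE//; apply: (@le_lt_trans _ _ (2 / r)); first by rewrite ler_pdivlMr// mulVf ?gt_eqF// ler1n.
  by rewrite /t ltr_pwDr// le_max lexx orbT.
case: ifP => _; rewrite nz ?z0 ?z1; last by rewrite mul0r oppr0 normr0.
by rewrite expr2 invfM mulrA mulfV ?gt_eqF// mul1r gtr0_norm// invr_gt0.
Qed.

Lemma constant_of_dens0 : (forall z, dens F z = 0) -> forall x y, f x = f y.
Proof.
move=> e0; have plane x y : F x = F y.
  apply: rdist_eq0 => e ep; have := @segment_dist R n X F JF x (y - x) (fun=> 0) (fun=> 0).
  rewrite (_ : x + (y - x) = y); last by rewrite addrC subrK.
  rewrite subrr => h; apply: (@le_trans _ _ 0%E); last by rewrite lee_fin ltW.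
  apply: h.
  - by move=> t _; exact: cvg_cst.
  - by move=> t _; rewrite e0 mulr0.
have inf x : f None = F x.
  apply: rdist_eq0 => e ep; have [z _ hz] := near_infinity 0 ep.
  by rewrite (plane x z).
suff h x : f x = f None by move=> x y; rewrite !h.
by case: x => [z|//]; have [p <-] := zcoord_onto z; rewrite (inf p).
Qed.

End one_sphere.

Lemma chord_constant_ge0 q : 0 <= chord_constant R q.
Proof. by rewrite /chord_constant mulr_ge0 ?mulr_ge0 ?sqr_ge0. Qed.

Lemma chord_constant_le p q : (p <= q)%N -> chord_constant R p <= chord_constant R q.
Proof.
move=> pq; have le1 : p%:R <= q%:R :> R by rewrite ler_nat.
have le2 : p.*2.+1%:R <= q.*2.+1%:R :> R by rewrite ler_nat ltnS leq_double.
rewrite /chord_constant; apply: ler_pM; rewrite ?mulr_ge0 ?sqr_ge0//.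
  by rewrite ler_wpM2l// lerXn2r ?nnegrE.
by rewrite lerXn2r ?nnegrE ?mulr_ge0// ler_wpM2l.
Qed.

(** [Q] consists of infinity and the marked points, and its triples (p, q, infinity) yield the
    hypothesis of the planar chord bound. If no point is selected, the density vanishes, the map is
    constant and [Q] is empty. *)
Theorem sphere_estimate : exists hq K : R, [/\ 0 < hq, 0 < K &
  forall (X : tamed_manifold R n) (f : P1 R -> X) (E : R), (forall x : X, exists c, bchart c x b) ->
    Jhol f -> (sphere_energy f <= E%:E)%E ->
  exists Q : seq (P1 R), [/\ uniq Q, (size Q)%:R <= E / hq,
    (Q = [::] /\ forall x y, f x = f y) \/ (3 <= size Q)%N &
    forall (d : R) x x', 0 <= d ->
      (forall p q r, p \in Q -> q \in Q -> r \in Q -> p != q -> q != r -> r != p ->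
        12 * br x x' * (br p q * br q r * br r p) <= d ^+ 2 * (spread p q r x * spread p q r x')) ->
      (rdist (f x) (f x') <= (K * chord_constant R (size Q) * d)%:E)%E]].
Proof.
have [mu0 [K [mu00 K0 ann]]] := annulus_estimate n b1.
pose eps := mu0 / 2.
have eps0 : 0 < eps by rewrite divr_gt0.
have eps_mu : 2 * eps <= mu0 by rewrite /eps mulrCA mulfV ?mulr1.
pose hq0 := quantum n b eps.
have hq00 : 0 < hq0 by apply: quantum_gt0.
have c1 : 0 < 2220 :> R by rewrite ltr0n.
have c2 : 0 < 12 :> R by rewrite ltr0n.
have C0 : 0 < 12 * K + 2220 * eps := addr_gt0 (mulr_gt0 c2 K0) (mulr_gt0 c1 eps0).
have [C CE] : {C | C = 12 * K + 2220 * eps} by exists (12 * K + 2220 * eps).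
rewrite -CE in C0.
(* The energy is half the integral of the density, so |P| hq0 <= 2 E; and |Q| <= 2 |P| + 1 <= 3
   |P|. *)
exists (hq0 / 6), C; split => //; first by rewrite divr_gt0.
move=> X f E bg Jf EE; have [JF JG] := Jf; set F := f \o _ in JF.
have E2 : (\int[@lebesgue_measure R \x @lebesgue_measure R]_z
     (energy_density F (\row_(i < 2) [:: z.1; z.2]`_i))%:E <= (2 * E)%:E)%E.
  move: EE; rewrite /sphere_energy -lee_pdivlMl//.
  by rewrite invrK.
have [M hM] := dens_bounded Jf.
have cnt P : admissible (dens F) eps P -> (size P)%:R <= 2 * E / hq0.
  by move=> aP; rewrite ler_pdivlMr//; exact: energy_count b1 eps0 _ _ _ _ JF bg E2 aP.
have [P aP ctrl] := selection eps0 hM cnt.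
have sP := cnt P aP.
have [P0|Pn] := eqVneq P [::].
  have e0 z : dens F z = 0.
    by apply/eqP; rewrite eq_le dens_ge0 andbT leNgt; apply/negP => /ctrl[p]; rewrite P0.
  have cst := constant_of_dens0 bg Jf e0.
  exists [::]; split => //.
  - by apply: le_trans (_ : 0 <= _); rewrite // invf_div mulrA divr_ge0 ?(ltW hq00)// mulr_ge0//; move: sP; rewrite P0 /= ler_pdivlMr// mul0r pmulr_rge0.
  - by left.
  - move=> d x x' d0 _; rewrite (cst x x') rdistxx lee_fin mulr_ge0// mulr_ge0 ?(ltW C0)//.
    by rewrite /chord_constant mulr_ge0 ?mulr_ge0 ?sqr_ge0.
have [_ Pgt _ _] := aP.
pose Q0 := undup (marked_points (dens F) eps P).
have dr z : exists p q, [/\ p \in Q0, q \in Q0, p != q & dens F z <= C * rho p q z].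
  have [p [q [pQ qQ pq h]]] := dens_le_rho eps0 K0 (fun a r1 r2 => ann X F JF bg a r1 r2) eps_mu aP ctrl Pn z.
  by exists p, q; rewrite !mem_undup CE.
have sQ0 : (size Q0 <= (size P).*2)%N.
  by apply: leq_trans (size_undup _) _; rewrite /marked_points size_cat size_map addnn.
have sP1 : (1 <= size P)%N by case: P Pn {aP ctrl sP Pgt Q0 dr sQ0}.
have sQ2 : (2 <= size Q0)%N.
  have [p [q [pQ qQ pq _]]] := dr 0.
  have : (size [:: p; q] <= size Q0)%N.
    by apply: uniq_leq_size; [rewrite /= inE pq|move=> z; rewrite !inE => /orP[]/eqP->].
  by [].
pose Q : seq (P1 R) := None :: map (@zcoord R) Q0.
have uQ : uniq Q.
  rewrite /= map_inj_uniq ?undup_uniq ?andbT; last exact: zcoord_inj.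
  by apply/mapP => -[].
have sQ : size Q = (size Q0).+1 by rewrite /= size_map.
have zQ p : p \in Q0 -> zcoord p \in Q by move=> pQ; rewrite inE map_f ?orbT.
exists Q; split => //.
- rewrite sQ invf_div mulrA ler_pdivlMr//.
  have h1 : (size P)%:R * hq0 <= 2 * E by rewrite -ler_pdivlMr.
  have h2 : ((size Q0).+1)%:R <= 3 * (size P)%:R :> R.
    by rewrite -natrM ler_nat mulSn mul2n -addn1 addnC leq_add.
  apply: (@le_trans _ _ (3 * (size P)%:R * hq0)); first by rewrite ler_wpM2r// ltW.
  by move: h1; rewrite -mulrA; move: (_ * hq0) => u; clear; move=> *; lra.
- by right; rewrite sQ.
have chle : chord_constant R (size Q0) <= chord_constant R (size Q).
  by apply: chord_constant_le; rewrite sQ.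
have plane (d : R) (x x' : 'rV[R]_2) : 0 <= d ->
    (forall p q, p \in Q0 -> q \in Q0 -> p != q -> len (p - q) * len (x - x') <= d * (Num.sqrt (spread2 p q x) * Num.sqrt (spread2 p q x'))) ->
    (rdist (F x) (F x') <= (C * chord_constant R (size Q) * d)%:E)%E.
  move=> d0 h; apply: le_trans (planar_chord_bound JF (ltW C0) dr d0 h) _.
  by rewrite lee_fin ler_wpM2r// ler_wpM2l// ltW.
have D0 (p q z : 'rV[R]_2) : 0 <= Num.sqrt (spread2 p q z) by exact: sqrtr_ge0.
(* Infinity is replaced by a distant point [z] with nearby image. Beyond [B] one has |x - z| <= 2
   sqrt(spread2 p q z), so the chord from x to z is controlled like the chord from x to infinity. *)
have infty (d : R) (x : 'rV[R]_2) : 0 <= d ->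
    (forall p q, p \in Q0 -> q \in Q0 -> p != q -> 12 * len (p - q) ^+ 2 <= d ^+ 2 * (spread2 p q x * 2)) ->
    (rdist (F x) (f None) <= (C * chord_constant R (size Q) * d)%:E)%E.
  move=> d0 h; apply/lee_addgt0Pr => e e0.
  have [B hB] : exists B : R, forall p, p \in Q0 -> len p + len (x - p) <= B.
    have [|p pQ pm] := @seq_argmin R _ Q0 (fun p => - (len p + len (x - p))); first by rewrite -size_eq0 -lt0n (ltn_trans _ sQ2).
    by exists (len p + len (x - p)) => q /pm; rewrite lerN2.
  have [z zB hz] := near_infinity bg Jf B e0.
  rewrite -EFinD; apply: rdist_triangle (rdist_le_sym hz); apply: plane => // p q pQ qQ pq.
  have l1 : len (x - z) <= 2 * Num.sqrt (spread2 p q z).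
    have h1 : len z <= len (z - p) + len p by have := len_tri z p 0; rewrite !subr0.
    have h2 := hB p pQ; have h3 := len_tri x p z; rewrite (lenB p z) in h3.
    have h4 : len (z - p) <= Num.sqrt (spread2 p q z).
      rewrite -[leLHS]ger0_norm ?len_ge0// -sqrtr_sqr ler_wsqrtr// /spread2 -addrA lerDl.
      by rewrite addr_ge0 ?sqr_ge0.
    by move: h1 h2 h3 h4 zB; clear; move=> *; lra.
  have l2 : 2 * len (p - q) <= d * Num.sqrt (spread2 p q x).
    rewrite -ler_sqr ?nnegrE ?mulr_ge0 ?len_ge0// !exprMn len_sqr (sqr_sqrtr (spread2_ge0 _ _ _)).
    have := h p q pQ qQ pq; rewrite len_sqr (_ : 2 ^+ 2 = 4 :> R); last by rewrite expr2 -natrM.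
    have := nrm2_ge0 (p - q); rewrite mulrA; move: (nrm2 _) (d ^+ 2 * _) => u v; clear; move=> *; lra.
  have := ler_pM (mulr_ge0 (ler0n _ 2) (len_ge0 _)) (len_ge0 _) l2 l1.
  move: (len (p - q)) (len (x - z)) (Num.sqrt _) (Num.sqrt _) => u1 u2 u3 u4.
  rewrite (_ : 2 * u1 * u2 = 2 * (u1 * u2)); last by ring.
  rewrite (_ : d * u4 * (2 * u3) = 2 * (d * (u4 * u3))); last by ring.
  by rewrite ler_pM2l.
have None_ne p : zcoord p != None by [].
move=> d x x' d0 h.
have hz p q : p \in Q0 -> q \in Q0 -> p != q ->
    12 * br x x' * (len (p - q) ^+ 2) <= d ^+ 2 * (spread (zcoord p) (zcoord q) None x * spread (zcoord p) (zcoord q) None x').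
  move=> pQ qQ pq; have := h (zcoord p) (zcoord q) None (zQ _ pQ) (zQ _ qQ) (mem_head _ _).
  rewrite br_zcoord /= !mulr1; apply => //; first by apply: contra pq => /eqP/zcoord_inj->.
case: x h hz => [z|]; case: x' => [z'|].
- have [x <-] := zcoord_onto z; have [x' <-] := zcoord_onto z' => _ hz.
  apply: plane => // p q pQ qQ pq; have := hz p q pQ qQ pq; rewrite br_zcoord !spread_zcoord => h.
  rewrite -ler_sqr ?nnegrE ?mulr_ge0 ?len_ge0// !exprMn !sqr_sqrtr ?spread2_ge0 ?nrm2_ge0//.
  apply: le_trans h; rewrite !len_sqr; have := mulr_ge0 (nrm2_ge0 (p - q)) (nrm2_ge0 (x - x')).
  move: (nrm2 (p - q)) (nrm2 (x - x')) => u v; clear.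
  by rewrite (_ : 12 * v * u = 12 * (u * v)); [move: (u * v) => w w0; lra|ring].
- have [x <-] := zcoord_onto z => _ hz; apply: infty => // p q pQ qQ pq.
  by have := hz p q pQ qQ pq; rewrite spread_zcoord spread_infinity /= mulr1.
- have [x <-] := zcoord_onto z' => _ hz; apply: rdist_le_sym; apply: infty => // p q pQ qQ pq.
  by have := hz p q pQ qQ pq; rewrite spread_zcoord spread_infinity /= mulr1 [2 * _]mulrC.
- by move=> _ _; rewrite rdistxx lee_fin mulr_ge0// mulr_ge0 ?(ltW C0)// chord_constant_ge0.
Qed.

End spheres.

(** * Trees and stable curves *)

Section trees.
Variables (T : finType) (e : rel T).
Hypothesis te : is_tree e.
Implicit Types u v w x y : T.

Definition avoiding v : rel T := [rel a b | [&& e a b, a != v & b != v]].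

Lemma tree_sym : symmetric e. Proof. by case: te. Qed.

Lemma tree_neq x y : e x y -> x != y.
Proof. by apply: contraTneq => ->; case: te => _ ->. Qed.

Lemma tree_path_uniq x p q : path e x p -> path e x q -> last x p = last x q ->
  uniq (x :: p) -> uniq (x :: q) -> p = q.
Proof.
move=> pp pq l up uq; have [_ _ /(_ x (last x p))[r [_ ur]]] := te.
by rewrite -(ur p)// -(ur q).
Qed.

Lemma path_avoiding v x p : path (avoiding v) x p -> x != v -> path e x p /\ v \notin x :: p.
Proof.
elim: p x => [|y p ih] x /=; first by move=> _ xv; rewrite inE eq_sym.
move=> /andP[/and3P[exy xv yv] pp] _; have [h1 h2] := ih y pp yv.
by rewrite exy h1; split=> //; rewrite in_cons negb_or eq_sym xv.
Qed.

Lemma avoiding_path v x p : path e x p -> v \notin x :: p -> path (avoiding v) x p.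
Proof.
elim: p x => [//|y p ih] x /= /andP[exy pp].
rewrite !inE !negb_or => /and3P[vx vy vp].
by rewrite /avoiding /= exy ![_ == v]eq_sym vx vy /= ih// inE negb_or vy vp.
Qed.

Lemma connect_avoiding v x w : x != v -> connect (avoiding v) x w ->
  exists p, [/\ path e x p, last x p = w & uniq (v :: x :: p)].
Proof.
move=> xv /connectP[p pp ->]; case/shortenP: pp => q pq uq _.
have [h1 h2] := path_avoiding pq xv.
by exists q; split => //; rewrite cons_uniq h2.
Qed.

(** Two neighbours of [v] from which [w] can be reached without meeting [v] would give two simple
    paths from [v] to [w]. *)
Lemma towardE v x w : e v x -> connect (avoiding v) x w -> toward e v w = x.
Proof.
move=> vx cx; rewrite /toward; case: pickP => [y /andP[vy cy]|/(_ x)]; last by rewrite vx cx.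
have xv : x != v by rewrite eq_sym tree_neq.
have yv : y != v by rewrite eq_sym tree_neq.
have [p [pp lp up]] := connect_avoiding xv cx.
have [q [pq lq uq]] := connect_avoiding yv cy.
have : y :: q = x :: p.
  by apply: (@tree_path_uniq v) => //=; rewrite ?vy ?vx ?lp ?lq.
by case.
Qed.

Lemma towardP v w : v != w ->
  exists p, [/\ path e v (toward e v w :: p), last (toward e v w) p = w & uniq (v :: toward e v w :: p)].
Proof.
move=> vw; have [_ _ /(_ v w)[[|x p] [[pp lp up] _]]] := te; first by move: lp vw => /= ->; rewrite eqxx.
have /andP[vx px] := pp.
have -> : toward e v w = x.
  by apply: towardE => //; apply/connectP; exists p => //; apply: avoiding_path => //; case/andP: up.
by exists p.
Qed.

Lemma toward_adj v w : v != w -> e v (toward e v w).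
Proof. by move=> /towardP[p [/andP[]]]. Qed.

Lemma toward_connect v w : v != w -> connect (avoiding v) (toward e v w) w.
Proof.
move=> /towardP[p [/andP[_ pp] lp /andP[vn _]]].
by apply/connectP; exists p => //; apply: avoiding_path.
Qed.

Lemma toward_neighbor v w : e v w -> toward e v w = w.
Proof. by move=> vw; apply: towardE. Qed.

Lemma toward_on_path v x p w : path e v (x :: p) -> uniq (v :: x :: p) -> w \in x :: p ->
  toward e v w = x.
Proof.
move=> /= /andP[vx pp] /andP[vn up] wp; apply: towardE => //.
have [->|wx] := eqVneq w x; first exact: connect0.
have {}wp : w \in p by move: wp; rewrite inE (negbTE wx).
case/splitPr: wp pp vn up => p1 p2 pp vn up.
apply/connectP; exists (rcons p1 w); last by rewrite last_rcons.
apply: avoiding_path; first by move: pp; rewrite -cat_rcons cat_path => /andP[].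
by move: vn; rewrite -cat_rcons -cat_cons mem_cat negb_or => /andP[].
Qed.

(** What [v] does not see in the direction of [v'] lies behind [v] as seen from [v']: the path from
    [v] to [w] avoids [v'] and continues the one from [v'] to [v]. *)
Lemma toward_other_branch v v' w : v != v' -> (w == v) || (toward e v w != toward e v v') ->
  w != v' /\ toward e v' w = toward e v' v.
Proof.
move=> vv'; have [->|wv] := eqVneq w v; first by [].
rewrite /= => tw; split; first by apply: contra_neq tw => ->.
have v'v : v' != v by rewrite eq_sym.
apply: towardE; first exact: toward_adj.
apply: connect_trans (toward_connect v'v) _.
rewrite eq_sym in wv; have [p [pp lp up]] := towardP wv.
apply/connectP; exists (toward e v w :: p) => //; apply: avoiding_path => //.
rewrite inE negb_or v'v/=; apply: contraNN tw => v'p.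
by rewrite (toward_on_path pp up v'p).
Qed.

Lemma toward_step u v w : e v w -> u != v -> u != w -> toward e u v = toward e u w.
Proof.
move=> vw uv uw; apply: towardE; first exact: toward_adj.
apply: connect_trans (toward_connect uw) (connect1 _).
by rewrite /avoiding /= tree_sym vw ![_ == u]eq_sym uv uw.
Qed.

(* The branches of a neighbour [w] of [v] other than that of [v] are strictly
   contained in the branch of [w] at [v]. *)
Lemma branch_ind (P : T -> T -> Prop) :
  (forall v w, e v w -> (forall x, e w x -> x != v -> P w x) -> P v w) ->
  forall v w, e v w -> P v w.
Proof.
move=> step v w; pose B v w := finset (fun u => (u != v) && (toward e v u == w)).
have [k] := ubnP #|B v w|; elim: k v w => [//|k ih] v w; rewrite ltnS => le vw.
apply: step => // x wx xv; apply: ih => //.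
apply: leq_trans le; apply: proper_card; apply/properP; split.
  apply/fintype.subsetP => u; rewrite !inE => /andP[uw /eqP tu].
  have wv : w != v by rewrite eq_sym tree_neq.
  have wv' : e w v by rewrite tree_sym.
  have [] := @toward_other_branch w v u wv.
    by rewrite tu (toward_neighbor wv') xv orbT.
  by move=> -> ->; rewrite toward_neighbor ?eqxx.
exists w; first by rewrite inE toward_neighbor// eqxx andbT eq_sym tree_neq.
by rewrite inE eqxx.
Qed.

End trees.

Lemma toward_iso (T T' : finType) (e : rel T) (e' : rel T') (h : T -> T') :
  is_tree e -> is_tree e' -> bijective h -> (forall v w, e' (h v) (h w) = e v w) ->
  forall v w, v != w -> toward e' (h v) (h w) = h (toward e v w).
Proof.
move=> te te' bh he v w vw; have [p [/= /andP[vx pp] lp /andP[vn up]]] := towardP te vw.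
apply: (towardE te'); first by rewrite he.
apply/connectP; exists (map h p); last by rewrite last_map lp.
apply: avoiding_path; last by rewrite -map_cons (mem_map (bij_inj bh)).
by rewrite path_map; apply: sub_path pp => a c /=; rewrite he.
Qed.

Section retractions.
Variables (R : realType) (l : nat) (C : curve R l).
Hypothesis hC : is_curve C.
Implicit Types (u v w : component C) (x : component C * P1 R).

Let te : is_tree (@adj R l C). Proof. by case: hC. Qed.

Lemma retract_at v z : retract v (v, z) = z.
Proof. by rewrite /retract eqxx. Qed.

Lemma retract_away v x : x.1 != v -> retract v x = node v (toward (@adj R l C) v x.1).
Proof. by rewrite /retract => /negbTE->. Qed.

Lemma retract_other v v' x : v != v' -> retract v x <> node v (toward (@adj R l C) v v') ->
  retract v' x = node v' (toward (@adj R l C) v' v).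
Proof.
move=> vv' rx; have [] := @toward_other_branch _ _ te v v' x.1 vv'.
  have [//|xv] := eqVneq x.1 v; apply/negP => /eqP tx; apply: rx.
  by rewrite retract_away// tx.
by move=> xv' tx; rewrite retract_away// tx.
Qed.

(** If v and v' differ, at most one of the three points projects on v to the node towards v'. The
    other two have the same projection on v', namely the node towards v. So three marks determine
    the component of their 4-point stabilizations. *)
Lemma distinct_retractions_component v v' x y z :
  retract v x <> retract v y -> retract v y <> retract v z -> retract v z <> retract v x ->
  retract v' x <> retract v' y -> retract v' y <> retract v' z -> retract v' z <> retract v' x ->
  v = v'.
Proof.
move=> xy yz zx xy' yz' zx'; apply/eqP/negPn/negP => vv'.
set n := node v (toward (@adj R l C) v v').
have r x0 : retract v x0 <> n -> retract v' x0 = node v' (toward (@adj R l C) v' v) by exact: retract_other.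
have [xn|/r rx] := pselect (retract v x = n).
  have ry : retract v y <> n by move=> yn; apply: xy; rewrite xn.
  have rz : retract v z <> n by move=> zn; apply: zx; rewrite zn.
  by apply: yz'; rewrite r// r.
have [yn|/r ry] := pselect (retract v y = n); last by apply: xy'; rewrite rx.
have rz : retract v z <> n by move=> zn; apply: yz; rewrite zn.
by apply: zx'; rewrite r// rx.
Qed.

Lemma retract_step u v w z : adj v w -> u != v -> retract u (w, node w v) = retract u (v, z).
Proof.
move=> vw uv; rewrite /retract /= [v == u]eq_sym (negbTE uv).
have [wu|wu] := eqVneq w u; last by congr (node u _); rewrite (toward_step te vw)// eq_sym.
by rewrite wu toward_neighbor// -wu (tree_sym te).
Qed.

Definition special_points v : seq (P1 R) :=
  [seq node v w | w <- enum [pred w | adj v w]] ++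
  [seq (mark C i).2 | i <- enum [pred i | (mark C i).1 == v]].

Lemma size_special_points v : size (special_points v) = nspecial v.
Proof. by rewrite size_cat !size_map -!cardE. Qed.

Lemma uniq_special_points v : uniq (special_points v).
Proof.
have [_ ni mi mn] := hC.
rewrite cat_uniq !map_inj_in_uniq ?enum_uniq; last first.
- by move=> w w'; rewrite !mem_enum => vw vw' /(ni _ _ _ vw vw').
- move=> i j; rewrite !mem_enum => /eqP iv /eqP jv ij; apply: mi.
  by move: iv jv ij; case: (mark C i) => ? ?; case: (mark C j) => ? ? /= -> -> ->.
rewrite /= andbT; apply/hasPn => _ /mapP[i + ->]; rewrite mem_enum => /eqP iv.
apply/mapP => -[w]; rewrite mem_enum => vw e; apply: (mn i v w vw).
by move: iv e; case: (mark C i) => ? ? /= -> ->.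
Qed.

Hypothesis st : forall v, (3 <= nspecial v)%N.

Lemma branch_mark v w : adj v w -> exists2 i, (mark C i).1 != v & toward (@adj R l C) v (mark C i).1 = w.
Proof.
move: v w; apply: (branch_ind te) => v w vw ih.
have wv : adj w v by rewrite (tree_sym te).
have nvw := tree_neq te vw.
have [i /eqP iw|nom] := pickP [pred i | (mark C i).1 == w].
  by exists i; rewrite iw ?toward_neighbor// eq_sym.
have [x /andP[wx xv]|nox] := pickP [pred x | adj w x & x != v].
  have [i iw ti] := ih x wx xv; have [] := @toward_other_branch _ _ te w v (mark C i).1.
  - by rewrite eq_sym.
  - by rewrite ti (toward_neighbor te wv) xv orbT.
  by move=> iv tv; exists i => //; rewrite tv toward_neighbor.
have := st w; rewrite /nspecial (eq_card0 nom) addn0.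
rewrite (_ : #|_| = 1)%N// -(card1 v); apply: eq_card => x; rewrite !inE.
have [->|xv] := eqVneq x v; first by rewrite wv.
by have := nox x; rewrite /= xv andbT.
Qed.

Lemma special_point_retract v p : p \in special_points v -> exists i, retract v (mark C i) = p.
Proof.
rewrite mem_cat => /orP[|] /mapP[i + ->]; rewrite mem_enum => h.
  have [j jv tj] := branch_mark h; exists j.
  by rewrite retract_away// tj.
by exists i; move: h; rewrite inE /retract => ->.
Qed.

Lemma three_marks v : exists i j k, [/\ retract v (mark C i) <> retract v (mark C j),
  retract v (mark C j) <> retract v (mark C k) & retract v (mark C k) <> retract v (mark C i)].
Proof.
have := uniq_special_points v; have := st v; rewrite -size_special_points.
have := @special_point_retract v; case: (special_points v) => [//|p [//|q [//|r s]]] h _.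
rewrite /= !inE !negb_or => /and3P[/and3P[/eqP pq /eqP pr _] /andP[/eqP qr _] _].
have [i hi] := h p (mem_head _ _).
have [|j hj] := h q; first by rewrite !inE eqxx orbT.
have [|k hk] := h r; first by rewrite !inE eqxx !orbT.
by exists i, j, k; rewrite hi hj hk; split => // /esym.
Qed.

End retractions.

Lemma retract_iso (R : realType) (l l' : nat) (C : curve R l) (C' : curve R l') h T v x :
  is_curve C -> is_curve C' -> is_biholomorphism h T ->
  @retract R l' C' (h v) (map_point h T x) = T v (@retract R l C v x).
Proof.
move=> [te _ _ _] [te' _ _ _] [bh ha _ hn]; rewrite /retract /map_point /= (bij_eq bh).
have [->//|xv] := eqVneq x.1 v; rewrite eq_sym in xv.
by rewrite (toward_iso te te' bh ha)// hn//; exact: toward_adj.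
Qed.

(** Along the path of components from [x] to [x'], the entry and exit points on each component are
    the projections of [x] and [x'], and consecutive ones are glued. *)
Lemma chain_bound (R : realType) (n l : nat) (X : tamed_manifold R n) (C : curve R l)
    (f : component C * P1 R -> X) (D : component C -> R) x x' :
  is_curve C -> (forall v w, adj v w -> f (v, node v w) = f (w, node w v)) ->
  (forall v, 0 <= D v) ->
  (forall v, (rdist (f (v, retract v x)) (f (v, retract v x')) <= (D v)%:E)%E) ->
  (rdist (f x) (f x') <= (\sum_v D v)%:E)%E.
Proof.
move=> hC fn D0 hD; have [te _ _ _] := hC.
have [_ _ /(_ x.1 x'.1)[p [[pp lp up] _]]] := te.
suff h : forall q v a, path (@adj R l C) v q -> last v q = x'.1 -> uniq (v :: q) ->
    (forall u, u \in v :: q -> (rdist (f (u, retract u (v, a))) (f (u, retract u x')) <= (D u)%:E)%E) ->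
    (rdist (f (v, a)) (f x') <= (\sum_(u <- v :: q) D u)%:E)%E.
  apply: le_trans (_ : _ <= (\sum_(u <- x.1 :: p) D u)%:E)%E _.
    by rewrite [in leLHS](surjective_pairing x); apply: h => // u _; rewrite -surjective_pairing.
  rewrite lee_fin (big_uniq _ up)/= [leRHS](bigID (mem (x.1 :: p)))/= lerDl.
  by apply: sumr_ge0.
elim=> [|w q ih] v a /=.
  move=> _ vx' _ /(_ v (mem_head _ _)); rewrite big_seq1 vx' retract_at.
  by rewrite /retract eqxx -surjective_pairing.
move=> /andP[vw pq] lq /andP[vn uq] h.
have uq' : uniq (v :: w :: q) by rewrite /= vn.
rewrite big_cons EFinD -EFinD; apply: (@rdist_triangle _ _ _ _ (f (v, node v w))).
  have := h v (mem_head _ _); rewrite retract_at retract_away.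
    rewrite (@toward_on_path _ _ te v w q)//=; first by rewrite vw.
    by rewrite -lq mem_last.
  by apply: contraNneq vn => <-; rewrite -lq mem_last.
rewrite fn//; apply: ih => // u uq1.
rewrite (@retract_step _ _ _ hC u v w a)//; first by apply: h; rewrite inE uq1 orbT.
by apply: contraNneq vn => <-.
Qed.

(** * Uniqueness of Moebius maps, and the embedding of stable curves *)

Section moebius_uniqueness.
Variable R : realType.
Implicit Types x y z : P1 R.

(* [x] is the point [hnum x : hden x] in homogeneous coordinates. *)
Definition hnum x : R[i] := if x is Some z then z else 1.
Definition hden x : R[i] := if x is Some _ then 1 else 0.

Lemma moebius_eq (a b c d a' b' c' d' : R[i]) x x' :
  a * d - b * c != 0 -> a' * d' - b' * c' != 0 ->
  (moebius a b c d x = moebius a' b' c' d' x') <->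
  (a * hnum x + b * hden x) * (c' * hnum x' + d' * hden x') =
  (a' * hnum x' + b' * hden x') * (c * hnum x + d * hden x).
Proof.
have key (p q p' q' : R[i]) : (q == 0 -> p != 0) -> (q' == 0 -> p' != 0) ->
   ((if q == 0 then None else Some (p / q)) = (if q' == 0 then None else Some (p' / q'))) <-> p * q' = p' * q.
  have [->|q0] := eqVneq q 0; have [->|q0'] := eqVneq q' 0 => /= h h'.
  - by rewrite !mulr0.
  - by split => // /eqP; rewrite mulr0 mulf_eq0 (negbTE (h isT)) (negbTE q0').
  - by split => // /esym/eqP; rewrite mulr0 mulf_eq0 (negbTE (h' isT)) (negbTE q0).
  - split => [[/eqP]|e]; first by rewrite eqr_div// => /eqP.
    by congr Some; apply/eqP; rewrite eqr_div// e.
have nz (s t u v p q : R[i]) : s * v - t * u != 0 -> (p != 0) || (q != 0) ->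
    u * p + v * q == 0 -> s * p + t * q != 0.
  move=> det pq /eqP e; apply/eqP => e'.
  have hp : (s * v - t * u) * p = 0.
    by rewrite (_ : _ * p = v * (s * p + t * q) - t * (u * p + v * q)); [rewrite e e' !mulr0 subr0|ring].
  have hq : (s * v - t * u) * q = 0.
    by rewrite (_ : _ * q = s * (u * p + v * q) - u * (s * p + t * q)); [rewrite e e' !mulr0 subr0|ring].
  by move: pq; move/eqP: hp; move/eqP: hq; rewrite !mulf_eq0 (negbTE det) /= => -> ->.
move=> det det'.
have hx y : (hnum y != 0) || (hden y != 0) by case: y => [z|]; rewrite /= oner_eq0 ?orbT.
have e s t u v y : moebius s t u v y = if u * hnum y + v * hden y == 0 then None else
   Some ((s * hnum y + t * hden y) / (u * hnum y + v * hden y)).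
  by case: y => [z|] /=; rewrite ?mulr1 ?mulr0 ?addr0.
by rewrite !e; apply: key; exact: nz.
Qed.

Lemma binary_quadratic_eq0 (al be ga : R[i]) p q r : p != q -> q != r -> r != p ->
  (forall x, x \in [:: p; q; r] -> al * hnum x ^+ 2 + be * (hnum x * hden x) + ga * hden x ^+ 2 = 0) ->
  [/\ al = 0, be = 0 & ga = 0].
Proof.
move=> pq qr rp h.
have lin (a b : R[i]) (z w : R[i]) : z != w -> a * z + b = 0 -> a * w + b = 0 -> a = 0 /\ b = 0.
  move=> zw h1 h2; have a0 : a = 0.
    have : a * (z - w) = 0 by rewrite (_ : a * _ = (a * z + b) - (a * w + b)); [rewrite h1 h2 subrr|ring].
    by move/eqP; rewrite mulf_eq0 subr_eq0 (negbTE zw) orbF => /eqP.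
  by move: h1; rewrite a0 mul0r add0r.
have inf (z w : R[i]) : z != w -> (forall x, x \in [:: None; Some z; Some w] ->
    al * hnum x ^+ 2 + be * (hnum x * hden x) + ga * hden x ^+ 2 = 0) -> [/\ al = 0, be = 0 & ga = 0].
  move=> zw k; have /= := k None (mem_head _ _); rewrite expr1n !mulr0 expr0n !mulr0 !addr0 mulr1 => al0.
  have /= h1 := k (Some z); have /= h2 := k (Some w).
  move: h1 h2; rewrite !inE !eqxx !orbT al0 !mul0r !add0r !expr1n !mulr1 => /(_ isT) h1 /(_ isT) h2.
  by have [] := lin _ _ _ _ zw h1 h2.
have sw (s : seq (P1 R)) : (forall x, x \in s -> x \in [:: p; q; r]) -> forall x, x \in s ->
    al * hnum x ^+ 2 + be * (hnum x * hden x) + ga * hden x ^+ 2 = 0 by move=> k x /k; exact: h.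
have sneq (z w : R[i]) : Some z != Some w :> P1 R -> z != w by apply: contra => /eqP->.
case: p q r pq qr rp h sw => [p|] [q|] [r|]// pq qr rp h sw.
- have vp := h (Some p); have vq := h (Some q); have vr := h (Some r).
  move: vp vq vr; rewrite !inE !eqxx !orbT /= !expr1n !mulr1 => /(_ isT) vp /(_ isT) vq /(_ isT) vr.
  have cancel (z w : R[i]) : z != w -> al * z ^+ 2 + be * z + ga = 0 -> al * w ^+ 2 + be * w + ga = 0 -> al * (z + w) + be = 0.
    move=> zw h1 h2; have : (al * (z + w) + be) * (z - w) = 0.
      rewrite (_ : _ * _ = (al * z ^+ 2 + be * z + ga) - (al * w ^+ 2 + be * w + ga)); last by ring.
      by rewrite h1 h2 subrr.
    by move/eqP; rewrite mulf_eq0 subr_eq0 (negbTE zw) orbF => /eqP.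
  have c1 := cancel _ _ (sneq _ _ pq) vp vq; have c2 := cancel _ _ (sneq _ _ qr) vq vr.
  have [|||al0 be0] := lin al (al * q + be) p r.
  - by rewrite eq_sym sneq.
  - by rewrite -c1; ring.
  - by rewrite -c2; ring.
  move: be0 vp; rewrite al0 mul0r add0r => be0.
  by rewrite be0 !mul0r !add0r.
- apply: (inf p q); first exact: sneq.
  by apply: sw => x; rewrite !inE => /or3P[]->; rewrite ?orbT.
- apply: (inf p r); first by rewrite eq_sym sneq.
  by apply: sw => x; rewrite !inE => /or3P[]->; rewrite ?orbT.
- apply: (inf q r); first exact: sneq.
  by apply: sw => x; rewrite !inE => /or3P[]->; rewrite ?orbT.
Qed.

(** In homogeneous coordinates S x = T x is a binary quadratic equation for x; having three distinct
    roots, it is trivial. *)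
Lemma moebius_uniq (S T : P1 R -> P1 R) p q r : is_moebius S -> is_moebius T ->
  p != q -> q != r -> r != p -> S p = T p -> S q = T q -> S r = T r -> S =1 T.
Proof.
move=> [a [b [c [d [det eS]]]]] [a' [b' [c' [d' [det' eT]]]]] pq qr rp ep eq er.
have quad x : (S x = T x) <-> (a * c' - a' * c) * hnum x ^+ 2 +
    (a * d' + b * c' - a' * d - b' * c) * (hnum x * hden x) + (b * d' - b' * d) * hden x ^+ 2 = 0.
  rewrite eS eT moebius_eq//; move: (hnum x) (hden x) => z w.
  rewrite [X in _ <-> X = 0](_ : _ = (a * z + b * w) * (c' * z + d' * w) - (a' * z + b' * w) * (c * z + d * w)); last by ring.
  by split => [->|/eqP]; rewrite ?subrr// subr_eq0 => /eqP.
have [|al be ga] := binary_quadratic_eq0 pq qr rp (al := a * c' - a' * c)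
    (be := a * d' + b * c' - a' * d - b' * c) (ga := b * d' - b' * d).
  by move=> x; rewrite !inE => /or3P[]/eqP->; apply/quad.
by move=> x; apply/quad; rewrite al be ga !mul0r !addr0.
Qed.

End moebius_uniqueness.

Section embedding.
Variables (R : realType) (l : nat) (C : curve R l).
Hypothesis hC : is_stable_curve C.
Implicit Types (v : component C) (x : component C * P1 R).

Lemma root3_neq : [/\ root3 R 0 <> root3 R 1, root3 R 1 <> root3 R (-1) & root3 R (-1) <> root3 R 0].
Proof.
have [h1 h2 h3 _] := root3_chords (root3 R 0).
by split => e; [move: h1|move: h2|move: h3]; rewrite e brxx !(mulr0, mul0r) => /esym/eqP; rewrite pnatr_eq0.
Qed.

Lemma sdist_le_zdist m (y y' : Z R m) t : sdist (y t) (y' t) <= zdist y y'.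
Proof. by rewrite /zdist (bigD1 t)//= le_max lexx. Qed.

Lemma zdist_ge0 m (y y' : Z R m) : 0 <= zdist y y'.
Proof. by rewrite /zdist; elim/big_rec: _ => // i x _ x0; rewrite le_max x0 orbT. Qed.

Lemma spreadC12 (p q r x : P1 R) : spread q p r x = spread p q r x.
Proof. by rewrite /spread (brC p r) (brC r q) (brC q p); ring. Qed.

Lemma spreadC23 (p q r x : P1 R) : spread p r q x = spread p q r x.
Proof. by rewrite /spread (brC r q) (brC q p) (brC p r); ring. Qed.

(** Only increasing triples are coordinates of Z, but the inequality is symmetric in i, j, k. For an
    increasing triple, the components and the Moebius maps in the stabilizations of x and x'
    coincide, because three marks determine them; then [standard_chord] applies. *)
Lemma chord_le_zdist x x' y y' v (i j k : 'I_l) : embeds x y -> embeds x' y' ->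
  let p := retract v (mark C i) in let q := retract v (mark C j) in let r := retract v (mark C k) in
  p <> q -> q <> r -> r <> p ->
  12 * br (retract v x) (retract v x') * (br p q * br q r * br r p) <=
  zdist y y' ^+ 2 * (spread p q r (retract v x) * spread p q r (retract v x')).
Proof.
move=> ex ex'; cbv zeta; have [cC _] := hC.
set X := retract v x; set X' := retract v x'.
pose P i j k := let p := retract v (mark C i) in let q := retract v (mark C j) in let r := retract v (mark C k) in
  p <> q -> q <> r -> r <> p ->
  12 * br X X' * (br p q * br q r * br r p) <= zdist y y' ^+ 2 * (spread p q r X * spread p q r X').
have P12 i' j' k' : P j' i' k' -> P i' j' k'.
  rewrite /P /= => h a1 a2 a3; have := h (nesym a1) (nesym a3) (nesym a2).
  rewrite !(spreadC12 (retract v (mark C i'))); congr (_ * _ <= _).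
  by rewrite (brC (retract v (mark C j'))) (brC (retract v (mark C i')) (retract v (mark C k'))) (brC (retract v (mark C k')) (retract v (mark C j'))); ring.
have P23 i' j' k' : P i' k' j' -> P i' j' k'.
  rewrite /P /= => h a1 a2 a3; have := h (nesym a3) (nesym a2) (nesym a1).
  rewrite !(spreadC23 _ (retract v (mark C j'))); congr (_ * _ <= _).
  by rewrite (brC (retract v (mark C i')) (retract v (mark C k'))) (brC (retract v (mark C k')) (retract v (mark C j'))) (brC (retract v (mark C j')) (retract v (mark C i'))); ring.
suff ord (i' j' k' : 'I_l) : (i' < j' < k')%N -> P i' j' k'.
  rewrite -/(P i j k); have [ij|ji|/val_inj ij] := ltngtP i j; last by rewrite /P /= ij.
  - have [jk|kj|/val_inj jk] := ltngtP j k; last by rewrite /P /= jk.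
      by apply: ord; rewrite ij jk.
    apply: (P23 _ _ _); have [ik|ki|/val_inj ik] := ltngtP i k; last by rewrite /P /= ik.
      by apply: ord; rewrite ik kj.
    by apply: (P12 _ _ _); apply: ord; rewrite ki ij.
  - apply: (P12 _ _ _); have [ik|ki|/val_inj ik] := ltngtP i k; last by rewrite /P /= ik => _ ? ?.
      by apply: ord; rewrite ji ik.
    apply: (P23 _ _ _); have [jk|kj|/val_inj jk] := ltngtP j k; last by rewrite /P /= jk.
      by apply: ord; rewrite jk ki.
    by apply: (P12 _ _ _); apply: ord; rewrite kj ji.
move=> ijk; rewrite /P /= => pq qr rp.
pose t : triple l := exist _ (i', j', k') ijk.
have [r01 r12 r20] := root3_neq.
have comp (w : component C) (T : P1 R -> P1 R) : T (retract w (mark C i')) = root3 R 0 ->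
    T (retract w (mark C j')) = root3 R 1 -> T (retract w (mark C k')) = root3 R (-1) -> w = v.
  move=> e0 e1 e2.
  apply: (@distinct_retractions_component _ _ _ cC w v (mark C i') (mark C j') (mark C k')) => // e.
  - by apply: r01; rewrite -e0 -e1 e.
  - by apply: r12; rewrite -e1 -e2 e.
  - by apply: r20; rewrite -e2 -e0 e.
have [w [T [mT [/= e0 e1 e2 yt]]]] := ex t.
have [w' [T' [mT' [/= e0' e1' e2' yt']]]] := ex' t.
have wv := comp _ _ e0 e1 e2; have wv' := comp _ _ e0' e1' e2'; subst w w'.
have TT : T' =1 T.
  by apply: (moebius_uniq mT' mT _ _ _ (etrans e0' (esym e0)) (etrans e1' (esym e1)) (etrans e2' (esym e2))); apply/eqP.
have := standard_chord X X' mT e0 e1 e2 => /le_trans; apply.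
rewrite ler_wpM2r ?mulr_ge0 ?spread_ge0// lerXn2r ?nnegrE ?sdist_ge0 ?zdist_ge0//.
by rewrite -yt -TT -yt'; exact: sdist_le_zdist.
Qed.

Lemma retract_eq_of_zdist0 x x' y y' v : embeds x y -> embeds x' y' -> zdist y y' = 0 ->
  retract v x = retract v x'.
Proof.
move=> ex ex' z0; have [cC st] := hC.
have [i [j [k [ij jk ki]]]] := three_marks cC st v.
have := chord_le_zdist ex ex' ij jk ki; rewrite /= z0 expr0n mul0r; apply: contra_leP => /eqP xx.
by rewrite !mulr_gt0 ?br_gt0 ?ltr0n//; apply/eqP.
Qed.

End embedding.

(** * Decorations of small Lipschitz constant *)

Lemma fresh_points (R : realType) (T : eqType) (g : R[i] -> T) (S : seq T) (m : nat) : injective g ->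
  exists s : seq T, [/\ uniq s, size s = m & forall x, x \in s -> x \notin S].
Proof.
move=> gi; elim: m => [|m [s [us ss ns]]]; first by exists [::].
pose N := [seq g (k%:R) | k <- iota 0 (size (s ++ S)).+1].
have uN : uniq N.
  rewrite map_inj_uniq ?iota_uniq// => a c /gi /eqP; rewrite eqr_nat => /eqP //.
have [/hasP[x xN xs]|/hasPn h] := boolP (has (predC (mem (s ++ S))) N).
  move: xs; rewrite /= mem_cat negb_or => /andP[xs xS].
  exists (x :: s); split => /=; rewrite ?xs ?ss// => z.
  by rewrite inE => /orP[/eqP->//|/ns].
have : (size N <= size (s ++ S))%N.
  by apply: uniq_leq_size => // x /h; rewrite /= negbK.
by rewrite size_map size_iota ltnn.
Qed.

Lemma sphere_energy_ge0 (R : realType) (n : nat) (X : tamed_manifold R n) (f : P1 R -> X) :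
  (0 <= sphere_energy f)%E.
Proof.
rewrite /sphere_energy mule_ge0 ?lee_fin ?invr_ge0//; apply: integral_ge0 => z _.
by rewrite lee_fin energy_density_ge0.
Qed.

(** [chord_constant a] is [a] times an increasing function of [a], hence superadditive. *)
Lemma sum_chord_constant (R : realType) (I : finType) (a : I -> nat) :
  \sum_i chord_constant R (a i) <= chord_constant R (\sum_i a i).
Proof.
set S := (\sum_i a i)%N.
have aS i : (a i <= S)%N by rewrite /S (bigD1 i)//= leq_addr.
apply: (@le_trans _ _ (\sum_i (a i)%:R * (80 * S%:R * (64 * (S.*2.+1)%:R) ^+ 2))).
  apply: ler_sum => i _; rewrite /chord_constant.
  rewrite (_ : 80 * (a i)%:R ^+ 2 * _ = (a i)%:R * (80 * (a i)%:R * (64 * (a i).*2.+1%:R) ^+ 2)); last first.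
    by move: (64 * _) => w; rewrite expr2; ring.
  rewrite ler_wpM2l// ler_pM ?mulr_ge0 ?sqr_ge0 ?ler_wpM2l ?ler_nat ?aS//.
  by rewrite lerXn2r ?nnegrE ?mulr_ge0 ?ler_wpM2l ?ler_nat ?ltnS ?leq_double ?aS.
rewrite -mulr_suml -natr_sum -/S /chord_constant; move: (64 * _) => w.
by rewrite [leRHS](_ : _ = S%:R * (80 * S%:R * w ^+ 2))// expr2; ring.
Qed.

Section adding_marks.
Variables (R : realType) (l m : nat) (C : curve R l) (S : seq (component C * P1 R)).
Hypothesis hC : is_curve C.
Hypothesis sS : size S = m.
Hypothesis uS : uniq S.
Hypothesis markS : forall i, mark C i \notin S.
Hypothesis nodeS : forall v w, adj v w -> (v, node v w) \notin S.

Definition added_mark (i : 'I_(l + m)) : component C * P1 R :=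
  match fintype.split i with inl j => mark C j | inr j => nth (ord0, None) S j end.

Definition marked_curve : curve R (l + m) := @Curve R (l + m) (ncomp C) (@adj R l C) (@node R l C) added_mark.

Lemma added_mark_lshift i : added_mark (lshift m i) = mark C i.
Proof. by rewrite /added_mark (unsplitK (inl i)). Qed.

Lemma added_mark_rshift (j : 'I_m) : added_mark (rshift l j) = nth (ord0, None) S j.
Proof. by rewrite /added_mark (unsplitK (inr j)). Qed.

Lemma nth_added (j : 'I_m) : nth (ord0, None) S j \in S.
Proof. by rewrite mem_nth// sS. Qed.

Lemma is_curve_marked : is_curve marked_curve.
Proof.
have [te ni mi mn] := hC; split => //.
- move=> i j /=; rewrite -(splitK i) -(splitK j).
  case: (fintype.split i) (fintype.split j) => [i'|i'] [j'|j'] /=;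
    rewrite ?added_mark_lshift ?added_mark_rshift => e.
  + by rewrite (mi _ _ e).
  + by have := markS i'; rewrite e nth_added.
  + by have := markS j'; rewrite -e nth_added.
  + by congr (rshift l _); apply/val_inj/eqP; rewrite -(nth_uniq (ord0, None) _ _ uS) ?sS ?ltn_ord ?e ?eqxx.
- move=> i v w vw /=; rewrite -(splitK i).
  case: (fintype.split i) => i' /=; rewrite ?added_mark_lshift ?added_mark_rshift; first exact: mn.
  by move=> e; have := nodeS vw; rewrite -e nth_added.
Qed.

Lemma special_marked_old v : {subset special_points (v : component C) <= special_points (v : component marked_curve)}.
Proof.
move=> p; rewrite !mem_cat => /orP[->//|/mapP[i + ->]]; rewrite mem_enum => iv.
by apply/orP; right; apply/mapP; exists (lshift m i); rewrite ?mem_enum /= ?inE /= added_mark_lshift.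
Qed.

Lemma special_marked_new v p : (v, p) \in S -> p \in special_points (v : component marked_curve).
Proof.
move=> vp; rewrite mem_cat; apply/orP; right; apply/mapP.
have lt : (index (v, p) S < m)%N by rewrite -sS index_mem.
exists (rshift l (Ordinal lt)); rewrite ?mem_enum /= ?inE /= added_mark_rshift /= nth_index//=.
Qed.

End adding_marks.

Section first_part.
Variables (R : realType) (n : nat) (b : R).
Hypothesis b1 : 1 <= b.

(** The curve is that of [u], with marks added by the identity. A component with nonempty [Q v] gets
    at least three special points; on the others the map is constant, and stability of the map
    provides them. The bound on A / hq ensures that [m] marks are enough. *)
Theorem decoration_exists : exists hq K : R, [/\ 0 < hq, 0 < K &
  forall (X : tamed_manifold R n) (l m : nat) (u : nodal_map R X l) (A : R),
    (forall x : X, exists c, bchart c x b) ->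
    is_stable_map u -> (energy u <= A%:E)%E -> A / hq < m.+1%:R ->
  exists (d : decoration R X l m) (q : nat), [/\ drep d = u,
    is_stable_curve (dcurve d) /\ is_biholomorphism (Defs.dcomp d) (dmoebius d),
    forall i : 'I_l, mark (dcurve d) (lshift m i) =
        map_point (Defs.dcomp d) (dmoebius d) (mark (domain (drep d)) i),
    q%:R <= A / hq &
    forall z z', graph d z -> graph d z' -> (rdist z.2 z'.2 <= (K * chord_constant R q * zdist z.1 z'.1)%:E)%E]].
Proof.
have [hq [K [hq0 K0 est]]] := sphere_estimate n b1.
exists hq, K; split => // X l m u A bg su EA Am.
have [hC Ju nu stu] := su; set C := domain u in hC Ju nu stu.
pose E v := sphere_energy (fun z => Defs.fmap u (v : component C, z)).
have E0 v : (0 <= E v)%E by exact: sphere_energy_ge0.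
have sumE : (\sum_v E v <= A%:E)%E by [].
have Efin v : E v \is a fin_num.
  rewrite ge0_fin_numE//; apply: le_lt_trans (ltry A); apply: le_trans sumE.
  by rewrite (bigD1 v)//= leeDl// sume_ge0.
have sumE' : \sum_v fine (E v) <= A.
  rewrite -lee_fin -sumEFin; apply: le_trans sumE.
  by apply: lee_sum => v _; rewrite fineK.
have /choice[Q hQ] : forall v, exists Q : seq (P1 R), [/\ uniq Q, (size Q)%:R <= fine (E v) / hq,
    (Q = [::] /\ forall x y, Defs.fmap u (v, x) = Defs.fmap u (v, y)) \/ (3 <= size Q)%N &
    forall (d : R) x x', 0 <= d ->
      (forall p q r, p \in Q -> q \in Q -> r \in Q -> p != q -> q != r -> r != p ->
        12 * br x x' * (br p q * br q r * br r p) <= d ^+ 2 * (spread p q r x * spread p q r x')) ->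
      (rdist (Defs.fmap u (v, x)) (Defs.fmap u (v, x')) <= (K * chord_constant R (size Q) * d)%:E)%E].
  by move=> v; apply: (est X _ _ bg (Ju v)); rewrite fineK.
pose q := (\sum_v size (Q v))%N.
have qA : q%:R <= A / hq.
  rewrite /q natr_sum; apply: le_trans (_ : _ <= \sum_v fine (E v) / hq) _.
    by apply: ler_sum => v _; have [] := hQ v.
  by rewrite -mulr_suml ler_wpM2r// invr_ge0 ltW.
have qm : (q <= m)%N by rewrite -ltnS -(ltr_nat R); exact: le_lt_trans qA Am.
(* Points of [Q v] that are already nodes or marks are not marked again, since special points have
   to be distinct. The marks left over after [B] are placed at fresh points. *)
pose Q' v := [seq p <- Q v | p \notin special_points (v : component C)].
pose B := [seq (v, p) | v <- enum 'I_(ncomp C).+1, p <- Q' v].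
have uB : uniq B.
  apply: allpairs_uniq_dep; rewrite ?enum_uniq//.
    by move=> v _; rewrite filter_uniq//; have [] := hQ v.
  by move=> [v p] [v' p'] _ _ /= [-> ->].
have sB : (size B <= q)%N.
  rewrite size_allpairs_dep sumnE big_map big_enum/=; apply: leq_sum => v _.
  by rewrite size_filter count_size.
pose forb := B ++ [seq mark C i | i <- enum 'I_l] ++
  [seq (v, node v w) | v <- enum 'I_(ncomp C).+1, w <- enum 'I_(ncomp C).+1].
have gi : injective (fun z : R[i] => (ord0 : component C, Some z : P1 R)) by move=> a c [].
have [s [us ss ns]] := fresh_points forb (m - size B) gi.
pose S := B ++ s.
have sS : size S = m by rewrite size_cat ss subnKC// (leq_trans sB).
have uS : uniq S.
  rewrite cat_uniq uB us andbT; apply/hasPn => x /ns; apply: contra => xB.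
  by rewrite /forb mem_cat [x \in B]xB.
have BP v p : (v, p) \in B -> p \notin special_points (v : component C).
  by move=> /allpairsPdep[v' [p' [_ + [-> ->]]]]; rewrite mem_filter => /andP[].
have markS i : mark C i \notin S.
  rewrite mem_cat negb_or; apply/andP; split.
    rewrite [mark C i]surjective_pairing; apply/negP => /BP/negP; apply.
    by rewrite mem_cat; apply/orP; right; apply: map_f; rewrite mem_enum inE.
  by apply/negP => /ns; rewrite !mem_cat map_f ?orbT// mem_enum.
have nodeS v w : adj v w -> (v, node v w) \notin S.
  move=> vw; rewrite mem_cat negb_or; apply/andP; split.
    apply/negP => /BP/negP; apply.
    by rewrite mem_cat; apply/orP; left; apply: map_f; rewrite mem_enum.
  apply/negP => /ns; rewrite !mem_cat !negb_or => /and3P[_ _ /negP]; apply.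
  by apply/allpairsP; exists (v, w); rewrite !mem_enum.
pose C' := marked_curve m S.
have cC' : is_curve C' by exact: is_curve_marked.
have QS v p : p \in Q v -> p \in special_points (v : component C').
  move=> pQ; have [ps|ps] := boolP (p \in special_points (v : component C)); first exact: special_marked_old.
  apply: special_marked_new => //; rewrite mem_cat; apply/orP; left.
  by apply/allpairsPdep; exists v, p; rewrite mem_enum mem_filter ps.
have stC' : is_stable_curve C'.
  split => // v; rewrite -size_special_points; have [uQ _ [[Q0 cst]|Q3] _] := hQ v.
    apply: leq_trans (stu v cst) _; rewrite -size_special_points.
    by apply: uniq_leq_size; [exact: uniq_special_points|exact: special_marked_old].
  by apply: leq_trans Q3 _; apply: uniq_leq_size => // p /QS.
pose d : decoration R X l m := @Decoration R X l m u C' (fun v => v) (fun _ z => z).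
exists d, q; split => //.
- split => //; split => //.
  + by exists id.
  + by move=> v; exists 1, 0, 0, 1; split; [rewrite mulr1 mulr0 subr0 oner_neq0|case=> [z|] /=; rewrite ?mul0r ?add0r ?oner_eq0 ?mul1r ?addr0 ?divr1 ?eqxx].
- by move=> i; rewrite /= added_mark_lshift /map_point /= -surjective_pairing.
move=> [y p] [y' p'] [x /= [ex ->]] [x' /= [ex' ->]].
rewrite /map_point /= -!surjective_pairing in ex ex'.
have [_ st'] := stC'.
pose D v := K * chord_constant R (size (Q v)) * zdist y y'.
have d0 : 0 <= zdist y y' by exact: zdist_ge0.
have D0 v : 0 <= D v by rewrite (mulr_ge0 (mulr_ge0 (ltW K0) (chord_constant_ge0 _ _)) d0).
apply: le_trans (@chain_bound R n _ X C' (Defs.fmap u) D x x' cC' nu D0 _) _.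
  move=> v; have [_ _ _ h] := hQ v; apply: h => // a c e aQ cQ eQ ac ce ea.
  have [i ia] := special_point_retract cC' st' (QS v a aQ).
  have [j jc] := special_point_retract cC' st' (QS v c cQ).
  have [k ke] := special_point_retract cC' st' (QS v e eQ).
  have := @chord_le_zdist R _ C' stC' x x' y y' v i j k ex ex'.
  by rewrite /= ia jc ke; apply; apply/eqP.
rewrite lee_fin /D -mulr_suml -mulr_sumr ler_wpM2r// ler_wpM2l ?(ltW K0)//.
exact: sum_chord_constant.
Qed.

End first_part.

(** * Counting cells *)

Section cells.
Variable R : realType.

(** The interval [-h, h] is cut into P.+1 equal parts; [minn] puts its right end into the last
    one. *)
Definition cell (P : nat) (h u : R) : 'I_P.+1 := inord (minn (Num.truncn ((u + h) * P.+1%:R / (2 * h))) P).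

Lemma cell_dist P h u u' : 0 < h -> `|u| <= h -> `|u'| <= h -> cell P h u = cell P h u' ->
  `|u - u'| <= 2 * h / P.+1%:R.
Proof.
move=> h0.
have bd v : `|v| <= h -> (cell P h v)%:R <= (v + h) * P.+1%:R / (2 * h) <= (cell P h v)%:R + 1.
  rewrite ler_norml => /andP[v1 v2]; rewrite /cell; set x := _ / (2 * h).
  have h2 : 0 < 2 * h by rewrite mulr_gt0.
  have x0 : 0 <= x by apply: divr_ge0 (ltW h2); apply: mulr_ge0 => //; move: v1; clear; move=> *; lra.
  have xP : x <= P.+1%:R.
    rewrite ler_pdivrMr// mulrC ler_wpM2l//; move: v2; clear; move=> *; lra.
  have /andP[t1 t2] := truncn_itv x0.
  rewrite inordK ?ltnS ?geq_minr//.
  have [tP|tP] := leqP (Num.truncn x) P.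
    by rewrite t1 natr1 ltW.
  rewrite natr1 xP andbT; apply: le_trans t1; rewrite ler_nat; exact: ltnW.
move=> /bd b1 /bd b2 e; rewrite e in b1.
have p0 : 0 < P.+1%:R :> R by rewrite ltr0n.
have h2 : 0 < 2 * h by rewrite mulr_gt0.
have : `|(u - u') * (P.+1%:R / (2 * h))| <= 1.
  rewrite (_ : _ * _ = (u + h) * P.+1%:R / (2 * h) - (u' + h) * P.+1%:R / (2 * h)); last by field; rewrite gt_eqF.
  move: b1 b2; move: (_ / (2 * h)) (_ / (2 * h)) (_%:R) => x y k; clear => /andP[? ?] /andP[? ?].
  by rewrite ler_norml; apply/andP; split; lra.
rewrite normrM (ger0_norm (ltW (divr_gt0 p0 h2))) -ler_pdivlMr ?divr_gt0//.
by rewrite mul1r invf_div.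
Qed.

Implicit Types x y : P1 R.

Definition inv_point x : P1 R := if x is Some z then (if z == 0 then None else Some z^-1) else Some 0.

Lemma chord_inv x y :
  br (inv_point x) (inv_point y) / (hsq (inv_point x) * hsq (inv_point y)) = br x y / (hsq x * hsq y).
Proof.
have n0 : nsq (0 : R[i]) = 0 by apply/eqP; rewrite nsq_eq0.
have nV (z : R[i]) : z != 0 -> nsq z^-1 = (nsq z)^-1.
  move=> z0; have nz : nsq z != 0 by rewrite nsq_eq0.
  by apply: (mulIf nz); rewrite mulVf// -nsqM mulVf// nsq1.
have p1 (z : R[i]) : 1 + nsq z != 0 by rewrite gt_eqF// ltr_pwDl// nsq_ge0.
case: x => [z|]; case: y => [w|] /=; last by rewrite n0 addr0 !mul0r -[0 - 0]/(0 - 0) subrr n0 mul0r.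
- have [->|z0] := eqVneq z 0; have [->|w0] := eqVneq w 0 => /=.
  + by rewrite subrr n0 !mul0r.
  + rewrite nV// sub0r nsqN n0 addr0 !mul1r; have := p1 w; have : nsq w != 0 by rewrite nsq_eq0.
    by move: (nsq w) => t; clear => t0 t1; field; rewrite ?t0 ?[t + 1]addrC ?t1.
  + rewrite nV// subr0 n0 addr0 !mulr1; have := p1 z; have : nsq z != 0 by rewrite nsq_eq0.
    by move: (nsq z) => t; clear => t0 t1; rewrite mul1r; field; rewrite ?t0 ?[t + 1]addrC ?t1.
  + have e : z^-1 - w^-1 = - (z - w) * (z^-1 * w^-1) by field; rewrite z0 w0.
    rewrite e nsqM nsqN nsqM !nV//; have := p1 w; have := p1 z.
    have : nsq z != 0 by rewrite nsq_eq0. have : nsq w != 0 by rewrite nsq_eq0.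
    move: (nsq (z - w)) (nsq z) (nsq w) => s t u; clear => u0 t0 t1 u1.
    by field; rewrite ?[t + 1]addrC ?[u + 1]addrC ?t1 ?u1 ?t0 ?u0.
- have [->|z0] := eqVneq z 0 => /=; first by rewrite n0 addr0 !mul1r.
  rewrite subr0 n0 addr0 !mulr1 nV// mul1r; have := p1 z; have : nsq z != 0 by rewrite nsq_eq0.
  by move: (nsq z) => t; clear => t0 t1; field; rewrite ?t0 ?[t + 1]addrC ?t1.
- have [->|w0] := eqVneq w 0 => /=; first by rewrite n0 addr0 !mul1r.
  rewrite sub0r nsqN n0 addr0 !mul1r nV//; have := p1 w; have : nsq w != 0 by rewrite nsq_eq0.
  by move: (nsq w) => t; clear => t0 t1; field; rewrite ?t0 ?[t + 1]addrC ?t1.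
Qed.

(** For s <= 1 the sine satisfies sin (s / 2) >= 7/8 s / 2, so an angle above s has a squared chord
    above 49/64 s^2, which is at least s^2 / 2. *)
Lemma sdist_le_chord x y (s : R) : 0 <= s <= 1 ->
  4 * br x y / (hsq x * hsq y) <= s ^+ 2 / 2 -> sdist x y <= s.
Proof.
move=> /andP[s0 s1]; have -> : 4 * br x y / (hsq x * hsq y) = 2 - 2 * (stereo x *m (stereo y)^T) 0 0.
  by rewrite sphere_inner; ring.
have rg := sphere_inner_range x y; have t0 := sdist_ge0 x y; have tp := acos_lepi rg.
rewrite -[X in 2 - 2 * X](acosK rg) -/(sdist x y); rewrite -/(sdist x y) in tp.
move: t0 tp; move: (sdist x y) => t t0 tp; apply: contraTT; rewrite -!ltNge => st.
have p2 := pi_ge2 R.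
have ct : cos t < cos s.
  by rewrite ltr_cos ?in_itv /= ?s0 ?t0 ?tp ?(le_trans s1) ?(le_trans _ p2)// ler1n.
have e : 2 - 2 * cos s = 4 * sin (s / 2) ^+ 2.
  by rewrite {1}(splitr s) cosD -!expr2 cos2sin2; ring.
have h0 : 0 <= s / 2 by rewrite divr_ge0.
have cosb v : Num.min 0 (s / 2) <= v <= Num.max 0 (s / 2) -> `|cos v - 1| <= 8^-1.
  rewrite (min_idPl h0) (max_idPr h0) => /andP[v0 vs].
  have : sin (v / 2) ^+ 2 <= (v / 2) ^+ 2.
    by rewrite -[leLHS]real_normK ?num_real// lerXn2r ?nnegrE ?divr_ge0// sin_le ?divr_ge0.
  have : (v / 2) ^+ 2 <= (4^-1) ^+ 2.
    by rewrite lerXn2r ?nnegrE ?divr_ge0 ?invr_ge0//; move: vs s1; clear; move=> *; lra.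
  rewrite (_ : cos v = 1 - 2 * sin (v / 2) ^+ 2); last by rewrite {1}(splitr v) cosD -!expr2 cos2sin2; ring.
  rewrite (_ : (4^-1) ^+ 2 = 16^-1 :> R); last by rewrite exprVn expr2 -natrM.
  have := sqr_ge0 (sin (v / 2)); move: (sin _ ^+ 2) ((v / 2) ^+ 2) => a c; clear => *.
  by rewrite ler_norml; apply/andP; split; lra.
have := @mvt_bound R (@sin R) (@cos R) 1 (8^-1) 0 (s / 2) (fun v _ => is_derive_sin v) cosb.
rewrite sin0 !subr0 mul1r (ger0_norm h0) ler_norml => /andP[lo _].
have lo' : 7 / 8 * (s / 2) <= sin (s / 2) by move: lo; move: (s / 2) (sin _) => a c; clear => *; lra.
have : (7 / 8 * (s / 2)) ^+ 2 <= sin (s / 2) ^+ 2.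
  by rewrite lerXn2r ?nnegrE ?mulr_ge0 ?divr_ge0 ?(le_trans _ lo') ?mulr_ge0 ?divr_ge0.
rewrite (_ : (7 / 8 * (s / 2)) ^+ 2 = 49 / 256 * s ^+ 2); last by field.
have := sqr_ge0 s; move: ct e; move: (cos t) (cos s) (sin _ ^+ 2) (s ^+ 2) => a c p q; clear => *; lra.
Qed.

Section sphere_cells.
Variable P : nat.

(** Both hemispheres are seen as the unit disc, the outer one through the isometry z |-> 1 / z, and
    are cut by the same square grid. *)
Definition hemisphere x : bool := if x is Some z then nsq z <= 1 else false.

Definition hcoord x : R[i] := odflt 0 (if hemisphere x then x else inv_point x).

Definition sphere_cell x : bool * ('I_P.+1 * 'I_P.+1) :=
  (hemisphere x, (cell P 1 (complex.Re (hcoord x)), cell P 1 (complex.Im (hcoord x)))).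

Lemma sphere_cell_chord x y : sphere_cell x = sphere_cell y ->
  4 * br x y / (hsq x * hsq y) <= 32 / P.+1%:R ^+ 2.
Proof.
have p0 : 0 < P.+1%:R :> R by rewrite ltr0n.
have gen (z w : R[i]) : nsq z <= 1 -> nsq w <= 1 -> cell P 1 (complex.Re z) = cell P 1 (complex.Re w) ->
    cell P 1 (complex.Im z) = cell P 1 (complex.Im w) ->
    4 * br (Some z) (Some w) / (hsq (Some z) * hsq (Some w)) <= 32 / P.+1%:R ^+ 2.
  move=> z1 w1 er ei.
  have le1 (a c : R) : a ^+ 2 + c ^+ 2 <= 1 -> `|a| <= 1 /\ `|c| <= 1.
    move=> ac; split; rewrite -ler_sqr ?nnegrE// real_normK ?num_real// expr1n; apply: le_trans ac.
      by rewrite lerDl sqr_ge0.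
    by rewrite lerDr sqr_ge0.
  have [zr zi] := le1 _ _ z1; have [wr wi] := le1 _ _ w1.
  have dr := cell_dist ltr01 zr wr er; have di := cell_dist ltr01 zi wi ei.
  have sq (a : R) : `|a| <= 2 * 1 / P.+1%:R -> a ^+ 2 <= 4 / P.+1%:R ^+ 2.
    rewrite mulr1 => ha; have -> : 4 / P.+1%:R ^+ 2 = (2 / P.+1%:R) ^+ 2 :> R by field.
    by rewrite -real_normK ?num_real// lerXn2r ?nnegrE ?divr_ge0.
  have bz : br (Some z) (Some w) <= 8 / P.+1%:R ^+ 2.
    have := lerD (sq _ dr) (sq _ di); rewrite -mulrDl -natrD.
    by case: z w {z1 w1 er ei zr zi wr wi dr di} => [a c] [a' c'].
  have hz : 1 <= hsq (Some z) * hsq (Some w).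
    by rewrite /= -[leLHS]mulr1 ler_pM// lerDl nsq_ge0.
  rewrite ler_pdivrMr ?(lt_le_trans _ hz)//.
  apply: le_trans (_ : 32 / P.+1%:R ^+ 2 <= _); last by rewrite ler_peMr// divr_ge0// sqr_ge0.
  by move: bz; rewrite -!/(_ / _); move: (br _ _) (_ ^- 2) => a c; clear => *; lra.
have hc (v : P1 R) : exists z, [/\ nsq z <= 1, hcoord v = z & (if hemisphere v then v else inv_point v) = Some z].
  rewrite /hcoord; case: v => [z|] /=; last by exists 0; rewrite /nsq /= expr0n addr0.
  case: ifPn => [z1|z1]; first by exists z.
  have z0 : z != 0 by apply: contraNneq z1 => ->; rewrite /nsq /= expr0n addr0.
  rewrite (negbTE z0) /=; exists z^-1; split => //.
  have nz : 0 < nsq z by rewrite lt_neqAle eq_sym nsq_eq0 z0 nsq_ge0.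
  by rewrite -(ler_pM2r nz) -nsqM mulVf// nsq1 mul1r ltW// ltNge.
move=> [hxy er ei]; have [z [z1 zE xz]] := hc x; have [w [w1 wE yw]] := hc y.
rewrite zE wE in er ei; have := gen _ _ z1 w1 er ei; rewrite -xz -yw hxy.
by case: ifP => // _; rewrite -!mulrA chord_inv.
Qed.

End sphere_cells.

(* [N] is chosen so that 4/r <= N.+1 <= (4 + 3/16)/r, and then
   2 (N.+1)^2 <= 36 / r^2 <= 18 pi / r^2. *)
Lemma sphere_cells (r : R) : 0 < r <= 3 / 16 -> exists P : nat,
  #|{: bool * ('I_P.+1 * 'I_P.+1)}|%:R <= 18 * pi / r ^+ 2 /\
  forall x y, sphere_cell P x = sphere_cell P y -> sdist x y <= 2 * r.
Proof.
move=> /andP[r0 r1]; pose P := Num.truncn (4 / r); exists P.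
have /andP[t1 t2] : P%:R <= 4 / r < P.+1%:R by apply: truncn_itv; rewrite divr_ge0 ?ltW.
have p0 : 0 < P.+1%:R :> R by rewrite ltr0n.
split.
  rewrite !card_prod card_bool card_ord !natrM.
  have h : r * P.+1%:R <= 4 + 3 / 16.
    move: t1; rewrite ler_pdivlMr// => t1; rewrite -natr1 mulrDr mulr1 mulrC; move: t1 r1.
    by move: (_ * r) => a; clear => *; lra.
  rewrite ler_pdivlMr ?exprn_gt0//.
  apply: (@le_trans _ _ 36); last by have := pi_ge2 R; clear => *; lra.
  have : (r * P.+1%:R) ^+ 2 <= (4 + 3 / 16) ^+ 2 by rewrite lerXn2r ?nnegrE ?mulr_ge0 ?(ltW r0)// addr_ge0.
  rewrite (_ : (r * P.+1%:R) ^+ 2 = P.+1%:R * P.+1%:R * r ^+ 2); last by ring.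
  rewrite [X in _ <= X]expr2 -(mulrA 2); move: (_ * r ^+ 2) => a; clear => *; lra.
move=> x y /sphere_cell_chord h; apply: sdist_le_chord.
  by rewrite mulr_ge0 ?(ltW r0)//=; move: r1; clear => *; lra.
apply: le_trans h _; rewrite ler_pdivrMr ?exprn_gt0//.
have : 4 <= r * P.+1%:R by rewrite -ler_pdivrMl// mulrC ltW.
move: (P.+1%:R) => q h.
have : 4 ^+ 2 <= (r * q) ^+ 2 by rewrite lerXn2r ?nnegrE ?(le_trans _ h).
rewrite (_ : (2 * r) ^+ 2 / 2 * q ^+ 2 = 2 * (r * q) ^+ 2); last by field.
by rewrite (_ : 4 ^+ 2 = 16 :> R); [move: (_ ^+ 2) => a; clear => *; lra|rewrite expr2 -natrM].
Qed.

End cells.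

Lemma hausdorff_le (R : realType) (T : Type) (d : T -> T -> \bar R) (A B : set T) (e : \bar R) :
  (forall a, A a -> exists2 b, B b & (d a b <= e)%E) ->
  (forall b, B b -> exists2 a, A a & (d a b <= e)%E) -> (hausdorff d A B <= e)%E.
Proof.
move=> hA hB; rewrite /hausdorff ge_max; apply/andP; split; apply/ereal_supP => x [].
  by move=> a /hA[b Bb ab] <-; apply: le_trans ab; apply: ereal_inf_lbound; exists b.
by move=> b /hB[a Aa ab] <-; apply: le_trans ab; apply: ereal_inf_lbound; exists a.
Qed.

(** * Nets and cells in the target *)

Section nets.
Variables (R : realType) (n : nat) (X : tamed_manifold R n) (b : R).
Hypothesis b1 : 1 <= b.
Hypothesis bg : forall x : X, exists c, bchart c x b.
Implicit Types (K : set X) (x y : X).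

Lemma finite_net K (a : R) : compact K -> 0 < a ->
  exists s : seq X, (forall y, y \in s -> K y) /\ forall x, K x -> exists2 y, y \in s & (rdist y x <= a%:E)%E.
Proof.
move=> /compact_near_coveringP cK a0.
(* The filter of the finite subsets of K that are large for inclusion: with it the near-covering
   form of compactness yields a finite subcover by balls. *)
pose F : set_system (seq X) := [set S : set (seq X) | exists2 s : seq X, (forall y, y \in s -> K y) &
  forall s' : seq X, (forall y, y \in s' -> K y) -> {subset s <= s'} -> S s'].
have fF : Filter F.
  split.
  - by exists [::].
  - move=> S T [s sK hs] [t tK ht]; exists (s ++ t).
      by move=> y; rewrite mem_cat => /orP[/sK|/tK].
    move=> s' s'K st; split; [apply: hs => // y ys|apply: ht => // y yt]; apply: st; rewrite mem_cat ?ys ?yt ?orbT//.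
  - by move=> S T ST [s sK hs]; exists s => // s' s'K ss'; apply: ST; exact: hs.
have [] := cK _ F (fun s x => exists2 y, y \in s & (rdist y x <= a%:E)%E) fF.
  move=> x Kx; exists ([set x' | (rdist x x' <= a%:E)%E], [set s : seq X | x \in s]); last first.
    by move=> [x' s] [/= h xs]; exists x.
  split => /=; first exact: (rdist_small b1 (bg x) a0).
  exists [:: x] => [y|s' _ /(_ x)]; first by rewrite inE => /eqP->.
  by apply; rewrite mem_head.
by move=> s sK hs; exists s; split => // x Kx; apply: (hs s sK (fun y => id)).
Qed.

Lemma net_number_attained K (a : R) : compact K -> 0 < a ->
  exists (q : nat) (Y : set X), [/\ q%:R <= net_number (@rdist R n X) K a, is_net (@rdist R n X) K a Y & (Y #= `I_q)%card].
Proof.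
move=> cK a0.
have ex : exists q, exists Y : set X, is_net (@rdist R n X) K a Y /\ (Y #= `I_q)%card.
  have [s [sK hs]] := finite_net cK (divr_gt0 a0 (ltr0n R 2)).
  have [q hq] : finite_set [set` s] by apply/finite_seqP; exists s.
  exists q, [set` s]; split => //; split; first by move=> y /= /sK.
  apply: (@le_lt_trans _ _ (a / 2)%:E); last by rewrite lte_fin ltr_pdivrMr// mulr_natr mulr2n ltrDl.
  apply: hausdorff_le.
    by move=> y /= ys; exists y; [exact: sK|rewrite rdistxx lee_fin divr_ge0// ltW].
  by move=> x /hs[y ys yx]; exists y.
pose p q := `[< exists Y : set X, is_net (@rdist R n X) K a Y /\ (Y #= `I_q)%card >].
have exp : exists q, p q by have [q h] := ex; exists q; apply/asboolP.
have [q /asboolP[Y [nY cY]] qmin] := ex_minnP exp.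
exists q, Y; split => //; apply: lb_le_inf; first by exists q%:R, q, Y.
by move=> _ [q' [Y' [-> nY' cY']]]; rewrite ler_nat; apply: qmin; apply/asboolP; exists Y'.
Qed.

(* A ball of radius [a] is seen in a single chart, where it is cut into small
   cubes. *)
Lemma net_cells K (a : R) : compact K -> 0 < a -> Num.sqrt b * a <= half R n ->
  exists q : nat, q%:R <= net_number (@rdist R n X) K a /\
  forall delta : R, 0 < delta <= 1 ->
  exists (P : nat) (kx : X -> option ('I_q * {ffun 'I_n -> 'I_P.+1})), [/\ P.+1%:R <= (2 * n%:R * b + 1) / delta,
    forall x, K x -> kx x <> None &
    forall x x', K x -> K x' -> kx x = kx x' -> (rdist x x' <= (delta * a)%:E)%E].
Proof.
move=> cK a0 sa; have [q [Y [qn [YK nY] /card_set_bijP[f [fY fi _]]]]] := net_number_attained cK a0.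
exists q; split => // delta /andP[d0 d1].
have near x : exists y, K x -> Y y /\ (rdist y x < a%:E)%E.
  have [Kx|nK] := pselect (K x); last by exists x.
  have : (ereal_inf [set rdist y x | y in Y] < a%:E)%E.
    apply: le_lt_trans nY; rewrite /hausdorff le_max; apply/orP; right.
    by apply: ereal_sup_ubound; exists x.
  by move=> /ereal_inf_lt[_ [y Yy <-] yx]; exists y.
have [ny hny] := choice near.
have [ch hch] := choice bg.
have b0 : 0 < b by rewrite (lt_le_trans ltr01).
have x0 : 0 <= 2 * n%:R * b / delta by rewrite divr_ge0 ?mulr_ge0 ?(ltW b0) ?(ltW d0).
(* Two points of a cube of side 2 h / (P + 1), where h = sqrt(b) a, are at distance at most n
   sqrt(b) 2 h / (P + 1) = 2 n b a / (P + 1); this has to be at most delta a. *)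
pose P := Num.truncn (2 * n%:R * b / delta).
pose h := Num.sqrt b * a.
have h0 : 0 < h by rewrite mulr_gt0// sqrtr_gt0.
have /andP[t1 t2] := truncn_itv x0.
pose kx x : option ('I_q * {ffun 'I_n -> 'I_P.+1}) :=
  omap (fun i : 'I_q => (i, [ffun k => cell P h (cmap (ch (ny x)) x 0 k)])) (insub (f (ny x))).
exists P, kx; split.
- rewrite -natr1 mulrDl lerD// mul1r -[leLHS]invr1 lef_pV2 ?posrE//.
- move=> x /hny[Yx _]; have lx : (f (ny x) < q)%N by exact: fY.
  by rewrite /kx (insubT (fun i => (i < q)%N) lx).
move=> x x' Kx Kx'; have [Yx nx] := hny x Kx; have [Yx' nx'] := hny x' Kx'.
have lx : (f (ny x) < q)%N by exact: fY.
have lx' : (f (ny x') < q)%N by exact: fY.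
rewrite /kx (insubT (fun i => (i < q)%N) lx) (insubT (fun i => (i < q)%N) lx') /= => -[e1 e2].
have e : ny x' = ny x by apply: fi; rewrite ?inE.
rewrite e in nx' e2; have [cx bx] := rdist_in_chart b1 (hch (ny x)) nx sa.
have [cx' bx'] := rdist_in_chart b1 (hch (ny x)) nx' sa.
have [ac _ _ _ _] := hch (ny x).
rewrite -(chartK ac cx) -(chartK ac cx').
have hk k : `|cmap (ch (ny x)) x' 0 k - cmap (ch (ny x)) x 0 k| <= 2 * h / P.+1%:R.
  rewrite distrC; apply: cell_dist h0 (bx k) (bx' k) _.
  by move/ffunP: e2 => /(_ k); rewrite !ffunE.
have m0 : 0 <= 2 * h / P.+1%:R by exact: divr_ge0 (mulr_ge0 (ler0n _ 2) (ltW h0)) (ler0n _ _).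
apply: le_trans (chart_segment_dist b1 (hch (ny x)) m0 (fun k => le_trans (bx k) sa) (fun k => le_trans (bx' k) sa) hk) _.
rewrite lee_fin.
have -> : n%:R * Num.sqrt b * (2 * h / P.+1%:R) = (2 * n%:R * b) * a / P.+1%:R.
  by rewrite /h -[in RHS](sqr_sqrtr (ltW b0)); ring.
rewrite ler_pdivrMr ?ltr0n// [leRHS]mulrAC ler_wpM2r ?(ltW a0)//.
by rewrite [leRHS]mulrC -ler_pdivrMr// ltW.
Qed.

End nets.

Lemma moebius_surjective (R : realType) (T : P1 R -> P1 R) : is_moebius T -> forall y, exists x, T x = y.
Proof.
move=> [a [b [c [d [det eT]]]]] y.
have [x hx] : exists x : P1 R, (a * hnum x + b * hden x) * hden y = hnum y * (c * hnum x + d * hden x).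
  case: y => [w|] /=.
    have [e|ne] := eqVneq (a - w * c) 0.
      by exists None; rewrite /= !mulr0 !addr0 !mulr1; apply/eqP; rewrite -subr_eq0 e.
    exists (Some ((w * d - b) / (a - w * c))); rewrite /= !mulr1.
    have := divfK ne (w * d - b); move: (_ / _) => t ht; apply/eqP; rewrite -subr_eq0.
    by rewrite [X in X == 0](_ : _ = t * (a - w * c) - (w * d - b)); [rewrite ht subrr|ring].
  have [->|c0] := eqVneq c 0; first by exists None; rewrite /= !mulr0 mul0r addr0 mulr0.
  by exists (Some (- d / c)); rewrite /= mulr0 mulr1; field.
exists x; rewrite eT -[RHS](_ : moebius 1 0 0 1 y = y); last first.
  by case: (y) => [w|] /=; rewrite ?mul0r ?add0r ?oner_eq0 ?mul1r ?addr0 ?divr1 ?eqxx.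
apply/(moebius_eq _ _ det); first by rewrite mulr1 mulr0 subr0 oner_neq0.
by rewrite !(mul0r, mul1r, add0r, addr0).
Qed.

Lemma moebius_inj (R : realType) (T : P1 R -> P1 R) : is_moebius T -> injective T.
Proof.
move=> [a [b [c [d [det eT]]]]] x y; rewrite !eT => e; apply/eqP/negPn/negP => /br_gt0 xy.
have := br_moebius det x y; rewrite e brxx mul0r => /esym/eqP.
by rewrite mulf_eq0 (gt_eqF xy) orbF nsq_eq0 (negbTE det).
Qed.

(** * Graphs of decorated maps *)

Section decorations.
Variables (R : realType) (n : nat) (X : tamed_manifold R n) (l m : nat) (K : set X) (A : R).
Variables (u : set (nodal_map R X l)) (d : decoration R X l m).
Hypothesis mu : moduli l K A u.
Hypothesis du : is_decoration u d.

Lemma decoration_stable_map : is_stable_map (drep d).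
Proof. by case: mu du => f [_ _ _ ->] [[]]. Qed.

Lemma decoration_image x : K (Defs.fmap (drep d) x).
Proof.
case: mu du => f [_ _ Kf ->] [[_ [h [T [[bh _ mT _] _ hf]]]] _ _ _].
case: x => v z; have [g gK hK] := bh.
have [z' <-] := moebius_surjective (mT (g v)) z.
by have := hf (g v, z'); rewrite /map_point /= hK => ->.
Qed.

Lemma graph_in_K q : graph d q -> K q.2.
Proof. by move=> [x [_ ->]]; exact: decoration_image. Qed.

Lemma marks_ge3 : (3 <= l + m)%N.
Proof.
have [_ [cC st] _ _] := du.
have [i [j [k [ij jk ki]]]] := three_marks cC st ord0.
have : (size [:: i; j; k] <= size (enum 'I_(l + m)))%N.
  apply: uniq_leq_size => [|x _]; last by rewrite mem_enum.
  rewrite /= !inE negb_or !andbT; apply/andP; split; last by apply/eqP => e; apply: jk; rewrite e.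
  by apply/andP; split; apply/eqP => e; [apply: ij|apply: ki]; rewrite e.
by rewrite size_enum_ord.
Qed.

(** [Lip] is about points at positive distance. Points at distance 0 have the same projections to
    all components of the stable curve, hence, by injectivity of the Moebius maps, of the domain;
    then [chain_bound] with zero bounds gives distance 0 of the values. *)
Lemma graph_rdist (M s : R) q q' : (Lip 1 d <= M%:E)%E -> 0 <= M -> s <= 1 -> zdist q.1 q'.1 <= s ->
  graph d q -> graph d q' -> (rdist q.2 q'.2 <= (M * s)%:E)%E.
Proof.
move=> /ereal_supP lip M0 s1 zs gq gq'; have z0 := zdist_ge0 q.1 q'.1.
have [z00|zn] := eqVneq (zdist q.1 q'.1) 0; last first.
  have zp : 0 < zdist q.1 q'.1 by rewrite lt_neqAle eq_sym zn.
  have := lip _ (ex_intro _ q (ex_intro _ q' (And4 gq gq' _ erefl))).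
  rewrite zp (le_trans zs s1) => /(_ isT).
  rewrite lee_pdivrMr// => /le_trans; apply.
  by rewrite -EFinM lee_fin ler_wpM2l.
apply: (@le_trans _ _ 0%E); last by rewrite lee_fin mulr_ge0// (le_trans z0).
case: gq gq' z00 => x [ex ->] [x' [ex' ->]] z00.
have [_ sC bih _] := du; have [cC' _] := sC.
have [cC _ nu _] := decoration_stable_map; have [_ _ mT _] := bih.
rewrite -[leRHS](_ : (\sum_(v : component (domain (drep d))) 0)%:E = 0%E); last by rewrite big1.
apply: chain_bound => // v.
have := retract_eq_of_zdist0 sC (Defs.dcomp d v) ex ex' z00.
by rewrite !(retract_iso _ _ cC cC' bih) => /(moebius_inj (mT v)) ->; rewrite rdistxx.
Qed.

End decorations.

Lemma card_triple m : (#|triple m| <= 'C(m, 3))%N.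
Proof.
pose f (t : triple m) : 3.-tuple 'I_m := [tuple (val t).1.1; (val t).1.2; (val t).2].
have fi : injective f.
  move=> [[[i j] k] h] [[[i' j'] k'] h'] /(congr1 val) /= [e1 e2 e3].
  by apply: val_inj; rewrite /= e1 e2 e3.
rewrite -[leqRHS]card_ltn_sorted_tuples -(card_imset _ fi); apply: subset_leq_card.
apply/fintype.subsetP => _ /imsetP[[[[i j] k] /= h] _ ->].
by rewrite inE /= andbT; exact: h.
Qed.

Section codes.
Variables (R : realType) (n : nat) (X : tamed_manifold R n) (l m : nat) (K : set X) (A : R).
Variables (P : nat) (J : finType) (kx : X -> option J) (a r M delta : R).
Hypothesis a0 : 0 < a.
Hypothesis M0 : 0 <= M.
Hypothesis r0 : 0 <= r.
Hypothesis r1 : 2 * r <= 1.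
Hypothesis rd : 2 * r <= 4 * delta.
Hypothesis rM : M * (2 * r) <= 3 * (delta * a).
Hypothesis cellP : forall x y : P1 R, sphere_cell P x = sphere_cell P y -> sdist x y <= 2 * r.
Hypothesis kxK : forall x, K x -> kx x <> None.
Hypothesis kxd : forall x x', K x -> K x' -> kx x = kx x' -> (rdist x x' <= (delta * a)%:E)%E.

Definition zcell (y : Z R (l + m)) : {ffun triple (l + m) -> bool * ('I_P.+1 * 'I_P.+1)} :=
  [ffun t => sphere_cell P (y t)].

Lemma zcell_dist y y' : zcell y = zcell y' -> zdist y y' <= 2 * r.
Proof.
move=> /ffunP e; rewrite /zdist; elim/big_ind: _ => [|x x' hx hx'|t _].
- by rewrite mulr_ge0.
- by rewrite ge_max hx.
- by apply: cellP; have := e t; rewrite !ffunE.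
Qed.

(* For each cell met by the graph, a cell of X containing the value of the map
   at some point of that cell. *)
Lemma code_exists (d : decoration R X l m) :
  exists code : {ffun {ffun triple (l + m) -> bool * ('I_P.+1 * 'I_P.+1)} -> option J},
    forall g, (exists q, [/\ graph d q, zcell q.1 = g & code g = kx q.2]) \/
              ((forall q, graph d q -> zcell q.1 <> g) /\ code g = None).
Proof.
have /choice[c hc] : forall g, exists o : option J, (exists q, [/\ graph d q, zcell q.1 = g & o = kx q.2]) \/
    ((forall q, graph d q -> zcell q.1 <> g) /\ o = None).
  move=> g; have [[q [gq zq]]|nq] := pselect (exists q, graph d q /\ zcell q.1 = g).
    by exists (kx q.2); left; exists q.
  by exists None; right; split => // q gq zq; apply: nq; exists q.
by exists (finfun c) => g; rewrite ffunE.
Qed.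

Definition code (d : decoration R X l m) := projT1 (cid (code_exists d)).

Lemma codeP d g : (exists q, [/\ graph d q, zcell q.1 = g & code d g = kx q.2]) \/
  ((forall q, graph d q -> zcell q.1 <> g) /\ code d g = None).
Proof. exact: (projT2 (cid (code_exists d)) g). Qed.

(** From [q] one passes to the sample [q0] of its cell on the same graph, at a cost of at most 3
    delta a by the Lipschitz bound, and then to the sample [q1] of the other graph in the same cell
    of K, at a cost of at most delta a. *)
Lemma dist_of_code u v d d' : moduli l K A u -> moduli l K A v -> is_decoration u d -> is_decoration v d' ->
  (Lip 1 d <= M%:E)%E -> code d = code d' ->
  forall q, graph d q -> exists2 q', graph d' q' & (ldist a q q' <= (4 * delta)%:E)%E.
Proof.
move=> mu mv du dv lip e q gq.
have Kd := graph_in_K mu du; have Kd' := graph_in_K mv dv.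
have [[q0 [gq0 zq0 cq0]]|[/(_ q gq)//]] := codeP d (zcell q.1).
have [[q1 [gq1 zq1 cq1]]|[_ c1]] := codeP d' (zcell q.1); last first.
  by case: (kxK (Kd _ gq0)); rewrite -cq0 e c1.
have k01 : kx q0.2 = kx q1.2 by rewrite -cq0 -cq1 e.
exists q1 => //; rewrite /ldist ge_max lee_fin (le_trans (zcell_dist (esym zq1)) rd)/=.
have h0 : (rdist q.2 q0.2 <= (M * (2 * r))%:E)%E.
  exact: (graph_rdist mu du lip M0 r1 (zcell_dist (esym zq0)) gq gq0).
have h1 := kxd (Kd _ gq0) (Kd' _ gq1) k01.
rewrite lee_pdivrMl//; apply: le_trans (rdist_triangle h0 h1) _.
rewrite -EFinM lee_fin (_ : a * (4 * delta) = 3 * (delta * a) + delta * a); last by ring.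
by rewrite lerD2r.
Qed.

Lemma dist_L_of_code u v d d' : moduli l K A u -> moduli l K A v -> is_decoration u d -> is_decoration v d' ->
  (Lip 1 d <= M%:E)%E -> (Lip 1 d' <= M%:E)%E -> code d = code d' -> (dist_L a d d' <= (4 * delta)%:E)%E.
Proof.
move=> mu mv du dv lip lip' e; apply: hausdorff_le; first exact: dist_of_code mu mv du dv lip e.
move=> q' gq'; have [q gq h] := dist_of_code mv mu dv du lip' (esym e) gq'.
exists q => //; move: h; rewrite /ldist rdist_sym (_ : zdist q.1 q'.1 = zdist q'.1 q.1)//.
by rewrite /zdist; apply: eq_bigr => t _; rewrite /sdist !mxE; congr acos; apply: eq_bigr => i _; rewrite !mxE mulrC.
Qed.

Let codes := {ffun {ffun triple (l + m) -> bool * ('I_P.+1 * 'I_P.+1)} -> option J}.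

(** For each code that occurs, one class with this code is put into [I]. *)
Lemma finite_cover (phi : set (nodal_map R X l) -> decoration R X l m) :
  (forall u, moduli l K A u -> is_decoration u (phi u) /\ (Lip 1 (phi u) <= M%:E)%E) ->
  exists I : set (set (nodal_map R X l)),
    [/\ I `<=` moduli l K A, (I #<= `I_#|codes|)%card,
        forall u, moduli l K A u -> exists2 v, I v & (dist_L a (phi u) (phi v) <= (4 * delta)%:E)%E &
        moduli l K A `<=` \bigcup_(v in I) V K A a (4 * delta) (phi v)].
Proof.
move=> hphi.
have /choice[s hs] : forall c : codes, exists u : set (nodal_map R X l),
    (exists2 v, moduli l K A v & code (phi v) = c) -> moduli l K A u /\ code (phi u) = c.
  move=> c; have [[u mu cu]|no] := pselect (exists2 v, moduli l K A v & code (phi v) = c).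
    by exists u.
  by exists set0.
have hsu u : moduli l K A u -> moduli l K A (s (code (phi u))) /\ code (phi (s (code (phi u)))) = code (phi u).
  by move=> mu; apply: hs; exists u.
pose I := [set s (code (phi u)) | u in moduli l K A].
have IM : I `<=` moduli l K A by move=> _ [u /hsu[mu _] <-].
exists I; split => //.
- pose f (k : nat) : set (nodal_map R X l) := oapp (fun i => s (enum_val i)) set0 (insub k : option 'I_#|codes|).
  apply: card_le_trans (card_image_le f `I_#|codes|); apply: subset_card_le => _ [u mu <-].
  exists (enum_rank (code (phi u))); first exact: ltn_ord.
  by rewrite /f valK /= enum_rankK.
- move=> u mu; have [msu csu] := hsu u mu; have [d1 l1] := hphi u mu; have [d2 l2] := hphi _ msu.
  exists (s (code (phi u))); first by exists u.
  exact: dist_L_of_code mu msu d1 d2 l1 l2 (esym csu).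
- move=> u mu; have [msu csu] := hsu u mu; have [d1 l1] := hphi u mu; have [d2 l2] := hphi _ msu.
  exists (s (code (phi u))); first by exists u.
  split => //; exists (phi u); split => //.
  exact: dist_L_of_code msu mu d2 d1 l2 l1 csu.
Qed.

End codes.

(** * Choice of the constants *)

Lemma chord_constant_expR (R : realType) : exists2 kappa : R, 0 < kappa &
  forall q, chord_constant R q <= kappa * expR q%:R.
Proof.
have k0 : 0 < 80 * 128 ^+ 2 * 4 ^+ 4 :> R by rewrite mulr_gt0 ?exprn_gt0 ?mulr_gt0 ?ltr0n.
exists (80 * 128 ^+ 2 * 4 ^+ 4) => // q.
have t0 : 0 <= 1 + q%:R :> R by rewrite addr_ge0.
have q4 : ((1 + q%:R) / 4) ^+ 4 <= expR q%:R :> R.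
  have -> : expR q%:R = expR (q%:R / 4) ^+ 4 :> R.
    by rewrite -expRM_natl; congr expR; field.
  rewrite lerXn2r ?nnegrE ?divr_ge0 ?expR_ge0//; apply: le_trans (expR_ge1Dx _).
  by rewrite mulrDl lerD2r mul1r invf_le1 ?ler1n ?ltr0n.
rewrite -mulrA; apply: (@le_trans _ _ (80 * 128 ^+ 2 * (1 + q%:R) ^+ 4)); last first.
  rewrite ler_wpM2l ?mulr_ge0 ?sqr_ge0//; apply: le_trans (_ : 4 ^+ 4 * ((1 + q%:R) / 4) ^+ 4 <= _).
    by rewrite -exprMn mulrCA mulfV ?mulr1 ?pnatr_eq0.
  by rewrite ler_wpM2l ?exprn_ge0.
rewrite /chord_constant -(mulrA 80 (q%:R ^+ 2)) -(mulrA 80 (128 ^+ 2)) ler_pM2l ?ltr0n//.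
rewrite (_ : 128 ^+ 2 * (1 + q%:R) ^+ 4 = (1 + q%:R) ^+ 2 * (64 * (2 * (1 + q%:R))) ^+ 2 :> R); last first.
  rewrite (_ : 64 * (2 * (1 + q%:R)) = 128 * (1 + q%:R)); last by rewrite mulrA -natrM.
  by rewrite exprMn; move: (128 ^+ 2) (1 + q%:R) => a x; ring.
rewrite ler_pM ?sqr_ge0 ?lerXn2r ?nnegrE ?mulr_ge0 ?lerDr// ler_wpM2l//.
by rewrite -natr1 -mul2n natrM; move: (q%:R) => x; clear; lra.
Qed.

(** [lambda] is such that A / lambda^2 = s x, where x = A / hq bounds the number q of marks and s -
    1 = Kc kappa / a is the factor to absorb. If q >= 1 then x >= 1, so s x >= x + (s - 1), and the
    exponential of the right side is at least exp(q) s. *)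
Lemma decorations_lipschitz (R : realType) (n : nat) (b a : R) : 1 <= b -> 0 < a ->
  exists2 lambda : R, 0 < lambda &
  forall (X : tamed_manifold R n) (l : nat) (A c : R) (K : set X), (forall x : X, exists c, bchart c x b) ->
    1 <= c -> 0 < A ->
    let m := Num.truncn (c * (l%:R + A / lambda ^+ 2)) in
    let Lambda := expR (c * (l%:R + A / lambda ^+ 2)) in
    forall u, moduli l K A u ->
      exists phi : decoration R X l m, is_decoration u phi /\ (Lip 1 phi <= (Lambda * a)%:E)%E.
Proof.
move=> b1 a0; have [hq [Kc [hq0 Kc0 est]]] := decoration_exists n b1.
have [kappa kappa0 hk] := chord_constant_expR R.
pose s := 1 + Kc * kappa / a.
have s1 : 1 <= s by rewrite lerDl divr_ge0 ?mulr_ge0 ?(ltW a0) ?(ltW Kc0) ?(ltW kappa0).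
have s0 : 0 < s by exact: lt_le_trans s1.
exists (Num.sqrt (hq / s)); first by rewrite sqrtr_gt0 divr_gt0.
move=> X l A c K bg c1 A0; cbv zeta; rewrite sqr_sqrtr ?divr_ge0 ?(ltW hq0) ?(ltW s0)//.
rewrite invf_div mulrCA; set x := A / hq; set w := c * _ => u [f [sf Ef Kf ->]].
have x0 : 0 <= x by rewrite divr_ge0 ?(ltW A0) ?(ltW hq0).
have xw : s * x <= w.
  have sx : 0 <= s * x by exact: mulr_ge0 (ltW s0) x0.
  by rewrite /w -[leLHS]mul1r; apply: ler_pM => //; rewrite lerDr.
have w0 : 0 <= w by apply: le_trans xw; rewrite mulr_ge0// ltW.
have xw1 : x <= w by apply: le_trans xw; rewrite ler_peMl.
have /andP[_ wm] := truncn_itv w0.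
have [d [q [dE [sd bd] md qA lip]]] := est X l (Num.truncn w) f A bg sf Ef (le_lt_trans xw1 wm).
exists d; split.
  split=> //; rewrite dE; split => //.
  exists (fun v => v), (fun _ z => z); split.
  - split => //; first by exists id.
    by move=> v; exists 1, 0, 0, 1; split; [rewrite mulr1 mulr0 subr0 oner_neq0|case=> [z|] /=; rewrite ?mul0r ?add0r ?oner_eq0 ?mul1r ?addr0 ?divr1 ?eqxx].
  - by move=> i; rewrite /map_point /= -surjective_pairing.
  - by move=> y; rewrite /map_point /= -surjective_pairing.
apply/ereal_supP => _ [z [z' [gz gz' /andP[zp z1] ->]]].
rewrite lee_pdivrMr//; apply: le_trans (lip _ _ gz gz') _.
rewrite -EFinM lee_fin ler_wpM2r ?(ltW zp)//.
have [->|q0] := eqVneq q 0%N.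
  by rewrite /chord_constant expr0n /= !mulr0 mul0r mulr0 mulr_ge0 ?expR_ge0// ltW.
have q1 : 1 <= q%:R :> R by rewrite ler1n lt0n.
have x1 : 1 <= x by exact: le_trans qA.
apply: (@le_trans _ _ (Kc * (kappa * expR q%:R))); first by rewrite ler_wpM2l// ltW.
have : expR (q%:R + (s - 1)) <= expR w.
  rewrite ler_expR; apply: le_trans xw; apply: (@le_trans _ _ (x + (s - 1))); first by rewrite lerD2r.
  have := mulr_ge0 (_ : 0 <= s - 1) (_ : 0 <= x - 1); rewrite !subr_ge0 => /(_ s1 x1).
  by move=> h; rewrite -subr_ge0 [leRHS](_ : _ = (s - 1) * (x - 1))//; ring.
rewrite expRD => h; have h2 := expR_ge1Dx (s - 1).
have h3 : expR q%:R * s <= expR w.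
  apply: le_trans h; rewrite ler_wpM2l ?expR_ge0//; apply: le_trans h2.
  by rewrite addrCA subrr addr0.
rewrite mulrA -ler_pdivrMr// mulrAC; apply: le_trans h3.
by rewrite mulrC ler_wpM2l ?expR_ge0// /s lerDr.
Qed.

Lemma card_codes (R : realType) (x y : R) (C J T : finType) (c : nat) : (0 < #|C|)%N ->
  #|C|%:R <= x -> #|J|%:R <= y -> (#|T| <= c)%N ->
  #|{ffun {ffun T -> C} -> option J}|%:R <= (1 + y) `^ (x ^+ c).
Proof.
move=> C0 Cx Jy Tc; rewrite !card_ffun card_option natrX -natr1 addrC.
have y0 : 0 <= y by exact: le_trans Jy.
have C1 : 1 <= #|C|%:R :> R by rewrite ler1n.
apply: (@le_trans _ _ ((1 + y) ^+ (#|C| ^ #|T|))).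
  by rewrite lerXn2r ?nnegrE ?addr_ge0// lerD2l.
rewrite -powR_mulrn ?addr_ge0//; apply: ler_powR; first by rewrite lerDl.
rewrite natrX; apply: (@le_trans _ _ (#|C|%:R ^+ c)); first by rewrite ler_weXn2l.
by rewrite lerXn2r ?nnegrE// (le_trans _ Cx).
Qed.

Lemma covering_number (R : realType) (n : nat) (b a : R) : 1 <= b -> 0 < a -> Num.sqrt b * a <= half R n ->
  forall (X : tamed_manifold R n) (l m : nat) (A w : R) (K : set X), (forall x : X, exists c, bchart c x b) ->
  compact K -> ((3 <= l + m)%N -> 3 <= w) ->
  forall phi : set (nodal_map R X l) -> decoration R X l m,
  (forall u, moduli l K A u -> is_decoration u (phi u) /\ (Lip 1 (phi u) <= (expR w * a)%:E)%E) ->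
  forall delta : R, 0 < delta <= 1 ->
  exists I : set (set (nodal_map R X l)),
    [/\ I `<=` moduli l K A,
        exists2 q : nat, q%:R <= (1 + (2 * n%:R * b + 1) ^+ n * delta ^- n * net_number (@rdist R n X) K a)
               `^ ((8 * pi * expR w ^+ 2 * delta ^- 2) ^+ 'C(l + m, 3)) & (I #<= `I_q)%card,
        forall u, moduli l K A u -> exists2 v, I v & (dist_L a (phi u) (phi v) <= (4 * delta)%:E)%E &
        moduli l K A `<=` \bigcup_(v in I) V K A a (4 * delta) (phi v)].
Proof.
move=> b1 a0 sa X l m A w K bg cK hw phi hphi delta dd; have /andP[d0 d1] := dd.
(* If the moduli space is empty, so is [I]. Otherwise there is a stable curve with l + m marks, so
   that l + m >= 3, which gives w >= 3 and La >= 8. *)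
have [[u0 mu0]|no] := pselect (exists u, moduli l K A u); last first.
  have e u : ~ moduli l K A u by move=> mu; apply: no; exists u.
  by exists set0; split => [u //||u /e//|u /e//]; exists 0%N; rewrite ?powR_ge0// card_le_emptyl.
have w3 : 3 <= w by have [du _] := hphi _ mu0; apply: hw (marks_ge3 du).
set La := expR w.
have La8 : 8 <= La.
  have -> : La = expR (w / 3) ^+ 3 by rewrite -expRM_natl; congr expR; field.
  rewrite (_ : 8 = 2 ^+ 3 :> R); last by rewrite -natrX.
  rewrite lerXn2r ?nnegrE ?expR_ge0//; apply: le_trans (expR_ge1Dx _); move: w3; clear; move=> *; lra.
have La0 : 0 < La by exact: expR_gt0.
(* With this [r] the cell count 18 pi / r^2 is 8 pi La^2 / delta^2, as in the exponent of N, and La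
   * 2 r = 3 delta leaves one delta for the cells of K. [La8] ensures r <= 3/16. *)
pose r := 3 / 2 * delta / La.
have r0 : 0 < r by rewrite divr_gt0 ?mulr_gt0 ?invr_gt0 ?ltr0n.
have r316 : r <= 3 / 16.
  by rewrite ler_pdivrMr//; move: d1 La8; clear; move=> *; lra.
have rLa : r * La = 3 / 2 * delta by rewrite mulfVK// gt_eqF.
have [|P [cP hP]] := @sphere_cells R r; first by rewrite r0.
have [q [qn hk]] := net_cells b1 bg cK a0 sa.
have [P' [kx [P'd kxK kxd]]] := hk delta dd.
have rd : 2 * r <= 4 * delta.
  have : r <= 3 / 16 * delta by rewrite ler_pdivrMr//; have := mulr_ge0 (ltW d0) (_ : 0 <= La - 8); rewrite subr_ge0 => /(_ La8); move: d0; clear; move=> *; lra.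
  by move: d0; clear; move=> *; lra.
have rM : La * a * (2 * r) <= 3 * (delta * a).
  rewrite (_ : _ * (2 * r) = 2 * (r * La) * a); last by ring.
  by rewrite rLa (_ : 2 * (3 / 2 * delta) * a = 3 * (delta * a)); last by field.
have r1 : 2 * r <= 1 by move: r316; clear; move=> *; lra.
have [I [IM cI h1 h2]] := @finite_cover R n X l m K A P _ kx a r (La * a) delta a0
  (mulr_ge0 (ltW La0) (ltW a0)) (ltW r0) r1 rd rM hP kxK kxd phi hphi.
exists I; split => //; eexists; last exact: cI.
apply: card_codes; last exact: card_triple.
- by rewrite !card_prod card_bool card_ord.
- apply: le_trans cP _; rewrite ler_pdivrMr ?exprn_gt0//.
  have e : r ^+ 2 = 9 / 4 * delta ^+ 2 / La ^+ 2.
    by rewrite /r; field; rewrite gt_eqF.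
  by rewrite e [leRHS](_ : _ = 18 * pi)//; field; rewrite !gt_eqF.
- rewrite card_prod card_ffun !card_ord natrM natrX.
  rewrite mulrC ler_pM ?exprn_ge0//.
  rewrite -exprVn -exprMn lerXn2r ?nnegrE// divr_ge0 ?(ltW d0)// addr_ge0// !mulr_ge0//.
  exact: le_trans b1.
Qed.

Theorem theorem1p3 (R : realType) :
  exists2 c0 : R, 0 < c0 &
  forall (k j : nat) (B : R), (3 <= j)%N ->
  exists lambda0 lambda sigma : R,
    [/\ 0 < lambda0, 0 < lambda & 0 < sigma] /\
  forall (c : R) (X : tamed_manifold R (2 * k)) (l : nat) (A : R),
    c0 <= c -> bounded_geometry X j B -> 0 < A ->
    let m := Num.truncn (c * (l%:R + A / lambda ^+ 2)) in
    let Lambda := expR (c * (l%:R + A / lambda ^+ 2)) in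
  forall K : set X, compact K ->
    (forall u, moduli l K A u ->
      exists phi : decoration R X l m,
        is_decoration u phi /\ (Lip 1 phi <= (Lambda * lambda0)%:E)%E) /\
    (forall phi : set (nodal_map R X l) -> decoration R X l m,
      (forall u, moduli l K A u ->
        is_decoration u (phi u) /\ (Lip 1 (phi u) <= (Lambda * lambda0)%:E)%E) ->
      forall delta : R, 0 < delta <= 1 ->
      let N := (1 + sigma * delta ^- (2 * k) *
                    net_number (@rdist R (2 * k) X) K lambda0)
               `^ ((8 * pi * Lambda ^+ 2 * delta ^- 2) ^+ 'C(m + l, 3)) in
      exists I : set (set (nodal_map R X l)),
        [/\ I `<=` moduli l K A,
            exists2 q : nat, q%:R <= N & (I #<= `I_q)%card,
            forall u, moduli l K A u -> exists2 v, I v &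
              (dist_L lambda0 (phi u) (phi v) <= (4 * delta)%:E)%E &
            moduli l K A `<=`
              \bigcup_(v in I) V K A lambda0 (4 * delta) (phi v)]).
Proof.
(* With c >= 3 the exponent c (l + A / lambda^2) is at least 3 whenever l + m >= 3: if l >= 1
   because of c, and if l = 0 because its integer part is m. *)
exists 3 => // k j B j3.
pose b := `|B| + 1.
have b1 : 1 <= b by rewrite lerDr.
have b0 : 0 < b by exact: lt_le_trans b1.
have sb : 0 < Num.sqrt b by rewrite sqrtr_gt0.
(* This is lambda0, the largest radius for which [rdist_in_chart] puts balls into the cube of a
   chart. *)
pose a := half R (2 * k) / Num.sqrt b.
have a0 : 0 < a by rewrite divr_gt0// half_gt0.
have sa : Num.sqrt b * a <= half R (2 * k) by rewrite mulrC divfK ?gt_eqF.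
have [lambda lambda0 part1] := @decorations_lipschitz R (2 * k) b a b1 a0.
(* [sigma * delta ^- (2 * k)] bounds the number of cubes into which [net_cells] cuts each ball of
   the net. *)
exists a, lambda, ((2 * (2 * k)%:R * b + 1) ^+ (2 * k)); split.
  by split => //; rewrite exprn_gt0// ltr_pwDr// !mulr_ge0// ltW.
move=> c X l A c3 bgX A0; cbv zeta => K cK.
have bg (x : X) : exists c, bchart c x b := bounded_geometry_bchart x j3 bgX.
have c1 : 1 <= c by apply: le_trans c3; rewrite ler1n.
split; first by move=> u; exact: part1.
move=> phi hphi delta dd; rewrite addnC; apply: covering_number => // h3.
have y0 : 0 <= A / lambda ^+ 2 by rewrite divr_ge0 ?sqr_ge0// ltW.
have [l0|l0] := posnP l.
  have := h3; rewrite {1}l0 add0n truncn_ge_nat//.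
  by rewrite mulr_ge0 ?addr_ge0// (le_trans _ c1).
apply: le_trans c3 _; rewrite ler_peMr ?(le_trans _ c1)//.
by rewrite -[leLHS]addr0 lerD// ler1n.
Qed.
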